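(* Assume $b=(b^0,b^1)\in C^{1,1}_b(\mathbb R^d\times\mathcal P_2(\mathbb R^d);\mathbb R^d\times\mathbb R^{d\times m})$. (i) For all $t\in[0,T]$, the map $\xi\in L^2(\mathcal F_0;\mathbb R^d)\mapsto X_t^\xi\in L^2(\mathcal F_t;\mathbb R^d)$ is Gateaux differentiable with bounded differential; i.e., for all $\xi\in L^2(\mathcal F_0;\mathbb R^d)$ there exists a bounded linear operator $D_\xi X_t^\xi\in\mathcal L(L^2(\mathcal F_0;\mathbb R^d);L^2(\mathcal F_t;\mathbb R^d))$ such that $$\sup_{\xi\in L^2(\mathcal F_0;\mathbb R^d)}\ \sup_{t\in[0,T]}\big\|D_\xi X_t^\xi\big\|_{\mathcal L}<\infty$$ and $$\lim_{r\to0}\frac1{|r|}\Big\|X_t^{\xi+r\eta}-X_t^\xi-r\,D_\xi X_t^\xi\,\eta\Big\|_{L^2}=0\qquad\text{for all }\eta\in L^2(\mathcal F_0;\mathbb R^d).$$ Moreover, $\xi\mapsto D_\xi X_t^\xi$ is uniformly strongly continuous: for every $\eta\in L^2(\mathcal F_0;\mathbb R^d)$ there exists a modulus of continuity $\varpi_\eta$ such that $$\Big\|\big(D_\xi X_t^{\xi'}-D_\xi X_t^\xi\big)\eta\Big\|_{L^2}\le\varpi_\eta\big(\|\xi'-\xi\|_{L^2}\big)\qquad\text{for all }\xi,\xi'\in L^2(\mathcal F_0;\mathbb R^d).$$ (ii) The adjoint $(D_\xi X_t^\xi)^*\in\mathcal L(L^2(\mathcal F_t;\mathbb R^d);L^2(\mathcal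 F_0;\mathbb R^d))$ inherits the boundedness and the uniform strong continuity: $\|(D_\xi X_t^\xi)^*\|_{\mathcal L}$ is bounded uniformly in $(t,\xi)\in[0,T]\times L^2(\mathcal F_0;\mathbb R^d)$, and for all $t\in[0,T]$ and all $\eta\in L^2(\mathcal F_t;\mathbb R^d)$ there is a modulus of continuity $\varpi_\eta$ such that $$\Big\|\big[(D_\xi X_t^{\xi'})^*-(D_\xi X_t^\xi)^*\big]\eta\Big\|_{L^2}\le\varpi_\eta\big(\|\xi'-\xi\|_{L^2}\big)\qquad\text{for all }\xi,\xi'\in L^2(\mathcal F_0;\mathbb R^d).$$
   Context: **Probabilistic setting.** $T>0$; $(\Omega,\mathcal F,\mathsf P)$ is a complete probability space carrying an $m$-dimensional Brownian motion $B=(B_t)_{t\in[0,T]}$ and a sub-$\sigma$-algebra $\mathcal F_0$ that is independent of $B$, contains all $\mathsf P$-null sets, and is atomless (so every law on a Euclidean space is the law of some $\mathcal F_0$-measurable random variable). $\mathbb F=(\mathcal F_t)_{t\in[0,T]}$ is the filtration $\mathcal F_t=\mathcal F_0\vee\sigma(B_s:s\le t)$, which satisfies the usual conditions. $\mathsf P_X$ is the law of $X$. $L^2(\mathcal F_t;\mathbb R^d)$ is the space of square-integrable $\mathcal F_t$-measurable $\mathbb R^d$-valued random variables with norm $\|X\|_{L^2}=(\mathsf E|X|^2)^{1/2}$. $\mathcal S^2([0,T];\mathbb R^d)$ is the space of continuous $\mathbb F$-adapted processes $Y$ with $\mathsf E[\sup_{t\in[0,T]}|Y_t|^2]<\infty$.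 $\mathcal L(E;F)$ is the space of bounded linear operators between Banach spaces $E,F$, with operator norm $\|\cdot\|_{\mathcal L}$. **Wasserstein space and derivatives.** $\mathcal P_2(\mathbb R^d)$ is the set of Borel probability measures on $\mathbb R^d$ with finite second moment, with the $2$-Wasserstein distance $\mathcal W_2$. A modulus of continuity is a nondecreasing function $\varpi:[0,\infty)\to[0,\infty)$ with $\lim_{s\downarrow0}\varpi(s)=0$. A function $\phi:\mathcal P_2(\mathbb R^d)\to\mathbb R$ has a linear functional derivative if there is a map $\delta_\mu\phi:\mathcal P_2(\mathbb R^d)\times\mathbb R^d\to\mathbb R$, continuous for the product topology, with at most quadratic growth in $x$ locally uniformly in $\mu$, such that $\phi(\mu')-\phi(\mu)=\int_0^1\int_{\mathbb R^d}\delta_\mu\phi(\mu+\lambda(\mu'-\mu),x)\,(\mu'-\mu)(dx)\,d\lambda$ for all $\mu,\mu'$. It is $L$-differentiable if in addition $x\mapsto\delta_\mu\phi(\mu,x)$ is differentiable for every $\mu$ and $(\mu,x)\mapsto\partial_x\delta_\mu\phi(\mu,x)\in\mathbb R^d$ is continuous with at most quadratic growth in $x$, locally uniformly in $\mu$; $\partial_x\delta_\mu\phi$ is the $L$-derivative. The same notions are used componentwise for vector- or matrix-valued maps. $C^{1,1}_b(\mathbb R^d\times\mathcal P_2(\mathbb R^d);E)$, for $E$ a Euclidean space, is the set of $f:\mathbb R^d\times\mathcal P_2(\mathbb R^d)\to E$ such that $f(\cdot,\mu)$ is $C^1$ for every $\mu$ with Jacobian $\partial_xf(x,\mu)$; $f(x,\cdot)$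 is $L$-differentiable for every $x$ with $L$-derivative $\partial_{\tilde x}\delta_\mu f(x,\mu,\tilde x)$; and both $\partial_xf$ and $\partial_{\tilde x}\delta_\mu f$ are bounded and Lipschitz in all their arguments (with $\mathcal W_2$ on $\mathcal P_2(\mathbb R^d)$). **McKean–Vlasov SDE.** For $\xi\in L^2(\mathcal F_0;\mathbb R^d)$, $X^\xi\in\mathcal S^2([0,T];\mathbb R^d)$ is the unique solution of $$X_t^\xi=\xi+\int_0^tb^0(X_s^\xi,\mathsf P_{X_s^\xi})\,ds+\int_0^tb^1(X_s^\xi,\mathsf P_{X_s^\xi})\,dB_s,\quad t\in[0,T].$$ **Notation.** $D_\xi X_t^{\xi'}$ denotes the Gateaux derivative of the map $\xi\mapsto X_t^\xi$ evaluated at the point $\xi'$; $(\cdot)^*$ denotes the Hilbert-space adjoint. *)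

(* Defs.v *)
From HB Require Import structures.
From mathcomp Require Import all_boot all_order all_algebra.
From mathcomp Require Import all_classical all_reals all_analysis.
From mathcomp Require Import measurable_realfun.

Set Implicit Arguments.
Unset Strict Implicit.
Unset Printing Implicit Defensive.

Import Order.TTheory GRing.Theory Num.Def Num.Theory.
Import numFieldNormedType.Exports.

Local Open Scope classical_set_scope.
Local Open Scope ring_scope.

(* Points of R^d are row vectors 'rV[R]_d; matrices carry the Borel
   sigma-algebra of their norm topology. *)
HB.instance Definition _ (R : realType) (p q : nat) :=
  Measurable.copy 'M[R]_(p, q) (g_sigma_algebraType (@open 'M[R]_(p, q))).

(* Euclidean (Frobenius) norm; the library norm `|x| on matrices is the
   sup norm. *)
Definition enorm (R : realType) (p q : nat) (x : 'M[R]_(p, q)) : R :=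
  Num.sqrt (\sum_i \sum_j x i j ^+ 2).

Definition edot (R : realType) (d : nat) (x y : 'rV[R]_d) : R :=
  \sum_i x 0 i * y 0 i.

Lemma measurable_coord (R : realType) (p q : nat) i j :
  measurable_fun setT (fun x : 'M[R]_(p, q) => x i j).
Proof.
apply: (measurability _ (RGenOpens.measurableE R)).
move=> _ [_ [a [b ->] <-]]; apply: sub_sigma_algebra; rewrite setTI.
apply: open_comp; last exact: interval_open.
by move=> x _; exact: coord_continuous.
Qed.

Lemma measurable_enorm_sqr (R : realType) (p q : nat) :
  measurable_fun setT (fun x : 'M[R]_(p, q) => enorm x ^+ 2).
Proof.
have -> : (fun x : 'M[R]_(p, q) => enorm x ^+ 2) =
    (fun x => \sum_i \sum_j x i j ^+ 2).
  apply/funext => x; rewrite sqr_sqrtr// sumr_ge0// => i _.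
  by rewrite sumr_ge0// => j _; exact: sqr_ge0.
apply: measurable_sum => i; apply: measurable_sum => j.
by apply: measurable_funX; exact: measurable_coord.
Qed.

Record P2 (R : realType) (d : nat) := MkP2 {
  P2_prob :> probability 'rV[R]_d R ;
  P2_moment : (\int[P2_prob]_x (enorm x ^+ 2)%:E < +oo)%E }.

Definition is_coupling (R : realType) (d : nat) (mu nu : P2 R d)
    (pi : probability ('rV[R]_d * 'rV[R]_d)%type R) : Prop :=
  forall A : set 'rV[R]_d, measurable A ->
    pi (A `*` setT) = mu A /\ pi (setT `*` A) = nu A.

Definition W2 (R : realType) (d : nat) (mu nu : P2 R d) : R :=
  Num.sqrt (fine (ereal_inf
    [set (\int[pi]_z (enorm (z.1 - z.2) ^+ 2)%:E)%E
      | pi in [set pi | is_coupling mu nu pi]])).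

(* The measure mu + l (nu - mu), for l in [0, 1] (l is clamped to [0, 1]
   so that the result is a probability measure for every real l). *)
Section mixture.
Context (R : realType) (d : nat).
Implicit Types (l : R) (mu nu : P2 R d).

Definition clamp01 l : R := Num.max 0 (Num.min 1 l).

Lemma clamp01_ge0 l : 0 <= clamp01 l.
Proof. by rewrite le_max lexx. Qed.

Lemma clamp01C_ge0 l : 0 <= 1 - clamp01 l.
Proof. by rewrite subr_ge0 ge_max ler01 ge_min lexx. Qed.

Definition mixture_measure l mu nu : set 'rV[R]_d -> \bar R :=
  measure_add (mscale (NngNum (clamp01C_ge0 l)) mu)
              (mscale (NngNum (clamp01_ge0 l)) nu).

HB.instance Definition _ l mu nu := Measure.on (mixture_measure l mu nu).

Let mixture_setT l mu nu : mixture_measure l mu nu setT = 1%E.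
Proof.
rewrite /mixture_measure measure_addE.
rewrite /= /mscale/=.
by rewrite !probability_setT !mule1 -EFinD subrK.
Qed.

HB.instance Definition _ l mu nu :=
  Measure_isProbability.Build _ _ _ (mixture_measure l mu nu)
    (mixture_setT l mu nu).

Lemma mixture_moment l mu nu :
  (\int[mixture_measure l mu nu]_x (enorm x ^+ 2)%:E < +oo)%E.
Proof.
have m2 : measurable_fun setT (fun x : 'rV[R]_d => (enorm x ^+ 2)%:E).
  by apply/measurable_EFinP; exact: measurable_enorm_sqr.
have p2 (x : 'rV[R]_d) : setT x -> (0 <= (enorm x ^+ 2)%:E)%E.
  by move=> _; rewrite lee_fin sqr_ge0.
rewrite /mixture_measure ge0_integral_measure_add// !ge0_integral_mscale//=.
by apply: lte_add_pinfty; rewrite lte_mul_pinfty// ?lee_fin ?clamp01_ge0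
  ?clamp01C_ge0// P2_moment.
Qed.

Definition mixture l mu nu : P2 R d := MkP2 (mixture_moment l mu nu).

End mixture.

Section derivatives.
Context (R : realType) (d : nat).

Definition continuous_P2 (g : P2 R d -> 'rV[R]_d -> R) : Prop :=
  forall mu x e, 0 < e -> exists2 r, 0 < r &
    forall mu' x', W2 mu mu' < r -> enorm (x' - x) < r ->
      `|g mu' x' - g mu x| < e.

Definition quadratic_growth (g : P2 R d -> 'rV[R]_d -> R) : Prop :=
  forall mu, exists r C : R, 0 < r /\
    forall mu' x, W2 mu mu' < r -> `|g mu' x| <= C * (1 + enorm x ^+ 2).

Definition is_linear_functional_derivative
    (phi : P2 R d -> R) (dphi : P2 R d -> 'rV[R]_d -> R) : Prop :=
  [/\ continuous_P2 dphi, quadratic_growth dphi &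
    forall mu mu', phi mu' - phi mu =
      \int[lebesgue_measure]_(l in `[0, 1])
        (\int[mu']_x dphi (mixture l mu mu') x
         - \int[mu]_x dphi (mixture l mu mu') x)].

Definition grad (g : 'rV[R]_d -> R) (x : 'rV[R]_d) : 'rV[R]_d :=
  \row_k 'D_(delta_mx 0 k) g x.

Definition is_L_derivative
    (phi : P2 R d -> R) (Dphi : P2 R d -> 'rV[R]_d -> 'rV[R]_d) : Prop :=
  exists dphi : P2 R d -> 'rV[R]_d -> R,
    [/\ is_linear_functional_derivative phi dphi,
        forall mu x, differentiable (dphi mu) x,
        forall mu x, Dphi mu x = grad (dphi mu) x &
        forall k, continuous_P2 (fun mu x => Dphi mu x 0 k) /\
                  quadratic_growth (fun mu x => Dphi mu x 0 k)].

Definition C11b_real (f : 'rV[R]_d -> P2 R d -> R) : Prop :=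
  [/\ forall mu x, differentiable (f^~ mu) x,
      forall mu, continuous (grad (f^~ mu)) &
      exists Df : 'rV[R]_d -> P2 R d -> 'rV[R]_d -> 'rV[R]_d,
        (forall x, is_L_derivative (f x) (Df x)) /\
        exists C : R,
          [/\ forall x mu, enorm (grad (f^~ mu) x) <= C,
              forall x mu y, enorm (Df x mu y) <= C,
              forall x x' mu mu',
                enorm (grad (f^~ mu') x' - grad (f^~ mu) x)
                <= C * (enorm (x' - x) + W2 mu mu') &
              forall x x' mu mu' y y',
                enorm (Df x' mu' y' - Df x mu y)
                <= C * (enorm (x' - x) + W2 mu mu' + enorm (y' - y))]].

Definition C11b (p q : nat) (f : 'rV[R]_d -> P2 R d -> 'M[R]_(p, q)) : Prop :=
  forall i j, C11b_real (fun x mu => f x mu i j).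

End derivatives.

Section L2.
Context (R : realType) (disp : measure_display) (Omega : measurableType disp).
Variable P : probability Omega R.

Definition measurable_wrt (G : set (set Omega)) (p q : nat)
    (X : Omega -> 'M[R]_(p, q)) : Prop :=
  measurable_fun (setT : set (g_sigma_algebraType G)) X.

Definition L2norm (p q : nat) (X : Omega -> 'M[R]_(p, q)) : \bar R :=
  ('N[P]_2[(fun w => (enorm (X w))%:E)])%E.

Definition L2inner (d : nat) (X Y : Omega -> 'rV[R]_d) : R :=
  \int[P]_w edot (X w) (Y w).

(* Representatives of the classes in L^2(G; R^d). *)
Definition L2 (G : set (set Omega)) (d : nat) : set (Omega -> 'rV[R]_d) :=
  [set X | measurable_wrt G X /\ (L2norm X < +oo)%E].

Definition opnorm (G : set (set Omega)) (d : nat)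
    (A : (Omega -> 'rV[R]_d) -> (Omega -> 'rV[R]_d)) : \bar R :=
  ereal_sup [set L2norm (A eta)
            | eta in L2 G (d:=d) `&` [set eta | (L2norm eta <= 1)%E]].

(* Operators act on representatives; linearity holds almost surely, and with
   a finite operator norm this makes A compatible with a.s. equality. *)
Definition bounded_linear (G H : set (set Omega)) (d : nat)
    (A : (Omega -> 'rV[R]_d) -> (Omega -> 'rV[R]_d)) : Prop :=
  [/\ forall eta, L2 G eta -> L2 H (A eta),
      forall (a : R) eta zeta, L2 G eta -> L2 G zeta ->
        {ae P, forall w, A (fun w' => a *: eta w' + zeta w') w
                         = a *: A eta w + A zeta w} &
      (opnorm G A < +oo)%E].

Definition is_adjoint (G H : set (set Omega)) (d : nat)
    (A Astar : (Omega -> 'rV[R]_d) -> (Omega -> 'rV[R]_d)) : Prop :=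
  bounded_linear H G Astar /\
  forall eta zeta, L2 G eta -> L2 H zeta ->
    L2inner (A eta) zeta = L2inner eta (Astar zeta).

Definition is_law (d : nat) (X : Omega -> 'rV[R]_d) (mu : P2 R d) : Prop :=
  forall A, measurable A -> mu A = P (X @^-1` A).

End L2.

Definition modulus (R : realType) (v : R -> R) : Prop :=
  [/\ forall s, 0 <= s -> 0 <= v s,
      forall s s', 0 <= s -> s <= s' -> v s <= v s' &
      v s @[s --> (0 : R)^'+] --> (0 : R)].

Section stochastic_calculus.
Context (R : realType) (disp : measure_display) (Omega : measurableType disp).
Variables (P : probability Omega R) (T : R) (d m : nat).
Variables (B : R -> Omega -> 'rV[R]_m) (F0 : set (set Omega)).

Definition sigma_process (I : set R) : set (set Omega) :=
  <<s [set C | exists u A, [/\ I u, measurable A & C = B u @^-1` A]] >>.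

Definition brownian_motion : Prop :=
  [/\ forall t, 0 <= t <= T -> measurable_fun setT (B t),
      {ae P, forall w, B 0 w = 0},
      {ae P, forall w, {within `[0, T], continuous (B^~ w)}},
      (forall s t, 0 <= s -> s < t -> t <= T ->
        forall A (C : set 'rV[R]_m), sigma_process `[0, s] A ->
        measurable C ->
        P (A `&` [set w | C (B t w - B s w)%R]) =
        (P A * P [set w | C (B t w - B s w)%R])%E) &
      (* B_t - B_s is centered Gaussian with covariance (t - s) Id *)
      (forall s t, 0 <= s -> s < t -> t <= T ->
        forall C : 'I_m -> set R, (forall i, measurable (C i)) ->
        P [set w | forall i, C i ((B t w - B s w) 0 i)] =
        (\prod_(i < m) normal_prob 0 (Num.sqrt (t - s)) (C i))%E)].

Definition initial_sigma_algebra : Prop :=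
  [/\ sigma_algebra setT F0, F0 `<=` measurable,
      P.-negligible `<=` F0,
      (forall A C, F0 A -> sigma_process `[0, T] C ->
        P (A `&` C) = (P A * P C)%E) &
      (forall A, F0 A -> (0 < P A)%E ->
        exists A', [/\ F0 A', A' `<=` A, (0 < P A')%E & (P A' < P A)%E])].

Definition filtration (t : R) : set (set Omega) :=
  <<s F0 `|` sigma_process `[0, t] >>.

Definition S2 (Y : R -> Omega -> 'rV[R]_d) : Prop :=
  [/\ forall t, 0 <= t <= T -> measurable_wrt (filtration t) (Y t),
      forall w, {within `[0, T], continuous (Y^~ w)} &
      (\int[P]_w ereal_sup [set (enorm (Y t w) ^+ 2)%:E | t in `[0%R, T]]
       < +oo)%E].

Definition progressive (H : R -> Omega -> 'M[R]_(d, m)) : Prop :=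
  forall t, 0 <= t <= T ->
    measurable_fun
      (`[0, t]%classic `*` setT :
        set (measurableTypeR R * g_sigma_algebraType (filtration t)))
      (fun z => H z.1 z.2).

(* H_s = \sum_(i < n) h_i 1_(tau_i < s <= tau_(i+1)) *)
Record simple_process := SimpleProcess {
  sp_size : nat ;
  sp_time : nat -> R ;
  sp_coef : nat -> Omega -> 'M[R]_(d, m) }.

Definition simple_adapted (S : simple_process) : Prop :=
  [/\ 0 <= sp_time S 0, sp_time S (sp_size S) <= T,
      forall i, (i < sp_size S)%N -> sp_time S i <= sp_time S i.+1,
      forall i, (i < sp_size S)%N ->
        measurable_wrt (filtration (sp_time S i)) (sp_coef S i) &
      exists C : R, forall i w, (i < sp_size S)%N -> enorm (sp_coef S i w) <= C].

Definition simple_value (S : simple_process) (s : R) (w : Omega) :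
    'M[R]_(d, m) :=
  \sum_(i < sp_size S | sp_time S i < s <= sp_time S i.+1) sp_coef S i w.

Definition simple_integral (S : simple_process) (t : R) (w : Omega) :
    'rV[R]_d :=
  \sum_(i < sp_size S)
    (B (Num.min (sp_time S i.+1) t) w - B (Num.min (sp_time S i) t) w)
      *m (sp_coef S i w)^T.

(* I_t is (a version of) the Ito integral of H over [0, t], for all t in
   [0, T]: the L^2 limit of the integrals of simple processes approximating
   H in L^2(ds dP). *)
Definition is_ito_integral (H : R -> Omega -> 'M[R]_(d, m))
    (I : R -> Omega -> 'rV[R]_d) : Prop :=
  [/\ progressive H,
      (\int[P]_w \int[lebesgue_measure]_(s in `[0%R, T])
          (enorm (H s w) ^+ 2)%:E < +oo)%E,
      forall t, 0 <= t <= T -> measurable_wrt (filtration t) (I t) &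
      exists S : nat -> simple_process,
        [/\ forall k, simple_adapted (S k),
            (\int[P]_w \int[lebesgue_measure]_(s in `[0%R, T])
               (enorm (H s w - simple_value (S k) s w) ^+ 2)%:E)%E
              @[k --> \oo] --> 0%E &
            forall t, 0 <= t <= T ->
              L2norm P (fun w => I t w - simple_integral (S k) t w)
                @[k --> \oo] --> 0%E]].

Definition mckean_vlasov_solution
    (b0 : 'rV[R]_d -> P2 R d -> 'rV[R]_d)
    (b1 : 'rV[R]_d -> P2 R d -> 'M[R]_(d, m))
    (xi : Omega -> 'rV[R]_d) (X : R -> Omega -> 'rV[R]_d) : Prop :=
  S2 X /\
  exists (mu : R -> P2 R d) (I : R -> Omega -> 'rV[R]_d),
    [/\ forall t, 0 <= t <= T -> is_law P (X t) (mu t),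
        is_ito_integral (fun s w => b1 (X s w) (mu s)) I &
        forall t, 0 <= t <= T ->
          {ae P, forall w, X t w = xi w
             + (\row_i \int[lebesgue_measure]_(s in `[0, t])
                         (b0 (X s w) (mu s) 0 i))
             + I t w}].

End stochastic_calculus.

(* Main.v *)
(* No tangent equation is solved: the derivative of xi |-> X_t^xi in the direction
   eta is the L^2 limit of the difference quotients
   Q_r = (X_t^{xi + r eta} - X_t^xi) / r, and everything follows from one Cauchy
   estimate for them.  The flow is L-Lipschitz in L^2 by Ito's isometry and Gronwall.
   Taylor's formula for C^{1,1} coefficients bounds the dynamics of
   Q_r^xi - Q_{r'}^{xi'} linearly, up to error terms quadratic in Q; squares of these
   involve fourth moments, which are infinite in general because eta is only in L^2.
   The remedy is the F_0-measurable weight rho = 1 / (1 + |eta|^2): being known at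
   time 0 it passes through stochastic integrals, E[rho^2 |Q_r|^4] is bounded by a
   localised fourth moment Gronwall argument, and for |eta|_{L^2} <= 1 the mean field
   term is controlled by (E|Z|)^2 <= E[1/rho] E[rho |Z|^2] <= 2 E[rho |Z|^2].  Hence
   E[rho |Q_r^xi - Q_{r'}^{xi'}|^2] <= K delta, uniformly in eta with
   |eta|_{L^2} <= 1, whenever |r|, |r'|, |xi - xi'|_{L^2} <= delta.  For bounded eta
   the weight is bounded below, and density of bounded random variables together
   with the Lipschitz bound gives (i).  For (ii) the adjoint is given by Riesz'
   theorem; its strong continuity is the continuity of E[(D^xi eta) . zeta] in xi
   uniformly in |eta|_{L^2} <= 1, which holds for bounded zeta by
   E|Z| <= (2 E[rho |Z|^2])^{1/2} and for all zeta by density. *)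

Require Import Defs.
From HB Require Import structures.
From mathcomp Require Import all_boot all_order all_algebra.
From mathcomp Require Import all_classical all_reals all_analysis.
From mathcomp Require Import measurable_realfun ring lra.

Set Implicit Arguments.
Unset Strict Implicit.
Unset Printing Implicit Defensive.

Import Order.TTheory GRing.Theory Num.Def Num.Theory.
Import numFieldNormedType.Exports.

Local Open Scope classical_set_scope.
Local Open Scope ring_scope.

(** * Hilbert space preliminaries *)

(** The worst error term is [|Q| min(1, del |Q|)]. Its square times [rho] is split by Young's
    inequality into [del rho^2 |Q|^4] and [del^-1 min(1, del |Q|)^4 <= del |Q|^2], both of order
    [del] in mean; hence the weight [rho^2] for fourth moments against [rho] for second moments. The
    particular [rho] gives [rho^2 |eta|^4 <= 1], so that the weighted fourth moment is finite at
    time 0, while [E[1/rho] = 1 + E|eta|^2]. In the fourth moment estimate the mean field term does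
    no harm, being bounded by the Lipschitz constant of the flow. Finiteness of that moment at later
    times is not known in advance. Localisation multiplies by the indicator that the path has stayed
    in a ball, sampled at the points of a partition, instead of stopping the integral. Expectations
    are extended-real integrals of nonnegative functions; terms of mean zero are split into positive
    and negative parts. Ito's isometry enters as an upper bound only, with constants that are not
    sharp, and W_2 is only bounded from above, by explicit couplings. *)

Definition submodule (R : realType) (V : lmodType R) (K : set V) : Prop :=
  K 0 /\ forall (a : R) x y, K x -> K y -> K (a *: x + y).

(** Only semi-definite, and relative to a subset [K]: the vectors will be representatives of L^2
    classes, so a vector of norm zero need not vanish, and the nested L^2 spaces share one pairing
    on all functions. Identities between vectors therefore often appear as differences of norm
    zero. *)
Definition inner_product (R : realType) (V : lmodType R) (K : set V)
    (ip : V -> V -> R) : Prop :=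
  [/\ forall x y, K x -> K y -> ip x y = ip y x,
      forall (a : R) x y z, K x -> K y -> K z ->
        ip (a *: x + y) z = a * ip x z + ip y z &
      forall x, K x -> 0 <= ip x x].

Section pre_hilbert.
Context (R : realType) (V : lmodType R) (K : set V) (ip : V -> V -> R).
Hypothesis (Ksub : submodule K) (ipP : inner_product K ip).

Definition ip_norm x : R := Num.sqrt (ip x x).
Local Notation nrm := ip_norm.

Lemma submodule0 : K 0. Proof. by case: Ksub. Qed.

Lemma submoduleD x y : K x -> K y -> K (x + y).
Proof. by move=> Kx Ky; rewrite -[x]scale1r; case: Ksub => _; apply. Qed.

Lemma submoduleZ (a : R) x : K x -> K (a *: x).
Proof.
by move=> Kx; rewrite -[_ *: _]addr0; case: Ksub => K0; apply.
Qed.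

Lemma submoduleN x : K x -> K (- x).
Proof. by move=> Kx; rewrite -scaleN1r; exact: submoduleZ. Qed.

Lemma submoduleB x y : K x -> K y -> K (x - y).
Proof. by move=> Kx Ky; apply: submoduleD => //; exact: submoduleN. Qed.

Let ipC x y : K x -> K y -> ip x y = ip y x. Proof. by case: ipP => H _ _; exact: H. Qed.

Lemma ipDl x y z : K x -> K y -> K z -> ip (x + y) z = ip x z + ip y z.
Proof.
move=> Kx Ky Kz; case: ipP => _ /(_ 1 x y z Kx Ky Kz) + _.
by rewrite scale1r mul1r.
Qed.

Lemma ip0l z : K z -> ip 0 z = 0.
Proof.
move=> Kz; have := ipDl submodule0 submodule0 Kz.
by rewrite addr0 => /eqP; rewrite -subr_eq0 opprD addNKr oppr_eq0 => /eqP.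
Qed.

Lemma ipZl (a : R) x z : K x -> K z -> ip (a *: x) z = a * ip x z.
Proof.
move=> Kx Kz; case: ipP => _ /(_ a x 0 z Kx submodule0 Kz) + _.
by rewrite addr0 ip0l// addr0.
Qed.

Lemma ipNl x z : K x -> K z -> ip (- x) z = - ip x z.
Proof. by move=> Kx Kz; rewrite -scaleN1r ipZl// mulN1r. Qed.

Lemma ipDr x y z : K x -> K y -> K z -> ip z (x + y) = ip z x + ip z y.
Proof.
move=> Kx Ky Kz.
by rewrite ipC ?ipDl ?(ipC Kx) ?(ipC Ky)//; exact: submoduleD.
Qed.

Lemma ipZr (a : R) x z : K x -> K z -> ip z (a *: x) = a * ip z x.
Proof.
by move=> Kx Kz; rewrite ipC ?ipZl ?(ipC Kx)//; exact: submoduleZ.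
Qed.

Lemma ipNr x z : K x -> K z -> ip z (- x) = - ip z x.
Proof. by move=> Kx Kz; rewrite -scaleN1r ipZr// mulN1r. Qed.

Lemma ip_ge0 x : K x -> 0 <= ip x x. Proof. by case: ipP => _ _; apply. Qed.

Lemma ip_sqrD x y : K x -> K y ->
  ip (x + y) (x + y) = ip x x + 2 * ip x y + ip y y.
Proof.
move=> Kx Ky; have Kxy := submoduleD Kx Ky.
by rewrite ipDl// !ipDr// (ipC Ky Kx); lra.
Qed.

Lemma ip_normE x : K x -> nrm x ^+ 2 = ip x x.
Proof. by move=> Kx; rewrite sqr_sqrtr// ip_ge0. Qed.

Lemma ip_norm_ge0 x : 0 <= nrm x. Proof. exact: sqrtr_ge0. Qed.

Lemma ip_norm0 : nrm 0 = 0.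
Proof. by rewrite /ip_norm ip0l ?sqrtr0//; exact: submodule0. Qed.

Lemma ip_normZ (a : R) x : K x -> nrm (a *: x) = `|a| * nrm x.
Proof.
move=> Kx; rewrite /ip_norm ipZl ?ipZr//; last exact: submoduleZ.
by rewrite mulrA -expr2 sqrtrM ?sqr_ge0// sqrtr_sqr.
Qed.

Lemma ip_normN x : K x -> nrm (- x) = nrm x.
Proof. by move=> Kx; rewrite -scaleN1r ip_normZ// normrN1 mul1r. Qed.

Lemma ip_normC x y : K x -> K y -> nrm (x - y) = nrm (y - x).
Proof. by move=> Kx Ky; rewrite -opprB ip_normN//; exact: submoduleB. Qed.

Lemma cauchy_schwarz x y : K x -> K y -> `|ip x y| <= nrm x * nrm y.
Proof.
move=> Kx Ky; set c := ip x y.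
have key (t : R) : 0 <= ip x x + 2 * t * c + t ^+ 2 * ip y y.
  have := ip_ge0 (submoduleD Kx (submoduleZ t Ky)).
  have Kty := submoduleZ t Ky.
  by rewrite ip_sqrD// ipZr// ipZl// ipZr// -/c expr2 !mulrA.
have hx := ip_ge0 Kx; have hy := ip_ge0 Ky.
have : c ^+ 2 <= ip x x * ip y y.
  move: hy; rewrite le_eqVlt => /predU1P[hy|hy].
    rewrite -hy mulr0; have /eqP -> : c ^+ 2 == 0; last by [].
    rewrite sqrf_eq0; apply/negPn/negP => c0.
    (* For a null vector [y] the quadratic in [t] degenerates to an affine function; this [t] gives
       it the value -1. *)
    have := key (- (ip x x + 1) / (2 * c)).
    rewrite -hy mulr0 addr0.
    have -> : 2 * (- (ip x x + 1) / (2 * c)) * c = - (ip x x + 1) by field.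
    lra.
  have := key (- c / ip y y).
  have -> : ip x x + 2 * (- c / ip y y) * c + (- c / ip y y) ^+ 2 * ip y y =
     (ip x x * ip y y - c ^+ 2) / ip y y by field; rewrite gt_eqF.
  by rewrite pmulr_lge0 ?invr_gt0// subr_ge0.
rewrite -(ler_sqrt _ (mulr_ge0 hx (ip_ge0 Ky))) sqrtr_sqr => h.
by rewrite /ip_norm -sqrtrM.
Qed.

Lemma ip_normD x y : K x -> K y -> nrm (x + y) <= nrm x + nrm y.
Proof.
move=> Kx Ky.
rewrite -(@ler_pXn2r _ 2) ?nnegrE ?addr_ge0 ?ip_norm_ge0//.
rewrite ip_normE ?ip_sqrD// ?sqrrD ?ip_normE//; last exact: submoduleD.
have := cauchy_schwarz Kx Ky; have := ler_norm (ip x y); lra.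
Qed.

Lemma ip_normB_le x y z : K x -> K y -> K z ->
  nrm (x - z) <= nrm (x - y) + nrm (y - z).
Proof.
move=> Kx Ky Kz; rewrite -[x - z](subrKA y).
by apply: ip_normD; exact: submoduleB.
Qed.

Definition ip_complete : Prop := forall u : nat -> V,
  (forall n, K (u n)) ->
  (forall e : R, 0 < e -> exists N, forall n p, (N <= n)%N -> (N <= p)%N ->
     nrm (u n - u p) <= e) ->
  exists2 x, K x & forall e : R, 0 < e -> exists N, forall n, (N <= n)%N ->
     nrm (u n - x) <= e.

Lemma ltr_natV_small (e : R) : 0 < e -> exists N, forall n, (N <= n)%N ->
  n.+1%:R^-1 <= e.
Proof.
move=> e0; exists (Num.trunc e^-1) => n Nn.
rewrite -[e]invrK lef_pV2 ?posrE ?invr_gt0//.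
apply: (le_trans (ltW (truncnS_gt _))).
by rewrite ler_nat ltnS.
Qed.

(* The representing vector minimises [ip x x - 2 l x]. *)
Theorem riesz_representation (l : V -> R) (C : R) : ip_complete ->
  (forall a x y, K x -> K y -> l (a *: x + y) = a * l x + l y) ->
  (forall x, K x -> `|l x| <= C * nrm x) ->
  exists2 z, K z & forall x, K x -> l x = ip x z.
Proof.
move=> cplt lin bnd.
have lD x y : K x -> K y -> l (x + y) = l x + l y.
  by move=> Kx Ky; have := lin 1 x y Kx Ky; rewrite scale1r mul1r.
have l0 : l 0 = 0.
  have := lD 0 0 submodule0 submodule0; rewrite addr0 => /eqP.
  by rewrite -subr_eq0 opprD addNKr oppr_eq0 => /eqP.
have lZ a x : K x -> l (a *: x) = a * l x.
  by move=> Kx; have := lin a x 0 Kx submodule0; rewrite addr0 l0 addr0.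
pose J x := ip x x - 2 * l x.
have Jlb x : K x -> - C ^+ 2 <= J x.
  move=> Kx; rewrite /J -ip_normE//.
  have h := bnd x Kx; have h' := ler_norm (l x).
  have := sqr_ge0 (nrm x - C); nra.
pose S := J @` K.
have S0 : S !=set0 by exists (J 0), 0 => //; exact: submodule0.
have lbS : has_lbound S by exists (- C ^+ 2) => _ [x Kx <-]; exact: Jlb.
pose m := inf S.
have mle x : K x -> m <= J x.
  by move=> Kx; apply: ge_inf => //; exists x.
have /choice[u uP] (n : nat) : exists x, K x /\ J x < m + n.+1%:R^-1.
  have n0 : 0 < n.+1%:R^-1 :> R by rewrite invr_gt0.
  have [_ [x Kx <-] lt] := inf_adherent n0 (conj S0 lbS).
  by exists x.
have Ku n : K (u n) by have [] := uP n.
(* Parallelogram identity for [J]: two near-minimisers are close, since [J] at their midpoint is at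
   least [m]. Hence a minimising sequence is Cauchy. *)
have par x y : K x -> K y ->
    nrm (x - y) ^+ 2 = 2 * J x + 2 * J y - 4 * J (2^-1 *: (x + y)).
  move=> Kx Ky; rewrite ip_normE /J; last exact: submoduleB.
  have Kxy := submoduleD Kx Ky; have Kny := submoduleN Ky.
  rewrite ip_sqrD// lZ// ipZl ?ipZr//; last exact: submoduleZ.
  by rewrite ip_sqrD// ipNr// !ipNl// ?ipNr// lD//; lra.
have [||x Kx xP] := cplt u => //.
  move=> e e0.
  have e24 : 0 < e ^+ 2 / 4 by rewrite divr_gt0// exprn_gt0.
  have [N HN] := ltr_natV_small e24.
  exists N => n p Nn Np.
  rewrite -(@ler_pXn2r _ 2) ?nnegrE ?ip_norm_ge0 ?(ltW e0)// par//.
  have [_ h1] := uP n; have [_ h2] := uP p.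
  have /mle : K (2^-1 *: (u n + u p)) by apply: submoduleZ; exact: submoduleD.
  move: h1 h2 (HN n Nn) (HN p Np); move: n.+1%:R^-1 p.+1%:R^-1 => a b.
  move: (J _) (J _) (J _) => c c' c''; lra.
have Jx : J x <= m.
  apply/ler_addgt0Pr => e e0.
  pose M := 2 * (nrm x + `|C| + 1).
  have M0 : 0 < M by rewrite mulr_gt0// ltr_pwDr// addr_ge0 ?ip_norm_ge0.
  have e'0 : 0 < minr 1 (e / 2 / M) by rewrite lt_min ltr01 divr_gt0// divr_gt0.
  have [N1 H1] := xP _ e'0.
  have [N2 H2] := ltr_natV_small (divr_gt0 e0 (ltr0n R 2)).
  set n := maxn N1 N2.
  have := H1 n (leq_maxl _ _); rewrite le_min => /andP[g1 g2].
  have h2 := H2 n (leq_maxr _ _); have [_ h3] := uP n.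
  set d := u n - x in g1 g2.
  have Kd : K d by exact: submoduleB.
  have ud : u n = x + d by rewrite /d addrC subrK.
  have : J x <= J (u n) + M * nrm d.
    rewrite ud /J ip_sqrD// lD//.
    have c1 := cauchy_schwarz Kx Kd; have c2 := bnd d Kd.
    have c3 := ler_norm (l d); have c4 := ler_normr (- ip x d) `|ip x d|.
    have c5 := ler_norm (- ip x d); rewrite normrN in c5.
    have c6 := ip_ge0 Kd; have c7 := ip_norm_ge0 d.
    have c8 : C * nrm d <= `|C| * nrm d by rewrite ler_wpM2r// ler_norm.
    rewrite /M; nra.
  have : M * nrm d <= e / 2 by rewrite mulrC -ler_pdivlMr.
  move: (M * nrm d) (J x) (J (u n)) h2 h3 => a b c h2 h3 h4 h5.
  apply: (le_trans h5); rewrite [e]splitr addrA; apply: lerD => //.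
  by apply: ltW; apply: (lt_le_trans h3); rewrite lerD2l.
exists x => // y Ky.
have key t : 0 <= 2 * t * (ip x y - l y) + t ^+ 2 * ip y y.
  have Kty := submoduleZ t Ky.
  have := mle _ (submoduleD Kx Kty).
  move: Jx; rewrite /J ip_sqrD// lD// ipZr// ipZl// ipZr// lZ//; lra.
rewrite (ipC Ky Kx); apply/eqP; rewrite -subr_eq0.
set c := l y - ip x y.
have {}key t : 2 * t * c <= t ^+ 2 * ip y y.
  have := key t; rewrite /c; lra.
rewrite -sqrf_eq0; apply/eqP/le_anti; rewrite sqr_ge0 andbT.
have q0 := ip_ge0 Ky; set q := ip y y in key q0.
have q1 : 0 < q + 1 by lra.
(* The optimal [t] would be [c / q]; the denominator [q + 1] also covers null vectors [y]. *)
have := key (c / (q + 1)).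
have -> : 2 * (c / (q + 1)) * c = 2 * (c ^+ 2 / (q + 1)) by field; lra.
have -> : (c / (q + 1)) ^+ 2 * q = c ^+ 2 / (q + 1) * (q / (q + 1)) by field; lra.
set s := c ^+ 2 / (q + 1).
have s0 : 0 <= s by rewrite divr_ge0 ?sqr_ge0// ltW.
have q2 : q / (q + 1) <= 1 by rewrite ler_pdivrMr// mul1r lerDl.
move=> hs.
have : s <= 0 by nra.
by rewrite /s pmulr_lle0 ?invr_gt0.
Qed.

End pre_hilbert.

(** * Derivatives as limits of difference quotients, and their adjoints *)

Section quotient_limit.
Context (R : realType) (V : lmodType R) (K K0 K1 : set V) (ip : V -> V -> R).
Hypothesis (Ksub : submodule K) (K0sub : submodule K0) (K1sub : submodule K1).
Hypothesis (K0K : K0 `<=` K) (K1K : K1 `<=` K) (ipP : inner_product K ip).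
Hypothesis (K0cplt : ip_complete K0 ip) (K1cplt : ip_complete K1 ip).
Local Notation nrm := (ip_norm ip).
Variables (Phi : V -> V) (L : R).
Hypothesis (PhiK : forall x, K0 x -> K1 (Phi x)).
Hypothesis (L_ge0 : 0 <= L).
Hypothesis PhiL : forall x y, K0 x -> K0 y ->
  nrm (Phi y - Phi x) <= L * nrm (y - x).

Definition diff_quot (r : R) (x h : V) : V := r^-1 *: (Phi (x + r *: h) - Phi x).

Hypothesis quotUC : forall h, K0 h -> forall e : R, 0 < e -> exists2 del : R, 0 < del &
  forall x x' (r r' : R), K0 x -> K0 x' -> r != 0 -> r' != 0 ->
    `|r| <= del -> `|r'| <= del -> nrm (x' - x) <= del ->
    nrm (diff_quot r x h - diff_quot r' x' h) <= e.

Lemma diff_quotK (r : R) x h : K0 x -> K0 h -> K1 (diff_quot r x h).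
Proof.
move=> K0x K0h; apply: (submoduleZ K1sub); apply: (submoduleB K1sub).
  by apply: PhiK; apply: (submoduleD K0sub) => //; exact: (submoduleZ K0sub).
exact: PhiK.
Qed.

Lemma diff_quot_le (r : R) x h : r != 0 -> K0 x -> K0 h ->
  nrm (diff_quot r x h) <= L * nrm h.
Proof.
move=> r0 K0x K0h; have K0rh := submoduleZ K0sub r K0h.
have K0xrh := submoduleD K0sub K0x K0rh.
rewrite /diff_quot (ip_normZ Ksub ipP); last first.
  by apply: (submoduleB Ksub); apply: K1K; apply: PhiK.
rewrite normfV ler_pdivrMl ?normr_gt0//.
apply: (le_trans (PhiL K0x K0xrh)).
by rewrite addrAC subrr add0r (ip_normZ Ksub ipP r (K0K K0h)) mulrCA.
Qed.

Lemma ip_norm_le_small (x : V) (c : R) :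
  (forall e, 0 < e -> nrm x <= c + e) -> nrm x <= c.
Proof. by move=> H; apply/ler_addgt0Pr. Qed.

(** One Cauchy estimate in which step and base point vary together yields everything: equal base
    points give the limit, distinct ones its continuity, and a base point shifted by [r *: k] its
    additivity. The bound on [D] is inherited from the Lipschitz constant of [Phi]. *)
Theorem quotient_derivative : exists D : V -> V -> V,
  [/\ forall x h, K0 x -> K0 h -> K1 (D x h),
      forall h, K0 h -> forall e : R, 0 < e -> exists2 del : R, 0 < del &
        forall x (r : R), K0 x -> r != 0 -> `|r| <= del ->
          nrm (diff_quot r x h - D x h) <= e,
      forall x h, K0 x -> K0 h -> nrm (D x h) <= L * nrm h,
      forall x a h k, K0 x -> K0 h -> K0 k ->
        nrm (D x (a *: h + k) - (a *: D x h + D x k)) = 0 &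
      forall h, K0 h -> forall e : R, 0 < e -> exists2 del : R, 0 < del &
        forall x x', K0 x -> K0 x' -> nrm (x' - x) <= del ->
          nrm (D x' h - D x h) <= e].
Proof.
have nrmB0 z : K z -> nrm (z - z) = 0.
  by move=> Kz; rewrite subrr (ip_norm0 Ksub ipP).
have lim x h : exists y, K0 x -> K0 h -> K1 y /\
    forall e : R, 0 < e -> exists2 del : R, 0 < del & forall r : R, r != 0 ->
      `|r| <= del -> nrm (diff_quot r x h - y) <= e.
  have [[K0x K0h]|nKK] := pselect (K0 x /\ K0 h); last first.
    by exists 0 => K0x K0h; exfalso; exact: nKK.
  have qK r : K (diff_quot r x h) by apply: K1K; exact: diff_quotK.
  have [n|e e0|y K1y yP] := K1cplt (u := fun n => diff_quot n.+1%:R^-1 x h).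
  - exact: diff_quotK.
  - have [del del0 H] := quotUC K0h e0.
    have [N HN] := ltr_natV_small del0.
    exists N => n p Nn Np; apply: H => //.
    + by rewrite ger0_norm ?invr_ge0// HN.
    + by rewrite ger0_norm ?invr_ge0// HN.
    + by rewrite nrmB0 ?(ltW del0)//; exact: K0K.
  exists y => _ _; split => // e e0.
  have e20 : 0 < e / 2 by rewrite divr_gt0.
  have [del del0 H] := quotUC K0h e20.
  exists del => // r r0 rdel.
  have [N1 HN1] := ltr_natV_small del0; have [N2 HN2] := yP _ e20.
  set n := maxn N1 N2.
  apply: (le_trans (ip_normB_le Ksub ipP (qK r) (qK n.+1%:R^-1) (K1K K1y))).
  rewrite [e]splitr lerD//; last by apply: HN2; exact: leq_maxr.
  apply: H => //; rewrite ?nrmB0 ?(ltW del0)//; last exact: K0K.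
  by rewrite ger0_norm ?invr_ge0// HN1// leq_maxl.
pose D x h := projT1 (cid (lim x h)).
have DP x h : K0 x -> K0 h -> K1 (D x h) /\
    forall e : R, 0 < e -> exists2 del : R, 0 < del & forall r : R, r != 0 ->
      `|r| <= del -> nrm (diff_quot r x h - D x h) <= e.
  by rewrite /D; case: cid => y /= H K0x K0h; exact: H.
have DK1 x h : K0 x -> K0 h -> K1 (D x h) by move=> a b; have [] := DP x h a b.
have DK x h : K0 x -> K0 h -> K (D x h) by move=> a b; apply: K1K; exact: DK1.
have qK r x h : K0 x -> K0 h -> K (diff_quot r x h).
  by move=> K0x K0h; apply: K1K; exact: diff_quotK.
(* the limit is uniform in the base point *)
have Dunif h : K0 h -> forall e : R, 0 < e -> exists2 del : R, 0 < del &
    forall x x' (r : R), K0 x -> K0 x' -> nrm (x' - x) <= del -> r != 0 ->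
      `|r| <= del -> nrm (diff_quot r x h - D x' h) <= e.
  move=> K0h e e0; have [del del0 H] := quotUC K0h e0.
  exists del => // x x' r K0x K0x' xx' r0 rdel.
  apply: ip_norm_le_small => e' e'0.
  have [_ /(_ _ e'0)[del' del'0 H']] := DP x' h K0x' K0h.
  pose r' := minr del del'.
  have r'0 : 0 < r' by rewrite lt_min del0.
  apply: (le_trans (ip_normB_le Ksub ipP (qK r x h K0x K0h) (qK r' x' h K0x' K0h)
    (DK _ _ K0x' K0h))).
  apply: lerD.
    apply: H => //; first by rewrite gt_eqF.
    by rewrite gtr0_norm// ge_min lexx.
  by apply: H' => //; rewrite ?gt_eqF// gtr0_norm// ge_min lexx orbT.
exists D; split => //.
- move=> h K0h e e0; have [del del0 H] := Dunif h K0h e e0.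
  exists del => // x r K0x r0 rdel; apply: H => //.
  by rewrite nrmB0 ?(ltW del0)//; exact: K0K.
- move=> x h K0x K0h; apply: ip_norm_le_small => e e0.
  have [_ /(_ _ e0)[del del0 H]] := DP x h K0x K0h.
  have r0 : del != 0 by rewrite gt_eqF.
  have Kq := qK del x h K0x K0h; have KD := DK x h K0x K0h.
  have -> : D x h = diff_quot del x h + - (diff_quot del x h - D x h).
    by rewrite opprB addrC subrK.
  have KB := submoduleB Ksub Kq KD.
  apply: (le_trans (ip_normD Ksub ipP Kq (submoduleN Ksub KB))).
  rewrite (ip_normN Ksub ipP KB) lerD//; first exact: diff_quot_le.
  by apply: H => //; rewrite gtr0_norm.
- move=> x a h k K0x K0h K0k.
  (* the quotient along a h + k at x splits into the quotients
     along h at x + r k and along k at x *)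
  have split (r : R) : r != 0 -> diff_quot r x (a *: h + k) =
      a *: diff_quot (r * a) (x + r *: k) h + diff_quot r x k.
    move=> r0; have [->|a0] := eqVneq a 0.
      by rewrite !scale0r !add0r.
    rewrite /diff_quot scalerA invfM mulrCA divff// mulr1 -scalerDr.
    have -> : x + r *: (a *: h + k) = x + r *: k + (r * a) *: h.
      by rewrite -addrA -scalerA -scalerDr (addrC k).
    by rewrite subrKA.
  have K0ahk : K0 (a *: h + k) by case: K0sub => _; apply.
  apply/le_anti; rewrite ip_norm_ge0 andbT.
  apply/ler_addgt0Pr => e e0; rewrite add0r.
  pose e' := e / (`|a| + 2).
  have a2 : 0 < `|a| + 2 by rewrite ltr_wpDl.
  have e'0 : 0 < e' by rewrite divr_gt0.
  have [d1 d10 H1] := Dunif _ K0ahk _ e'0.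
  have [d2 d20 H2] := Dunif _ K0h _ e'0.
  have [d3 d30 H3] := Dunif _ K0k _ e'0.
  have xx0 : nrm (x - x) <= 0 by rewrite nrmB0//; exact: K0K.
  (* The step must suit the three limits; moreover [r * a] must be at most [d2] in size and the
     shifted base point [x + r *: k] within [d2] of [x]. Adding 1 to the denominators keeps them
     positive. *)
  pose r := minr (minr d1 d3) (minr (d2 / (`|a| + 1)) (d2 / (nrm k + 1))).
  have a1 : 0 < `|a| + 1 by rewrite ltr_wpDl.
  have k1 : 0 < nrm k + 1 by rewrite ltr_wpDl ?ip_norm_ge0.
  have r0 : 0 < r by rewrite !lt_min d10 d30 !divr_gt0.
  have r0' : r != 0 by rewrite gt_eqF.
  have : r <= r by []. 
  rewrite {2}/r !le_min => /andP[/andP[rd1 rd3] /andP[rd2 rd2']].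
  have K0rk := submoduleZ K0sub r K0k.
  have K0xrk := submoduleD K0sub K0x K0rk.
  have g1 : nrm (diff_quot r x (a *: h + k) - D x (a *: h + k)) <= e'.
    by apply: H1 => //; rewrite ?gtr0_norm// (le_trans xx0)// ltW.
  have g3 : nrm (diff_quot r x k - D x k) <= e'.
    by apply: H3 => //; rewrite ?gtr0_norm// (le_trans xx0)// ltW.
  have g2 : nrm (a *: (diff_quot (r * a) (x + r *: k) h - D x h)) <= `|a| * e'.
    have [->|a0] := eqVneq a 0.
      by rewrite scale0r (ip_norm0 Ksub ipP) normr0 mul0r.
    rewrite (ip_normZ Ksub ipP); last first.
      by apply: (submoduleB Ksub); [exact: qK|exact: DK].
    apply: ler_wpM2l => //; apply: H2 => //.
    + rewrite opprD addNKr (ip_normN Ksub ipP (K0K K0rk)) (ip_normZ Ksub ipP r (K0K K0k)).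
      rewrite gtr0_norm// (le_trans (ler_wpM2r (ip_norm_ge0 _ _) rd2'))//.
      by rewrite mulrAC ler_pdivrMr// ler_wpM2l ?(ltW d20)// lerDl ler01.
    + by rewrite mulf_neq0.
    + rewrite normrM gtr0_norm// (le_trans (ler_wpM2r (normr_ge0 _) rd2))//.
      by rewrite mulrAC ler_pdivrMr// ler_wpM2l ?(ltW d20)// lerDl ler01.
  have aux (E A B C0 D0 : V) : E - (C0 + D0) = E - (A + B) + (A - C0 + (B - D0)).
    by rewrite (addrACA A) -opprD addrA subrK.
  have KA := submoduleB Ksub (qK r _ _ K0x K0ahk) (DK _ _ K0x K0ahk).
  have KB : K (a *: (diff_quot (r * a) (x + r *: k) h - D x h)).
    by apply: (submoduleZ Ksub); apply: (submoduleB Ksub); [exact: qK|exact: DK].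
  have KC := submoduleB Ksub (qK r _ _ K0x K0k) (DK _ _ K0x K0k).
  have -> : D x (a *: h + k) - (a *: D x h + D x k) =
     - (diff_quot r x (a *: h + k) - D x (a *: h + k)) +
     (a *: (diff_quot (r * a) (x + r *: k) h - D x h) +
      (diff_quot r x k - D x k)).
    rewrite {1}split// scalerBr opprB.
    exact: aux.
  apply: (le_trans (ip_normD Ksub ipP (submoduleN Ksub KA) (submoduleD Ksub KB KC))).
  rewrite (ip_normN Ksub ipP KA).
  have := ip_normD Ksub ipP KB KC.
  have -> : e = e' + (`|a| * e' + e').
    by rewrite /e'; field; rewrite gt_eqF.
  lra.
- move=> h K0h e e0; have e20 : 0 < e / 2 by rewrite divr_gt0.
  have [del del0 H] := Dunif h K0h _ e20.
  exists del => // x x' K0x K0x' xx'.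
  have r0 : del != 0 by rewrite gt_eqF.
  have ndel : `|del| <= del by rewrite gtr0_norm.
  have Kq := qK del x h K0x K0h.
  have KD := DK x h K0x K0h; have KD' := DK x' h K0x' K0h.
  apply: (le_trans (ip_normB_le Ksub ipP KD' Kq KD)).
  rewrite (ip_normC Ksub ipP KD' Kq) [e]splitr lerD// H//.
  by rewrite nrmB0 ?(ltW del0)//; exact: K0K.
Qed.

(** Riesz' theorem on [K0] represents [h |-> ip (D x h) z]. Since a norm is a supremum of pairings
    over the unit ball, strong continuity of the adjoint amounts to weak continuity of [D] uniformly
    over the unit ball of [h], which is the last assumption. *)
Theorem adjoint_family (D : V -> V -> V) :
  (forall x h, K0 x -> K0 h -> K1 (D x h)) ->
  (forall x h, K0 x -> K0 h -> nrm (D x h) <= L * nrm h) ->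
  (forall x a h k, K0 x -> K0 h -> K0 k ->
     nrm (D x (a *: h + k) - (a *: D x h + D x k)) = 0) ->
  (forall z, K1 z -> forall e : R, 0 < e -> exists2 del : R, 0 < del &
     forall x x' h, K0 x -> K0 x' -> K0 h -> nrm (x' - x) <= del -> nrm h <= 1 ->
       `|ip (D x' h - D x h) z| <= e) ->
  exists Ds : V -> V -> V,
  [/\ forall x z, K0 x -> K1 z -> K0 (Ds x z),
      forall x h z, K0 x -> K0 h -> K1 z -> ip (D x h) z = ip h (Ds x z),
      forall x z, K0 x -> K1 z -> nrm (Ds x z) <= L * nrm z,
      forall x a z y, K0 x -> K1 z -> K1 y ->
        nrm (Ds x (a *: z + y) - (a *: Ds x z + Ds x y)) = 0 &
      forall z, K1 z -> forall e : R, 0 < e -> exists2 del : R, 0 < del &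
        forall x x', K0 x -> K0 x' -> nrm (x' - x) <= del ->
          nrm (Ds x' z - Ds x z) <= e].
Proof.
move=> DK1 Dle Dlin Dweak.
have ip0P : inner_product K0 ip.
  case: ipP => a b c; split => [x y /K0K ? /K0K ?|r x y z /K0K ? /K0K ? /K0K ?|x /K0K ?].
  - exact: a.
  - exact: b.
  - exact: c.
have [ipC _ _] := ipP.
have DK x h : K0 x -> K0 h -> K (D x h) by move=> a b; apply: K1K; exact: DK1.
(* [D x] is linear only up to vectors of norm zero; these pair to zero, so the functional to be
   represented is exactly linear. *)
have ipnull u z : K u -> K z -> nrm u = 0 -> ip u z = 0.
  move=> Ku Kz u0; apply/eqP; rewrite -normr_eq0; apply/eqP/le_anti.
  by rewrite normr_ge0 andbT (le_trans (cauchy_schwarz Ksub ipP Ku Kz))// u0 mul0r.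
have ex x z : exists y, K0 x -> K1 z -> K0 y /\
    forall h, K0 h -> ip (D x h) z = ip h y.
  have [[K0x K1z]|nKK] := pselect (K0 x /\ K1 z); last first.
    by exists 0 => K0x K1z; exfalso; exact: nKK.
  have Kz := K1K K1z.
  have lin a h k : K0 h -> K0 k -> ip (D x (a *: h + k)) z =
      a * ip (D x h) z + ip (D x k) z.
    move=> K0h K0k; have K0ahk : K0 (a *: h + k) by case: K0sub => _; apply.
    have KA := DK _ _ K0x K0ahk; have KB := DK _ _ K0x K0h.
    have KC := DK _ _ K0x K0k; have KD : K (a *: D x h + D x k) by case: Ksub => _; apply.
    have := ipnull _ _ (submoduleB Ksub KA KD) Kz (Dlin _ _ _ _ K0x K0h K0k).
    rewrite (ipDl ipP KA (submoduleN Ksub KD) Kz) (ipNl Ksub ipP KD Kz).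
    case: ipP => _ -> // _; lra.
  have bnd h : K0 h -> `|ip (D x h) z| <= (L * nrm z) * nrm h.
    move=> K0h; apply: (le_trans (cauchy_schwarz Ksub ipP (DK _ _ K0x K0h) Kz)).
    by rewrite mulrAC ler_wpM2r ?ip_norm_ge0// Dle.
  have [y K0y yP] := riesz_representation K0sub ip0P K0cplt lin bnd.
  by exists y.
pose Ds x z := projT1 (cid (ex x z)).
have DsP x z : K0 x -> K1 z -> K0 (Ds x z) /\
    forall h, K0 h -> ip (D x h) z = ip h (Ds x z).
  by rewrite /Ds; case: cid => y /= H K0x K1z; exact: H.
have DsK0 x z : K0 x -> K1 z -> K0 (Ds x z) by move=> a b; have [] := DsP x z a b.
have DsE x z h : K0 x -> K1 z -> K0 h -> ip (D x h) z = ip h (Ds x z).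
  by move=> a b; have [_] := DsP x z a b; apply.
(* the norm of y in K0 is controlled by testing against y itself *)
have dual y c : K0 y -> 0 <= c -> (forall h, K0 h -> nrm h <= 1 -> `|ip h y| <= c) ->
    nrm y <= c.
  move=> K0y c0 H; have [->//|y0] := eqVneq (nrm y) 0.
  have y_gt0 : 0 < nrm y by rewrite lt_neqAle eq_sym y0 ip_norm_ge0.
  have := H ((nrm y)^-1 *: y) (submoduleZ K0sub _ K0y).
  have Ky := K0K K0y.
  rewrite (ip_normZ Ksub ipP _ Ky) normfV gtr0_norm// mulVf// => /(_ (lexx _)).
  rewrite (ipZl Ksub ipP _ Ky Ky) -(ip_normE ipP Ky) expr2 mulKf//.
  by rewrite gtr0_norm.
exists Ds; split => //.
- by move=> x h z K0x K0h K1z; exact: DsE.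
- move=> x z K0x K1z; apply: dual; first exact: DsK0.
    by rewrite mulr_ge0// ip_norm_ge0.
  move=> h K0h h1; rewrite -DsE//.
  apply: (le_trans (cauchy_schwarz Ksub ipP (DK _ _ K0x K0h) (K1K K1z))).
  rewrite ler_wpM2r ?ip_norm_ge0// (le_trans (Dle _ _ K0x K0h))//.
  by rewrite -[leRHS]mulr1 ler_wpM2l.
- move=> x a z y K0x K1z K1y.
  have K1azy : K1 (a *: z + y) by case: K1sub => _; apply.
  have KA := DsK0 _ _ K0x K1azy; have KB := DsK0 _ _ K0x K1z.
  have KC := DsK0 _ _ K0x K1y.
  have KD : K0 (a *: Ds x z + Ds x y) by case: K0sub => _; apply.
  apply/le_anti; rewrite ip_norm_ge0 andbT.
  apply: dual => //; first exact: (submoduleB K0sub).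
  move=> h K0h _.
  rewrite (ipDr Ksub ipP (K0K KA) (submoduleN Ksub (K0K KD)) (K0K K0h)).
  rewrite (ipNr Ksub ipP (K0K KD) (K0K K0h)).
  rewrite (ipDr Ksub ipP (submoduleZ Ksub a (K0K KB)) (K0K KC) (K0K K0h)).
  rewrite (ipZr Ksub ipP a (K0K KB) (K0K K0h)) -!DsE//.
  have KDh := DK _ _ K0x K0h.
  rewrite (ipDr Ksub ipP (submoduleZ Ksub a (K1K K1z)) (K1K K1y) KDh).
  by rewrite (ipZr Ksub ipP a (K1K K1z) KDh) subrr normr0.
- move=> z K1z e e0; have [del del0 H] := Dweak z K1z e e0.
  exists del => // x x' K0x K0x' xx'.
  have KA := DsK0 _ _ K0x K1z; have KB := DsK0 _ _ K0x' K1z.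
  apply: dual; [exact: (submoduleB K0sub)|exact: ltW|].
  move=> h K0h h1; have := H _ _ _ K0x K0x' K0h xx' h1.
  have KDx := DK _ _ K0x K0h; have KDx' := DK _ _ K0x' K0h.
  rewrite (ipDl ipP KDx' (submoduleN Ksub KDx) (K1K K1z)).
  rewrite (ipNl Ksub ipP KDx (K1K K1z)) !DsE//.
  rewrite (ipDr Ksub ipP (K0K KB) (submoduleN Ksub (K0K KA)) (K0K K0h)).
  by rewrite (ipNr Ksub ipP (K0K KA) (K0K K0h)).
Qed.

End quotient_limit.

(** * Square-integrable random vectors *)

Section nonneg_integral.
Context d (T : measurableType d) (R : realType) (mu : {measure set T -> \bar R}).
Implicit Types (D : set T) (f g : T -> \bar R).

(** The integral of a nonnegative function is a supremum over simple functions below it, so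
    monotonicity holds for arbitrary functions. This is used wherever a section or an iterated
    integral is not known to be measurable. *)
Lemma ge0_integral_mono D f g : (forall x, D x -> (0 <= f x)%E) ->
  (forall x, D x -> (f x <= g x)%E) ->
  (\int[mu]_(x in D) f x <= \int[mu]_(x in D) g x)%E.
Proof.
move=> f0 fg; rewrite !ge0_integralE//; last first.
  by move=> x Dx; rewrite (le_trans (f0 x Dx))// fg.
apply: ge_ereal_sup => _ [h hf <-]; apply: ereal_sup_ubound.
exists h => // x; apply: (le_trans (hf x)); rewrite /patch.
by case: ifPn => // /set_mem Dx; exact: fg.
Qed.

(** The positive and the negative part of [f] both lie between 0 and [h], so monotonicity of
    nonnegative integrals applies to each; the difference of two numbers in [[0, a]] is at most [a]
    in absolute value. *)
Lemma le_normr_Rintegral_nonmeas D (f h : T -> R) :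
  (forall x, D x -> `|f x| <= h x) -> (\int[mu]_(x in D) (h x)%:E < +oo)%E ->
  `|\int[mu]_(x in D) f x|%R <= fine (\int[mu]_(x in D) (h x)%:E).
Proof.
move=> fh hoo; rewrite /Rintegral.
have h0 x : D x -> 0 <= h x by move=> Dx; rewrite (le_trans _ (fh x Dx)).
have bnd (g : T -> R) : (forall x, D x -> 0 <= g x <= h x) ->
    exists2 r : R, (\int[mu]_(x in D) (g x)%:E)%E = r%:E &
      0 <= r <= fine (\int[mu]_(x in D) (h x)%:E).
  move=> gh; have g0 : (0 <= \int[mu]_(x in D) (g x)%:E)%E.
    by apply: integral_ge0 => x Dx; rewrite lee_fin; case/andP: (gh x Dx).
  have ghE : (\int[mu]_(x in D) (g x)%:E <= \int[mu]_(x in D) (h x)%:E)%E.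
    by apply: ge0_integral_mono => x Dx; rewrite lee_fin; case/andP: (gh x Dx).
  have gfin : (\int[mu]_(x in D) (g x)%:E)%E \is a fin_num.
    by rewrite ge0_fin_numE// (le_lt_trans ghE).
  exists (fine (\int[mu]_(x in D) (g x)%:E)); first by rewrite fineK.
  rewrite fine_ge0//= fine_le//.
  by rewrite ge0_fin_numE// integral_ge0// => x Dx; rewrite lee_fin h0.
rewrite integralE.
have [|r1 + r1P] := bnd (fun x => f^\+ x).
  move=> x Dx; rewrite funrpos_ge0/= /funrpos ge_max h0// andbT.
  by rewrite (le_trans (ler_norm _))// fh.
have [|r2 + r2P] := bnd (fun x => f^\- x).
  move=> x Dx; rewrite funrneg_ge0/= /funrneg ge_max h0// andbT.
  by rewrite (le_trans _ (fh x Dx))// -normrN ler_norm.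
move=> f2 f1.
have -> : (\int[mu]_(x in D) (fun x0 => (f x0)%:E)^\+ x = r1%:E)%E.
  by rewrite -f1; apply: eq_integral => x _; rewrite funeposE /funrpos EFin_max.
have -> : (\int[mu]_(x in D) (fun x0 => (f x0)%:E)^\- x = r2%:E)%E.
  by rewrite -f2; apply: eq_integral => x _; rewrite funenegE /funrneg EFin_max EFinN.
rewrite -EFinB/= ler_norml; case/andP: r1P => r10 r1h; case/andP: r2P => r20 r2h.
by rewrite lerBrDr (le_trans _ r10) ?lerBlDr ?(le_trans r1h) ?lerDl// addrC subr_le0.
Qed.

(** Serves the average over [l] in the definition of the functional derivative, whose integrand is
    not known to be measurable in [l]. The parts of [f] are trapped between the parts of [c - e] and
    [c + e], and [max a 0 - max (- a) 0 = a]. *)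
Lemma Rintegral_near_cst D (f : T -> R) (c e : R) : measurable D -> mu D = 1%E ->
  (forall x, D x -> `|f x - c| <= e) -> `|\int[mu]_(x in D) f x - c|%R <= e.
Proof.
move=> mD muD fc; rewrite /Rintegral integralE.
have bnd (g : T -> \bar R) (a b : R) : 0 <= a ->
    (forall x, D x -> (a%:E <= g x)%E && (g x <= b%:E)%E) ->
    exists2 r : R, (\int[mu]_(x in D) g x)%E = r%:E & a <= r <= b.
  move=> a0 gab.
  have cstE (k : R) : (\int[mu]_(x in D) k%:E = k%:E)%E.
    by rewrite integral_cst// muD mule1.
  have h1 : (a%:E <= \int[mu]_(x in D) g x)%E.
    by rewrite -cstE; apply: ge0_integral_mono => x Dx; rewrite ?lee_fin//; case/andP: (gab x Dx).
  have h2 : (\int[mu]_(x in D) g x <= b%:E)%E.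
    rewrite -(cstE b); apply: ge0_integral_mono => x Dx; case/andP: (gab x Dx) => // h _.
    by rewrite (le_trans _ h)// lee_fin.
  have gfin : (\int[mu]_(x in D) g x)%E \is a fin_num.
    by rewrite fin_numElt (lt_le_trans _ h1) ?ltNyr//= (le_lt_trans h2)// ltry.
  by exists (fine (\int[mu]_(x in D) g x)); rewrite ?fineK// -!lee_fin fineK// h1.
have fx x : D x -> c - e <= f x <= c + e.
  by move=> /fc; rewrite ler_norml => /andP[h1 h2]; apply/andP; split; lra.
have M0 (a : R) : 0 <= Num.max a 0 by rewrite le_max lexx orbT.
have [||r1 -> r1P] := bnd (fun x => (f x)%:E)^\+%E (Num.max (c - e) 0) (Num.max (c + e) 0) => //.
  move=> x /fx/andP[h1 h2]; rewrite funeposE -EFin_max !lee_fin.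
  by rewrite !ge_max !le_max h1 h2 !lexx !orbT.
have [||r2 -> r2P] := bnd (fun x => (f x)%:E)^\-%E (Num.max (- (c + e)) 0) (Num.max (- (c - e)) 0) => //.
  move=> x /fx/andP[h1 h2]; rewrite funenegE -EFin_max !lee_fin.
  by rewrite !ge_max !le_max !lerN2 h1 h2 !lexx !orbT.
have ME (a : R) : Num.max a 0 - Num.max (- a) 0 = a.
  by rewrite /Num.max; case: ifP; case: ifP; lra.
have := ME (c - e); have := ME (c + e); case/andP: r1P => ? ?; case/andP: r2P => ? ?.
by rewrite -EFinB/= ler_norml => ? ?; apply/andP; split; lra.
Qed.

End nonneg_integral.

(** * Measurability of matrix-valued maps *)

Section measurable_matrix.
Context d (T : measurableType d) (R : realType) (p q : nat).
Implicit Types X Y : T -> 'M[R]_(p, q).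

(** An open set is a countable union of balls with rational centre and radius, and a ball of the sup
    norm is a finite intersection of conditions on the entries. The domain is arbitrary, so the
    criterion applies to every sub-sigma-algebra. *)
Lemma measurable_mx X : (forall i j, measurable_fun setT (fun w => X w i j)) ->
  measurable_fun setT X.
Proof.
move=> mX; apply: (@measurability _ _ _ _ _ X (@open 'M[R]_(p, q))) => //.
move=> _ [U oU <-]; rewrite setTI.
pose F (k : 'M[rat]_(p, q) * rat) : set T :=
  if `[< ball (map_mx ratr k.1 : 'M[R]_(p, q)) (ratr k.2) `<=` U >]
  then X @^-1` ball (map_mx ratr k.1 : 'M[R]_(p, q)) (ratr k.2) else set0.
suff -> : X @^-1` U = \bigcup_k F k.
  apply: countable_bigcupT_measurable => [|k]; first exact: countableP.
  rewrite /F; case: ifPn => [_|_]; last exact: measurable0.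
  have [k0|k0] := ltP 0 (ratr k.2 : R); last first.
    suff -> : X @^-1` ball (map_mx ratr k.1 : 'M[R]_(p, q)) (ratr k.2) = set0 by [].
    by apply/seteqP; split => // w [/lt_le_trans/(_ k0)]; rewrite ltxx.
  suff -> : X @^-1` ball (map_mx ratr k.1 : 'M[R]_(p, q)) (ratr k.2) =
      \bigcap_(ij : 'I_p * 'I_q)
        (fun w => X w ij.1 ij.2) @^-1` ball (ratr (k.1 ij.1 ij.2) : R) (ratr k.2).
    apply: fin_bigcap_measurable => // ij _.
    rewrite -[_ @^-1` _]setTI; apply: mX => //; exact: measurable_ball.
  apply/seteqP; split => w.
    by move=> [_ H] [i j] _ /=; have := H i j; rewrite mxE.
  by move=> H; split => // i j; rewrite mxE; exact: (H (i, j)).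
apply/seteqP; split => [w Uw|w [k _]]; last first.
  by rewrite /F; case: ifPn => // /asboolP kU /kU.
have /nbhs_ballP[e /= e0 eU] : nbhs (X w) U by apply: open_nbhs_nbhs.
(* A rational radius [r] below [e / 2] and a rational centre within [r] of [X w]: the ball then
   contains [X w] and stays inside the ball of radius [e] around it. *)
have e20 : 0 < e / 2 by rewrite divr_gt0.
have [r] := rat_in_itvoo e20; rewrite in_itv/= => /andP[r0 re].
have /choice[c cP] (ij : 'I_p * 'I_q) : exists c : rat,
    `|X w ij.1 ij.2 - ratr c| < ratr r.
  have lt : X w ij.1 ij.2 - ratr r < X w ij.1 ij.2 + ratr r by lra.
  have [c] := rat_in_itvoo lt; rewrite in_itv/= => /andP[c1 c2].
  by exists c; rewrite ltr_norml; apply/andP; split; lra.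
exists (\matrix_(i, j) c (i, j), r) => //.
have bw i j : ball (ratr (c (i, j)) : R) (ratr r) (X w i j).
  by rewrite /ball/= distrC; exact: (cP (i, j)).
rewrite /F; case: ifPn => [_|/asboolP[]] /=.
  by split => // i j; rewrite !mxE.
move=> x [_ xr]; apply: eU; split => // i j.
have := xr i j; rewrite !mxE => h.
move: h (bw i j); rewrite /ball/= => h1 h2.
have := ler_distD (ratr (c (i, j))) (X w i j) (x i j).
rewrite (distrC (X w i j) (ratr _)) => /le_lt_trans; apply.
by rewrite [e]splitr ltrD ?(lt_trans _ re).
Qed.

Lemma measurable_entry X i j : measurable_fun setT X ->
  measurable_fun setT (fun w => X w i j).
Proof. by move=> mX; exact: (measurableT_comp (@measurable_coord R p q i j) mX). Qed.

Lemma measurable_mxD X Y : measurable_fun setT X -> measurable_fun setT Y ->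
  measurable_fun setT (fun w => X w + Y w).
Proof.
move=> mX mY; apply: measurable_mx => i j.
under eq_fun do rewrite mxE.
by apply: measurable_funD; exact: measurable_entry.
Qed.

Lemma measurable_mxZ (f : T -> R) X : measurable_fun setT f -> measurable_fun setT X ->
  measurable_fun setT (fun w => f w *: X w).
Proof.
move=> mf mX; apply: measurable_mx => i j.
under eq_fun do rewrite mxE.
by apply: measurable_funM => //; exact: measurable_entry.
Qed.

Lemma measurable_mxB X Y : measurable_fun setT X -> measurable_fun setT Y ->
  measurable_fun setT (fun w => X w - Y w).
Proof.
move=> mX mY; apply: measurable_mx => i j.
under eq_fun do rewrite !mxE.
by apply: measurable_funB; exact: measurable_entry.
Qed.

Lemma measurable_enorm X : measurable_fun setT X ->
  measurable_fun setT (fun w => enorm (X w)).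
Proof.
move=> mX; have -> : (fun w => enorm (X w)) = Num.sqrt \o (fun w => enorm (X w) ^+ 2).
  by apply/funext => w /=; rewrite sqrtr_sqr ger0_norm// sqrtr_ge0.
apply: measurableT_comp.
  by apply: continuous_measurable_fun; exact: sqrt_continuous.
by apply: (measurableT_comp (@measurable_enorm_sqr R p q)).
Qed.

Lemma measurable_enorm_sqr_comp X : measurable_fun setT X ->
  measurable_fun setT (fun w => enorm (X w) ^+ 2).
Proof. by move=> mX; apply: measurable_funX; exact: measurable_enorm. Qed.

End measurable_matrix.

(** * The Euclidean norm of matrices *)

Section euclidean_norm.
Context (R : realType) (p q : nat).
Implicit Types x y : 'M[R]_(p, q).

Definition mxdot x y : R := \sum_i \sum_j x i j * y i j.

Lemma mxdot_inner_product : inner_product setT mxdot.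
Proof.
split.
- by move=> x y _ _; apply: eq_bigr => i _; apply: eq_bigr => j _; rewrite mulrC.
- move=> a x y z _ _ _; rewrite /mxdot mulr_sumr -big_split/=.
  apply: eq_bigr => i _; rewrite mulr_sumr -big_split/=.
  by apply: eq_bigr => j _; rewrite !mxE mulrDl mulrA.
- by move=> x _; apply: sumr_ge0 => i _; apply: sumr_ge0 => j _; rewrite -expr2 sqr_ge0.
Qed.

Lemma setT_submodule (V : lmodType R) : submodule (@setT V).
Proof. by []. Qed.

Lemma enormE x : enorm x = ip_norm mxdot x.
Proof.
by rewrite /enorm /ip_norm; congr (Num.sqrt _); apply: eq_bigr => i _;
  apply: eq_bigr => j _; rewrite expr2.
Qed.

Let sub := setT_submodule 'M[R]_(p, q).
Let ipP := mxdot_inner_product.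

Lemma enorm_ge0 x : 0 <= enorm x. Proof. exact: sqrtr_ge0. Qed.

Lemma enorm_sqr x : enorm x ^+ 2 = \sum_i \sum_j x i j ^+ 2.
Proof.
rewrite sqr_sqrtr//; apply: sumr_ge0 => i _; apply: sumr_ge0 => j _; exact: sqr_ge0.
Qed.

Lemma enorm0 : enorm (0 : 'M[R]_(p, q)) = 0.
Proof. by rewrite enormE (ip_norm0 sub ipP). Qed.

Lemma enormD x y : enorm (x + y) <= enorm x + enorm y.
Proof. by rewrite !enormE (ip_normD sub ipP). Qed.

Lemma enormZ a x : enorm (a *: x) = `|a| * enorm x.
Proof. by rewrite !enormE (ip_normZ sub ipP). Qed.

Lemma enormN x : enorm (- x) = enorm x.
Proof. by rewrite !enormE (ip_normN sub ipP). Qed.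

Lemma enormB x y : enorm (x - y) <= enorm x + enorm y.
Proof. by rewrite -(enormN y) enormD. Qed.

Lemma enormC x y : enorm (x - y) = enorm (y - x).
Proof. by rewrite -opprB enormN. Qed.

Lemma enorm_entry x i j : `|x i j| <= enorm x.
Proof.
rewrite -(@ler_pXn2r _ 2) ?nnegrE ?enorm_ge0// enorm_sqr real_normK ?num_real//.
rewrite (bigD1 i)//= (bigD1 j)//= -!addrA lerDl addr_ge0//.
  by apply: sumr_ge0 => k _; exact: sqr_ge0.
by apply: sumr_ge0 => k _; apply: sumr_ge0 => l _; exact: sqr_ge0.
Qed.

Lemma enorm_le_sum x : enorm x <= \sum_i \sum_j `|x i j|.
Proof.
have S0 : 0 <= \sum_i \sum_j `|x i j| by apply: sumr_ge0 => i _; apply: sumr_ge0.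
rewrite -(@ler_pXn2r _ 2) ?nnegrE ?enorm_ge0// enorm_sqr expr2.
rewrite mulr_suml ler_sum// => i _; rewrite mulr_suml ler_sum// => j _.
rewrite -real_normK ?num_real// expr2 ler_wpM2l//.
rewrite (bigD1 i)//= (bigD1 j)//= -!addrA lerDl addr_ge0//.
  by apply: sumr_ge0.
by apply: sumr_ge0 => k _; apply: sumr_ge0.
Qed.

Lemma enorm_sqrD x y : enorm (x + y) ^+ 2 <= 2 * enorm x ^+ 2 + 2 * enorm y ^+ 2.
Proof.
have := enormD x y; have := enorm_ge0 x; have := enorm_ge0 y.
have := enorm_ge0 (x + y); have := sqr_ge0 (enorm x - enorm y); nra.
Qed.

End euclidean_norm.

Lemma edotE (R : realType) (n : nat) (x y : 'rV[R]_n) : edot x y = mxdot x y.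
Proof. by rewrite /mxdot big_ord1. Qed.

Lemma edot_le (R : realType) (n : nat) (x y : 'rV[R]_n) :
  `|edot x y| <= enorm x * enorm y.
Proof.
rewrite edotE !enormE.
exact: (cauchy_schwarz (@setT_submodule R _) (@mxdot_inner_product R 1 n)).
Qed.

(** * The inner product of square-integrable random vectors *)

Section L2_space.
Context (R : realType) (disp : measure_display) (Omega : measurableType disp).
Variables (P : probability Omega R) (d : nat).
Implicit Types (G : set (set Omega)) (X Y : Omega -> 'rV[R]_d).

Definition msq (p q : nat) (X : Omega -> 'M[R]_(p, q)) : \bar R :=
  (\int[P]_w (enorm (X w) ^+ 2)%:E)%E.

Lemma msq_ge0 (p q : nat) (X : Omega -> 'M[R]_(p, q)) : (0 <= msq X)%E.
Proof. by apply: integral_ge0 => w _; rewrite lee_fin sqr_ge0. Qed.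

Lemma L2normE (p q : nat) (X : Omega -> 'M[R]_(p, q)) : L2norm P X = sqrte (msq X).
Proof.
rewrite /L2norm unlock -poweR12_sqrt ?msq_ge0//; congr (_ `^ _)%E.
apply: eq_integral => w _ /=.
by rewrite ger0_norm ?enorm_ge0// -powR_mulrn ?enorm_ge0.
Qed.

Lemma L2norm_lty (p q : nat) (X : Omega -> 'M[R]_(p, q)) :
  (L2norm P X < +oo)%E = (msq X < +oo)%E.
Proof.
rewrite L2normE; have := msq_ge0 X; case: (msq X) => //= r _; by rewrite !ltry.
Qed.

Lemma measurable_wrtW (p q : nat) G (X : Omega -> 'M[R]_(p, q)) : G `<=` measurable -> measurable_wrt G X ->
  measurable_fun setT X.
Proof.
move=> Gm mX _ A mA; have := mX measurableT A mA; rewrite !setTI => h.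
exact: (smallest_sub (@sigma_algebra_measurable _ Omega) Gm).
Qed.

Lemma measurable_wrt_sub (p q : nat) G H (X : Omega -> 'M[R]_(p, q)) :
  G `<=` <<s H>> -> measurable_wrt G X -> measurable_wrt H X.
Proof.
move=> GH mX _ A mA; have := mX measurableT A mA; rewrite !setTI => h.
exact: (smallest_sub (smallest_sigma_algebra _ _) GH).
Qed.

Lemma measurable_wrtT (p q : nat) (X : Omega -> 'M[R]_(p, q)) : measurable_fun setT X -> measurable_wrt measurable X.
Proof.
move=> mX _ A mA; rewrite setTI; apply: sub_sigma_algebra.
by rewrite -[_ @^-1` _]setTI; exact: mX.
Qed.

Lemma L2T G : G `<=` measurable -> L2 P G (d:=d) `<=` L2 P measurable (d:=d).
Proof.
by move=> Gm X [mX Xoo]; split => //; apply: measurable_wrtT; exact: measurable_wrtW mX.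
Qed.

Lemma L2_measurable X : L2 P measurable X -> measurable_fun setT X.
Proof. by move=> [mX _]; exact: measurable_wrtW mX. Qed.

Lemma L2_msq G X : L2 P G X -> (msq X < +oo)%E.
Proof. by move=> [_]; rewrite L2norm_lty. Qed.

Lemma measurable_sqr_EFin (p q : nat) (X : Omega -> 'M[R]_(p, q)) :
  measurable_fun setT X -> measurable_fun setT (fun w => (enorm (X w) ^+ 2)%:E).
Proof. by move=> mX; apply/measurable_EFinP; exact: measurable_enorm_sqr_comp. Qed.

Lemma msqD_le (p q : nat) (X Y : Omega -> 'M[R]_(p, q)) :
  measurable_fun setT X -> measurable_fun setT Y ->
  (msq (fun w => X w + Y w)%R <= 2%:E * msq X + 2%:E * msq Y)%E.
Proof.
move=> mX mY; have mX2 := measurable_sqr_EFin mX; have mY2 := measurable_sqr_EFin mY.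
have sq0 (Z : Omega -> 'M[R]_(p, q)) w : setT w -> (0 <= (enorm (Z w) ^+ 2)%:E)%E.
  by rewrite lee_fin sqr_ge0.
rewrite /msq -!ge0_integralZl//; try exact: sq0; try by rewrite lee_fin.
rewrite -ge0_integralD//; last 4 first.
- by move=> w _; rewrite mule_ge0 ?sq0// lee_fin.
- exact: measurable_funeM.
- by move=> w _; rewrite mule_ge0 ?sq0// lee_fin.
- exact: measurable_funeM.
apply: ge0_integral_mono => w _; first by rewrite lee_fin sqr_ge0.
by rewrite -!EFinM -EFinD lee_fin enorm_sqrD.
Qed.

Lemma msqZ (p q : nat) (a : R) (X : Omega -> 'M[R]_(p, q)) : measurable_fun setT X ->
  msq (fun w => a *: X w) = ((a ^+ 2)%:E * msq X)%E.
Proof.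
move=> mX; rewrite /msq -ge0_integralZl//.
- by apply: eq_integral => w _; rewrite enormZ exprMn real_normK ?num_real.
- exact: measurable_sqr_EFin.
- by move=> w _; rewrite lee_fin sqr_ge0.
- by rewrite lee_fin sqr_ge0.
Qed.

Lemma msqN (p q : nat) (X : Omega -> 'M[R]_(p, q)) : msq (fun w => - X w) = msq X.
Proof. by apply: eq_integral => w _; rewrite enormN. Qed.

Lemma msqB_le (p q : nat) (X Y : Omega -> 'M[R]_(p, q)) :
  measurable_fun setT X -> measurable_fun setT Y ->
  (msq (fun w => X w - Y w)%R <= 2%:E * msq X + 2%:E * msq Y)%E.
Proof.
move=> mX mY; rewrite -(msqN Y); apply: msqD_le => //.
under eq_fun do rewrite -scaleN1r.
by apply: measurable_mxZ => //; exact: measurable_cst.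
Qed.

Lemma L2_submodule G : G `<=` measurable -> submodule (L2 P G (d:=d)).
Proof.
move=> Gm; split.
  split; first exact: (@measurable_cst _ _ (g_sigma_algebraType G)).
  rewrite L2norm_lty /msq; under eq_integral do rewrite enorm0 expr0n/=.
  by rewrite integral0.
move=> a X Y [mX Xoo] [mY Yoo].
have maX : measurable_wrt G (fun w => a *: X w).
  by apply: measurable_mxZ => //; exact: measurable_cst.
split; first exact: measurable_mxD.
rewrite !L2norm_lty in Xoo Yoo *.
have [mX' mY'] := (measurable_wrtW Gm mX, measurable_wrtW Gm mY).
apply: le_lt_trans (msqD_le (measurable_wrtW Gm maX) mY') _.
by rewrite msqZ// lte_add_pinfty// ?lte_mul_pinfty ?mule_ge0 ?msq_ge0 ?lee_fin ?sqr_ge0.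
Qed.

Lemma integrable_edot X Y : L2 P measurable X -> L2 P measurable Y ->
  P.-integrable setT (fun w => (edot (X w) (Y w))%:E).
Proof.
move=> LX LY; have [mX mY] := (L2_measurable LX, L2_measurable LY).
have mXY : measurable_fun setT (fun w => edot (X w) (Y w)).
  by apply: measurable_sum => i; apply: measurable_funM; exact: measurable_entry.
have sq_int (Z : Omega -> 'rV[R]_d) : L2 P measurable Z -> P.-integrable setT (fun w => (enorm (Z w) ^+ 2)%:E).
  move=> LZ; apply/integrableP; split; first by apply: measurable_sqr_EFin; exact: L2_measurable.
  under eq_integral do rewrite gee0_abs ?lee_fin ?sqr_ge0//.
  exact: (L2_msq LZ).
apply: (@le_integrable _ _ _ _ _ measurableT _
  (fun w => ((enorm (X w) ^+ 2)%:E + (enorm (Y w) ^+ 2)%:E)%E)).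
- exact/measurable_EFinP.
- move=> w _; rewrite -EFinD/= lee_fin (le_trans (edot_le _ _))//.
  rewrite [leRHS]ger0_norm ?addr_ge0 ?sqr_ge0//.
  have := sqr_ge0 (enorm (X w) - enorm (Y w)).
  by have := mulr_ge0 (enorm_ge0 (X w)) (enorm_ge0 (Y w)); nra.
- by apply: integrableD => //; exact: sq_int.
Qed.

Lemma L2inner_product : inner_product (L2 P measurable (d:=d)) (L2inner P (d:=d)).
Proof.
split.
- by move=> X Y _ _; apply: eq_Rintegral => w _; apply: eq_bigr => i _; rewrite mulrC.
- move=> a X Y Z LX LY LZ; rewrite /L2inner -RintegralZl//; last exact: integrable_edot.
  rewrite -RintegralD//; last 2 first.
  + have := integrableZl measurableT a (integrable_edot LX LZ).
    by apply: eq_integrable.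
  + exact: integrable_edot.
  apply: eq_Rintegral => w _; rewrite /edot mulr_sumr -big_split/=.
  by apply: eq_bigr => i _; rewrite !mxE mulrDl mulrA.
- move=> X _; apply: Rintegral_ge0 => w _; apply: sumr_ge0 => i _.
  by rewrite -expr2 sqr_ge0.
Qed.

Lemma L2inner_sqr X : L2inner P X X = fine (msq X).
Proof.
rewrite /L2inner /Rintegral /msq; congr fine; apply: eq_integral => w _.
by rewrite enorm_sqr big_ord1; congr EFin; apply: eq_bigr => i _; rewrite expr2.
Qed.

Lemma msqE X : L2 P measurable X -> msq X = (ip_norm (L2inner P (d:=d)) X ^+ 2)%:E.
Proof.
move=> LX; rewrite (ip_normE L2inner_product LX) L2inner_sqr fineK//.
by rewrite ge0_fin_numE ?msq_ge0// (L2_msq LX).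
Qed.

Lemma L2norm_ip X : L2 P measurable X ->
  L2norm P X = (ip_norm (L2inner P (d:=d)) X)%:E.
Proof.
by move=> LX; rewrite L2normE msqE//= sqrtr_sqr ger0_norm// ip_norm_ge0.
Qed.

Lemma ip_norm_leP X (e : R) : L2 P measurable X -> 0 <= e ->
  (ip_norm (L2inner P (d:=d)) X <= e) = (msq X <= (e ^+ 2)%:E)%E.
Proof.
by move=> LX e0; rewrite msqE// lee_fin ler_pXn2r ?nnegrE ?ip_norm_ge0.
Qed.

End L2_space.

(** * Completeness, density and the Gronwall lemma *)

Lemma limn_einf_le (R : realType) (u : (\bar R)^nat) c :
  (forall n, (u n <= c)%E) -> (limn_einf u <= c)%E.
Proof.
move=> uc; rewrite limn_einf_lim; apply: lime_le; first exact: is_cvg_einfs.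
by apply: nearW => n; apply: (le_trans _ (uc n)); apply: ereal_inf_lbound; exists n => /=.
Qed.

(** Passes a moment bound that is uniform along a sequence to its almost sure limit: to the limit of
    a Cauchy subsequence, and to the removal of truncations in the fourth moment estimates. *)
Lemma fatou_ae_le d (T : measurableType d) (R : realType)
    (mu : {measure set T -> \bar R}) (f : (T -> \bar R)^nat) (g : T -> \bar R) c :
  (forall n, measurable_fun setT (f n)) -> measurable_fun setT g ->
  (forall n w, (0 <= f n w)%E) -> (forall w, (0 <= g w)%E) ->
  {ae mu, forall w, f^~ w @ \oo --> g w} ->
  (forall n, (\int[mu]_w f n w <= c)%E) -> (\int[mu]_w g w <= c)%E.
Proof.
move=> mf mg f0 g0 fg fc.
have mlim : measurable_fun setT (fun w => limn_einf (f^~ w)).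
  have -> : (fun w => limn_einf (f^~ w)) = (fun w => - limn_esup (fun n => - f n w))%E.
    by apply/funext => w.
  apply: measurableT_comp => //; apply: measurable_fun_limn_esup => n.
  by apply: measurableT_comp.
have lim0 w : (0 <= limn_einf (f^~ w))%E.
  rewrite limn_einf_lim; apply: lime_ge; first exact: is_cvg_einfs.
  by apply: nearW => n; apply: le_ereal_inf_tmp => _ [k /= _ <-].
apply: (le_trans _ (limn_einf_le fc)).
apply: (le_trans _ (fatou mu measurableT mf (fun n w _ => f0 n w))).
apply: ae_ge0_le_integral => //.
apply: filterS fg => w fgw _.
by rewrite (cvg_limn_einf_sup fgw).1.
Qed.

Lemma cvg_big_sum (R : realType) (I : Type) (r : seq I) (f : I -> nat -> R) (l : I -> R) :
  (forall i, f i n @[n --> \oo] --> l i) ->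
  (\sum_(i <- r) f i n) @[n --> \oo] --> \sum_(i <- r) l i.
Proof.
move=> fl; elim: r => [|i r IH].
  by under eq_fun do rewrite big_nil; rewrite big_nil; exact: cvg_cst.
by under eq_fun do rewrite big_cons; rewrite big_cons; exact: cvgD.
Qed.

Lemma cvg_enorm_sqr (R : realType) (p q : nat) (x : nat -> 'M[R]_(p, q)) (y : 'M[R]_(p, q)) :
  (forall i j, x n i j @[n --> \oo] --> y i j) ->
  enorm (x n) ^+ 2 @[n --> \oo] --> enorm y ^+ 2.
Proof.
move=> xy; under eq_fun do rewrite enorm_sqr; rewrite enorm_sqr.
apply: cvg_big_sum => i; apply: cvg_big_sum => j.
under eq_fun do rewrite expr2; rewrite expr2.
exact: cvgM.
Qed.

(** * Expectations of nonnegative real functions *)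

Section nonneg_real_integral.
Context d (T : measurableType d) (R : realType) (mu : {measure set T -> \bar R}).
Implicit Types f g : T -> R.

Lemma Eint_le f g : (forall w, 0 <= f w) -> (forall w, f w <= g w) ->
  (\int[mu]_w (f w)%:E <= \int[mu]_w (g w)%:E)%E.
Proof. by move=> f0 fg; apply: ge0_integral_mono => w _; rewrite lee_fin. Qed.

Lemma Eint_ge0 f : (forall w, 0 <= f w) -> (0 <= \int[mu]_w (f w)%:E)%E.
Proof. by move=> f0; apply: integral_ge0 => w _; rewrite lee_fin. Qed.

Lemma Eint_D f g : measurable_fun setT f -> measurable_fun setT g ->
  (forall w, 0 <= f w) -> (forall w, 0 <= g w) ->
  (\int[mu]_w (f w + g w)%:E = \int[mu]_w (f w)%:E + \int[mu]_w (g w)%:E)%E.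
Proof.
move=> mf mg f0 g0; under eq_integral do rewrite EFinD.
by rewrite ge0_integralD//; (try by move=> w _; rewrite lee_fin); exact/measurable_EFinP.
Qed.

Lemma Eint_Z (c : R) f : measurable_fun setT f -> (forall w, 0 <= f w) -> 0 <= c ->
  (\int[mu]_w (c * f w)%:E = c%:E * \int[mu]_w (f w)%:E)%E.
Proof.
move=> mf f0 c0; under eq_integral do rewrite EFinM.
by rewrite ge0_integralZl//; [exact/measurable_EFinP|move=> w _; rewrite lee_fin].
Qed.

Lemma Eint_sum (I : Type) (s : seq I) (f : I -> T -> R) :
  (forall i, measurable_fun setT (f i)) -> (forall i w, 0 <= f i w) ->
  (\int[mu]_w (\sum_(i <- s) f i w)%:E = \sum_(i <- s) \int[mu]_w (f i w)%:E)%E.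
Proof.
move=> mf f0; under eq_integral do rewrite -sumEFin.
rewrite ge0_integral_sum//; first by move=> i; exact/measurable_EFinP.
by move=> i w _; rewrite lee_fin.
Qed.

End nonneg_real_integral.

Lemma Eint_cst d (T : measurableType d) (R : realType) (P : probability T R) (c : R) :
  (\int[P]__ c%:E = c%:E)%E.
Proof.
transitivity (c%:E * P setT)%E; first exact: integral_cst.
by rewrite probability_setT mule1.
Qed.

(** * Completeness of L^2 and density of bounded vectors *)

Section L2_complete.
Context (R : realType) (disp : measure_display) (Omega : measurableType disp).
Variables (P : probability Omega R) (d : nat).
Local Notation nrm := (ip_norm (L2inner P (d:=d))).

(** Riesz-Fischer. Along a fast subsequence the sum of the increments is integrable, hence the
    subsequence converges almost surely, and Fatou's lemma gives convergence in L^2 of the whole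
    sequence. The limit is written as an upper limit at every point, which makes it measurable for
    [G] itself. *)
Lemma L2_complete (G : set (set Omega)) : G `<=` measurable ->
  ip_complete (L2 P G (d:=d)) (L2inner P (d:=d)).
Proof.
move=> Gm u uL cau.
have Kall n : L2 P measurable (u n) by apply: (L2T Gm).
have Ksub := L2_submodule P d (@subset_refl _ (@measurable _ Omega)).
have KB (X Y : Omega -> 'rV[R]_d) : L2 P measurable X -> L2 P measurable Y -> L2 P measurable (X - Y).
  exact: (submoduleB Ksub).
have half k : 0 < (2 ^ k.+1)%:R^-1 :> R by rewrite invr_gt0 ltr0n expn_gt0.
have /choice[N NP] k := cau _ (half k).
(* Summing the thresholds makes [n] monotone and at least [N k]; the summand [k] makes it tend to
   infinity. *)
pose n k := (k + \sum_(i < k.+1) N i)%N.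
have nmono k : (n k <= n k.+1)%N.
  by rewrite /n [in X in (_ <= X)%N]big_ord_recr/= addSn addnA ltnW// ltnS leq_addr.
have nN k : (N k <= n k)%N.
  by rewrite /n big_ord_recr/= addnA leq_addl.
have nge k : (k <= n k)%N by rewrite /n leq_addr.
pose v k := u (n k).
have Kv k : L2 P measurable (v k) by exact: Kall.
have mv k : measurable_fun setT (v k) by exact: L2_measurable (Kv k).
have vle k : (msq P (fun w => v k.+1 w - v k w)%R <= (((2 ^ k.+1)%:R^-1) ^+ 2)%:E)%E.
  rewrite -ip_norm_leP ?(ltW (half k))//; last exact: (KB _ _ (Kv k.+1) (Kv k)).
  apply: NP; last exact: nN.
  exact: leq_trans (nN k) (nmono k).
pose g k w := (enorm (v k.+1 w - v k w))%:E.
have mg k : measurable_fun setT (g k).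
  by apply/measurable_EFinP; apply: measurable_enorm; exact: measurable_mxB.
have gle k : (\int[P]_w g k w <= ((2 ^ k.+1)%:R^-1)%:E)%E.
  set a := (2 ^ k.+1)%:R^-1; have a0 : 0 < a :> R by exact: half.
  (* Expanding [(x - a)^2 / a >= 0] bounds [x] by [x^2 / (2 a) + a / 2]: an L^1 bound by [a] from an
     L^2 bound by [a]. *)
  have step w : (g k w <= (2^-1 * a^-1)%:E * (enorm (v k.+1 w - v k w) ^+ 2)%:E + (2^-1 * a)%:E)%E.
    rewrite /g -EFinM -EFinD lee_fin.
    set x := enorm _; have : 0 <= (x - a) ^+ 2 / a by rewrite divr_ge0 ?sqr_ge0 ?ltW.
    have -> : (x - a) ^+ 2 / a = x ^+ 2 / a - 2 * x + a by field; rewrite gt_eqF.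
    have -> : 2^-1 * a^-1 * x ^+ 2 = 2^-1 * (x ^+ 2 / a) by rewrite -mulrA [a^-1 * _]mulrC.
    lra.
  have c0 : 0 <= 2^-1 * a^-1 by rewrite mulr_ge0 ?invr_ge0 ?ltW.
  apply: (@le_trans _ _ (\int[P]_w ((2^-1 * a^-1)%:E * (enorm (v k.+1 w - v k w) ^+ 2)%:E + (2^-1 * a)%:E))%E).
    by apply: ge0_integral_mono => w _; [rewrite lee_fin enorm_ge0|exact: step].
  have msqm : measurable_fun setT (fun w => (enorm (v k.+1 w - v k w) ^+ 2)%:E).
    by apply: measurable_sqr_EFin; exact: measurable_mxB.
  have -> : (fun w => (2^-1 * a^-1)%:E * (enorm (v k.+1 w - v k w) ^+ 2)%:E + (2^-1 * a)%:E)%E =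
      (fun w => (2^-1 * a^-1 * enorm (v k.+1 w - v k w) ^+ 2 + 2^-1 * a)%:E) by [].
  have msqm' : measurable_fun setT (fun w => enorm (v k.+1 w - v k w) ^+ 2).
    by apply: measurable_enorm_sqr_comp; exact: measurable_mxB.
  have ca0 : 0 <= 2^-1 * a by rewrite mulr_ge0 ?invr_ge0// ltW.
  rewrite Eint_D//; last 2 first.
  - exact: measurable_funM.
  - by move=> w; rewrite mulr_ge0 ?sqr_ge0.
  rewrite Eint_Z//; last by move=> w; rewrite sqr_ge0.
  rewrite Eint_cst.
  apply: (@le_trans _ _ ((2^-1 * a^-1)%:E * (a ^+ 2)%:E + (2^-1 * a)%:E)%E).
    by rewrite leeD2r// lee_wpmul2l ?lee_fin//; exact: vle.
  rewrite -EFinM -EFinD lee_fin.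
  have -> : 2^-1 * a^-1 * a ^+ 2 + 2^-1 * a = a by field; rewrite gt_eqF.
  by [].
have gsum : (\int[P]_w \sum_(0 <= k <oo) g k w < +oo)%E.
  rewrite integral_nneseries//; last by move=> k w _; rewrite lee_fin enorm_ge0.
  apply: (@le_lt_trans _ _ 1%:E); last by rewrite ltry.
  apply: (@le_trans _ _ (\sum_(0 <= k <oo) (1 / (2 ^ k.+1)%:R)%:E)%E).
    apply: lee_nneseries => k _; first by move=> _; apply: integral_ge0 => w _; rewrite lee_fin enorm_ge0.
    by rewrite div1r; exact: gle.
  exact: epsilon_trick0.
have gae : {ae P, forall w, (\sum_(0 <= k <oo) g k w < +oo)%E}.
  have g0 w : (0 <= \sum_(0 <= k <oo) g k w)%E.
    by apply: nneseries_ge0 => k _ _; rewrite lee_fin enorm_ge0.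
  have : P.-integrable setT (fun w => \sum_(0 <= k <oo) g k w)%E.
    apply/integrableP; split.
      by apply: ge0_emeasurable_sum => // k w _ _; rewrite lee_fin enorm_ge0.
    by under eq_integral do rewrite gee0_abs//.
  move=> /(integrable_ae measurableT); apply: filterS => w /(_ I).
  by rewrite ge0_fin_numE.
pose Y w : 'rV[R]_d := \row_i fine (limn_esup (fun k => (v k w 0 i)%:E)).
have mGY : measurable_wrt G Y.
  apply: measurable_mx => i j; rewrite ord1.
  under eq_fun do rewrite mxE.
  apply: (measurableT_comp (fine_measurable measurableT)).
  apply: (@measurable_fun_limn_esup _ (g_sigma_algebraType G)) => k.
  by apply/measurable_EFinP; apply: measurable_entry; have [] := uL (n k).
have mY : measurable_fun setT Y by exact: measurable_wrtW mGY.
have vY : {ae P, forall w, forall i j, v k w i j @[k --> \oo] --> Y w i j}.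
  apply: filterS gae => w gw i j; rewrite ord1 mxE.
  have cv : cvgn (series (fun k => v k.+1 w 0 j - v k w 0 j)).
    apply: normed_cvg; apply: (@series_le_cvg _ _ (fun k => enorm (v k.+1 w - v k w))).
    - by move=> k /=.
    - by move=> k; exact: enorm_ge0.
    - by move=> k /=; have := enorm_entry (v k.+1 w - v k w) 0 j; rewrite !mxE.
    - by apply: nnseries_is_cvg => // k; exact: enorm_ge0.
  have vcv : cvgn (fun k => v k w 0 j).
    pose f k := v k w 0 j.
    have -> : (fun k => v k w 0 j) = (fun k => f 0%N + series (telescope f) k).
      by apply/funext => k; rewrite -(eq_sum_telescope f).
    by apply: is_cvgD => //; exact: is_cvg_cst.
  have : (v k w 0 j)%:E @[k --> \oo] --> (limn (fun k => v k w 0 j))%:E.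
    by apply: cvg_EFin; [exact: nearW|exact: vcv].
  by move=> /cvg_limn_einf_sup[_ ->] /=.
clearbody Y.
have YL2 (e : R) : 0 < e -> exists N0, forall p, (N0 <= p)%N ->
    (msq P (fun w => u p w - Y w)%R <= (e ^+ 2)%:E)%E.
  move=> e0; have [N0 HN0] := cau e e0; exists N0 => p Np.
  apply: (@fatou_ae_le _ _ _ _ (fun k w => (enorm (u p w - v (k + N0)%N w) ^+ 2)%:E)).
  - move=> k; apply: measurable_sqr_EFin; apply: measurable_mxB => //.
    exact: L2_measurable (Kall p).
  - by apply: measurable_sqr_EFin; apply: measurable_mxB => //; exact: L2_measurable (Kall p).
  - by move=> k w; rewrite lee_fin sqr_ge0.
  - by move=> w; rewrite lee_fin sqr_ge0.
  - apply: filterS vY => w vYw; apply: cvg_EFin; first exact: nearW.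
    apply: cvg_enorm_sqr => i j.
    under eq_fun do rewrite !mxE; rewrite !mxE.
    apply: cvgB; first exact: cvg_cst.
    by have := vYw i j; rewrite -(cvg_shiftn N0).
  - move=> k; have KBk := KB _ _ (Kall p) (Kv (k + N0)%N).
    have := HN0 p (n (k + N0)%N) Np (leq_trans (leq_addl _ _) (nge _)).
    by rewrite ip_norm_leP// ltW.
have LY : L2 P G Y.
  split => //; rewrite L2norm_lty.
  have [N0 HN0] := YL2 1 ltr01.
  have mB : measurable_fun setT (fun w => u N0 w - Y w).
    by apply: measurable_mxB => //; exact: L2_measurable (Kall N0).
  have -> : Y = (fun w => u N0 w - (u N0 w - Y w)).
    by apply/funext => w; rewrite opprB addrC subrK.
  apply: le_lt_trans (msqB_le P _ mB) _; first exact: L2_measurable (Kall N0).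
  rewrite lte_add_pinfty// lte_mul_pinfty ?lee_fin//; first exact: L2_msq (Kall N0).
  by rewrite (le_lt_trans (HN0 _ (leqnn _)))// ltry.
exists Y => // e e0; have [N0 HN0] := YL2 e e0; exists N0 => p Np.
rewrite ip_norm_leP ?HN0 ?(ltW e0)//.
by apply: KB => //; exact: (L2T Gm).
Qed.

(** Truncation of [X] to the event [|X| <= n], with dominated convergence under [|X|^2]. The
    truncated vector is still measurable for [G]. *)
Lemma L2_bounded_dense (G : set (set Omega)) (X : Omega -> 'rV[R]_d) (e : R) :
  G `<=` measurable -> L2 P G X -> 0 < e ->
  exists Y (M : R), [/\ L2 P G Y, forall w, enorm (Y w) <= M & nrm (X - Y) <= e].
Proof.
move=> Gm LX e0; have LX' := L2T Gm LX.
have [mGX _] := LX; have mX := L2_measurable LX'.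
pose Y (n : nat) w := \1_[set w | enorm (X w) <= n%:R] w *: X w.
have YE n w : Y n w = if enorm (X w) <= n%:R then X w else 0.
  rewrite /Y indicE; case: ifPn => h; first by rewrite mem_set// scale1r.
  by rewrite memNset ?scale0r//; exact/negP.
have mGY n : measurable_wrt G (Y n).
  apply: measurable_mxZ => //; apply: measurable_indic.
  have := measurable_enorm mGX measurableT (measurable_itv `]-oo, (n%:R : R)]).
  by rewrite setTI (_ : _ @^-1` _ = [set w | enorm (X w) <= n%:R]).
have mY n : measurable_fun setT (Y n) by exact: measurable_wrtW (mGY n).
have YX n w : enorm (Y n w) <= enorm (X w).
  by rewrite YE; case: ifP => _ //; rewrite enorm0 enorm_ge0.
have XYX n w : enorm (X w - Y n w) <= enorm (X w).
  by rewrite YE; case: ifP => _; rewrite ?subr0// subrr enorm0 enorm_ge0.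
have LY n : L2 P G (Y n).
  split => //; rewrite L2norm_lty (le_lt_trans _ (L2_msq LX))//.
  apply: Eint_le => w; first by rewrite sqr_ge0.
  by rewrite ler_pXn2r ?nnegrE ?enorm_ge0.
have intX : P.-integrable setT (fun w => (enorm (X w) ^+ 2)%:E).
  apply/integrableP; split; first exact: measurable_sqr_EFin.
  under eq_integral do rewrite gee0_abs ?lee_fin ?sqr_ge0//.
  exact: (L2_msq LX).
have cv : (\int[P]_w (enorm (X w - Y n w) ^+ 2)%:E)%E @[n --> \oo] --> (\int[P]_w 0%:E)%E.
  apply: (dominated_cvg measurableT _ _ _ intX).
  - by move=> n; apply: measurable_sqr_EFin; exact: measurable_mxB.
  - move=> w _; apply: cvg_near_cst; near=> n.
    rewrite YE ifT ?subrr ?enorm0 ?expr0n//.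
    by near: n; exact: nbhs_infty_ger.
  - by [].
  - move=> n w _; rewrite gee0_abs ?lee_fin ?sqr_ge0//.
    by rewrite ler_pXn2r ?nnegrE ?enorm_ge0.
rewrite integral0 in cv.
have [N _ HN] : \forall n \near \oo, (msq P (fun w => X w - Y n w)%R <= (e ^+ 2)%:E)%E.
  move/fine_cvgP: cv => [cvfin /cvgrPdist_le/(_ _ (exprn_gt0 2 e0))].
  move=> H; near=> n.
  have fin : msq P (fun w => X w - Y n w)%R \is a fin_num by near: n.
  rewrite -(fineK fin) lee_fin.
  have : `|0 - fine (msq P (fun w => X w - Y n w)%R)| <= e ^+ 2 by near: n.
  by rewrite sub0r normrN; apply: le_trans; exact: ler_norm.
exists (Y N), N%:R; split => //.
  by move=> w; rewrite YE; case: ifP => // _; rewrite enorm0.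
have LXY : L2 P measurable (X - Y N).
  exact: (submoduleB (L2_submodule P d (@subset_refl _ _)) LX' (L2T Gm (LY N))).
by rewrite ip_norm_leP ?(ltW e0)//; apply: HN => /=.
Unshelve. all: by end_near. Qed.

End L2_complete.

(** * Exchange of time and expectation, Gronwall's lemma *)

Section time_integral.
Context (R : realType) (disp : measure_display) (Omega : measurableType disp).
Variable (P : probability Omega R).
Local Notation leb := (@lebesgue_measure R).

Lemma Eint_time_swap (D : set R) (h : R -> Omega -> R) : measurable D ->
  measurable_fun (setT : set (measurableTypeR R * Omega)) (fun z => h z.1 z.2) ->
  (forall s w, D s -> 0 <= h s w) ->
  (\int[P]_w \int[leb]_(s in D) (h s w)%:E =
   \int[leb]_(s in D) \int[P]_w (h s w)%:E)%E.
Proof.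
move=> mD mh h0.
pose f (z : measurableTypeR R * Omega) := (\1_D z.1 * h z.1 z.2)%:E.
have mf : measurable_fun setT f.
  apply/measurable_EFinP; apply: measurable_funM => //.
  apply: (@measurableT_comp _ _ _ _ _ _ (\1_D : measurableTypeR R -> R)) => //.
have f0 z : (0 <= f z)%E.
  rewrite /f lee_fin indicE; case: (boolP (_ \in _)) => [/set_mem Dz|_].
    by rewrite mul1r h0.
  by rewrite mul0r.
have := @fubini_tonelli _ _ _ _ R leb P f mf f0.
have -> : (fun w => \int[leb]_(s in D) (h s w)%:E)%E = (fun w => \int[leb]_s f (s, w))%E.
  apply/funext => w; rewrite [LHS]integral_mkcond; apply: eq_integral => s _.
  by rewrite /f /= patchE indicE; case: ifP => _; rewrite ?mul1r ?mul0r.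
move=> <-; rewrite [RHS]integral_mkcond; apply: eq_integral => s _.
rewrite /f /= patchE indicE; case: ifP => _.
  by under eq_integral do rewrite mul1r.
by under eq_integral do rewrite mul0r; rewrite integral0.
Qed.

Lemma Eint_time_measurable (D : set R) (h : R -> Omega -> R) : measurable D ->
  measurable_fun (setT : set (measurableTypeR R * Omega)) (fun z => h z.1 z.2) ->
  (forall s w, D s -> 0 <= h s w) ->
  measurable_fun setT (fun w => (\int[leb]_(s in D) (h s w)%:E)%E).
Proof.
move=> mD mh h0.
pose f (z : measurableTypeR R * Omega) := (\1_D z.1 * h z.1 z.2)%:E.
have mf : measurable_fun setT f.
  apply/measurable_EFinP; apply: measurable_funM => //.
  apply: (@measurableT_comp _ _ _ _ _ _ (\1_D : measurableTypeR R -> R)) => //.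
have f0 z : (0 <= f z)%E.
  rewrite /f lee_fin indicE; case: (boolP (_ \in _)) => [/set_mem Dz|_].
    by rewrite mul1r h0.
  by rewrite mul0r.
have := @measurable_fun_fubini_tonelli_G _ _ _ _ R leb f mf f0.
congr (measurable_fun _ _); apply/funext => w.
rewrite /fubini_G [RHS]integral_mkcond; apply: eq_integral => s _.
by rewrite /f /= patchE indicE; case: ifP => _; rewrite ?mul1r ?mul0r.
Qed.

End time_integral.

Lemma expR_ge1_nneg (R : realType) (x : R) : 0 <= x -> 1 <= expR x.
Proof. by move=> x0; rewrite -[leLHS]expR0 ler_expR. Qed.

Lemma integral_expR_le (R : realType) (K t : R) : 0 < K -> 0 <= t ->
  (\int[lebesgue_measure]_(s in `[0%R, t]) (expR (K * s))%:E <= (K^-1 * expR (K * t))%:E)%E.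
Proof.
move=> K0 t0.
have dE (x : R) : is_derive x 1 (fun s => K^-1 * expR (K * s)) (expR (K * x)).
  have -> : expR (K * x) = K^-1 *: (K *: expR (K * x)).
    by rewrite scalerA mulVf ?gt_eqF// scale1r.
  apply: is_deriveZ; rewrite /GRing.scale/= mulrC.
  have h : is_derive x 1 (fun s : R => K * s) K.
    by rewrite -[X in is_derive _ _ _ X]mulr1; apply: (@is_deriveZ _ _ _ id).
  exact: (@is_derive1_comp _ expR (fun s : R => K * s)).
move: t0; rewrite le_eqVlt => /predU1P[<-|t0].
  by rewrite set_itv1 integral_set1 lee_fin mulr_ge0 ?invr_ge0 ?expR_ge0// ltW.
have cE : continuous (fun s : R => expR (K * s)).
  by move=> s; apply: continuous_comp; [exact: mulrl_continuous|exact: continuous_expR].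
have cF : continuous (fun s : R => K^-1 * expR (K * s)).
  by move=> s; apply: (continuous_comp (cE s)); exact: mulrl_continuous.
rewrite (@continuous_FTC2 _ _ (fun s => K^-1 * expR (K * s)))//.
- by rewrite -EFinB lee_fin lerBlDr lerDl mulr_ge0 ?invr_ge0 ?expR_ge0// ltW.
- exact: continuous_subspaceT.
- split.
  + by move=> x _; exact: ex_derive.
  + by apply: cvg_at_right_filter; exact: cF.
  + by apply: cvg_at_left_filter; exact: cF.
- by move=> x _; rewrite derive1E derive_val.
Qed.

(** Iteration replaces differentiation, [u] being merely bounded and nonnegative. Inserting the
    bound [(2 a + M' / 2^n) e^(2 K t)] into the integral inequality reproduces it with [n + 1],
    because [K] times the integral of [e^(2 K s)] is at most half of [e^(2 K t)]. This explains the
    doubled rate and the factor 2. *)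
Theorem gronwall (R : realType) (T a K M : R) (u : R -> \bar R) :
  0 <= a -> 0 < K ->
  (forall t : R, 0 <= t <= T -> (0 <= u t)%E) ->
  (forall t : R, 0 <= t <= T -> (u t <= M%:E)%E) ->
  (forall t : R, 0 <= t <= T ->
    (u t <= a%:E + K%:E * \int[lebesgue_measure]_(s in `[0%R, t]) u s)%E) ->
  forall t, 0 <= t <= T -> (u t <= (2 * a * expR (2 * K * t))%:E)%E.
Proof.
move=> a0 K0 u0 uM uint.
pose M' := Num.max M 0.
have M'0 : 0 <= M' by rewrite le_max lexx orbT.
have K20 : 0 < 2 * K by rewrite mulr_gt0.
have step n t : 0 <= t <= T ->
    (u t <= ((2 * a + M' / 2 ^+ n) * expR (2 * K * t))%:E)%E.
  elim: n t => [|n IH] t tT; have /andP[t0 t1] := tT.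
    rewrite (le_trans (uM t tT))// lee_fin expr0 divr1.
    have e1 : 1 <= expR (2 * K * t) by rewrite expR_ge1_nneg// mulr_ge0// ltW.
    have MM' : M <= M' by rewrite le_max lexx.
    nra.
  set c := 2 * a + M' / 2 ^+ n in IH.
  have c0 : 0 <= c by rewrite addr_ge0 ?divr_ge0 ?exprn_ge0// mulr_ge0.
  have sT s : `[0%R, t]%classic s -> 0 <= s <= T.
    by rewrite /= in_itv/= => /andP[-> /le_trans ->].
  have h1 : (\int[lebesgue_measure]_(s in `[0%R, t]) u s <=
      (c * ((2 * K)^-1 * expR (2 * K * t)))%:E)%E.
    apply: (@le_trans _ _ (\int[lebesgue_measure]_(s in `[0%R, t]) (c%:E * (expR (2 * K * s))%:E))%E).
      by apply: ge0_integral_mono => s /sT sT'; [exact: u0|rewrite -EFinM; exact: IH].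
    rewrite ge0_integralZl//.
    - by rewrite EFinM lee_wpmul2l ?lee_fin// integral_expR_le.
    - apply/measurable_EFinP; apply: measurable_funTS.
      by apply: measurableT_comp => //; exact: mulrl_measurable.
  rewrite (le_trans (uint t tT))//.
  have h2 : (K%:E * \int[lebesgue_measure]_(s in `[0%R, t]) u s <= (c / 2 * expR (2 * K * t))%:E)%E.
    have -> : c / 2 * expR (2 * K * t) = K * (c * ((2 * K)^-1 * expR (2 * K * t))).
      by field; rewrite gt_eqF.
    by rewrite EFinM lee_wpmul2l// lee_fin ltW.
  rewrite (le_trans (leeD2l _ h2))// -EFinD lee_fin.
  have e1 : 1 <= expR (2 * K * t) by rewrite expR_ge1_nneg// mulr_ge0// ltW.
  have -> : 2 * a + M' / 2 ^+ n.+1 = a + c / 2.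
    by rewrite /c exprS; field; rewrite expf_neq0.
  by rewrite (mulrDl a) lerD2r -[leLHS]mulr1 ler_wpM2l.
move=> t tT.
have cv : ((2 * a + M' / 2 ^+ n) * expR (2 * K * t)) @[n --> \oo] --> 2 * a * expR (2 * K * t).
  rewrite -[in X in _ --> X](addr0 (2 * a)); apply: cvgM; last exact: cvg_cst.
  apply: cvgD; first exact: cvg_cst.
  have -> : (fun n => M' / 2 ^+ n) = geometric M' 2^-1.
    by apply/funext => n; rewrite /geometric/= exprVn.
  by apply: cvg_geometric; rewrite ger0_norm ?invr_ge0// invf_lt1// ltr1n.
have fin : u t \is a fin_num.
  by rewrite ge0_fin_numE ?u0// (le_lt_trans (uM t tT))// ltry.
rewrite -(fineK fin) lee_fin.
apply: (ler_cvg_to (cvg_cst (fine (u t))) cv).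
by apply: nearW => n; rewrite -lee_fin fineK//; exact: step.
Qed.

(** * Brownian increments *)

Ltac meas := repeat first
  [ assumption | exact: measurable_cst | apply: measurable_funD
  | apply: measurable_funB | apply: measurable_funM | apply: measurable_funX
  | apply: measurable_maxr | apply: measurable_funN
  | (apply: measurable_sum => ?) ].

(** * Independent real random variables *)

Section independence.
Context (R : realType) (disp : measure_display) (Omega : measurableType disp).
Variable (P : probability Omega R).
Implicit Types U V : Omega -> R.

Definition indep U V : Prop := forall A C : set R, measurable A -> measurable C ->
  P (U @^-1` A `&` V @^-1` C) = (P (U @^-1` A) * P (V @^-1` C))%E.

Lemma indep_Eint U V : measurable_fun setT U -> measurable_fun setT V ->
  (forall w, 0 <= U w) -> (forall w, 0 <= V w) -> indep U V ->
  (\int[P]_w (U w * V w)%:E = (\int[P]_w (U w)%:E) * (\int[P]_w (V w)%:E))%E.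
Proof.
move=> mU mV U0 V0 UV.
pose U' : {mfun Omega >-> R} := mfun_Sub (mem_set mU).
pose V' : {mfun Omega >-> R} := mfun_Sub (mem_set mV).
have mUV : measurable_fun setT (fun w => (U w, V w)) by exact: measurable_fun_pair.
pose W' : {mfun Omega >-> (R * R)%type} := mfun_Sub (mem_set mUV).
have prodE (X : set (R * R)) : measurable X ->
    (distribution P U' \x distribution P V')%E X = distribution P W' X.
  apply: product_measure_unique => A C mA mC.
  exact: UV.
(* Tonelli asks for an integrand that is nonnegative on the whole plane; the absolute values change
   nothing on the ranges of [U] and [V]. *)
pose f (z : R * R) : \bar R := (`|z.1| * `|z.2|)%:E.
have mf : measurable_fun setT f.
  apply/measurable_EFinP; apply: measurable_funM.
    by apply: measurableT_comp => //.
  by apply: measurableT_comp => //.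
have f0 z : (0 <= f z)%E by rewrite lee_fin mulr_ge0.
transitivity (\int[distribution P W']_z f z)%E.
  rewrite ge0_integral_pushforward//=.
  by apply: eq_integral => w _; rewrite /f /= !ger0_norm.
transitivity (\int[distribution P U' \x distribution P V']_z f z)%E.
  by apply: eq_measure_integral => A mA _; exact/esym/prodE.
rewrite fubini_tonelli1//.
have mabs : measurable_fun [set: R] (fun x : R => `|x|%:E).
  by apply/measurable_EFinP; exact: normr_measurable.
have abs0 (x : R) : (0 <= `|x|%:E)%E by rewrite lee_fin.
have marg (Z : {mfun Omega >-> R}) : (forall w, 0 <= Z w) ->
    (\int[distribution P Z]_x `|x|%:E = \int[P]_w (Z w)%:E)%E.
  move=> Z0; rewrite ge0_integral_pushforward//=.
  by apply: eq_integral => w _ /=; rewrite ger0_norm.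
rewrite -(marg U')// -(marg V')//.
rewrite -ge0_integralZr//; last by apply: integral_ge0.
apply: eq_integral => x _; rewrite /fubini_F /f /=.
under eq_integral do rewrite EFinM.
by rewrite ge0_integralZl.
Qed.

Lemma indep_comp U V (f g : R -> R) : measurable_fun setT f -> measurable_fun setT g ->
  indep U V -> indep (f \o U) (g \o V).
Proof.
move=> mf mg UV A C mA mC; apply: (UV (f @^-1` A) (g @^-1` C)).
  by rewrite -[_ @^-1` _]setTI; exact: mf.
by rewrite -[_ @^-1` _]setTI; exact: mg.
Qed.

Let pos (x : R) := Num.max x 0.
Let neg (x : R) := Num.max (- x) 0.

Let posB x : pos x - neg x = x.
Proof. by rewrite /pos /neg /Num.max; case: ifP; case: ifP; lra. Qed.

Let pos_ge0 x : 0 <= pos x. Proof. by rewrite le_max lexx orbT. Qed.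
Let neg_ge0 x : 0 <= neg x. Proof. by rewrite le_max lexx orbT. Qed.

(* The signed terms [U i * V i] have mean zero; splitting them into positive and
   negative parts keeps every integral nonnegative. *)
Lemma Eint_le_mean0 (I : finType) (X Y : Omega -> R) (U V : I -> Omega -> R) :
  measurable_fun setT X -> measurable_fun setT Y ->
  (forall i, measurable_fun setT (U i)) -> (forall i, measurable_fun setT (V i)) ->
  (forall w, 0 <= X w) -> (forall w, 0 <= Y w) ->
  (forall i, indep (U i) (V i)) ->
  (forall i, (\int[P]_w `|U i w|%:E < +oo)%E) ->
  (forall i, (\int[P]_w (Num.max (V i w) 0)%:E = \int[P]_w (Num.max (- V i w) 0)%:E)%E) ->
  (forall i, (\int[P]_w (Num.max (V i w) 0)%:E < +oo)%E) ->
  (forall w, X w <= Y w + \sum_i U i w * V i w) ->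
  (\int[P]_w (X w)%:E <= \int[P]_w (Y w)%:E)%E.
Proof.
move=> mX mY mU mV X0 Y0 UV Ufin Vmean Vfin XY.
have mpos : measurable_fun setT pos by apply: measurable_maxr; [exact: measurable_id|exact: measurable_cst].
have mneg : measurable_fun setT neg.
  by apply: measurable_maxr; [exact: oppr_measurable|exact: measurable_cst].
pose Zp i w := pos (U i w) * pos (V i w) + neg (U i w) * neg (V i w).
pose Zn i w := pos (U i w) * neg (V i w) + neg (U i w) * pos (V i w).
have mc (f : R -> R) (W : I -> Omega -> R) i : measurable_fun setT f ->
    (forall i, measurable_fun setT (W i)) -> measurable_fun setT (fun w => f (W i w)).
  by move=> mf mW; exact: (measurableT_comp mf (mW i)).
have EM (f g : R -> R) i : measurable_fun setT f -> measurable_fun setT g ->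
    (forall x, 0 <= f x) -> (forall x, 0 <= g x) ->
    (\int[P]_w (f (U i w) * g (V i w))%:E =
     \int[P]_w (f (U i w))%:E * \int[P]_w (g (V i w))%:E)%E.
  move=> mf mg f0 g0; apply: (@indep_Eint (f \o U i) (g \o V i)) => //=;
    [exact: (measurableT_comp mf (mU i))|exact: (measurableT_comp mg (mV i))|].
  exact: (indep_comp mf mg (UV i)).
have EUle (f : R -> R) i : (forall x, 0 <= f x <= `|x|) ->
    (\int[P]_w (f (U i w))%:E < +oo)%E.
  move=> fx; apply: le_lt_trans (Ufin i).
  by apply: Eint_le => w; case/andP: (fx (U i w)).
have posle x : 0 <= pos x <= `|x|.
  by rewrite pos_ge0 /pos ge_max normr_ge0 ler_norm.
have negle x : 0 <= neg x <= `|x|.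
  by rewrite neg_ge0 /neg ge_max normr_ge0 -normrN ler_norm.
have EZ i : (\int[P]_w (Zp i w)%:E = \int[P]_w (Zn i w)%:E)%E.
  rewrite /Zp /Zn !Eint_D ?EM//; try (by move=> w; rewrite mulr_ge0);
    try (by apply: measurable_funM; apply: mc => //).
  by rewrite (Vmean i).
have EZfin i : (\int[P]_w (Zn i w)%:E < +oo)%E.
  rewrite /Zn Eint_D ?EM//; try (by move=> w; rewrite mulr_ge0);
    try (by apply: measurable_funM; apply: mc => //).
  have Vn : (\int[P]_w (neg (V i w))%:E < +oo)%E by rewrite -(Vmean i).
  rewrite lte_add_pinfty// lte_mul_pinfty//; try exact: EUle; try exact: Eint_ge0.
  - by rewrite ge0_fin_numE; [exact: EUle|exact: Eint_ge0].
  - by rewrite ge0_fin_numE; [exact: EUle|exact: Eint_ge0].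
  - exact: Vfin.
have mZp i : measurable_fun setT (Zp i).
  by apply: measurable_funD; apply: measurable_funM; apply: mc.
have mZn i : measurable_fun setT (Zn i).
  by apply: measurable_funD; apply: measurable_funM; apply: mc.
have Zp0 i w : 0 <= Zp i w by rewrite addr_ge0 ?mulr_ge0.
have Zn0 i w : 0 <= Zn i w by rewrite addr_ge0 ?mulr_ge0.
(* [Zp i - Zn i = U i * V i], and both have the same finite expectation. Adding the negative parts
   to both sides avoids a subtraction, and the common term is cancelled at the end. *)
have : (\int[P]_w (X w + \sum_i Zn i w)%:E <= \int[P]_w (Y w + \sum_i Zp i w)%:E)%E.
  apply: Eint_le => w; first by rewrite addr_ge0// sumr_ge0.
  have -> : \sum_i Zp i w = \sum_i U i w * V i w + \sum_i Zn i w.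
    rewrite -big_split/=; apply: eq_bigr => i _; rewrite /Zp /Zn.
    have -> : U i w * V i w =
      (pos (U i w) - neg (U i w)) * (pos (V i w) - neg (V i w)) by rewrite !posB.
    ring.
  by rewrite addrA lerD2r.
rewrite !Eint_D//; try (by meas); try (by move=> w; rewrite sumr_ge0).
rewrite !Eint_sum//.
have -> : (\sum_(i <- index_enum I) \int[P]_w (Zp i w)%:E =
    \sum_(i <- index_enum I) \int[P]_w (Zn i w)%:E)%E.
  by apply: eq_bigr => i _; exact: EZ.
rewrite leeD2rE// ge0_fin_numE; last by apply: sume_ge0 => i _; exact: Eint_ge0.
by apply/lte_sum_pinfty => i _; exact: EZfin.
Qed.

End independence.

(** * Moments of the centred normal law *)

Section normal_moments.
Context (R : realType).
Local Notation leb := (@lebesgue_measure R).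

(** The Radon-Nikodym derivative of the normal law agrees almost everywhere with the density, both
    having the same integral over every measurable set. *)
Lemma ge0_integral_normal_prob (s : R) (f : R -> \bar R) :
  (forall x, (0 <= f x)%E) -> measurable_fun setT f ->
  (\int[normal_prob 0 s]_x f x = \int[leb]_x (f x * (normal_pdf 0 s x)%:E))%E.
Proof.
move=> f0 mf; have dom := @normal_prob_dominates R 0 s.
rewrite -(Radon_Nikodym_SigmaFinite.change_of_variables dom f0 measurableT mf).
have mpdf : measurable_fun setT (fun x : R => (normal_pdf 0 s x)%:E).
  by apply/measurable_EFinP; exact: measurable_normal_pdf.
have RNint := Radon_Nikodym_SigmaFinite.f_integrable dom.
apply: ae_eq_integral => //.
- by apply: emeasurable_funM => //; exact: (measurable_int _ RNint).
- exact: emeasurable_funM.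
- apply: ae_eqe_mul2l; apply: integral_ae_eq => //.
  by move=> E _ mE; rewrite -Radon_Nikodym_SigmaFinite.f_integral.
Qed.

(** The exact value is [3 s^4]; the cruder 64 dispenses with integration by parts. With
    [y = x^2 / (4 s^2)] the integrand is [16 s^4 y^2 e^(-2 y)] times the peak; [y^2 e^(-y) <= 2],
    the remaining [e^(-y)] belongs to the normal density of variance [2 s^2], and the ratio of the
    peaks is at most 2. *)
Lemma normal_moment4 (s : R) : 0 < s ->
  (\int[normal_prob 0 s]_x (x ^+ 4)%:E <= (64 * s ^+ 4)%:E)%E.
Proof.
move=> s0; rewrite ge0_integral_normal_prob; last 2 first.
- by move=> x; rewrite lee_fin exprn_even_ge0.
- by apply/measurable_EFinP; exact: exprn_measurable.
pose s' := Num.sqrt 2 * s.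
have r2 : 0 < Num.sqrt 2 :> R by rewrite sqrtr_gt0.
have r2E : Num.sqrt 2 ^+ 2 = 2 :> R by rewrite sqr_sqrtr.
have s'0 : 0 < s' by rewrite mulr_gt0.
apply: (@le_trans _ _ (\int[leb]_x (64 * s ^+ 4 * normal_pdf 0 s' x)%:E)%E).
  apply: Eint_le => x; first by rewrite mulr_ge0 ?normal_pdf_ge0 ?exprn_even_ge0.
  rewrite !normal_pdfE ?gt_eqF// /normal_fun subr0.
  set y := x ^+ 2 / (4 * s ^+ 2).
  have sn0 : s != 0 by rewrite gt_eqF.
  have -> : - x ^+ 2 / (s ^+ 2 *+ 2) = - y - y by rewrite /y -mulr_natl; field.
  have -> : - x ^+ 2 / (s' ^+ 2 *+ 2) = - y.
    by rewrite /y /s' exprMn r2E -mulr_natl; field.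
  rewrite expRD.
  have y0 : 0 <= y by rewrite divr_ge0 ?sqr_ge0// mulr_ge0 ?sqr_ge0.
  have -> : x ^+ 4 = 16 * s ^+ 4 * y ^+ 2 by rewrite /y; field.
  have ybnd : y ^+ 2 * expR (- y) <= 2.
    have h := expR_ge1Dxn 1 y0.
    rewrite expRN ler_pdivrMr ?expR_gt0//.
    have f2 : (2`!)%:R = 2 :> R by [].
    rewrite f2 in h; move: h; rewrite mulrC => h; have := expR_ge0 y; lra.
  have pk : normal_peak s <= 2 * normal_peak s'.
    have p0 := pi_gt0 R.
    have e1 : Num.sqrt (s' ^+ 2 * pi *+ 2) = Num.sqrt 2 * Num.sqrt (s ^+ 2 * pi *+ 2) :> R.
      rewrite -sqrtrM//; congr Num.sqrt.
      by rewrite /s' exprMn r2E !mulr2n; ring.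
    rewrite /normal_peak e1 invfM mulrA ler_peMl//.
    rewrite ler_pdivlMr// mul1r -(@ler_pXn2r _ 2) ?nnegrE ?ltW// r2E; lra.
  have E0 := expR_ge0 (- y); have k0 := @normal_peak_ge0 R s.
  have k0' := @normal_peak_ge0 R s'.
  have s40 : 0 <= s ^+ 4 by rewrite exprn_even_ge0.
  have -> : 16 * s ^+ 4 * y ^+ 2 * (normal_peak s * (expR (- y) * expR (- y))) =
    (16 * s ^+ 4) * ((y ^+ 2 * expR (- y)) * (normal_peak s * expR (- y))) by ring.
  have -> : 64 * s ^+ 4 * (normal_peak s' * expR (- y)) =
    (16 * s ^+ 4) * (2 * (2 * normal_peak s' * expR (- y))) by ring.
  apply: ler_wpM2l; first by rewrite mulr_ge0.
  apply: ler_pM => //; [by rewrite mulr_ge0 ?sqr_ge0|by rewrite mulr_ge0|].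
  exact: ler_wpM2r.
rewrite Eint_Z//.
- by rewrite integral_normal_pdf mule1.
- exact: measurable_normal_pdf.
- by move=> x; exact: normal_pdf_ge0.
- by rewrite mulr_ge0// exprn_even_ge0.
Qed.

(** The reflection [x |-> - x] preserves Lebesgue measure, and the density is even. Mean zero is
    stated as equality of the means of both parts, the form that [Eint_le_mean0] takes. *)
Lemma normal_mean0 (s : R) : 0 < s ->
  (\int[normal_prob 0 s]_x (Num.max x 0)%:E = \int[normal_prob 0 s]_x (Num.max (- x) 0)%:E)%E.
Proof.
move=> s0.
have mmax : measurable_fun setT (fun x : R => (Num.max x 0)%:E).
  by apply/measurable_EFinP; apply: measurable_maxr; [exact: measurable_id|exact: measurable_cst].
have mmin : measurable_fun setT (fun x : R => (Num.max (- x) 0)%:E).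
  by apply/measurable_EFinP; apply: measurable_maxr; [exact: oppr_measurable|exact: measurable_cst].
have max0 (x : R) : (0 <= (Num.max x 0)%:E)%E by rewrite lee_fin le_max lexx orbT.
rewrite !ge0_integral_normal_prob//.
have mpdf : measurable_fun setT (fun x : R => (normal_pdf 0 s x)%:E).
  by apply/measurable_EFinP; exact: measurable_normal_pdf.
pose g (x : R) := ((Num.max x 0)%:E * (normal_pdf 0 s x)%:E)%E.
transitivity (\int[leb]_(x in (-%R : _ -> measurableTypeR R) @^-1` setT) (g \o -%R) x)%E.
  rewrite -ge0_integral_pushforward//=.
  - by apply: eq_measure_integral => //= A mA _; exact/esym/lebesgue_measureN.
  - exact: emeasurable_funM.
  - by move=> x _; rewrite /g mule_ge0// lee_fin normal_pdf_ge0.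
apply: eq_integral => x _; rewrite /g/=; congr (_ * _%:E)%E.
by rewrite !normal_pdfE ?gt_eqF// /normal_fun !subr0 sqrrN.
Qed.

End normal_moments.

Lemma sigma_setT (X : Type) (G : set (set X)) : sigma_algebra setT G -> G setT.
Proof. by case=> G0 GC _; have := GC _ G0; rewrite setD0. Qed.

Lemma sigma_setI (X : pointedType) (G : set (set X)) A C : sigma_algebra setT G ->
  G A -> G C -> G (A `&` C).
Proof.
move=> sG GA GC; rewrite -(sigma_algebra_id sG).
by apply: (@measurableI _ (g_sigma_algebraType G)); apply: sub_sigma_algebra.
Qed.

(** * Increments and the filtration *)

Section brownian_increments.
Context (R : realType) (disp : measure_display) (Omega : measurableType disp).
Variables (P : probability Omega R) (T : R) (m : nat).
Variables (B : R -> Omega -> 'rV[R]_m) (F0 : set (set Omega)).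
Hypotheses (Bbm : brownian_motion P T B) (F0i : initial_sigma_algebra P T B F0).
Local Notation F := (filtration B F0).

Lemma sigma_process_measurable (I : set R) : (forall t, I t -> 0 <= t <= T) ->
  sigma_process B I `<=` measurable.
Proof.
case: Bbm => mB _ _ _ _ IT; apply: smallest_sub; first exact: sigma_algebra_measurable.
move=> _ [u [A [Iu mA ->]]]; rewrite -[_ @^-1` _]setTI.
by apply: mB => //; exact: IT.
Qed.

Lemma sigma_process_mono (I J : set R) : I `<=` J -> sigma_process B I `<=` sigma_process B J.
Proof.
move=> IJ; apply: sub_sigma_algebra2 => _ [u [A [Iu mA ->]]].
by exists u, A; split => //; exact: IJ.
Qed.

Lemma filtration_measurable t : t <= T -> F t `<=` measurable.
Proof.
move=> tT; case: F0i => _ F0m _ _ _.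
apply: smallest_sub; first exact: sigma_algebra_measurable.
rewrite subUset; split => //; apply: sigma_process_measurable => s.
by rewrite /= in_itv/= => /andP[-> /le_trans ->].
Qed.

Lemma filtration_mono s t : s <= t -> F s `<=` F t.
Proof.
move=> st; apply: sub_sigma_algebra2; apply: setUS; apply: sigma_process_mono => u.
by rewrite /= !in_itv/= => /andP[-> /le_trans ->].
Qed.

Lemma F0_sub_filtration t : F0 `<=` F t.
Proof. by move=> A F0A; apply: sub_sigma_algebra; left. Qed.

Lemma sigma_process_wrt (I : set R) u : I u -> measurable_wrt (sigma_process B I) (B u).
Proof.
move=> Iu _ A mA; rewrite setTI; apply: sub_sigma_algebra; apply: sub_sigma_algebra.
by exists u, A.
Qed.

Lemma brownian_adapted u t : 0 <= u <= t -> measurable_wrt (F t) (B u).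
Proof.
move=> ut; apply: (@measurable_wrt_sub _ _ _ _ _ (sigma_process B `[0, t])).
  move=> A HA; apply: sub_sigma_algebra; apply: sub_sigma_algebra; right.
  exact: HA.
by apply: sigma_process_wrt; rewrite /= in_itv.
Qed.

(** The definitions give two separate facts: an increment is independent of the past of [B], and
    [F0] is independent of all of [B]. Together they give the product formula on sets [A1 /\ A2]
    with [A1] in [F0] and [A2] in the past of [B]. These form a system stable under intersection
    that generates [F s], and two finite measures agreeing on it, [A |-> P (A /\ D)] and
    [P D * P A], coincide. *)
Lemma increment_indep_filtration (s t : R) A (C : set 'rV[R]_m) :
  0 <= s -> s < t -> t <= T -> F s A -> measurable C ->
  P (A `&` [set w | C (B t w - B s w)%R]) = (P A * P [set w | C (B t w - B s w)%R])%E.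
Proof.
move=> s0 st tT FA mC; set D := [set w | C (B t w - B s w)%R].
have sT : s <= T by rewrite (le_trans (ltW st)).
have t0 : 0 <= t by rewrite (le_trans s0 (ltW st)).
have [mB _ _ Bind _] := Bbm; have [F0s F0m _ F0ind _] := F0i.
have spm (u : R) : u <= T -> sigma_process B `[0, u] `<=` measurable.
  move=> uT; apply: sigma_process_measurable => v.
  by rewrite /= in_itv/= => /andP[-> /le_trans ->].
have spT u : sigma_process B `[0, u] setT.
  by apply: sigma_setT; exact: smallest_sigma_algebra.
have mDT : sigma_process B `[0, T] D.
  have mBt : measurable_wrt (sigma_process B `[0, T]) (fun w => B t w - B s w).
    by apply: measurable_mxB; apply: sigma_process_wrt; rewrite /= in_itv/= ?t0// s0.
  have := mBt measurableT C mC; rewrite setTI.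
  by apply: smallest_sub; first exact: smallest_sigma_algebra.
have mD : measurable D by exact: (spm T).
pose r : {nonneg R} := NngNum (fine_ge0 (measure_ge0 P D)).
pose G := [set X | exists A1 A2, [/\ F0 A1, sigma_process B `[0, s] A2 & X = A1 `&` A2]].
have F0T : F0 setT by exact: sigma_setT.
have PD : P D = (fine (P D))%:E by rewrite fineK// fin_num_measure.
have Gm : G `<=` measurable.
  by move=> _ [A1 [A2 [h1 h2 ->]]]; apply: measurableI; [exact: F0m|exact: (spm s)].
have GT (k : nat) : G setT by exists setT, setT; rewrite setTI.
have cov : \bigcup_(k : nat) (setT : set Omega) = setT by rewrite bigcup_const//; exists 0%N.
have GI : setI_closed G.
  move=> _ _ [A1 [A2 [h1 h2 ->]]] [A3 [A4 [h3 h4 ->]]].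
  exists (A1 `&` A3), (A2 `&` A4); split.
  - exact: sigma_setI.
  - exact: (sigma_setI (smallest_sigma_algebra _ _) h2 h4).
  - by rewrite setIACA.
have GP X : G X -> mrestr P mD X = mscale r P X.
  move=> [A1 [A2 [h1 h2 ->]]].
  rewrite /mrestr /mscale/= -PD muleC -setIA F0ind//; last first.
    apply: (sigma_setI (smallest_sigma_algebra _ _)) => //.
    apply: sigma_process_mono h2 => u.
    by rewrite /= !in_itv/= => /andP[-> /le_trans ->].
  rewrite (Bind s t s0 st tT A2 C h2 mC) F0ind ?muleA//.
  apply: sigma_process_mono h2 => u.
  by rewrite /= !in_itv/= => /andP[-> /le_trans ->].
have GA : <<s G>> A.
  move: A FA; apply: sub_sigma_algebra2 => A [F0A|spA].
    by exists A, setT; rewrite setIT.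
  by exists setT, A; rewrite setTI.
have : mrestr P mD A = mscale r P A.
  have H := g_sigma_algebra_measure_unique G Gm (fun=> setT) GT cov
    (mrestr P mD) (mscale r P) GI GP.
  apply: H GA => _.
  change (P (setT `&` D) < +oo)%E.
  by rewrite setTI -ge0_fin_numE// fin_num_measure.
by rewrite /mrestr /mscale/= -PD muleC.
Qed.

Lemma increment_entry_law (s t : R) (l : 'I_m) (A : set R) : 0 <= s -> s < t -> t <= T ->
  measurable A ->
  P [set w | A ((B t w - B s w)%R 0 l)] = normal_prob 0 (Num.sqrt (t - s)) A.
Proof.
move=> s0 st tT mA; have [_ _ _ _ Blaw] := Bbm.
pose C i : set R := if i == l then A else setT.
have mC i : measurable (C i) by rewrite /C; case: ifP.
have := Blaw s t s0 st tT C mC.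
rewrite (bigD1 l)//= big1 ?mule1; last first.
  by move=> i il; rewrite /C (negbTE il) probability_setT.
rewrite /C eqxx => <-; congr (P _); apply/seteqP; split => w /=.
  by move=> h i; case: ifPn => // /eqP ->.
by move=> /(_ l); rewrite eqxx.
Qed.

Section one_increment.
Variables (s t : R) (l : 'I_m).
Hypotheses (s0 : 0 <= s) (st : s < t) (tT : t <= T).
Let V w := (B t w - B s w)%R 0 l.

Lemma measurable_increment : measurable_fun setT V.
Proof.
have [mB _ _ _ _] := Bbm.
apply: measurable_entry; apply: measurable_mxB; apply: mB.
  by rewrite tT (le_trans s0 (ltW st)).
by rewrite s0 (le_trans (ltW st) tT).
Qed.

Lemma increment_indep (U : Omega -> R) :
  measurable_fun (setT : set (g_sigma_algebraType (F s))) U -> indep P U V.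
Proof.
move=> mU A C mA mC.
have FA : F s (U @^-1` A).
  have := mU measurableT A mA; rewrite setTI.
  by apply: smallest_sub => //; exact: smallest_sigma_algebra.
have mC' : measurable [set x : 'rV[R]_m | C (x 0 l)].
  by rewrite -[X in measurable X]setTI; exact: (@measurable_coord R 1 m 0 l).
exact: (increment_indep_filtration s0 st tT FA mC').
Qed.

Lemma increment_Eint (f : R -> R) : measurable_fun setT f -> (forall x, 0 <= f x) ->
  (\int[P]_w (f (V w))%:E = \int[normal_prob 0 (Num.sqrt (t - s))]_x (f x)%:E)%E.
Proof.
move=> mf f0.
pose V' : {mfun Omega >-> measurableTypeR R} :=
  @mfun_Sub _ _ Omega (measurableTypeR R) V (mem_set measurable_increment).
have mfE : measurable_fun setT (EFin \o f) by exact/measurable_EFinP.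
transitivity (\int[distribution P V']_x (f x)%:E)%E.
  by rewrite ge0_integral_pushforward// => x _; rewrite lee_fin.
by apply: eq_measure_integral => A mA _; exact: increment_entry_law.
Qed.

Lemma increment_moment4 : (\int[P]_w (V w ^+ 4)%:E <= (64 * (t - s) ^+ 2)%:E)%E.
Proof.
have ts : 0 < t - s by rewrite subr_gt0.
rewrite (increment_Eint (f := fun x => x ^+ 4)); last 2 first.
- exact: exprn_measurable.
- by move=> x; rewrite exprn_even_ge0.
have := @normal_moment4 R (Num.sqrt (t - s)); rewrite sqrtr_gt0 => /(_ ts).
by rewrite (exprM _ 2 2) sqr_sqrtr// ltW.
Qed.

(** Deduced from the fourth moment by [x^2 <= x^4 / (2 a) + a / 2] with [a = t - s]: the outcome is
    [32 a + a / 2], rounded up to [33 a], where the exact value is [a]. *)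
Lemma increment_moment2 : (\int[P]_w (V w ^+ 2)%:E <= (33 * (t - s))%:E)%E.
Proof.
have ts : 0 < t - s by rewrite subr_gt0.
have mV := measurable_increment.
set a := (t - s) in ts *.
apply: (@le_trans _ _ (\int[P]_w ((2 * a)^-1 * V w ^+ 4 + a / 2)%:E)%E).
  apply: Eint_le => w; first by rewrite sqr_ge0.
  set x := V w; have : 0 <= (x ^+ 2 - a) ^+ 2 / (2 * a).
    by rewrite divr_ge0 ?sqr_ge0// mulr_ge0// ltW.
  have -> : (x ^+ 2 - a) ^+ 2 / (2 * a) = (2 * a)^-1 * x ^+ 4 + a / 2 - x ^+ 2.
    by field; rewrite gt_eqF.
  by rewrite subr_ge0.
have V40 w : 0 <= V w ^+ 4 by rewrite exprn_even_ge0.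
have a20 : 0 <= (2 * a)^-1 by rewrite invr_ge0 mulr_ge0// ltW.
rewrite Eint_D//; try solve [meas]; try (by move=> w; rewrite mulr_ge0);
  try by move=> w; rewrite divr_ge0// ltW.
rewrite Eint_Z ?Eint_cst//; last by meas.
apply: (@le_trans _ _ ((2 * a)^-1%:E * (64 * a ^+ 2)%:E + (a / 2)%:E)%E).
  by rewrite leeD2r// lee_wpmul2l ?lee_fin//; exact: increment_moment4.
rewrite -EFinM -EFinD lee_fin.
have -> : (2 * a)^-1 * (64 * a ^+ 2) + a / 2 = 32 * a + a / 2 by field; rewrite gt_eqF.
lra.
Qed.

Lemma increment_mean0 :
  (\int[P]_w (Num.max (V w) 0)%:E = \int[P]_w (Num.max (- V w) 0)%:E)%E.
Proof.
have ts : 0 < Num.sqrt (t - s) by rewrite sqrtr_gt0 subr_gt0.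
rewrite (increment_Eint (f := fun x => Num.max x 0)); last 2 first.
- by apply: measurable_maxr; [exact: measurable_id|exact: measurable_cst].
- by move=> x; rewrite le_max lexx orbT.
rewrite (increment_Eint (f := fun x => Num.max (- x) 0)); last 2 first.
- by apply: measurable_maxr; [exact: oppr_measurable|exact: measurable_cst].
- by move=> x; rewrite le_max lexx orbT.
exact: normal_mean0.
Qed.

Lemma increment_pos_fin : (\int[P]_w (Num.max (V w) 0)%:E < +oo)%E.
Proof.
have mV := measurable_increment.
apply: (@le_lt_trans _ _ (\int[P]_w (V w ^+ 2 + 1)%:E)%E).
  apply: Eint_le => w; first by rewrite le_max lexx orbT.
  rewrite ge_max; have := sqr_ge0 (V w); have := sqr_ge0 (V w - 1) => h1 h2.
  by apply/andP; split; nra.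
rewrite Eint_D ?Eint_cst//; try solve [meas]; try by move=> w; rewrite sqr_ge0.
by rewrite lte_add_pinfty ?ltry// (le_lt_trans increment_moment2)// ltry.
Qed.

End one_increment.

End brownian_increments.

(** * Elementary stochastic sums *)

Lemma sqr_sum_le (R : realType) (m : nat) (a : 'I_m -> R) :
  (\sum_i a i) ^+ 2 <= m%:R * \sum_i a i ^+ 2.
Proof.
pose x : 'rV[R]_m := \row_i a i; pose y : 'rV[R]_m := \row_i 1.
have := edot_le x y.
have -> : edot x y = \sum_i a i by apply: eq_bigr => i _; rewrite !mxE mulr1.
rewrite -(@ler_pXn2r _ 2) ?nnegrE ?mulr_ge0 ?enorm_ge0// real_normK ?num_real//.
rewrite exprMn !enorm_sqr !big_ord1.
have -> : \sum_j x ord0 j ^+ 2 = \sum_i a i ^+ 2 by apply: eq_bigr => i _; rewrite mxE.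
have -> : \sum_j y ord0 j ^+ 2 = m%:R.
  under eq_bigr do rewrite mxE expr1n.
  by rewrite big_const_ord iter_addr_0.
by rewrite mulrC.
Qed.

Lemma moment4_const_ge0 (R : realType) (m : nat) (T : R) : 0 <= T ->
  0 <= 132 * m%:R ^+ 2 + 132 * m%:R + 192 * m%:R ^+ 3 * T.
Proof.
move=> T0; have h1 := mulr_ge0 (ler0n R 132) (exprn_ge0 2 (ler0n R m)).
have h2 := mulr_ge0 (mulr_ge0 (ler0n R 192) (exprn_ge0 3 (ler0n R m))) T0.
exact: (addr_ge0 (addr_ge0 h1 (mulr_ge0 (ler0n R 132) (ler0n R m))) h2).
Qed.

Lemma pow4_sum_le (R : realType) (m : nat) (a : 'I_m -> R) :
  (\sum_i a i) ^+ 4 <= m%:R ^+ 3 * \sum_i a i ^+ 4.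
Proof.
have h1 := sqr_sum_le a; have h2 := sqr_sum_le (fun i => a i ^+ 2).
rewrite (exprM _ 2 2); apply: (@le_trans _ _ ((m%:R * \sum_i a i ^+ 2) ^+ 2)).
  rewrite ler_pXn2r ?nnegrE ?sqr_ge0//.
  by rewrite mulr_ge0// sumr_ge0// => i _; exact: sqr_ge0.
rewrite exprMn [m%:R ^+ 3]exprSr -mulrA ler_wpM2l ?sqr_ge0// (le_trans h2)//.
by under [X in _ <= _ * X]eq_bigr do rewrite (exprM _ 2 2).
Qed.

Section elementary_sums.
Context (R : realType) (disp : measure_display) (Omega : measurableType disp).
Variables (P : probability Omega R) (T : R) (m : nat).
Variables (B : R -> Omega -> 'rV[R]_m) (F0 : set (set Omega)).
Hypotheses (Bbm : brownian_motion P T B) (F0i : initial_sigma_algebra P T B F0).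
Local Notation F := (filtration B F0).

Definition Fmeas (t : R) (U : Omega -> R) : Prop :=
  measurable_fun (setT : set (g_sigma_algebraType (F t))) U.

Lemma Fmeas_measurable t U : t <= T -> Fmeas t U -> measurable_fun setT U.
Proof.
move=> tT mU _ A mA; have := mU measurableT A mA; rewrite !setTI => h.
exact: (smallest_sub (@sigma_algebra_measurable _ Omega) (filtration_measurable Bbm F0i tT)).
Qed.

Lemma Fmeas_mono s t U : s <= t -> Fmeas s U -> Fmeas t U.
Proof.
move=> st mU _ A mA; have := mU measurableT A mA; rewrite !setTI.
by apply: sub_sigma_algebra2; exact: filtration_mono.
Qed.

Lemma F0_Fmeas t U : measurable_fun (setT : set (g_sigma_algebraType F0)) U -> Fmeas t U.
Proof.
move=> mU _ A mA; have := mU measurableT A mA; rewrite !setTI.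
by apply: sub_sigma_algebra2; exact: F0_sub_filtration.
Qed.

Let dot (c : 'I_m -> Omega -> R) (s t : R) w := \sum_l c l w * (B t w - B s w) 0 l.

(** * One step of an elementary stochastic integral *)

Section one_step.
Variables (s t K : R) (rho M : Omega -> R) (c : 'I_m -> Omega -> R).
Hypotheses (s0 : 0 <= s) (st : s <= t) (tT : t <= T).
Hypotheses (mrho : Fmeas s rho) (mM : Fmeas s M) (mc : forall l, Fmeas s (c l)).
Hypotheses (rho01 : forall w, 0 <= rho w <= 1) (cK : forall l w, `|c l w| <= K).

Let rho0 w : 0 <= rho w. Proof. by case/andP: (rho01 w). Qed.
Let sT : s <= T. Proof. exact: le_trans tT. Qed.
Let mrho' := Fmeas_measurable sT mrho.
Let mM' := Fmeas_measurable sT mM.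
Let mc' l := Fmeas_measurable sT (mc l).

(** [rho], [M] and [c] are known at time [s], so the cross term [2 rho M c . (B_t - B_s)] has mean
    zero. Cauchy-Schwarz over the coordinates gives the factor [m], the second moment of an
    increment the factor 33. *)
Lemma elementary_step2 : (\int[P]_w (M w ^+ 2)%:E < +oo)%E ->
  (\int[P]_w (rho w * (M w + dot c s t w) ^+ 2)%:E <=
   \int[P]_w (rho w * M w ^+ 2)%:E +
   (33 * m%:R * (t - s))%:E * \sum_l \int[P]_w (rho w * c l w ^+ 2)%:E)%E.
Proof.
move=> Mfin; have rs0 w l : 0 <= rho w * c l w ^+ 2 by rewrite mulr_ge0 ?sqr_ge0.
have rM0 w : 0 <= rho w * M w ^+ 2 by rewrite mulr_ge0 ?sqr_ge0.
have S0 : (0 <= \sum_l \int[P]_w (rho w * c l w ^+ 2)%:E)%E.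
  by apply: sume_ge0 => l _; apply: Eint_ge0.
have ts0 : 0 <= t - s by rewrite subr_ge0.
move: (st); rewrite le_eqVlt => /predU1P[stE|slt].
  have -> : (fun w => (rho w * (M w + dot c s t w) ^+ 2)%:E) = (fun w => (rho w * M w ^+ 2)%:E).
    apply/funext => w; rewrite /dot stE big1 ?addr0// => l _.
    by rewrite subrr mxE mulr0.
  by rewrite leeDl// mule_ge0// lee_fin mulr_ge0.
pose V l w := (B t w - B s w)%R 0 l.
have mV l : measurable_fun setT (V l) by exact: (measurable_increment Bbm).
have V20 l w : 0 <= V l w ^+ 2 by exact: sqr_ge0.
pose Y w := rho w * M w ^+ 2 + m%:R * \sum_l (rho w * c l w ^+ 2) * V l w ^+ 2.
have mcV l : measurable_fun setT (fun w => (rho w * c l w ^+ 2) * V l w ^+ 2).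
  by have mcl := mc' l; have mVl := mV l; meas.
have Y2 w : 0 <= m%:R * \sum_l (rho w * c l w ^+ 2) * V l w ^+ 2.
  by rewrite mulr_ge0// sumr_ge0// => l _; rewrite mulr_ge0.
have mdot : measurable_fun setT (dot c s t).
  by apply: measurable_sum => l; apply: measurable_funM => //; exact: mV.
apply: (@le_trans _ _ (\int[P]_w (Y w)%:E)%E).
  apply: (@Eint_le_mean0 _ _ _ P _ _ _ (fun l w => 2 * rho w * M w * c l w) V) => //.
  - by meas.
  - by rewrite /Y; meas.
  - by move=> l; have := mc' l; meas.
  - by move=> w; rewrite mulr_ge0// sqr_ge0.
  - by move=> w; rewrite addr_ge0.
  - move=> l; apply: (increment_indep Bbm F0i) => //.
    by have mcl : Fmeas s (c l) := mc l; meas.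
  - move=> l; apply: (@le_lt_trans _ _ (\int[P]_w (K * (1 + M w ^+ 2))%:E)%E).
      apply: Eint_le => w //.
      rewrite !normrM (ger0_norm (rho0 w)) ger0_norm//.
      have h1 := cK l w; have h2 := normr_ge0 (M w); have /andP[h3 h4] := rho01 w.
      have h5 := real_normK (num_real (M w)); have h6 := normr_ge0 (c l w).
      rewrite -h5; set a := `|M w| in h2 h5 *; set b := `|c l w| in h1 h6 *.
      have : 2 * a <= 1 + a ^+ 2 by have := sqr_ge0 (a - 1); nra.
      move=> h7; have h8 : rho w * (2 * a) <= 1 + a ^+ 2.
        by rewrite (le_trans _ h7)// ler_piMl// mulr_ge0.
      have -> : 2 * rho w * a * b = b * (rho w * (2 * a)) by ring.
      by apply: ler_pM => //; rewrite mulr_ge0// mulr_ge0.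
    have K0 : 0 <= K \/ m = 0%N.
      by left; rewrite (le_trans _ (cK l point)).
    have {}K0 : 0 <= K by rewrite (le_trans _ (cK l point)).
    have mM1 : measurable_fun setT (fun w => 1 + M w ^+ 2) by meas.
    rewrite Eint_Z//; last by move=> w; rewrite addr_ge0 ?sqr_ge0.
    rewrite Eint_D//; try solve [meas]; try by move=> w; rewrite sqr_ge0.
    by rewrite Eint_cst lte_mul_pinfty// lte_add_pinfty// ltry.
  - by move=> l; exact: (increment_mean0 Bbm).
  - by move=> l; exact: (increment_pos_fin Bbm).
  move=> w; rewrite /Y.
  have -> : \sum_i 2 * rho w * M w * c i w * V i w = 2 * rho w * M w * dot c s t w.
    by rewrite /dot mulr_sumr; apply: eq_bigr => l _; rewrite !mulrA.
  have := sqr_sum_le (fun l => c l w * V l w); rewrite -/(dot c s t w) => h.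
  have : rho w * dot c s t w ^+ 2 <= m%:R * \sum_l rho w * c l w ^+ 2 * V l w ^+ 2.
    have -> : \sum_l rho w * c l w ^+ 2 * V l w ^+ 2 = rho w * \sum_l (c l w * V l w) ^+ 2.
      by rewrite mulr_sumr; apply: eq_bigr => l _; ring.
    by rewrite [leRHS]mulrCA ler_wpM2l.
  move=> h'; have -> : rho w * (M w + dot c s t w) ^+ 2 = rho w * M w ^+ 2 +
     rho w * dot c s t w ^+ 2 + 2 * rho w * M w * dot c s t w by ring.
  by rewrite lerD2r lerD2l.
rewrite /Y Eint_D//; try solve [meas]; last first.
  by apply: measurable_funM => //; exact: measurable_sum.
rewrite leeD2l//.
rewrite Eint_Z//; first last.
- by move=> w; rewrite sumr_ge0// => l _; rewrite mulr_ge0.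
- exact: measurable_sum.
rewrite Eint_sum//; last by move=> l w; rewrite mulr_ge0.
have -> : 33 * m%:R * (t - s) = m%:R * (33 * (t - s)) by ring.
rewrite EFinM -muleA lee_wpmul2l ?lee_fin// ge0_sume_distrr//; last first.
  by move=> l _; exact: Eint_ge0.
apply: lee_sum => l _; rewrite muleC.
rewrite (@indep_Eint _ _ _ P (fun w => rho w * c l w ^+ 2) (fun w => V l w ^+ 2))//; first last.
- apply: (@indep_comp _ _ _ P _ (V l) id (fun x => x ^+ 2)) => //.
  apply: (increment_indep Bbm F0i) => //.
  by have mcl : Fmeas s (c l) := mc l; meas.
- by have mVl := mV l; meas.
- by have mcl := mc' l; have mVl := mV l; meas.
rewrite lee_wpmul2l//; first by apply: Eint_ge0.
exact: (increment_moment2 Bbm).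
Qed.

(** Write [D] for the increment. In [(M + D)^4] the term [4 M^3 D] has mean zero and
    [4 M D^3 <= 2 M^2 D^2 + 2 D^4], which leaves [8 M^2 D^2 + 3 D^4]. Young's inequality for
    [M^2 c^2] and the second moment of increments yield [132 m^2] and [132 m] from the first term;
    [D^4 <= m^3 (...)] and [64 (t - s)^2 <= 64 T (t - s)] yield [192 m^3 T] from the second. *)
Lemma elementary_step4 : (\int[P]_w (M w ^+ 4)%:E < +oo)%E ->
  (\int[P]_w (rho w * (M w + dot c s t w) ^+ 4)%:E <=
   (1 + (132 * m%:R ^+ 2 + 132 * m%:R + 192 * m%:R ^+ 3 * T) * (t - s))%:E *
      \int[P]_w (rho w * M w ^+ 4)%:E +
   ((132 * m%:R ^+ 2 + 132 * m%:R + 192 * m%:R ^+ 3 * T) * (t - s))%:E *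
      \sum_l \int[P]_w (rho w * c l w ^+ 4)%:E)%E.
Proof.
move=> Mfin; set kap := 132 * m%:R ^+ 2 + 132 * m%:R + 192 * m%:R ^+ 3 * T.
have e4 (x : R) : 0 <= x ^+ 4 by rewrite exprn_even_ge0.
have rs0 w l : 0 <= rho w * c l w ^+ 4 by rewrite mulr_ge0.
have rM0 w : 0 <= rho w * M w ^+ 4 by rewrite mulr_ge0.
set S := (\sum_l _)%E.
have S0 : (0 <= S)%E by apply: sume_ge0 => l _; apply: Eint_ge0.
set EM := (\int[P]_w (rho w * M w ^+ 4)%:E)%E.
have EM0 : (0 <= EM)%E by apply: Eint_ge0.
have ts0 : 0 <= t - s by rewrite subr_ge0.
have T0 : 0 <= T by rewrite (le_trans s0).
have m0 : 0 <= m%:R :> R by [].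
have kap0 : 0 <= kap by exact: moment4_const_ge0.
move: (st); rewrite le_eqVlt => /predU1P[stE|slt].
  have -> : (fun w => (rho w * (M w + dot c s t w) ^+ 4)%:E) = (fun w => (rho w * M w ^+ 4)%:E).
    apply/funext => w; rewrite /dot stE big1 ?addr0// => l _.
    by rewrite subrr mxE mulr0.
  by rewrite stE subrr mulr0 addr0 mul1e mul0e adde0.
pose V l w := (B t w - B s w)%R 0 l.
have mV l : measurable_fun setT (V l) by exact: (measurable_increment Bbm).
pose Y1 w := \sum_l (rho w * M w ^+ 2 * c l w ^+ 2) * V l w ^+ 2.
pose Y2 w := \sum_l (rho w * c l w ^+ 4) * V l w ^+ 4.
have mcV1 l : measurable_fun setT (fun w => (rho w * M w ^+ 2 * c l w ^+ 2) * V l w ^+ 2).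
  by have mcl := mc' l; have mVl := mV l; meas.
have mcV2 l : measurable_fun setT (fun w => (rho w * c l w ^+ 4) * V l w ^+ 4).
  by have mcl := mc' l; have mVl := mV l; meas.
have cV10 l w : 0 <= (rho w * M w ^+ 2 * c l w ^+ 2) * V l w ^+ 2.
  by rewrite mulr_ge0 ?sqr_ge0// mulr_ge0 ?sqr_ge0// mulr_ge0 ?sqr_ge0.
have cV20 l w : 0 <= (rho w * c l w ^+ 4) * V l w ^+ 4.
  by rewrite mulr_ge0.
have Y10 w : 0 <= Y1 w by rewrite sumr_ge0.
have Y20 w : 0 <= Y2 w by rewrite sumr_ge0.
have mY1 : measurable_fun setT Y1 by apply: measurable_sum.
have mY2 : measurable_fun setT Y2 by apply: measurable_sum.
pose Y w := rho w * M w ^+ 4 + (8 * m%:R * Y1 w + 3 * m%:R ^+ 3 * Y2 w).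
have c1 : 0 <= 8 * m%:R :> R by rewrite mulr_ge0.
have c2 : 0 <= 3 * m%:R ^+ 3 :> R by rewrite mulr_ge0 ?exprn_ge0.
have mdot : measurable_fun setT (dot c s t).
  by apply: measurable_sum => l; apply: measurable_funM => //; exact: mV.
apply: (@le_trans _ _ (\int[P]_w (Y w)%:E)%E).
  apply: (@Eint_le_mean0 _ _ _ P _ _ _ (fun l w => 4 * rho w * M w ^+ 3 * c l w) V) => //.
  - by meas.
  - by rewrite /Y; meas.
  - by move=> l; have mcl := mc' l; meas.
  - by move=> w; rewrite mulr_ge0.
  - by move=> w; rewrite !addr_ge0// mulr_ge0.
  - move=> l; apply: (increment_indep Bbm F0i) => //.
    by have mcl : Fmeas s (c l) := mc l; meas.
  - move=> l; apply: (@le_lt_trans _ _ (\int[P]_w (4 * K * (1 + M w ^+ 4))%:E)%E).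
      apply: Eint_le => w //.
      rewrite normrM (normrM (4 * rho w)) (normrM 4) (ger0_norm (rho0 w)) normrX.
      rewrite (ger0_norm (ler0n R 4)).
      have h1 := cK l w; have h2 := normr_ge0 (M w); have /andP[h3 h4] := rho01 w.
      have h6 := normr_ge0 (c l w).
      have -> : M w ^+ 4 = `|M w| ^+ 4 by rewrite -normrX ger0_norm.
      set a := `|M w| in h2 *; set b := `|c l w| in h1 h6 *.
      have h7 : a ^+ 3 <= 1 + a ^+ 4.
        have -> : a ^+ 3 = a ^+ 2 * a by ring.
        have -> : a ^+ 4 = a ^+ 2 * a ^+ 2 by ring.
        have := sqr_ge0 (a - 1); have := sqr_ge0 (a ^+ 2); have := sqr_ge0 (a ^+ 2 - a); nra.
      have h8 : rho w * a ^+ 3 <= 1 + a ^+ 4.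
        by rewrite (le_trans _ h7)// ler_piMl// exprn_ge0.
      have -> : 4 * rho w * a ^+ 3 * b = 4 * (b * (rho w * a ^+ 3)) by ring.
      rewrite -mulrA ler_wpM2l//.
      by apply: ler_pM => //; rewrite mulr_ge0// exprn_ge0.
    have K0 : 0 <= K by rewrite (le_trans _ (cK l point)).
    have mM1 : measurable_fun setT (fun w => 1 + M w ^+ 4) by meas.
    rewrite Eint_Z//; [|by move=> w; rewrite addr_ge0|by rewrite mulr_ge0].
    rewrite Eint_D//; try solve [meas].
    by rewrite Eint_cst lte_mul_pinfty ?lee_fin ?mulr_ge0// lte_add_pinfty// ltry.
  - by move=> l; exact: (increment_mean0 Bbm).
  - by move=> l; exact: (increment_pos_fin Bbm).
  move=> w; rewrite /Y.
  have -> : \sum_i 4 * rho w * M w ^+ 3 * c i w * V i w = 4 * rho w * M w ^+ 3 * dot c s t w.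
    by rewrite /dot mulr_sumr; apply: eq_bigr => l _; rewrite !mulrA.
  have := sqr_sum_le (fun l => c l w * V l w); rewrite -/(dot c s t w) => h1.
  have := pow4_sum_le (fun l => c l w * V l w); rewrite -/(dot c s t w) => h2.
  have {}h1 : rho w * M w ^+ 2 * dot c s t w ^+ 2 <= m%:R * Y1 w.
    have -> : Y1 w = rho w * M w ^+ 2 * \sum_l (c l w * V l w) ^+ 2.
      by rewrite mulr_sumr; apply: eq_bigr => l _; ring.
    by rewrite [leRHS]mulrCA ler_wpM2l// mulr_ge0 ?sqr_ge0.
  have {}h2 : rho w * dot c s t w ^+ 4 <= m%:R ^+ 3 * Y2 w.
    have -> : Y2 w = rho w * \sum_l (c l w * V l w) ^+ 4.
      by rewrite mulr_sumr; apply: eq_bigr => l _; ring.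
    by rewrite [leRHS]mulrCA ler_wpM2l.
  set D := dot c s t w in h1 h2 *; set N := M w in h1 *.
  have h3 : rho w * (4 * N * D ^+ 3) <= rho w * (2 * N ^+ 2 * D ^+ 2 + 2 * D ^+ 4).
    rewrite ler_wpM2l// -subr_ge0.
    have -> : 2 * N ^+ 2 * D ^+ 2 + 2 * D ^+ 4 - 4 * N * D ^+ 3 = 2 * ((N - D) * D) ^+ 2 by ring.
    by rewrite mulr_ge0// sqr_ge0.
  have -> : rho w * (N + D) ^+ 4 = rho w * N ^+ 4 + 6 * (rho w * N ^+ 2 * D ^+ 2) +
    rho w * (4 * N * D ^+ 3) + rho w * D ^+ 4 + 4 * rho w * N ^+ 3 * D by ring.
  rewrite lerD2r.
  have h4 : rho w * (2 * N ^+ 2 * D ^+ 2 + 2 * D ^+ 4) =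
     2 * (rho w * N ^+ 2 * D ^+ 2) + 2 * (rho w * D ^+ 4) by ring.
  move: h1 h2 h3; rewrite {}h4.
  move: (rho w * N ^+ 2 * D ^+ 2) (rho w * D ^+ 4) (rho w * (4 * N * D ^+ 3)) (rho w * N ^+ 4).
  rewrite -!(mulrA _ m%:R) -!(mulrA 3).
  move: (m%:R * Y1 w) (m%:R ^+ 3 * Y2 w) => a1 a2 b1 b2 b3 b4; lra.
have EV2 l : (\int[P]_w (rho w * M w ^+ 2 * c l w ^+ 2 * V l w ^+ 2)%:E <=
    (33 * (t - s) / 2)%:E * (EM + \int[P]_w (rho w * c l w ^+ 4)%:E))%E.
  have mcl := mc' l; have mVl := mV l.
  rewrite (@indep_Eint _ _ _ P (fun w => rho w * M w ^+ 2 * c l w ^+ 2) (fun w => V l w ^+ 2))//;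
    first last.
  - apply: (@indep_comp _ _ _ P _ (V l) id (fun x => x ^+ 2)) => //.
    apply: (increment_indep Bbm F0i) => //.
    by have mcl' : Fmeas s (c l) := mc l; meas.
  - by move=> w; exact: sqr_ge0.
  - by move=> w; rewrite mulr_ge0 ?sqr_ge0// mulr_ge0 ?sqr_ge0.
  - by meas.
  - by meas.
  have h1 : (\int[P]_w (rho w * M w ^+ 2 * c l w ^+ 2)%:E <=
      2^-1%:E * (EM + \int[P]_w (rho w * c l w ^+ 4)%:E))%E.
    rewrite -Eint_D//; try solve [meas].
    rewrite -Eint_Z//; try solve [meas]; last by move=> w; rewrite addr_ge0.
    apply: Eint_le => w; first by rewrite mulr_ge0 ?sqr_ge0// mulr_ge0 ?sqr_ge0.
    rewrite -mulrA -mulrDr [leRHS]mulrCA ler_wpM2l// ler_pdivlMl//.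
    rewrite (exprM _ 2 2) (exprM (c l w) 2 2).
    have := sqr_ge0 (M w ^+ 2 - c l w ^+ 2); nra.
  apply: (le_trans (lee_pmul _ _ h1 (increment_moment2 Bbm l s0 slt tT))).
  - by apply: Eint_ge0 => w; rewrite mulr_ge0 ?sqr_ge0// mulr_ge0 ?sqr_ge0.
  - by apply: Eint_ge0 => w; rewrite sqr_ge0.
  by rewrite muleAC -EFinM mulrC.
have EV4 l : (\int[P]_w (rho w * c l w ^+ 4 * V l w ^+ 4)%:E <=
    (64 * T * (t - s))%:E * \int[P]_w (rho w * c l w ^+ 4)%:E)%E.
  have mcl := mc' l; have mVl := mV l.
  rewrite (@indep_Eint _ _ _ P (fun w => rho w * c l w ^+ 4) (fun w => V l w ^+ 4))//;
    first last.
  - apply: (@indep_comp _ _ _ P _ (V l) id (fun x => x ^+ 4)) => //.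
    apply: (increment_indep Bbm F0i) => //.
    by have mcl' : Fmeas s (c l) := mc l; meas.
  - by meas.
  - by meas.
  rewrite muleC lee_wpmul2r//; first by apply: Eint_ge0.
  apply: (le_trans (increment_moment4 Bbm l s0 slt tT)); rewrite lee_fin.
  have tsT : t - s <= T by rewrite lerBlDr (le_trans tT)// lerDl.
  by rewrite expr2 mulrA ler_wpM2r// ler_wpM2l.
have h8 : (\int[P]_w (8 * m%:R * Y1 w)%:E <=
    (132 * m%:R ^+ 2 * (t - s))%:E * EM + (132 * m%:R * (t - s))%:E * S)%E.
  rewrite Eint_Z// Eint_sum//.
  apply: (@le_trans _ _ ((8 * m%:R)%:E *
     \sum_(l < m) ((33 * (t - s) / 2)%:E * (EM + \int[P]_w (rho w * c l w ^+ 4)%:E)))%E).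
    by rewrite lee_wpmul2l ?lee_fin//; apply: lee_sum => l _; exact: EV2.
  rewrite -ge0_sume_distrr//; last by move=> l _; rewrite adde_ge0// Eint_ge0.
  rewrite big_split/= -/S.
  have -> : (\sum_(l < m) EM = m%:R%:E * EM)%E.
    by rewrite sumr_const card_ord mule_natl.
  rewrite muleA -EFinM ge0_muleDr//; last by rewrite mule_ge0// lee_fin.
  rewrite muleA -EFinM leeD// lee_wpmul2r// lee_fin.
    by rewrite -subr_ge0; have -> : 132 * m%:R ^+ 2 * (t - s) -
      8 * m%:R * (33 * (t - s) / 2) * m%:R = 0 by field.
  by rewrite -subr_ge0; have -> : 132 * m%:R * (t - s) -
      8 * m%:R * (33 * (t - s) / 2) = 0 by field.
have h9 : (\int[P]_w (3 * m%:R ^+ 3 * Y2 w)%:E <= (192 * m%:R ^+ 3 * T * (t - s))%:E * S)%E.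
  rewrite Eint_Z// Eint_sum//.
  have -> : 192 * m%:R ^+ 3 * T * (t - s) = 3 * m%:R ^+ 3 * (64 * T * (t - s)) by ring.
  rewrite (EFinM (3 * m%:R ^+ 3)) -muleA lee_wpmul2l ?lee_fin// ge0_sume_distrr//; last first.
    by move=> l _; exact: Eint_ge0.
  by apply: lee_sum => l _; exact: EV4.
rewrite /Y Eint_D//; try solve [meas]; last by move=> w; rewrite addr_ge0// mulr_ge0.
rewrite Eint_D//; try solve [meas]; try by move=> w; rewrite mulr_ge0.
apply: (le_trans (leeD2l _ (leeD h8 h9))).
have k1 : 132 * m%:R ^+ 2 <= kap.
  rewrite /kap -addrA lerDl; apply: addr_ge0; first exact: (mulr_ge0 (ler0n _ _)).
  exact: (mulr_ge0 (mulr_ge0 (ler0n _ _) (exprn_ge0 _ m0))).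
rewrite -/EM; clearbody EM S.
rewrite (EFinD 1) ge0_muleDl ?lee_fin ?mulr_ge0// mul1e -!addeA leeD2l//.
apply: leeD; first by rewrite lee_wpmul2r// lee_fin ler_wpM2r.
rewrite -ge0_muleDl ?lee_fin ?mulr_ge0 ?exprn_ge0// -EFinD lee_wpmul2r// lee_fin.
by rewrite -mulrDl ler_wpM2r// /kap -addrA lerDr mulr_ge0 ?exprn_ge0.
Qed.

End one_step.

(** * Elementary integrals along a partition *)

Section partition_sums.
Variables (p : nat -> R) (c : nat -> 'I_m -> Omega -> R) (n : nat) (K : R).
Hypotheses (p0 : 0 <= p 0%N) (pn : p n <= T) (K0 : 0 <= K).
Hypothesis pmono : forall j, (j < n)%N -> p j <= p j.+1.
Hypothesis mc : forall j l, (j < n)%N -> Fmeas (p j) (c j l).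
Hypothesis cK : forall j l w, (j < n)%N -> `|c j l w| <= K.

Definition elementary_sum (k : nat) w := \sum_(j < k) dot (c j) (p j) (p j.+1) w.

Lemma partition_le i k : (i <= k)%N -> (k <= n)%N -> p i <= p k.
Proof.
elim: k => [|k IH]; first by rewrite leqn0 => /eqP ->.
rewrite leq_eqVlt => /predU1P[->//|]; rewrite ltnS => ik kn.
by rewrite (le_trans (IH ik (ltnW kn)))// pmono.
Qed.

Let p_ge0 k : (k <= n)%N -> 0 <= p k.
Proof. by move=> kn; rewrite (le_trans p0)// partition_le. Qed.

Let p_leT k : (k <= n)%N -> p k <= T.
Proof. by move=> kn; rewrite (le_trans _ pn)// partition_le. Qed.

Lemma elementary_sumS k w :
  elementary_sum k.+1 w = elementary_sum k w + dot (c k) (p k) (p k.+1) w.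
Proof. by rewrite /elementary_sum big_ord_recr. Qed.

Lemma elementary_sum_Fmeas k : (k <= n)%N -> Fmeas (p k) (elementary_sum k).
Proof.
move=> kn; apply: measurable_sum => j; apply: measurable_sum => l.
have jn : (j < n)%N := leq_trans (ltn_ord j) kn.
apply: measurable_funM.
  by apply: (Fmeas_mono (partition_le (ltnW (ltn_ord j)) kn)); exact: mc.
apply: measurable_entry; apply: measurable_mxB; apply: brownian_adapted.
  by rewrite p_ge0//= partition_le.
by rewrite p_ge0 ?(ltnW jn)//= partition_le// ltnW.
Qed.

Let kap := 132 * m%:R ^+ 2 + 132 * m%:R + 192 * m%:R ^+ 3 * T.

Lemma elementary_sum_L2_aux (rho : Omega -> R) k :
  measurable_fun (setT : set (g_sigma_algebraType F0)) rho ->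
  (forall w, 0 <= rho w <= 1) -> (k <= n)%N ->
  (\int[P]_w (elementary_sum k w ^+ 4)%:E < +oo)%E ->
  (\int[P]_w (elementary_sum k w ^+ 2)%:E < +oo)%E.
Proof.
move=> mrho rho01 kn h4.
have mE := Fmeas_measurable (p_leT kn) (elementary_sum_Fmeas kn).
apply: (@le_lt_trans _ _ (\int[P]_w (elementary_sum k w ^+ 4 + 1)%:E)%E).
  apply: Eint_le => w; first exact: sqr_ge0.
  by rewrite (exprM _ 2 2); have := sqr_ge0 (elementary_sum k w ^+ 2 - 1); have := sqr_ge0 (elementary_sum k w); nra.
rewrite Eint_D//; try solve [meas]; last by move=> w; rewrite exprn_even_ge0.
by rewrite Eint_cst lte_add_pinfty// ltry.
Qed.

(** Discrete Gronwall: the one-step bound multiplies by [1 + kap dl <= e^(kap dl)] and adds [kap dl]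
    times the moment of the coefficients. Finiteness is carried through the same induction, because
    the cross term of the next step is integrable only if the unweighted fourth moment is finite. *)
Lemma elementary_sum_L4 (rho : Omega -> R) k :
  measurable_fun (setT : set (g_sigma_algebraType F0)) rho ->
  (forall w, 0 <= rho w <= 1) -> (k <= n)%N ->
  (\int[P]_w (elementary_sum k w ^+ 4)%:E < +oo)%E /\
  (\int[P]_w (rho w * elementary_sum k w ^+ 4)%:E <=
   (kap * expR (kap * p k))%:E *
   \sum_(j < k) (p j.+1 - p j)%:E * \sum_l \int[P]_w (rho w * c j l w ^+ 4)%:E)%E.
Proof.
have T0 : 0 <= T by rewrite (le_trans p0)// p_leT.
have kap0 : 0 <= kap by exact: moment4_const_ge0.
have e4 (x : R) : 0 <= x ^+ 4 by rewrite exprn_even_ge0.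
have p2 j : (j < n)%N -> 0 <= p j.+1 - p j by move=> jn; rewrite subr_ge0 pmono.
have cE j l (rho' : Omega -> R) : (j < n)%N -> (forall w, 0 <= rho' w <= 1) ->
    (\int[P]_w (rho' w * c j l w ^+ 4)%:E < +oo)%E.
  move=> jn rho'01; apply: (@le_lt_trans _ _ (\int[P]__ (K ^+ 4)%:E)%E).
    apply: Eint_le => w; first by rewrite mulr_ge0//; case/andP: (rho'01 w).
    have h1 : c j l w ^+ 4 <= K ^+ 4.
      by rewrite -[c j l w ^+ 4]ger0_norm// normrX lerXn2r ?nnegrE ?cK.
    by case/andP: (rho'01 w) => h2 h3; rewrite (le_trans _ h1)// ler_piMl.
  by rewrite Eint_cst ltry.
have rec (rho' : Omega -> R) j : measurable_fun (setT : set (g_sigma_algebraType F0)) rho' ->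
    (forall w, 0 <= rho' w <= 1) -> (j < n)%N ->
    (\int[P]_w (elementary_sum j w ^+ 4)%:E < +oo)%E ->
    (\int[P]_w (rho' w * elementary_sum j.+1 w ^+ 4)%:E <=
     (1 + kap * (p j.+1 - p j))%:E * \int[P]_w (rho' w * elementary_sum j w ^+ 4)%:E +
     (kap * (p j.+1 - p j))%:E * \sum_l \int[P]_w (rho' w * c j l w ^+ 4)%:E)%E.
  move=> mrho' rho'01 jn fin.
  under eq_integral do rewrite elementary_sumS.
  apply: elementary_step4 => //.
  - by rewrite p_ge0// ltnW.
  - exact: pmono.
  - exact: p_leT.
  - exact: F0_Fmeas.
  - by apply: elementary_sum_Fmeas; exact: ltnW.
  - by move=> l; exact: mc.
  - by move=> l w; exact: cK.
move=> mrho rho01; elim: k => [_|k IH kn].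
  split.
    rewrite /elementary_sum; under eq_integral do rewrite big_ord0 expr0n/=.
    by rewrite integral0.
  rewrite /elementary_sum; under eq_integral do rewrite big_ord0 expr0n/= mulr0.
  by rewrite integral0 big_ord0 mule0.
have [fin {}IH] := IH (ltnW kn).
split.
  (* The recursion with weight 1 propagates finiteness of the unweighted moment. *)
  have m1 : measurable_fun (setT : set (g_sigma_algebraType F0)) (cst 1 : Omega -> R).
    exact: measurable_cst.
  have := rec (cst 1) k m1; rewrite /cst.
  have mul1 (U : Omega -> R) : (\int[P]_w (1 * U w)%:E = \int[P]_w (U w)%:E)%E.
    by under eq_integral do rewrite mul1r.
  rewrite !(mul1 (fun w => _ w ^+ 4)).
  move=> h; apply: (le_lt_trans (h _ kn fin)).
    by move=> w; rewrite ler01 lexx.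
  rewrite lte_add_pinfty// lte_mul_pinfty//.
  - by rewrite lee_fin addr_ge0// mulr_ge0// p2.
  - by rewrite lee_fin mulr_ge0// p2.
  - apply/lte_sum_pinfty => l _; apply: (cE k l (cst 1)) => // w.
    by rewrite /cst ler01 lexx.
apply: (le_trans (rec rho k mrho rho01 kn fin)).
set S := (\sum_(j < k) _)%E in IH; set e := (\sum_l \int[P]_w (rho w * c k l w ^+ 4)%:E)%E.
have rc0 j l w : 0 <= rho w * c j l w ^+ 4.
  by rewrite mulr_ge0//; case/andP: (rho01 w).
have e0 : (0 <= e)%E by apply: sume_ge0 => l _; exact: Eint_ge0.
have S0 : (0 <= S)%E.
  apply: sume_ge0 => j _; rewrite mule_ge0 ?lee_fin ?p2//.
    by rewrite (leq_trans (ltn_ord j))// ltnW.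
  by apply: sume_ge0 => l _; exact: Eint_ge0.
set dl := p k.+1 - p k; have dl0 : 0 <= dl by exact: p2.
have E1 : 1 + kap * dl <= expR (kap * dl) by exact: expR_ge1Dx.
have kE : expR (kap * p k.+1) = expR (kap * dl) * expR (kap * p k).
  by rewrite -expRD -mulrDr /dl subrK.
rewrite big_ord_recr/= -/S -/e -/dl [leRHS]ge0_muleDr//; last by rewrite mule_ge0// lee_fin.
apply: leeD.
  apply: (@le_trans _ _ ((1 + kap * dl)%:E * ((kap * expR (kap * p k))%:E * S))%E).
    by rewrite lee_wpmul2l// lee_fin addr_ge0// mulr_ge0.
  rewrite muleA -EFinM lee_wpmul2r// lee_fin kE [leRHS]mulrCA ler_wpM2r//.
  by rewrite mulr_ge0// expR_ge0.
rewrite muleA -EFinM lee_wpmul2r// lee_fin ler_wpM2r//.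
by rewrite -[leLHS]mulr1 ler_wpM2l// expR_ge1_nneg// mulr_ge0// p_ge0.
Qed.

Lemma elementary_sum_L2 (rho : Omega -> R) k :
  measurable_fun (setT : set (g_sigma_algebraType F0)) rho ->
  (forall w, 0 <= rho w <= 1) -> (k <= n)%N ->
  (\int[P]_w (rho w * elementary_sum k w ^+ 2)%:E <=
   (33 * m%:R)%:E *
   \sum_(j < k) (p j.+1 - p j)%:E * \sum_l \int[P]_w (rho w * c j l w ^+ 2)%:E)%E.
Proof.
move=> mrho rho01; elim: k => [_|k IH kn].
  rewrite /elementary_sum; under eq_integral do rewrite big_ord0 expr0n/= mulr0.
  by rewrite integral0 big_ord0 mule0.
have {}IH := IH (ltnW kn).
have [fin4 _] := elementary_sum_L4 mrho rho01 (ltnW kn).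
have fin := elementary_sum_L2_aux mrho rho01 (ltnW kn) fin4.
have rc0 j l w : 0 <= rho w * c j l w ^+ 2.
  by rewrite mulr_ge0 ?sqr_ge0//; case/andP: (rho01 w).
under eq_integral do rewrite elementary_sumS.
have step : (\int[P]_w (rho w * (elementary_sum k w + dot (c k) (p k) (p k.+1) w) ^+ 2)%:E <=
   \int[P]_w (rho w * elementary_sum k w ^+ 2)%:E +
   (33 * m%:R * (p k.+1 - p k))%:E * \sum_l \int[P]_w (rho w * c k l w ^+ 2)%:E)%E.
  apply: (@elementary_step2 (p k) (p k.+1) K) => //.
  - by rewrite p_ge0// ltnW.
  - exact: pmono.
  - exact: p_leT.
  - exact: F0_Fmeas.
  - by apply: elementary_sum_Fmeas; exact: ltnW.
  - by move=> l; exact: mc.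
  - by move=> l w; exact: cK.
apply: (le_trans step).
rewrite big_ord_recr/= ge0_muleDr//.
- by apply: leeD => //; rewrite muleA -EFinM.
- apply: sume_ge0 => j _; rewrite mule_ge0 ?lee_fin ?subr_ge0 ?pmono//.
    by rewrite (leq_trans (ltn_ord j))// ltnW.
  by apply: sume_ge0 => l _; exact: Eint_ge0.
- rewrite mule_ge0 ?lee_fin ?subr_ge0 ?pmono//.
  by apply: sume_ge0 => l _; exact: Eint_ge0.
Qed.

End partition_sums.

End elementary_sums.

(** * Adapted families of random intervals *)

Section step_functions.
Context (R : realType).
Variables (p : nat -> R) (n : nat) (t : R).
Hypotheses (p0 : 0 <= p 0%N) (pn : p n <= t).
Hypothesis pmono : forall j, (j < n)%N -> p j <= p j.+1.

Let ple i k : (i <= k)%N -> (k <= n)%N -> p i <= p k.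
Proof.
elim: k => [|k IH]; first by rewrite leqn0 => /eqP ->.
rewrite leq_eqVlt => /predU1P[->//|]; rewrite ltnS => ik kn.
by rewrite (le_trans (IH ik (ltnW kn)))// pmono.
Qed.

(** The cells are half-open, so at each time at most one of them is active and the step function
    lies below [G] pointwise. *)
Lemma step_sum_le_integral (g : nat -> R) (G : R -> R) :
  (forall j, (j < n)%N -> 0 <= g j) -> (forall s, 0 <= G s) ->
  (forall j s, (j < n)%N -> p j < s <= p j.+1 -> g j <= G s) ->
  ((\sum_(j < n) (p j.+1 - p j) * g j)%:E <=
   \int[lebesgue_measure]_(s in `[0%R, t]) (G s)%:E)%E.
Proof.
move=> g0 G0 gG.
pose h (j : 'I_n) (s : R) := g j * \1_(`]p j, p j.+1]%classic) s.
have h0 j s : 0 <= h j s by rewrite mulr_ge0 ?g0.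
have mi j : measurable_fun setT (\1_(`]p j, p j.+1]%classic) : R -> R).
  exact: measurable_indic.
have mh j : measurable_fun setT (h j) by apply: measurable_funM.
apply: (@le_trans _ _ (\int[lebesgue_measure]_s (\sum_j h j s)%:E)%E).
  rewrite (Eint_sum lebesgue_measure (index_enum _))//.
  rewrite -sumEFin; apply: lee_sum => j _; rewrite mulrC /h.
  rewrite Eint_Z ?g0//.
  rewrite EFinM lee_wpmul2l ?lee_fin ?g0//.
  rewrite integral_indic// setIT.
  suff : ((p j.+1 - p j)%:E <= lebesgue_measure (`]p j, p j.+1]%classic : set R))%E by [].
  rewrite lebesgue_measure_itv/= lte_fin.
  case: ifPn => [_|]; first by rewrite -EFinD.
  by rewrite -leNgt lee_fin subr_le0.
rewrite [leRHS]integral_mkcond; apply: ge0_integral_mono => s _.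
  by rewrite lee_fin sumr_ge0.
have [[j sj]|none] := pselect (exists j : 'I_n, p j < s <= p j.+1).
  have sD : s \in `[0, t]%classic.
    case/andP: sj => s1 s2; rewrite inE/= in_itv/=; apply/andP; split.
      by rewrite (le_trans p0)// (le_trans _ (ltW s1))// ple// ltnW.
    by rewrite (le_trans s2)// (le_trans _ pn)// ple.
  rewrite /patch sD lee_fin (bigD1 j)//= big1 ?addr0.
    by rewrite /h indicE mem_set/= ?in_itv//= mulr1 gG.
  move=> i ij; rewrite /h indicE memNset ?mulr0//= in_itv/= => /andP[i1 i2].
  case/andP: sj => s1 s2.
  have [lij|lji|eij] := ltngtP i j.
  - by have := ple lij (ltnW (ltn_ord j)); rewrite leNgt (lt_le_trans s1 i2).
  - by have := ple lji (ltnW (ltn_ord i)); rewrite leNgt (lt_le_trans i1 s2).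
  - by move/eqP: ij; apply; exact/val_inj.
rewrite big1 => [|j _]; first by rewrite /patch; case: ifP => // _; rewrite lee_fin.
rewrite /h indicE memNset ?mulr0//= in_itv/= => js.
by apply: none; exists j.
Qed.

End step_functions.

Section clamp.
Context (R : realType).
Implicit Types (K x y : R).

(** Truncation to [[-K, K]]. It bounds the coefficients of an approximating sum without spoiling the
    approximation, being 1-Lipschitz and the identity on values already bounded by [K]. *)
Definition clamp K x := Num.max (- K) (Num.min K x).

Lemma clamp_le K x : 0 <= K -> `|clamp K x| <= K.
Proof.
move=> K0; rewrite /clamp ler_norml le_max lexx/= ge_max ge_min lexx/=.
by rewrite andbT (le_trans _ K0)// oppr_le0.
Qed.

Lemma clamp_id K x : `|x| <= K -> clamp K x = x.
Proof. by rewrite ler_norml /clamp => /andP[h1 h2]; rewrite min_r// max_r. Qed.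

Lemma clamp_lip K x y : `|clamp K x - clamp K y| <= `|x - y|.
Proof.
rewrite /clamp; case: (leP K x) => h1; case: (leP K y) => h2; rewrite /Order.max;
  repeat case: ifPn; rewrite -?leNgt => *; rewrite ler_norml; apply/andP;
  have h3 := ler_norm (x - y); have h4 := ler_norm (- (x - y)); rewrite normrN in h4;
  split; lra.
Qed.

Lemma measurable_clamp d (Omega : measurableType d) K (U : Omega -> R) :
  measurable_fun setT U -> measurable_fun setT (fun w => clamp K (U w)).
Proof.
move=> mU; apply: measurable_maxr; first exact: measurable_cst.
by apply: measurable_minr => //; exact: measurable_cst.
Qed.

End clamp.

(** * Families of intervals and their refinement to a partition *)

Section families.
Context (R : realType) (disp : measure_display) (Omega : measurableType disp).
Variables (P : probability Omega R) (T : R) (m : nat).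
Variables (B : R -> Omega -> 'rV[R]_m) (F0 : set (set Omega)).
Hypotheses (Bbm : brownian_motion P T B) (F0i : initial_sigma_algebra P T B F0).
Local Notation F := (filtration B F0).
Local Notation leb := (@lebesgue_measure R).

(* A simple process as a finite family of possibly overlapping intervals, so
   that linear combinations are disjoint unions of families. *)
Record simple_family := SimpleFamily {
  fam_ix : finType ;
  fam_l : fam_ix -> R ;
  fam_r : fam_ix -> R ;
  fam_c : fam_ix -> Omega -> 'rV[R]_m }.

(** Measurability is asked of nondegenerate intervals only: stopping a simple process at [t]
    collapses its later intervals to the point [t], at which their coefficients are not yet
    known. *)
Definition fam_adapted (t : R) (f : simple_family) : Prop :=
  [/\ forall i : fam_ix f, 0 <= fam_l i /\ fam_l i <= fam_r i <= t,
      forall i : fam_ix f, fam_l i < fam_r i -> measurable_wrt (F (fam_l i)) (fam_c i) &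
      exists C : R, forall (i : fam_ix f) w, enorm (fam_c i w) <= C].

Definition fam_value (f : simple_family) (s : R) (w : Omega) : 'rV[R]_m :=
  \sum_(i : fam_ix f | fam_l i < s <= fam_r i) fam_c i w.

Definition fam_integral (f : simple_family) (w : Omega) : R :=
  \sum_(i : fam_ix f) edot (fam_c i w) (B (fam_r i) w - B (fam_l i) w).

(** All endpoints, together with the prescribed [pts], are sorted into one partition. No endpoint
    lies strictly inside a cell, so every interval of the family is active on a whole cell or not at
    all, and the coefficient of a cell is the sum over the active intervals. [pts] later imposes a
    mesh. *)
Lemma fam_refine (f : simple_family) (t : R) (pts : seq R) : t <= T -> fam_adapted t f ->
  (forall x, x \in pts -> 0 <= x <= t) -> 0 <= t ->
  exists (n : nat) (p : nat -> R) (c : nat -> 'I_m -> Omega -> R) (K : R),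
  [/\ [/\ 0 <= p 0%N, p n <= t, 0 <= K & forall j, (j < n)%N -> p j <= p j.+1],
      forall x j, x \in pts -> (j < n)%N -> p j < x -> p j.+1 <= x,
      forall j l, (j < n)%N -> Fmeas B F0 (p j) (c j l),
      forall j l w, (j < n)%N -> `|c j l w| <= K &
      (forall w, fam_integral f w = elementary_sum B p c n w) /\
      forall j l s w, (j < n)%N -> p j < s <= p j.+1 -> fam_value f s w 0 l = c j l w].
Proof.
move=> tT [flr fm [C fC]] ptsP t0.
pose ends := [seq fam_l i | i : fam_ix f] ++ [seq fam_r i | i : fam_ix f].
pose q := sort <=%O (undup (0 :: ends ++ pts)).
have qs : sorted <%O q by rewrite /q sort_lt_sorted undup_uniq.
have memq x : (x \in q) = (x \in 0 :: ends ++ pts) by rewrite mem_sort mem_undup.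
have q0t x : x \in q -> 0 <= x <= t.
  rewrite memq inE !mem_cat => /orP[/eqP->|]; first by rewrite lexx.
  move=> /orP[/orP[]|]; last exact: ptsP.
    by case/mapP => i _ ->; case: (flr i) => h0 /andP[h1 h2]; rewrite h0 (le_trans h1 h2).
  by case/mapP => i _ ->; case: (flr i) => h0 /andP[h1 h2]; rewrite h2 (le_trans h0 h1).
have lq (i : fam_ix f) : fam_l i \in q.
  have h : fam_l i \in [seq fam_l i | i : fam_ix f] by apply/mapP; exists i; rewrite ?mem_enum.
  by rewrite memq inE !mem_cat h ?orbT.
have rq (i : fam_ix f) : fam_r i \in q.
  have h : fam_r i \in [seq fam_r i | i : fam_ix f] by apply/mapP; exists i; rewrite ?mem_enum.
  by rewrite memq inE !mem_cat h ?orbT.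
have q_gt0 : (0 < size q)%N.
  by have := lq; case: q {qs memq q0t lq rq} (memq 0); rewrite ?inE ?eqxx//.
pose n := (size q).-1; pose p := nth 0 q.
have szq : size q = n.+1 by rewrite prednK.
have pq j : (j <= n)%N -> p j \in q by move=> jn; rewrite mem_nth// szq ltnS.
have plt i j : (i <= n)%N -> (j <= n)%N -> (p i < p j) = (i < j)%N.
  by move=> il jl; apply: (lt_sorted_ltn_nth 0 qs); rewrite inE szq ltnS.
have ple i j : (i <= n)%N -> (j <= n)%N -> (p i <= p j) = (i <= j)%N.
  by move=> il jl; rewrite leNgt plt// -leqNgt.
have pmono j : (j < n)%N -> p j <= p j.+1 by move=> jn; rewrite ple// ltnW.
have pnext x j : x \in q -> (j < n)%N -> p j < x -> p j.+1 <= x.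
  move=> xq jn; have xi : (index x q <= n)%N by rewrite -ltnS -szq index_mem.
  by rewrite -(nth_index 0 xq) -/p plt ?(ltnW jn)// ple.
pose c j l w := \sum_(i : fam_ix f | fam_l i <= p j < fam_r i) fam_c i w 0 l.
pose K := #|fam_ix f|%:R * `|C|.
have cnd j s (i : fam_ix f) : (j < n)%N -> p j < s <= p j.+1 ->
    (fam_l i < s <= fam_r i) = (fam_l i <= p j < fam_r i).
  move=> jn /andP[s1 s2]; apply/andP/andP => -[h1 h2]; split.
  - rewrite leNgt; apply/negP => h; have := pnext _ _ (lq i) jn h.
    by rewrite leNgt (lt_le_trans h1 s2).
  - exact: lt_le_trans h2.
  - exact: le_lt_trans s1.
  - exact: (le_trans s2 (pnext _ _ (rq i) jn h2)).
exists n, p, c, K; split.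
- split=> //; first by case/andP: (q0t _ (pq 0%N isT)).
    by case/andP: (q0t _ (pq n (leqnn n))).
  by rewrite mulr_ge0.
- move=> x j xp; apply: pnext; rewrite memq inE mem_cat.
  by rewrite xp !orbT.
- move=> j l jn; rewrite /Fmeas /c.
  under eq_fun do rewrite big_mkcond/=.
  apply: measurable_sum => i.
  have [/andP[h1 h2]|_] := boolP (fam_l i <= p j < fam_r i); last exact: measurable_cst.
  apply: (Fmeas_mono h1); apply: measurable_entry; apply: fm.
  exact: le_lt_trans h2.
- move=> j l w jn; apply: (le_trans (ler_norm_sum _ _ _)).
  apply: (@le_trans _ _ (\sum_(i : fam_ix f) `|C|)).
    rewrite big_mkcond/=; apply: ler_sum => i _; case: ifP => // _.
    by rewrite (le_trans (enorm_entry _ _ _))// (le_trans (fC i w))// ler_norm.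
  by rewrite sumr_const -mulr_natl.
split=> [w|j l s w jn sj]; last first.
  by rewrite /fam_value summxE; apply: eq_bigl => i; exact: cnd.
rewrite /fam_integral /elementary_sum /c.
pose D j := B (p j.+1) w - B (p j) w.
transitivity (\sum_(j < n) \sum_(i : fam_ix f | fam_l i <= p j < fam_r i)
    edot (fam_c i w) (D j)); last first.
  apply: eq_bigr => j _; rewrite exchange_big/=; apply: eq_bigr => l _.
  by rewrite mulr_suml.
rewrite [RHS](exchange_big_dep xpredT)//=; apply: eq_bigr => i _.
have -> : B (fam_r i) w - B (fam_l i) w =
    \sum_(j < n | fam_l i <= p j < fam_r i) D j.
  (* The path along the partition with its time clamped to [[fam_l i, fam_r i]]: its increments
     vanish on the cells outside the interval and telescope to the increment over the interval. *)
  pose g j := B (Num.max (fam_l i) (Num.min (fam_r i) (p j))) w.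
  have [l0 /andP[lr rt]] := flr i.
  transitivity (g n - g 0%N).
    have rn : fam_r i <= p n.
      rewrite -(nth_index 0 (rq i)) -/p ple//; last by rewrite -ltnS -szq index_mem.
      by rewrite -ltnS -szq index_mem.
    have l0' : p 0%N <= fam_l i.
      rewrite -(nth_index 0 (lq i)) -/p ple//.
      by rewrite -ltnS -szq index_mem.
    by rewrite /g (min_l rn) (max_r lr) max_l// ge_min l0' orbT.
  rewrite -telescope_sumr// big_mkord [RHS]big_mkcond/=; apply: eq_bigr => j _.
  have jn := ltn_ord j; rewrite /g /D.
  have [rj|jr] := leP (fam_r i) (p j).
    rewrite andbF (min_l (le_trans rj (pmono _ jn))) subrr//.
  have r1 : p j.+1 <= fam_r i by exact: pnext.
  rewrite andbT (min_r r1).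
  have [lj|jl] := leP (fam_l i) (p j).
    by rewrite (max_r (le_trans lj (pmono _ jn))).
  have l1 : p j.+1 <= fam_l i by exact: pnext.
  by rewrite (max_l l1) subrr.
rewrite /edot [RHS]exchange_big/=; apply: eq_bigr => l _.
by rewrite summxE mulr_sumr.
Qed.

Lemma measurable_time_indic (a b : R) :
  measurable_fun (setT : set (measurableTypeR R * Omega))
    (fun z => if a < z.1 <= b then 1 else 0 : R).
Proof.
have -> : (fun z : measurableTypeR R * Omega => if a < z.1 <= b then 1 else 0 : R) =
    (\1_(`]a, b]%classic) : R -> R) \o fst.
  apply/funext => z /=; rewrite indicE; case: ifPn => h.
    by rewrite mem_set//= in_itv.
  by rewrite memNset//= in_itv/=; exact/negP.
apply: measurableT_comp; last exact: measurable_fst.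
exact: measurable_indic.
Qed.

Lemma measurable_comp_snd (U : Omega -> R) : measurable_fun setT U ->
  measurable_fun (setT : set (measurableTypeR R * Omega)) (fun z => U z.2).
Proof. by move=> mU; apply: (measurableT_comp mU); exact: measurable_snd. Qed.

Lemma fam_value_measurable (f : simple_family) (t : R) : t <= T -> fam_adapted t f ->
  measurable_fun (setT : set (measurableTypeR R * Omega))
    (fun z => fam_value f z.1 z.2).
Proof.
move=> tT [flr fm _]; apply: measurable_mx => i l; rewrite (ord1 i).
(* The coefficient of a degenerate interval may fail to be measurable; it is replaced by 0, which
   changes nothing because no time belongs to that interval. *)
have -> : (fun z : measurableTypeR R * Omega => fam_value f z.1 z.2 0 l) =
   fun z => \sum_(k : fam_ix f) (if fam_l k < z.1 <= fam_r k then 1 else 0) *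
     (if fam_l k < fam_r k then fam_c k z.2 0 l else 0).
  apply/funext => z; rewrite /fam_value summxE big_mkcond/=; apply: eq_bigr => k _.
  case: ifPn => [/andP[h1 h2]|_]; last by rewrite mul0r.
  by rewrite (lt_le_trans h1 h2) mul1r.
apply: measurable_sum => k; apply: measurable_funM.
  exact: measurable_time_indic.
have [lr|lr] := boolP (fam_l k < fam_r k); last exact: measurable_cst.
apply: (measurable_comp_snd (U := fun w => fam_c k w 0 l)).
have [_ /andP[h1 h2]] := flr k.
apply: (Fmeas_measurable Bbm F0i (le_trans h1 (le_trans h2 tT))).
by apply: measurable_entry; exact: fm.
Qed.

Lemma fam_integral_measurable (f : simple_family) (t : R) : 0 <= t -> t <= T -> fam_adapted t f ->
  measurable_fun setT (fam_integral f).
Proof.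
move=> t0 tT fa.
have nil x : x \in [::] -> 0 <= x <= t by [].
have [n [p [c [K [[p0 pn K0 pm] _ mc cK [fE _]]]]]] := fam_refine tT fa nil t0.
rewrite (funext fE); apply: (Fmeas_measurable Bbm F0i (t := p n)).
  exact: le_trans pn tT.
apply: (elementary_sum_Fmeas p0 pm mc (leqnn n)).
Qed.

End families.

(** * Second moments of Ito integrals *)

Section time_integral.
Context (R : realType) (disp : measure_display) (Omega : measurableType disp).
Variable (P : probability Omega R).
Local Notation leb := (@lebesgue_measure R).
Implicit Types f g h : R -> Omega -> R.

Definition jmeas (f : R -> Omega -> R) : Prop :=
  measurable_fun (setT : set (measurableTypeR R * Omega)) (fun z => f z.1 z.2).

Definition dint (t : R) (f : R -> Omega -> R) : \bar R :=
  (\int[P]_w \int[leb]_(s in `[0%R, t]) (f s w)%:E)%E.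

Lemma jmeas_section f (w : Omega) : jmeas f ->
  measurable_fun setT (f^~ w).
Proof.
move=> mf; have h : measurable_fun (setT : set (measurableTypeR R)) (fun s => (s, w)).
  by apply: measurable_fun_pair => //; exact: measurable_cst.
exact: (measurableT_comp mf h).
Qed.

Lemma jmeas_time f (s : R) : jmeas f -> measurable_fun setT (f s).
Proof.
move=> mf; have h : measurable_fun (setT : set Omega) (fun w => (s : measurableTypeR R, w)).
  by apply: measurable_fun_pair => //; exact: measurable_cst.
exact: (measurableT_comp mf h).
Qed.

Lemma dint_le t f g : (forall s w, 0 <= s <= t -> 0 <= f s w) ->
  (forall s w, 0 <= s <= t -> f s w <= g s w) -> (dint t f <= dint t g)%E.
Proof.
move=> f0 fg; apply: ge0_integral_mono => w _.
  by apply: integral_ge0 => s; rewrite /= in_itv/= => st; rewrite lee_fin f0.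
apply: ge0_integral_mono => s; rewrite /= in_itv/= => st; rewrite lee_fin; first exact: f0.
exact: fg.
Qed.

Lemma dint_ge0 t f : (forall s w, 0 <= s <= t -> 0 <= f s w) -> (0 <= dint t f)%E.
Proof.
move=> f0; apply: integral_ge0 => w _; apply: integral_ge0 => s.
by rewrite /= in_itv/= => st; rewrite lee_fin f0.
Qed.

Lemma dint_D t f g : jmeas f -> jmeas g -> (forall s w, 0 <= f s w) ->
  (forall s w, 0 <= g s w) ->
  dint t (fun s w => f s w + g s w) = (dint t f + dint t g)%E.
Proof.
move=> mf mg f0 g0; rewrite /dint.
rewrite -ge0_integralD//; first last.
- by apply: Eint_time_measurable.
- by move=> w _; apply: integral_ge0 => s _; rewrite lee_fin.
- by apply: Eint_time_measurable.
- by move=> w _; apply: integral_ge0 => s _; rewrite lee_fin.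
apply: eq_integral => w _; rewrite -ge0_integralD//.
- by move=> s _; rewrite lee_fin.
- by apply/measurable_EFinP; apply: measurable_funTS; exact: jmeas_section.
- by move=> s _; rewrite lee_fin.
- by apply/measurable_EFinP; apply: measurable_funTS; exact: jmeas_section.
Qed.

Lemma dint_Z t (c : R) f : jmeas f -> (forall s w, 0 <= f s w) -> 0 <= c ->
  dint t (fun s w => c * f s w) = (c%:E * dint t f)%E.
Proof.
move=> mf f0 c0; rewrite /dint.
rewrite -ge0_integralZl//; first last.
- by move=> w _; apply: integral_ge0 => s _; rewrite lee_fin.
- by apply: Eint_time_measurable.
apply: eq_integral => w _; rewrite -ge0_integralZl//.
- by apply/measurable_EFinP; apply: measurable_funTS; exact: jmeas_section.
- by move=> s _; rewrite lee_fin.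
Qed.

Lemma dint_sum t (I : Type) (r : seq I) (f : I -> R -> Omega -> R) :
  (forall i, jmeas (f i)) -> (forall i s w, 0 <= f i s w) ->
  dint t (fun s w => \sum_(i <- r) f i s w) = (\sum_(i <- r) dint t (f i))%E.
Proof.
move=> mf f0; elim: r => [|i r IH].
  rewrite big_nil /dint; apply: integral0_eq => w _.
  by apply: integral0_eq => s _; rewrite big_nil.
have mS : jmeas (fun s w => \sum_(j <- r) f j s w) by apply: measurable_sum => j; exact: mf.
have S0 s w : 0 <= \sum_(j <- r) f j s w by rewrite sumr_ge0.
rewrite big_cons -IH -(dint_D t (mf i) mS (f0 i) S0).
by congr dint; apply/funext => s; apply/funext => w; rewrite big_cons.
Qed.

Lemma dint_swap t f : jmeas f -> (forall s w, 0 <= f s w) ->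
  dint t f = (\int[leb]_(s in `[0%R, t]) \int[P]_w (f s w)%:E)%E.
Proof. by move=> mf f0; rewrite /dint Eint_time_swap. Qed.

Lemma jmeas_snd (f : Omega -> R) : measurable_fun setT f -> jmeas (fun _ w => f w).
Proof. by move=> mf; apply: (measurableT_comp mf); exact: measurable_snd. Qed.

(** In time [chi] drops once from 1 to 0, at [tau]. Hence [chi (s - h) - chi s] vanishes off
    [[tau, tau + h]]. This is the price of sampling [chi] on a grid of mesh [h] instead of at the
    current time. *)
Lemma dint_window (t h : R) (chi : R -> Omega -> R) (w : Omega) :
  (forall s, chi s w = 0 \/ chi s w = 1) ->
  (forall s s', s <= s' -> chi s' w <= chi s w) -> 0 <= h ->
  (\int[leb]_(s in `[0%R, t]) (chi (s - h) w - chi s w)%:E <= h%:E)%E.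
Proof.
move=> chi01 chid h0.
have [none|some] := pselect (forall s, chi (s - h) w = chi s w).
  rewrite integral0_eq ?lee_fin// => s _.
  by rewrite none subrr.
have [s0 s0P] : exists s0, chi (s0 - h) w = 1 /\ chi s0 w = 0.
  have [s1 s1P] := (existsNP _).2 some.
  exists s1; have := chid (s1 - h) s1; rewrite gerBl h0 => /(_ isT).
  case: (chi01 (s1 - h)) => e1; case: (chi01 s1) => e2; rewrite e1 e2 ?e1 ?e2//.
  - by rewrite e1 e2 in s1P.
  - by rewrite ler10.
  - by rewrite e1 e2 in s1P.
case: s0P => e1 e0.
pose A := [set s | chi s w = 1].
have Aub s : A s -> s <= s0.
  move=> As; rewrite leNgt; apply/negP => /ltW/chid; rewrite e0 As.
  by rewrite ler10.
have hs : has_sup A by split; [exists (s0 - h) | exists s0].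
pose tau := sup A.
apply: (@le_trans _ _ (\int[leb]_s (\1_(`[tau, tau + h]%classic) s)%:E)%E).
  rewrite integral_mkcond; apply: ge0_integral_mono => s _.
    rewrite /patch; case: ifP => // _; rewrite lee_fin subr_ge0; apply: chid.
    by rewrite gerBl.
  rewrite /patch; case: ifP => _; last by rewrite lee_fin.
  rewrite lee_fin indicE; case: (boolP (s \in _)) => [_|].
    case: (chi01 (s - h)) => ->; case: (chi01 s) => ->;
    by rewrite ?subr0 ?subrr ?sub0r ?ler01 ?lexx// (le_trans _ (@ler01 R))// oppr_le0.
  rewrite notin_setE/= in_itv/= => /negP; rewrite negb_and -!ltNge => /orP[st|ts].
    have [s' As' ss'] := sup_gt hs.1 st.
    have : chi s w = 1.
      case: (chi01 s) => // e; have := chid _ _ (ltW ss').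
      by rewrite As' e ler10.
    move=> e; have := chid (s - h) s; rewrite gerBl h0 e => /(_ isT).
    by case: (chi01 (s - h)) => ->; rewrite ?ler10// subrr.
  have : chi (s - h) w = 0.
    case: (chi01 (s - h)) => // e; have : s - h <= tau by apply: ub_le_sup => //; case: hs.
    by rewrite leNgt ltrBrDr ts.
  move=> ->; rewrite sub0r lerNl oppr0.
  by case: (chi01 s) => ->.
rewrite integral_indic// setIT.
suff : (lebesgue_measure (`[tau, (tau + h)%R]%classic : set R) <= h%:E)%E by [].
rewrite lebesgue_measure_itv/= lte_fin; case: ifP => _; last by rewrite lee_fin.
by rewrite -EFinD addrAC subrr add0r.
Qed.

End time_integral.

(** * Scalar Ito integrals as limits of families *)

Section ito_limits.
Context (R : realType) (disp : measure_display) (Omega : measurableType disp).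
Variables (P : probability Omega R) (T : R) (m : nat).
Variables (B : R -> Omega -> 'rV[R]_m) (F0 : set (set Omega)).
Hypotheses (Bbm : brownian_motion P T B) (F0i : initial_sigma_algebra P T B F0).
Local Notation F := (filtration B F0).
Local Notation leb := (@lebesgue_measure R).

(** One time and one scalar component at once: [U] is the integral over [[0, t]] of a row-valued
    [H]. The approximating families for different times need not be related, and the condition is
    stable under linear combinations. *)
Definition ito_at (t : R) (H : R -> Omega -> 'rV[R]_m) (U : Omega -> R) : Prop :=
  [/\ measurable_fun (setT : set (measurableTypeR R * Omega)) (fun z => H z.1 z.2),
      measurable_fun setT U &
      forall e : R, 0 < e -> exists f : @simple_family R disp Omega m,
        [/\ fam_adapted B F0 t f,
            (dint P t (fun s w => (enorm (H s w - fam_value f s w) ^+ 2)%R) <= e%:E)%E &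
            (\int[P]_w ((U w - fam_integral B f w) ^+ 2)%:E <= e%:E)%E]].

Definition fam_lin (a : R) (f g : @simple_family R disp Omega m) : @simple_family R disp Omega m :=
  @SimpleFamily R disp Omega m (fam_ix f + fam_ix g)%type
    (fun i => match i with inl i => fam_l i | inr i => fam_l i end)
    (fun i => match i with inl i => fam_r i | inr i => fam_r i end)
    (fun i => match i with inl i => fun w => a *: fam_c i w | inr i => fam_c i end).

Lemma fam_lin_value a f g s w :
  fam_value (fam_lin a f g) s w = a *: fam_value f s w + fam_value g s w.
Proof. by rewrite /fam_value big_sumType/= scaler_sumr. Qed.

Lemma fam_lin_integral a f g w :
  fam_integral B (fam_lin a f g) w = a * fam_integral B f w + fam_integral B g w.
Proof.
rewrite /fam_integral big_sumType/= mulr_sumr; congr (_ + _); apply: eq_bigr => i _.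
by rewrite /edot mulr_sumr; apply: eq_bigr => l _; rewrite mxE mulrA.
Qed.

Lemma fam_lin_adapted a f g t : fam_adapted B F0 t f -> fam_adapted B F0 t g ->
  fam_adapted B F0 t (fam_lin a f g).
Proof.
move=> [f1 f2 [C1 f3]] [g1 g2 [C2 g3]]; split.
- by case=> i; [exact: f1 | exact: g1].
- case=> i lr; last exact: g2.
  apply: measurable_mxZ; first exact: measurable_cst.
  exact: f2.
- exists (`|a| * `|C1| + `|C2|) => -[i|i] w /=.
    rewrite enormZ (le_trans (ler_wpM2l (normr_ge0 a) (f3 i w)))//.
    by rewrite (le_trans (ler_wpM2l _ (ler_norm C1)))// lerDl.
  by rewrite (le_trans (g3 i w))// (le_trans (ler_norm _))// lerDr mulr_ge0.
Qed.

Lemma ito_at_lin (t a : R) H U H' U' : 0 <= t <= T -> ito_at t H U -> ito_at t H' U' ->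
  ito_at t (fun s w => a *: H s w + H' s w) (fun w => a * U w + U' w).
Proof.
move=> /andP[t0 tT] [mH mU HU] [mH' mU' HU']; split.
- apply: measurable_mxD => //; apply: measurable_mxZ => //; exact: measurable_cst.
- by meas.
move=> e e0; pose c := 2 * a ^+ 2 + 2.
have c0 : 0 < c by rewrite ltr_wpDl// mulr_ge0// sqr_ge0.
have ec0 : 0 < e / c by rewrite divr_gt0.
have [f [fa f1 f2]] := HU _ ec0; have [g [ga g1 g2]] := HU' _ ec0.
have eE : e = 2 * a ^+ 2 * (e / c) + 2 * (e / c).
  by rewrite -mulrDl -/c mulrCA divff ?mulr1// gt_eqF.
have ca0 : 0 <= 2 * a ^+ 2 by rewrite mulr_ge0// sqr_ge0.
exists (fam_lin a f g); split; first exact: fam_lin_adapted.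
- have mf : jmeas (fun s w => enorm (H s w - fam_value f s w) ^+ 2).
    apply: measurable_enorm_sqr_comp; apply: measurable_mxB => //.
    exact: (fam_value_measurable Bbm F0i tT fa).
  have mg : jmeas (fun s w => enorm (H' s w - fam_value g s w) ^+ 2).
    apply: measurable_enorm_sqr_comp; apply: measurable_mxB => //.
    exact: (fam_value_measurable Bbm F0i tT ga).
  apply: (@le_trans _ _ (dint P t (fun s w =>
(      2 * a ^+ 2 * enorm (H s w - fam_value f s w) ^+ 2 +
      2 * enorm (H' s w - fam_value g s w) ^+ 2)%R))).
    apply: dint_le => s w _; first exact: sqr_ge0.
    rewrite fam_lin_value.
    have -> : a *: H s w + H' s w - (a *: fam_value f s w + fam_value g s w) =
      a *: (H s w - fam_value f s w) + (H' s w - fam_value g s w).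
      by rewrite scalerBr opprD addrACA.
    rewrite (le_trans (enorm_sqrD _ _))// enormZ exprMn real_normK ?num_real//.
    by rewrite mulrA.
  rewrite dint_D; first last.
  - by move=> s w; rewrite mulr_ge0// sqr_ge0.
  - by move=> s w; rewrite mulr_ge0// sqr_ge0.
  - by apply: measurable_funM => //; exact: measurable_cst.
  - by apply: measurable_funM => //; exact: measurable_cst.
  rewrite !dint_Z//; try by move=> s w; rewrite sqr_ge0.
  apply: (@le_trans _ _ ((2 * a ^+ 2)%:E * (e / c)%:E + 2%:E * (e / c)%:E)%E).
    have c2 : (0 <= (2 * a ^+ 2)%:E)%E by rewrite lee_fin.
    exact: (leeD (lee_wpmul2l c2 f1) (lee_wpmul2l (@lee0n R 2) g1)).
  by rewrite -!EFinM -EFinD -eE.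
- have mf := fam_integral_measurable Bbm F0i t0 tT fa.
  have mg := fam_integral_measurable Bbm F0i t0 tT ga.
  apply: (@le_trans _ _ (\int[P]_w (2 * a ^+ 2 * (U w - fam_integral B f w) ^+ 2 +
      2 * (U' w - fam_integral B g w) ^+ 2)%:E)%E).
    apply: Eint_le => w; first exact: sqr_ge0.
    rewrite fam_lin_integral -subr_ge0.
    set x := U w; set y := fam_integral B f w; set x' := U' w; set y' := fam_integral B g w.
    have -> : 2 * a ^+ 2 * (x - y) ^+ 2 + 2 * (x' - y') ^+ 2 -
      (a * x + x' - (a * y + y')) ^+ 2 = (a * (x - y) - (x' - y')) ^+ 2 by ring.
    exact: sqr_ge0.
  rewrite Eint_D; first last.
  - by move=> w; rewrite mulr_ge0// sqr_ge0.
  - by move=> w; rewrite mulr_ge0// sqr_ge0.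
  - by meas.
  - by meas.
  rewrite !Eint_Z//; try (by meas); try by move=> w; rewrite sqr_ge0.
  apply: (@le_trans _ _ ((2 * a ^+ 2)%:E * (e / c)%:E + 2%:E * (e / c)%:E)%E).
    have c2 : (0 <= (2 * a ^+ 2)%:E)%E by rewrite lee_fin.
    exact: (leeD (lee_wpmul2l c2 f2) (lee_wpmul2l (@lee0n R 2) g2)).
  by rewrite -!EFinM -EFinD -eE.
Qed.

Lemma step_Eint_le (t : R) (n : nat) (p : nat -> R) (g : nat -> Omega -> R) (G : R -> Omega -> R) :
  0 <= p 0%N -> p n <= t -> (forall j, (j < n)%N -> p j <= p j.+1) ->
  (forall j, (j < n)%N -> measurable_fun setT (g j)) ->
  (forall j w, (j < n)%N -> 0 <= g j w) -> (forall s w, 0 <= G s w) ->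
  (forall j s w, (j < n)%N -> p j < s <= p j.+1 -> g j w <= G s w) ->
  (\sum_(j < n) (p j.+1 - p j)%:E * \int[P]_w (g j w)%:E <= dint P t G)%E.
Proof.
move=> p0 pn pm mg g0 G0 gG.
have pm' (j : 'I_n) : 0 <= p j.+1 - p j by rewrite subr_ge0 pm.
have mg' (j : 'I_n) : measurable_fun setT (g j) by exact: mg.
have -> : (\sum_(j < n) (p j.+1 - p j)%:E * \int[P]_w (g j w)%:E)%E =
    (\int[P]_w (\sum_(j < n) (p j.+1 - p j) * g j w)%:E)%E.
  rewrite (Eint_sum P (index_enum _) (f := fun (j : 'I_n) w => (p j.+1 - p j) * g j w)).
  - by apply: eq_bigr => j _; rewrite Eint_Z// => w; exact: g0.
  - by move=> j; apply: measurable_funM.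
  - by move=> j w; rewrite mulr_ge0// g0.
apply: ge0_integral_mono => w _.
  by rewrite lee_fin sumr_ge0// => j _; rewrite mulr_ge0// g0.
apply: (step_sum_le_integral p0 pn pm (g := fun j => g j w)) => //.
- by move=> j jn; exact: g0.
- by move=> j s jn sj; exact: gG.
Qed.

Lemma enorm_row_sqr (x : 'rV[R]_m) : enorm x ^+ 2 = \sum_l x 0 l ^+ 2.
Proof. by rewrite enorm_sqr big_ord1. Qed.

(** The upper half of Ito's isometry, weighted. The constant is [2 * 33 * 2]: 33 from elementary
    sums, one factor 2 for replacing [U] by the approximating integral and one for replacing the
    simple integrand by [H]. *)
Lemma ito_L2_le (t : R) H U (rho : Omega -> R) : 0 <= t <= T -> ito_at t H U ->
  measurable_fun (setT : set (g_sigma_algebraType F0)) rho ->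
  (forall w, 0 <= rho w <= 1) ->
  (\int[P]_w (rho w * U w ^+ 2)%:E <=
   (132 * m%:R)%:E * dint P t (fun s w => (rho w * enorm (H s w) ^+ 2)%R))%E.
Proof.
move=> /andP[t0 tT] [mH mU HU] mrho rho01.
have rho0 w : 0 <= rho w by case/andP: (rho01 w).
have mrho' : measurable_fun setT rho.
  by apply: (Fmeas_measurable Bbm F0i tT); exact: F0_Fmeas.
have mHn : jmeas (fun s w => rho w * enorm (H s w) ^+ 2).
  apply: measurable_funM; first exact: jmeas_snd.
  exact: measurable_enorm_sqr_comp.
apply/lee_addgt0Pr => e e0.
(* Sum of the multiples of the accuracy [e / c] in the final estimate: 2 from the approximation of
   [U] and [132 m] from that of [H]. *)
pose c := 2 + 132 * m%:R : R.
have c0 : 0 < c by rewrite ltr_pwDl// mulr_ge0.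
have ec0 : 0 < e / c by rewrite divr_gt0.
have [f [fa f1 f2]] := HU _ ec0.
have nil x : x \in [::] -> 0 <= x <= t by [].
have [n [p [cc [K [[p0 pn K0 pm] _ mc cK [fE fV]]]]]] := fam_refine tT fa nil t0.
have mJ := fam_integral_measurable Bbm F0i t0 tT fa.
have EJ : (\int[P]_w (rho w * fam_integral B f w ^+ 2)%:E <=
    (33 * m%:R)%:E * dint P t (fun s w => (rho w * enorm (fam_value f s w) ^+ 2)%R))%E.
  under eq_integral do rewrite fE.
  apply: (le_trans (elementary_sum_L2 Bbm F0i p0 (le_trans pn tT) K0 pm mc cK mrho rho01 (leqnn n))).
  rewrite lee_wpmul2l ?lee_fin ?mulr_ge0//.
  have mcl j l : (j < n)%N -> measurable_fun setT (cc j l).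
    move=> jn; apply: (Fmeas_measurable Bbm F0i _ (mc j l jn)).
    by rewrite (le_trans _ (le_trans pn tT))// (partition_le pm)// ltnW.
  apply: (@le_trans _ _ (\sum_(j < n) (p j.+1 - p j)%:E *
     \int[P]_w (\sum_l rho w * cc j l w ^+ 2)%:E)%E).
    apply: lee_sum => j _; rewrite Eint_sum//.
      by move=> l; apply: measurable_funM => //; apply: measurable_funX; exact: mcl.
    by move=> l w; rewrite mulr_ge0// sqr_ge0.
  apply: (step_Eint_le (g := fun j w => \sum_l rho w * cc j l w ^+ 2)) => //.
  - move=> j jn; apply: measurable_sum => l.
    by apply: measurable_funM => //; apply: measurable_funX; exact: mcl.
  - by move=> j w _; rewrite sumr_ge0// => l _; rewrite mulr_ge0// sqr_ge0.
  - by move=> s w; rewrite mulr_ge0// sqr_ge0.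
  - move=> j s w jn sj; rewrite enorm_row_sqr mulr_sumr; apply: ler_sum => l _.
    by rewrite (fV j l s w jn sj).
have mD : jmeas (fun s w => enorm (H s w - fam_value f s w) ^+ 2).
  apply: measurable_enorm_sqr_comp; apply: measurable_mxB => //.
  exact: (fam_value_measurable Bbm F0i tT fa).
have DV : (dint P t (fun s w => (rho w * enorm (fam_value f s w) ^+ 2)%R) <=
   2%:E * dint P t (fun s w => (rho w * enorm (H s w) ^+ 2)%R) + (2 * (e / c))%:E)%E.
  apply: (@le_trans _ _ (dint P t (fun s w => (2 * (rho w * enorm (H s w) ^+ 2) +
     2 * enorm (H s w - fam_value f s w) ^+ 2)%R))).
    apply: dint_le => s w _; first by rewrite mulr_ge0// sqr_ge0.
    have h := enorm_sqrD (H s w) (- (H s w - fam_value f s w)).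
    rewrite enormN opprB addrC subrK in h.
    apply: (le_trans (ler_wpM2l (rho0 w) h)); rewrite mulrDr mulrCA lerD2l mulrCA.
    rewrite ler_wpM2l// ler_piMl ?sqr_ge0//; by case/andP: (rho01 w).
  rewrite dint_D; first last.
  - by move=> s w; rewrite mulr_ge0// sqr_ge0.
  - by move=> s w; rewrite mulr_ge0// mulr_ge0// sqr_ge0.
  - by apply: measurable_funM => //; exact: measurable_cst.
  - by apply: measurable_funM => //; exact: measurable_cst.
  rewrite !dint_Z//; try (by move=> s w; exact: sqr_ge0); try by move=> s w; rewrite mulr_ge0// sqr_ge0.
  by rewrite EFinM leeD2l// lee_wpmul2l.
apply: (@le_trans _ _ (\int[P]_w (2 * (U w - fam_integral B f w) ^+ 2 +
   2 * (rho w * fam_integral B f w ^+ 2))%:E)%E).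
  apply: Eint_le => w; first by rewrite mulr_ge0// sqr_ge0.
  move: (U w) (fam_integral B f w) (rho w) (rho01 w) => x y r /andP[r0 r1].
  have h1 := sqr_ge0 (x - y); have h2 := mulr_ge0 r0 (sqr_ge0 (x - 2 * y)).
  have h3 : r * (x - y) ^+ 2 <= (x - y) ^+ 2 by rewrite ler_piMl.
  rewrite -subr_ge0; have -> : 2 * (x - y) ^+ 2 + 2 * (r * y ^+ 2) - r * x ^+ 2 =
    2 * ((x - y) ^+ 2 - r * (x - y) ^+ 2) + r * (x - 2 * y) ^+ 2 by ring.
  by rewrite addr_ge0// mulr_ge0// subr_ge0.
rewrite Eint_D; first last.
- by move=> w; rewrite mulr_ge0// mulr_ge0// sqr_ge0.
- by move=> w; rewrite mulr_ge0// sqr_ge0.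
- by meas.
- by meas.
rewrite !Eint_Z//; try (by meas); try (by move=> w; exact: sqr_ge0); try by move=> w; rewrite mulr_ge0// sqr_ge0.
apply: (@le_trans _ _ ((2 * (e / c))%:E + 2%:E * ((33 * m%:R)%:E *
  (2%:E * dint P t (fun s w => (rho w * enorm (H s w) ^+ 2)%R) + (2 * (e / c))%:E)))%E).
  apply: leeD; first by rewrite EFinM lee_wpmul2l.
  rewrite lee_wpmul2l// (le_trans EJ)// lee_wpmul2l// lee_fin mulr_ge0//.
have D0 : (0 <= dint P t (fun s w => (rho w * enorm (H s w) ^+ 2)%R))%E.
  by apply: dint_ge0 => s w _; rewrite mulr_ge0// sqr_ge0.
move: (dint P t _) D0 => D D0.
rewrite muleA -EFinM ge0_muleDr//; last 2 first.
- by rewrite mule_ge0.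
- by rewrite lee_fin mulr_ge0// ltW.
rewrite muleA -!EFinM addeCA -EFinD.
apply: leeD.
  rewrite lee_wpmul2r// lee_fin -subr_ge0.
  by have -> : 132 * m%:R - 2 * (33 * m%:R) * 2 = 0 :> R by ring.
rewrite lee_fin; have -> : 2 * (e / c) + 2 * (33 * m%:R) * (2 * (e / c)) = c * (e / c).
  by rewrite /c; move: (e / _) => x; ring.
by rewrite mulrCA divff ?mulr1// gt_eqF.
Qed.

End ito_limits.

(** * Localised fourth moments of Ito integrals *)

Lemma cvge0_le (R : realType) (u : nat -> \bar R) (e : R) : 0 < e ->
  u n @[n --> \oo] --> 0%E -> exists N, forall n, (N <= n)%N -> (u n <= e%:E)%E.
Proof.
move=> e0 u0; have h : nbhs (0%E : \bar R) [set y | (y < e%:E)%E].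
  by apply: open_nbhs_nbhs; split; [exact: open_ereal_lt_ereal | rewrite /= lte_fin].
have [N _ NP] := u0 _ h; exists N => n Nn; apply: ltW; exact: (NP n Nn).
Qed.

(** * Rows of matrix-valued Ito integrals *)

Section ito_of_definition.
Context (R : realType) (disp : measure_display) (Omega : measurableType disp).
Variables (P : probability Omega R) (T : R) (d m : nat).
Variables (B : R -> Omega -> 'rV[R]_m) (F0 : set (set Omega)).
Hypotheses (Bbm : brownian_motion P T B) (F0i : initial_sigma_algebra P T B F0).
Local Notation F := (filtration B F0).
Local Notation leb := (@lebesgue_measure R).

Definition fam_of_simple (S : simple_process R Omega d m) (t : R) (e : 'I_d) :
    simple_family R Omega m :=
  @SimpleFamily R disp Omega m 'I_(sp_size S)
    (fun i => Num.min (sp_time S i) t) (fun i => Num.min (sp_time S i.+1) t)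
    (fun i w => row e (sp_coef S i w)).

Lemma enorm_row_le (A : 'M[R]_(d, m)) e : enorm (row e A) ^+ 2 <= enorm A ^+ 2.
Proof.
rewrite !enorm_sqr big_ord1 (bigD1 e)//=.
under eq_bigr do rewrite mxE.
by rewrite lerDl sumr_ge0// => i _; rewrite sumr_ge0// => j _; exact: sqr_ge0.
Qed.

Lemma simple_time_ge0 (S : simple_process R Omega d m) i :
  simple_adapted T B F0 S -> (i <= sp_size S)%N -> 0 <= sp_time S i.
Proof.
move=> [t0 _ mono _ _]; elim: i => // i IH iS.
by rewrite (le_trans (IH (ltnW iS)))// mono.
Qed.

Lemma fam_of_simple_adapted S t e : 0 <= t <= T -> simple_adapted T B F0 S ->
  fam_adapted B F0 t (fam_of_simple S t e).
Proof.
move=> /andP[t0 tT] Sa; have [_ _ mono mc [C SC]] := Sa; split.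
- move=> i /=; have iS := ltn_ord i.
  split; first by rewrite le_min t0 andbT; apply: (simple_time_ge0 Sa); exact: ltnW.
  apply/andP; split; last by rewrite ge_min lexx orbT.
  by rewrite le_min !ge_min lexx orbT andbT mono.
- move=> i /= lr; have it : sp_time S i < t.
    by move: lr; rewrite lt_min !gt_min ltxx !orbF => /andP[].
  rewrite min_l ?(ltW it)//; apply: measurable_mx => a b.
  under eq_fun do rewrite mxE.
  by apply: measurable_entry; exact: mc.
- exists `|C| => i w /=; rewrite -(@ler_pXn2r _ 2) ?nnegrE ?enorm_ge0//.
  rewrite (le_trans (enorm_row_le _ _))// ler_pXn2r ?nnegrE ?enorm_ge0//.
  by rewrite (le_trans (SC _ _ (ltn_ord i)))// ler_norm.
Qed.

Lemma fam_of_simple_value S t e s w : s <= t ->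
  fam_value (fam_of_simple S t e) s w = row e (simple_value S s w).
Proof.
move=> st; apply/rowP => l; rewrite /fam_value/= mxE /simple_value !summxE.
apply: eq_big => [i|i _]; last by rewrite mxE.
by rewrite gt_min le_min st andbT [t < s]ltNge st orbF.
Qed.

Lemma fam_of_simple_integral S t e w :
  fam_integral B (fam_of_simple S t e) w = simple_integral B S t w 0 e.
Proof.
rewrite /fam_integral/= /simple_integral summxE; apply: eq_bigr => i _.
by rewrite mxE /edot; apply: eq_bigr => l _; rewrite !mxE mulrC.
Qed.

(** [is_ito_integral] constrains its integrand on [[0, T]] only; [H'] is an extension that is
    jointly measurable on the whole line, as [ito_at] demands. The approximating simple processes
    are stopped at [t] and read row by row. *)
Lemma ito_integral_at (H H' : R -> Omega -> 'M[R]_(d, m)) I t e : 0 <= t <= T ->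
  is_ito_integral P T B F0 H I ->
  measurable_fun (setT : set (measurableTypeR R * Omega)) (fun z => H' z.1 z.2) ->
  (forall s w, 0 <= s <= T -> H' s w = H s w) ->
  ito_at P B F0 t (fun s w => row e (H' s w)) (fun w => I t w 0 e).
Proof.
move=> t0T [_ _ mI [S [Sa SH SI]]] mH' H'E; have /andP[t0 tT] := t0T.
have FtM := filtration_measurable Bbm F0i tT.
split.
- apply: measurable_mx => a b; under eq_fun do rewrite mxE.
  exact: measurable_entry.
- by apply: measurable_entry; apply: (measurable_wrtW FtM); exact: mI.
move=> eps eps0.
have [N1 SH1] := cvge0_le eps0 SH.
have se0 : 0 < Num.sqrt eps by rewrite sqrtr_gt0.
have [N2 SI2] := cvge0_le se0 (SI t t0T).
pose k := maxn N1 N2; exists (fam_of_simple (S k) t e).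
split; first exact: fam_of_simple_adapted.
- apply: (le_trans _ (SH1 k (leq_maxl _ _))).
  apply: ge0_integral_mono => w _; first by apply: integral_ge0 => s _; rewrite lee_fin sqr_ge0.
  rewrite [leLHS]integral_mkcond [leRHS]integral_mkcond.
  apply: ge0_integral_mono => s _; rewrite /patch; case: ifP => //.
    by rewrite lee_fin sqr_ge0.
    rewrite inE/= in_itv/= => /andP[s0 st]; rewrite mem_set; last first.
      by rewrite /= in_itv/= s0 (le_trans st).
    rewrite lee_fin fam_of_simple_value// H'E; last by rewrite s0 (le_trans st).
    have -> : row e (H s w) - row e (simple_value (S k) s w) =
      row e (H s w - simple_value (S k) s w) by rewrite linearB.
    exact: enorm_row_le.
  by move=> _; case: ifP => // _; rewrite lee_fin sqr_ge0.
- have := SI2 k (leq_maxr _ _); rewrite L2normE => h.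
  have {}h : (msq P (fun w => (I t w - simple_integral B (S k) t w)%R) <= eps%:E)%E.
    rewrite -(sqr_sqrte (msq_ge0 _ _)).
    have -> : eps%:E = (((Num.sqrt eps)%:E) ^+ 2)%E.
      by rewrite -EFin_expe sqr_sqrtr// ltW.
    by apply: lee_pmul; rewrite ?sqrte_ge0.
  apply: (le_trans _ h); apply: Eint_le => w; first exact: sqr_ge0.
  rewrite fam_of_simple_integral.
  rewrite -[X in X <= _]real_normK ?num_real// ler_pXn2r ?nnegrE ?enorm_ge0//.
  by have := enorm_entry (I t w - simple_integral B (S k) t w) 0 e; rewrite !mxE.
Qed.

End ito_of_definition.

(** * Fourth moments on the event of not having left a ball *)

Section local_fourth_moment.
Context (R : realType) (disp : measure_display) (Omega : measurableType disp).
Variables (P : probability Omega R) (T : R) (m : nat).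
Variables (B : R -> Omega -> 'rV[R]_m) (F0 : set (set Omega)).
Hypotheses (Bbm : brownian_motion P T B) (F0i : initial_sigma_algebra P T B F0).
Local Notation F := (filtration B F0).
Local Notation leb := (@lebesgue_measure R).

(** The multiples of [h] up to [t] are adjoined to the endpoints; a cell longer than [h] would
    contain one of them strictly inside. *)
Lemma fam_refine_mesh (f : simple_family R Omega m) (t h : R) : t <= T ->
  fam_adapted B F0 t f -> 0 <= t -> 0 < h ->
  exists (n : nat) (p : nat -> R) (c : nat -> 'I_m -> Omega -> R) (K : R),
  [/\ [/\ 0 <= p 0%N, p n <= t, 0 <= K & forall j, (j < n)%N -> p j <= p j.+1],
      forall j, (j < n)%N -> p j.+1 <= p j + h,
      forall j l, (j < n)%N -> Fmeas B F0 (p j) (c j l),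
      forall j l w, (j < n)%N -> `|c j l w| <= K &
      (forall w, fam_integral B f w = elementary_sum B p c n w) /\
      forall j l s w, (j < n)%N -> p j < s <= p j.+1 -> fam_value f s w 0 l = c j l w].
Proof.
move=> tT fa t0 h0.
pose N := (Num.trunc (t / h)).+1.
pose pts := [seq x <- [seq k%:R * h | k <- iota 0 N.+1] | x <= t].
have ptsP x : x \in pts -> 0 <= x <= t.
  rewrite mem_filter => /andP[-> /mapP[k _ ->]]; rewrite andbT.
  by rewrite mulr_ge0// ltW.
have [n [p [c [K [[p0 pn K0 pm] mesh mc cK [fE fV]]]]]] := fam_refine tT fa ptsP t0.
exists n, p, c, K; split => // j jn.
rewrite leNgt; apply/negP => ph.
have pj0 : 0 <= p j by rewrite (le_trans p0)// (partition_le pm)// ltnW.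
have pjt : p j.+1 <= t by rewrite (le_trans _ pn)// (partition_le pm).
have pjh0 : 0 <= p j / h by rewrite divr_ge0// ltW.
have /andP[k1 k2] := truncn_itv pjh0.
set k := Num.trunc (p j / h) in k1 k2.
have k1' : k%:R * h <= p j by rewrite -ler_pdivlMr.
have k2' : p j < k.+1%:R * h by rewrite -ltr_pdivrMr.
have kp : k.+1%:R * h < p j.+1.
  by apply: le_lt_trans ph; rewrite -natr1 mulrDl mul1r lerD2r.
have := mesh (k.+1%:R * h) j _ jn k2'; rewrite leNgt kp => /(_ _)/notF; apply.
rewrite mem_filter (le_trans (ltW kp) pjt) andTb; apply/mapP; exists k.+1 => //.
rewrite mem_iota/= add0n ltnS /N ltnS.
apply: (@leq_trans (Num.trunc (p j / h))) => //.
rewrite truncn_le_nat; apply: le_lt_trans (truncnS_gt _).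
rewrite ler_pdivrMr// divfK ?gt_eqF//.
by rewrite (le_trans _ pjt)// (le_trans _ (ltW ph))// lerDl ltW.
Qed.

(** The factor [kap e^(kap T)] of the discrete Gronwall argument, with [kap] the constant of
    [elementary_step4]. *)
Definition ito4_const : R :=
  (132 * m%:R ^+ 2 + 132 * m%:R + 192 * m%:R ^+ 3 * T) *
  expR ((132 * m%:R ^+ 2 + 132 * m%:R + 192 * m%:R ^+ 3 * T) * T).

Lemma pow4_add_le (x y : R) : (x + y) ^+ 4 <= 8 * x ^+ 4 + 8 * y ^+ 4.
Proof.
have h1 := sqr_ge0 (x - y); have h2 := sqr_ge0 (x ^+ 2 - y ^+ 2).
have h3 : (x + y) ^+ 2 <= 2 * (x ^+ 2 + y ^+ 2).
  by rewrite -subr_ge0; have -> : 2 * (x ^+ 2 + y ^+ 2) - (x + y) ^+ 2 = (x - y) ^+ 2 by ring.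
have h4 : ((x + y) ^+ 2) ^+ 2 <= (2 * (x ^+ 2 + y ^+ 2)) ^+ 2.
  by rewrite lerXn2r ?nnegrE ?sqr_ge0// mulr_ge0// addr_ge0 ?sqr_ge0.
rewrite (exprM _ 2 2) (le_trans h4)// -subr_ge0.
have -> : 8 * x ^+ 4 + 8 * y ^+ 4 - (2 * (x ^+ 2 + y ^+ 2)) ^+ 2 = 4 * (x ^+ 2 - y ^+ 2) ^+ 2 by ring.
by rewrite mulr_ge0.
Qed.

Section local.
Variables (t K : R) (H : R -> Omega -> 'rV[R]_m) (U G rho : Omega -> R).
Variable chi : R -> Omega -> R.
Hypotheses (t0T : 0 <= t <= T) (HU : ito_at P B F0 t H U).
Hypotheses (chi01 : forall s w, chi s w = 0 \/ chi s w = 1).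
Hypotheses (chi_dec : forall s s' w, s <= s' -> chi s' w <= chi s w).
Hypotheses (mchi : forall s, 0 <= s <= T -> Fmeas B F0 s (chi s)).
Hypotheses (jchi : jmeas chi) (K0 : 0 <= K).
Hypotheses (HK : forall s w l, 0 <= s <= t -> chi s w = 1 -> `|H s w 0 l| <= K).
Hypotheses (HG : forall s w l, 0 <= s <= t -> `|H s w 0 l| <= G w).
Hypotheses (mG : measurable_fun setT G) (Gfin : (\int[P]_w (G w ^+ 2)%:E < +oo)%E).
Hypotheses (mrho : measurable_fun (setT : set (g_sigma_algebraType F0)) rho).
Hypotheses (rho01 : forall w, 0 <= rho w <= 1).

Let t0 : 0 <= t. Proof. by case/andP: t0T. Qed.
Let tT : t <= T. Proof. by case/andP: t0T. Qed.
Let rho0 w : 0 <= rho w. Proof. by case/andP: (rho01 w). Qed.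
Let chi0 s w : 0 <= chi s w. Proof. by case: (chi01 s w) => ->. Qed.
Let chi1 s w : chi s w <= 1. Proof. by case: (chi01 s w) => ->. Qed.
Let e4 (x : R) : 0 <= x ^+ 4. Proof. by rewrite exprn_even_ge0. Qed.
Let mrho' : measurable_fun setT rho.
Proof. by apply: (Fmeas_measurable Bbm F0i tT); exact: F0_Fmeas. Qed.
Let KA0 : 0 <= ito4_const.
Proof.
have T0 : 0 <= T by exact: le_trans tT.
exact: (mulr_ge0 (moment4_const_ge0 m T0) (expR_ge0 _)).
Qed.

Let D := dint P t (fun s w => (rho w * (chi s w * \sum_l H s w 0 l ^+ 4))%R).

(** Here [cpj], [cs], [csh] are the values of [chi] at the grid point, at the current time [s] and
    at [s - h], [x] is the integrand and [v] the simple coefficient. If [cs = 1] then [|x| <= K],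
    and the difference of the truncations, at most [2 K], trades a fourth power for a square. If
    [cs = 0] but [cpj = 1], the time lies in the window where [chi] drops, and [K^4] is paid
    there. *)
Let coef4 (cpj cs csh r v x : R) : (cpj = 0 \/ cpj = 1) -> (cs = 0 \/ cs = 1) ->
  (csh = 0 \/ csh = 1) -> cs <= cpj -> cpj <= csh -> cs <= csh -> 0 <= r <= 1 ->
  (cs = 1 -> `|x| <= K) ->
  r * (cpj * clamp K v) ^+ 4 <=
    8 * (r * (cs * x ^+ 4)) + 32 * K ^+ 2 * (x - v) ^+ 2 + K ^+ 4 * (csh - cs).
Proof.
move=> pj s_ sh s_pj pj_sh s_sh /andP[r0 r1] xK.
have K40 : 0 <= K ^+ 4 by [].
have A0 : 0 <= 32 * K ^+ 2 * (x - v) ^+ 2 by rewrite mulr_ge0 ?sqr_ge0// mulr_ge0 ?sqr_ge0.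
have C4 : clamp K v ^+ 4 <= K ^+ 4.
  by rewrite -[X in X <= _]ger0_norm// normrX lerXn2r ?nnegrE// clamp_le.
case: pj => pj; rewrite pj in s_pj pj_sh *.
  rewrite mul0r expr0n/= mulr0 addr_ge0// ?addr_ge0//.
    by rewrite mulr_ge0// mulr_ge0// mulr_ge0//; case: s_ => ->.
  by rewrite mulr_ge0// subr_ge0.
rewrite mul1r; have csh1 : csh = 1.
  by case: sh pj_sh => -> //; rewrite ler10.
case: s_ => cs_; rewrite cs_ in s_pj xK *; rewrite csh1; last first.
  rewrite subrr mulr0 addr0 mul1r.
  set y := clamp K v in C4 *.
  have yK : `|y| <= K by exact: clamp_le.
  have xE : clamp K x = x by rewrite clamp_id// xK.
  have h := pow4_add_le x (y - x); rewrite addrC subrK in h.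
  have d1 : (y - x) ^+ 2 <= (x - v) ^+ 2.
    rewrite -[X in X <= _]real_normK ?num_real// -[X in _ <= X]real_normK ?num_real//.
    by rewrite lerXn2r ?nnegrE// -{1}xE distrC /y clamp_lip.
  have d2 : (y - x) ^+ 2 <= 4 * K ^+ 2.
    rewrite -[X in X <= _]real_normK ?num_real//.
    have -> : 4 * K ^+ 2 = (2 * K) ^+ 2 by ring.
    rewrite lerXn2r ?nnegrE// ?mulr_ge0//.
    by rewrite (le_trans (ler_normB _ _))// mulr2n mulrDl mul1r lerD// xK.
  have d3 : (y - x) ^+ 4 <= 4 * K ^+ 2 * (x - v) ^+ 2.
    by rewrite (exprM _ 2 2) expr2; apply: ler_pM; rewrite ?sqr_ge0.
  apply: (le_trans (ler_wpM2l r0 h)); rewrite mulrDr; apply: lerD.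
    by rewrite mulrCA.
  have -> : 32 * K ^+ 2 * (x - v) ^+ 2 = 8 * (4 * K ^+ 2 * (x - v) ^+ 2) by ring.
  apply: (@le_trans _ _ (8 * (y - x) ^+ 4)); first by rewrite ler_piMl// mulr_ge0.
  by rewrite ler_wpM2l.
rewrite subr0 mulr1 mul0r !mulr0 add0r.
have h : r * clamp K v ^+ 4 <= K ^+ 4 by rewrite (le_trans _ C4)// ler_piMl.
by rewrite (le_trans h)// lerDr.
Qed.

(** The overshoot of the truncation. While [cs = 1] the truncation fixes [x], so the overshoot of
    [v] is at most [2 |x - v|]; in the window where [chi] drops the overshoot of [x] itself is
    added, which [g] dominates. *)
Let coef2 (cpj cs csh v x g : R) : (cpj = 0 \/ cpj = 1) -> (cs = 0 \/ cs = 1) ->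
  (csh = 0 \/ csh = 1) -> cs <= cpj -> cpj <= csh -> cs <= csh ->
  (cs = 1 -> `|x| <= K) -> `|x| <= g ->
  (cpj * (v - clamp K v)) ^+ 2 <= 8 * (x - v) ^+ 2 + 2 * ((csh - cs) * g ^+ 2).
Proof.
move=> pj s_ sh s_pj pj_sh s_sh xK xg.
have A0 : 0 <= 8 * (x - v) ^+ 2 by rewrite mulr_ge0 ?sqr_ge0.
have B0 : 0 <= 2 * ((csh - cs) * g ^+ 2) by rewrite mulr_ge0// mulr_ge0 ?sqr_ge0// subr_ge0.
case: pj => pj; rewrite pj in s_pj pj_sh *.
  by rewrite mul0r expr0n/= addr_ge0.
rewrite mul1r; have csh1 : csh = 1.
  by case: sh pj_sh => -> //; rewrite ler10.
have h1 : `|v - clamp K v| <= 2 * `|x - v| + `|x - clamp K x|.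
  have -> : v - clamp K v = (v - x) + (x - clamp K x) + (clamp K x - clamp K v) by ring.
  rewrite (le_trans (ler_normD _ _))//.
  have h2 := clamp_lip K x v; have h3 := ler_normD (v - x) (x - clamp K x).
  by rewrite (distrC v) in h3; lra.
have n0 := normr_ge0 (x - v); have n1 := normr_ge0 (v - clamp K v).
have rs (y : R) : y ^+ 2 = `|y| ^+ 2 by rewrite real_normK ?num_real.
case: s_ => cs_; rewrite cs_ in s_pj xK B0 *; rewrite csh1; last first.
  have xE : clamp K x = x by rewrite clamp_id// xK.
  rewrite xE subrr normr0 addr0 in h1.
  rewrite subrr mul0r mulr0 addr0 rs (rs (x - v)).
  by move: h1 n0 n1; move: `|_ - _| `|_ - _| => a b; nra.
rewrite subr0 mul1r rs (rs (x - v)).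
have h2 : `|x - clamp K x| <= g.
  rewrite (le_trans _ xg)// /clamp.
  have K_ := K0; have NK : - K <= K by rewrite (le_trans _ K0)// oppr_le0.
  case: (leP K x) => k1; last first.
    case: (leP (- K) x) => k2; first by rewrite subrr normr0.
    rewrite !ltr0_norm; first by lra.
      by lra.
    by lra.
  rewrite (max_r NK) !ger0_norm; first by lra.
    by lra.
  by lra.
move: h1 h2 n0 n1 (normr_ge0 (x - clamp K x)).
move: `|v - clamp K v| `|x - v| `|x - clamp K x| => a b c h1 h2 b0 a0 c0.
have h3 : a <= 2 * b + g by lra.
have h4 : a ^+ 2 <= (2 * b + g) ^+ 2 by rewrite lerXn2r ?nnegrE//; lra.
have := sqr_ge0 (2 * b - g); nra.
Qed.

Let g := fine (\int[P]_w (G w ^+ 2)%:E).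

Let gE : (\int[P]_w (G w ^+ 2)%:E)%E = g%:E.
Proof. by rewrite /g fineK// ge0_fin_numE// Eint_ge0// => w; exact: sqr_ge0. Qed.

Let win (h : R) : 0 <= h -> jmeas (fun s w => chi (s - h) w - chi s w).
Proof.
move=> h0; apply: measurable_funB => //.
have mshift : measurable_fun (setT : set (measurableTypeR R * Omega))
    (fun z => (z.1 - h : measurableTypeR R, z.2)).
  apply: measurable_fun_pair; last exact: measurable_snd.
  by apply: (@measurable_funB _ _ R _ fst (cst h)) => //; exact: measurable_fst.
exact: (measurableT_comp jchi mshift).
Qed.

Let win0 (h : R) s w : 0 <= h -> 0 <= chi (s - h) w - chi s w.
Proof. by move=> h0; rewrite subr_ge0 chi_dec// gerBl. Qed.

Let dint_win (h : R) : 0 <= h -> (dint P t (fun s w => (chi (s - h) w - chi s w)%R) <= h%:E)%E.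
Proof.
move=> h0; rewrite -(Eint_cst P h); apply: ge0_integral_mono => w _.
  by apply: integral_ge0 => s _; rewrite lee_fin win0.
exact: (dint_window t (fun s => chi01 s w) (fun s s' => @chi_dec s s' w) h0).
Qed.

Let dint_winG (h : R) : 0 <= h ->
  (dint P t (fun s w => ((chi (s - h) w - chi s w) * G w ^+ 2)%R) <= (h * g)%:E)%E.
Proof.
move=> h0; rewrite EFinM -gE -Eint_Z//; [|by meas|by move=> w; exact: sqr_ge0].
apply: ge0_integral_mono => w _.
  by apply: integral_ge0 => s _; rewrite lee_fin mulr_ge0 ?win0 ?sqr_ge0.
under eq_integral do rewrite mulrC EFinM.
rewrite ge0_integralZl//.
- rewrite (mulrC h) (EFinM (G w ^+ 2) h) lee_wpmul2l ?lee_fin ?sqr_ge0//.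
  exact: (dint_window t (fun s => chi01 s w) (fun s s' => @chi_dec s s' w) h0).
- by apply/measurable_EFinP; apply: measurable_funTS; apply: (jmeas_section w (win h0)).
- by move=> s _; rewrite lee_fin win0.
- by rewrite lee_fin sqr_ge0.
Qed.

(** Either [|u| <= 2 |y|], or [|u| <= 2 |z + w|] and two of the four factors are bounded by [A].
    Thus errors [z] and [w] that are small in L^2 only may enter a fourth moment. *)
Let min4 (A u y z w : R) : 0 <= A -> u = y + z + w ->
  Num.min `|u| A ^+ 4 <= 16 * y ^+ 4 + 8 * A ^+ 2 * z ^+ 2 + 8 * A ^+ 2 * w ^+ 2.
Proof.
move=> A0 uE; set q := Num.min _ _.
have q0 : 0 <= q by rewrite le_min normr_ge0.
have qu : q <= `|u| by rewrite ge_min lexx.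
have qA : q <= A by rewrite ge_min lexx orbT.
have [h|h] := leP `|u| (2 * `|y|).
  have h1 : q ^+ 4 <= (2 * `|y|) ^+ 4.
    by rewrite lerXn2r ?nnegrE ?mulr_ge0// (le_trans qu).
  rewrite (le_trans h1)// -addrA exprMn -normrX (ger0_norm (e4 y)).
  have -> : 2 ^+ 4 = 16 :> R by ring.
  by rewrite lerDl addr_ge0// mulr_ge0 ?sqr_ge0// mulr_ge0 ?sqr_ge0.
have h1 : q <= 2 * `|z + w|.
  have := ler_normD y (z + w); rewrite addrA -uE => h2.
  by lra.
have h2 : q ^+ 2 <= 4 * (z + w) ^+ 2.
  rewrite -[(z + w) ^+ 2]real_normK ?num_real//.
  have -> : 4 * `|z + w| ^+ 2 = (2 * `|z + w|) ^+ 2 by ring.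
  by rewrite lerXn2r ?nnegrE ?mulr_ge0.
have h3 : q ^+ 4 <= A ^+ 2 * (4 * (z + w) ^+ 2).
  rewrite (exprM _ 2 2) expr2; apply: ler_pM; rewrite ?sqr_ge0//.
  by rewrite lerXn2r ?nnegrE.
rewrite (le_trans h3)// -addrA -mulrDr -subr_ge0.
have -> : 16 * y ^+ 4 + 8 * A ^+ 2 * (z ^+ 2 + w ^+ 2) - A ^+ 2 * (4 * (z + w) ^+ 2) =
  16 * y ^+ 4 + 4 * (A ^+ 2 * (z - w) ^+ 2) by ring.
by rewrite addr_ge0// mulr_ge0// mulr_ge0 ?sqr_ge0.
Qed.

Let mH : measurable_fun (setT : set (measurableTypeR R * Omega)) (fun z => H z.1 z.2).
Proof. by case: HU. Qed.
Let mU : measurable_fun setT U. Proof. by case: HU. Qed.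

Let jD : jmeas (fun s w => rho w * (chi s w * \sum_l H s w 0 l ^+ 4)).
Proof.
apply: measurable_funM; first exact: jmeas_snd.
apply: measurable_funM => //; apply: measurable_sum => l; apply: measurable_funX.
exact: measurable_entry.
Qed.

Let D0 s w : 0 <= rho w * (chi s w * \sum_l H s w 0 l ^+ 4).
Proof. by rewrite mulr_ge0// mulr_ge0// sumr_ge0. Qed.

Let Dfin : (D < +oo)%E.
Proof.
have K40 : 0 <= m%:R * K ^+ 4 by rewrite mulr_ge0.
apply: (@le_lt_trans _ _ (\int[P]_w (t * (m%:R * K ^+ 4))%:E)%E); last first.
  by rewrite Eint_cst ltry.
apply: ge0_integral_mono => w _.
  by apply: integral_ge0 => s _; rewrite lee_fin.
apply: (@le_trans _ _ (\int[leb]_(s in `[0%R, t]) (m%:R * K ^+ 4)%:E)%E); last first.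
  rewrite (integral_cst leb)// (mulrC t) (EFinM (_ * _) t) lee_wpmul2l ?lee_fin//.
  suff : (leb (`[0%R, t]%classic : set R) <= t%:E)%E by [].
  rewrite lebesgue_measure_itv/= lte_fin; case: ifP => _; last by rewrite lee_fin.
  by rewrite -EFinD subr0.
apply: ge0_integral_mono => s; rewrite /= in_itv/= => st; rewrite lee_fin//.
case: (chi01 s w) => cs; rewrite cs ?mul0r ?mulr0//.
rewrite mul1r (le_trans (ler_piMl _ (_ : rho w <= 1)))//; first by rewrite sumr_ge0.
  by case/andP: (rho01 w).
rewrite -[m in m%:R]card_ord mulr_natl -sumr_const; apply: ler_sum => l _.
by rewrite -[X in X <= _]ger0_norm// normrX lerXn2r ?nnegrE// HK.
Qed.

Let DE : D = (fine D)%:E.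
Proof. by rewrite fineK// ge0_fin_numE// /D; apply: dint_ge0 => s w _. Qed.

(** [chi] is frozen at the left end of each cell, which keeps the coefficients adapted; where
    [chi t = 1] all frozen values are 1, so the integral of the family is [M1 + M2]. [M1] has
    truncated coefficients, with a controlled fourth moment; [M2] collects the overshoots and, like
    the error of the family, tends to 0 in L^2. The cap [A] makes L^2 smallness sufficient for both.
    The constant is 16 from [min4] times 8 from [coef4]. *)
Lemma ito_local4_min (A : R) : 0 <= A ->
  (\int[P]_w (rho w * (chi t w * Num.min `|U w| A ^+ 4))%:E <=
   (128 * ito4_const)%:E * D)%E.
Proof.
move=> A0; apply/lee_addgt0Pr => e epos.
have g0 : 0 <= g by rewrite -lee_fin -gE; apply: Eint_ge0 => w; exact: sqr_ge0.
(* Total coefficient of [h] in the errors of [M1], of the family and of [M2]. The same [h] serves as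
   accuracy of the family and as mesh of the partition. *)
pose C := 16 * (ito4_const * (32 * K ^+ 2 + m%:R * K ^+ 4)) + 8 * A ^+ 2 +
   8 * A ^+ 2 * (33 * m%:R * (8 + m%:R * (2 * g))).
have c1 : 0 <= 32 * K ^+ 2 + m%:R * K ^+ 4 by rewrite addr_ge0// mulr_ge0 ?sqr_ge0.
have c2 : 0 <= 33 * m%:R * (8 + m%:R * (2 * g)) by rewrite mulr_ge0 ?mulr_ge0// addr_ge0// !mulr_ge0.
have A2 : 0 <= 8 * A ^+ 2 by rewrite mulr_ge0// sqr_ge0.
have C0 : 0 <= C.
  apply: addr_ge0; last by rewrite mulr_ge0.
  by rewrite addr_ge0// mulr_ge0// mulr_ge0.
pose h := e / (C + 1).
have h0 : 0 < h by rewrite divr_gt0// ltr_wpDl.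
have Ch : C * h <= e.
  by rewrite /h mulrCA ler_piMr ?(ltW epos)// ler_pdivrMr ?mul1r ?lerDl// ltr_wpDl.
have [_ _ /(_ h h0)[f [fa f1 f2]]] := HU.
have [n [p [c [Kc [[p0 pn Kc0 pm] mesh mc cK [fE fV]]]]]] := fam_refine_mesh tT fa t0 h0.
have pj j : (j < n)%N -> 0 <= p j <= t.
  move=> jn; rewrite (le_trans p0 (partition_le pm (leq0n _) (ltnW jn)))/=.
  by rewrite (le_trans _ pn)// (partition_le pm)// ltnW.
have pjT j : (j < n)%N -> 0 <= p j <= T.
  by move=> /pj /andP[-> /le_trans]; apply.
pose c1_ j l w := chi (p j) w * clamp K (c j l w).
pose c2_ j l w := chi (p j) w * (c j l w - clamp K (c j l w)).
have mc1 j l : (j < n)%N -> Fmeas B F0 (p j) (c1_ j l).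
  move=> jn; apply: measurable_funM; first exact: (mchi (pjT _ jn)).
  by apply: measurable_clamp; exact: mc.
have mc2 j l : (j < n)%N -> Fmeas B F0 (p j) (c2_ j l).
  move=> jn; apply: measurable_funM; first exact: (mchi (pjT _ jn)).
  by apply: measurable_funB; [exact: mc | apply: measurable_clamp; exact: mc].
have c1K j l w : (j < n)%N -> `|c1_ j l w| <= K.
  move=> jn; rewrite normrM ger0_norm// -[K]mul1r; apply: ler_pM => //.
  by rewrite mul1r clamp_le.
have c2K j l w : (j < n)%N -> `|c2_ j l w| <= Kc + K.
  move=> jn; rewrite normrM ger0_norm// -[Kc + K]mul1r; apply: ler_pM => //.
  by rewrite (le_trans (ler_normB _ _))// lerD ?cK ?clamp_le.
have Kc20 : 0 <= Kc + K by rewrite addr_ge0.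
pose M1 := elementary_sum B p c1_ n; pose M2 := elementary_sum B p c2_ n.
have pnT : p n <= T by exact: le_trans tT.
have mM1 : measurable_fun setT M1.
  exact: (Fmeas_measurable Bbm F0i pnT (elementary_sum_Fmeas p0 pm mc1 (leqnn n))).
have mM2 : measurable_fun setT M2.
  exact: (Fmeas_measurable Bbm F0i pnT (elementary_sum_Fmeas p0 pm mc2 (leqnn n))).
have split_ w : chi t w = 1 -> fam_integral B f w = M1 w + M2 w.
  move=> ct; rewrite fE /M1 /M2 /elementary_sum -big_split/=; apply: eq_bigr => j _.
  rewrite -big_split/=; apply: eq_bigr => l _.
  have cp : chi (p j) w = 1.
    have /andP[_ jt] := pj _ (ltn_ord j).
    by case: (chi01 (p j) w) => // e1; have := chi_dec w jt; rewrite ct e1 ler10.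
  by rewrite /c1_ /c2_ cp !mul1r -mulrDl (addrC (clamp K _)) subrK.
have mJ := fam_integral_measurable Bbm F0i t0 tT fa.
have mfv := fam_value_measurable Bbm F0i tT fa.
have mfD : jmeas (fun s w => enorm (H s w - fam_value f s w) ^+ 2).
  by apply: measurable_enorm_sqr_comp; apply: measurable_mxB.
have mcl j l : (j < n)%N -> measurable_fun setT (c1_ j l).
  by move=> jn; have /andP[_ h1] := pjT _ jn; exact: (Fmeas_measurable Bbm F0i h1 (mc1 j l jn)).
have mcl2 j l : (j < n)%N -> measurable_fun setT (c2_ j l).
  by move=> jn; have /andP[_ h1] := pjT _ jn; exact: (Fmeas_measurable Bbm F0i h1 (mc2 j l jn)).
have pts j s w : (j < n)%N -> p j < s <= p j.+1 ->
    [/\ chi s w <= chi (p j) w, chi (p j) w <= chi (s - h) w & 0 <= s <= t].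
  move=> jn /andP[s1 s2]; have /andP[q1 q2] := pj _ jn; split.
  - by apply: chi_dec; exact: ltW.
  - by apply: chi_dec; rewrite lerBlDr (le_trans s2)// mesh.
  - rewrite (le_trans q1 (ltW s1)) (le_trans s2)// (le_trans _ pn)//.
    exact: (partition_le pm).
have E1 : (\int[P]_w (rho w * M1 w ^+ 4)%:E <=
    (ito4_const * (8 * fine D + (32 * K ^+ 2 + m%:R * K ^+ 4) * h))%:E)%E.
  have [_ h1] := elementary_sum_L4 Bbm F0i p0 pnT K0 pm mc1 c1K mrho rho01 (leqnn n).
  apply: (le_trans h1).
  have kap0 : 0 <= 132 * m%:R ^+ 2 + 132 * m%:R + 192 * m%:R ^+ 3 * T.
    by apply: moment4_const_ge0; exact: le_trans tT.
  have g1 : (\sum_(j < n) (p j.+1 - p j)%:E *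
      \sum_l \int[P]_w (rho w * c1_ j l w ^+ 4)%:E <=
      (8 * fine D + (32 * K ^+ 2 + m%:R * K ^+ 4) * h)%:E)%E.
    pose G1 s w := 8 * (rho w * (chi s w * \sum_l H s w 0 l ^+ 4)) +
      (32 * K ^+ 2 * enorm (H s w - fam_value f s w) ^+ 2 +
       m%:R * K ^+ 4 * (chi (s - h) w - chi s w)).
    have b1 s w : 0 <= 32 * K ^+ 2 * enorm (H s w - fam_value f s w) ^+ 2.
      by rewrite mulr_ge0 ?sqr_ge0// mulr_ge0 ?sqr_ge0.
    have b2 s w : 0 <= m%:R * K ^+ 4 * (chi (s - h) w - chi s w).
      by rewrite mulr_ge0 ?win0 ?(ltW h0)// mulr_ge0.
    have mwin := win (ltW h0).
    apply: (@le_trans _ _ (dint P t G1)).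
      apply: (@le_trans _ _ (\sum_(j < n) (p j.+1 - p j)%:E *
         \int[P]_w (\sum_l rho w * c1_ j l w ^+ 4)%:E)%E).
        apply: lee_sum => j _; rewrite Eint_sum//.
          by move=> l; apply: measurable_funM => //; apply: measurable_funX; exact: mcl.
        by move=> l w; rewrite mulr_ge0.
      apply: (step_Eint_le P (g := fun j w => \sum_l rho w * c1_ j l w ^+ 4)) => //.
      - move=> j jn; apply: measurable_sum => l.
        by apply: measurable_funM => //; apply: measurable_funX; exact: mcl.
      - by move=> j w _; rewrite sumr_ge0// => l _; rewrite mulr_ge0.
      - move=> s w; apply: addr_ge0; last exact: addr_ge0.
        by rewrite mulr_ge0.
      - move=> j s w jn sj; have [q1 q2 q3] := pts j s w jn sj.
        apply: (@le_trans _ _ (\sum_l (8 * (rho w * (chi s w * H s w 0 l ^+ 4)) +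
           32 * K ^+ 2 * (H s w 0 l - fam_value f s w 0 l) ^+ 2 +
           K ^+ 4 * (chi (s - h) w - chi s w)))).
          apply: ler_sum => l _; rewrite /c1_ -(fV j l s w jn sj).
          apply: coef4 => //; first exact: (le_trans q1 q2).
          exact: HK.
        rewrite !big_split/= /G1 -addrA; apply: lerD; last apply: lerD.
        + by rewrite !mulr_sumr.
        + rewrite enorm_row_sqr mulr_sumr; apply: ler_sum => l _.
          by rewrite !mxE.
        + by rewrite sumr_const card_ord -[leLHS]mulr_natl mulrA.
    rewrite /G1 dint_D; first last.
    - by move=> s w; rewrite addr_ge0.
    - by move=> s w; rewrite mulr_ge0.
    - by apply: measurable_funD; apply: measurable_funM => //; exact: measurable_cst.
    - by apply: measurable_funM => //; exact: measurable_cst.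
    rewrite (dint_D P t (f := fun s w => 32 * K ^+ 2 * enorm (H s w - fam_value f s w) ^+ 2))//;
      first last.
    - by apply: measurable_funM => //; exact: measurable_cst.
    - by apply: measurable_funM => //; exact: measurable_cst.
    rewrite !dint_Z//; first last.
    - by rewrite mulr_ge0// sqr_ge0.
    - by move=> s w; exact: sqr_ge0.
    - by rewrite mulr_ge0.
    - by move=> s w; rewrite win0// ltW.
    have k1 : (0 <= (32 * K ^+ 2)%:E)%E by rewrite lee_fin mulr_ge0// sqr_ge0.
    have k2 : (0 <= (m%:R * K ^+ 4)%:E)%E by rewrite lee_fin mulr_ge0.
    rewrite -/D DE.
    apply: (le_trans (leeD (lexx _) (leeD (lee_wpmul2l k1 f1)
      (lee_wpmul2l k2 (dint_win (ltW h0)))))).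
    by rewrite -!EFinM -!EFinD lee_fin /= [X in _ <= _ + X]mulrDl.
  rewrite (EFinM ito4_const); apply: lee_pmul; last exact: g1.
  - rewrite lee_fin; exact: (mulr_ge0 kap0 (expR_ge0 _)).
  - apply: sume_ge0 => j _; rewrite mule_ge0 ?lee_fin ?subr_ge0 ?pm//.
    by apply: sume_ge0 => l _; apply: Eint_ge0 => w; rewrite mulr_ge0.
  - by rewrite lee_fin /ito4_const ler_wpM2l// ler_expR ler_wpM2l.
have E2 : (\int[P]_w (M2 w ^+ 2)%:E <= (33 * m%:R * (8 + m%:R * (2 * g)) * h)%:E)%E.
  have one_ : measurable_fun (setT : set (g_sigma_algebraType F0)) (cst 1 : Omega -> R).
    exact: measurable_cst.
  have h1 := elementary_sum_L2 Bbm F0i p0 pnT Kc20 pm mc2 c2K one_.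
  have {}h1 : (\int[P]_w (M2 w ^+ 2)%:E <=
   (33 * m%:R)%:E *
   \sum_(j < n) (p j.+1 - p j)%:E * \sum_l \int[P]_w (c2_ j l w ^+ 2)%:E)%E.
    have mul1 (V : Omega -> R) : (\int[P]_w (V w)%:E = \int[P]_w (cst 1 w * V w)%:E)%E.
      by apply: eq_integral => w _; rewrite /cst mul1r.
    rewrite mul1; apply: (le_trans (h1 _ _ (leqnn n))).
      by move=> w; rewrite /cst ler01 lexx.
    rewrite lee_wpmul2l ?lee_fin ?mulr_ge0//; apply: lee_sum => j _.
    rewrite lee_wpmul2l ?lee_fin ?subr_ge0 ?pm//; apply: lee_sum => l _.
    by rewrite -mul1.
  apply: (le_trans h1); rewrite -(mulrA (33 * m%:R)) (EFinM (33 * m%:R)) lee_wpmul2l ?lee_fin ?mulr_ge0//.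
  pose G2 s w := 8 * enorm (H s w - fam_value f s w) ^+ 2 +
      m%:R * 2 * ((chi (s - h) w - chi s w) * G w ^+ 2).
  have b2 s w : 0 <= (chi (s - h) w - chi s w) * G w ^+ 2.
    by rewrite mulr_ge0 ?win0 ?(ltW h0)// sqr_ge0.
  have jG2 : jmeas (fun s w => (chi (s - h) w - chi s w) * G w ^+ 2).
    apply: measurable_funM; first exact: (win (ltW h0)).
    by apply: measurable_funX; exact: jmeas_snd.
  apply: (@le_trans _ _ (dint P t G2)).
    apply: (@le_trans _ _ (\sum_(j < n) (p j.+1 - p j)%:E *
         \int[P]_w (\sum_l c2_ j l w ^+ 2)%:E)%E).
      apply: lee_sum => j _; rewrite Eint_sum//.
        by move=> l; apply: measurable_funX; exact: mcl2.
      by move=> l w; exact: sqr_ge0.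
    apply: (step_Eint_le P (g := fun j w => \sum_l c2_ j l w ^+ 2)) => //.
    - by move=> j jn; apply: measurable_sum => l; apply: measurable_funX; exact: mcl2.
    - by move=> j w _; rewrite sumr_ge0// => l _; exact: sqr_ge0.
    - move=> s w; apply: addr_ge0; first by rewrite mulr_ge0// sqr_ge0.
      by rewrite mulr_ge0// mulr_ge0.
    - move=> j s w jn sj; have [q1 q2 q3] := pts j s w jn sj.
      apply: (@le_trans _ _ (\sum_l (8 * (H s w 0 l - fam_value f s w 0 l) ^+ 2 +
           2 * ((chi (s - h) w - chi s w) * G w ^+ 2)))).
        apply: ler_sum => l _; rewrite /c2_ -(fV j l s w jn sj).
        apply: coef2 => //; first exact: (le_trans q1 q2).
        - exact: HK.
        - exact: HG.
      rewrite !big_split/= /G2; apply: lerD.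
      + rewrite enorm_row_sqr mulr_sumr; apply: ler_sum => l _.
        by rewrite !mxE.
      + by rewrite sumr_const card_ord -[leLHS]mulr_natl mulrA.
  rewrite /G2 dint_D; first last.
  - by move=> s w; rewrite mulr_ge0// mulr_ge0.
  - by move=> s w; rewrite mulr_ge0// sqr_ge0.
  - by apply: measurable_funM => //; exact: measurable_cst.
  - by apply: measurable_funM => //; exact: measurable_cst.
  rewrite !dint_Z//; try (by rewrite mulr_ge0); try by move=> s w; exact: sqr_ge0.
  have k1 : (0 <= 8%:E :> \bar R)%E by rewrite lee_fin.
  have k2 : (0 <= (m%:R * 2)%:E :> \bar R)%E by rewrite lee_fin mulr_ge0.
  apply: (le_trans (leeD (lee_wpmul2l k1 f1) (lee_wpmul2l k2 (dint_winG (ltW h0))))).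
  rewrite -!EFinM -!EFinD lee_fin [leRHS]mulrDl lerD2l.
  by have -> : m%:R * (2 * g) * h = m%:R * 2 * (h * g) by ring.
apply: (@le_trans _ _ (\int[P]_w (16 * (rho w * M1 w ^+ 4) +
   (8 * A ^+ 2 * (U w - fam_integral B f w) ^+ 2 + 8 * A ^+ 2 * M2 w ^+ 2))%:E)%E).
  apply: Eint_le => w.
    by rewrite mulr_ge0// mulr_ge0// exprn_ge0// le_min normr_ge0.
  have z1 : 0 <= 8 * A ^+ 2 * (U w - fam_integral B f w) ^+ 2 by rewrite mulr_ge0 ?sqr_ge0.
  have z2 : 0 <= 8 * A ^+ 2 * M2 w ^+ 2 by rewrite mulr_ge0 ?sqr_ge0.
  case: (chi01 t w) => ct; rewrite ct.
    rewrite mul0r mulr0; apply: addr_ge0; last exact: addr_ge0.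
    by rewrite mulr_ge0// mulr_ge0.
  rewrite mul1r; have uE : U w = M1 w + (U w - fam_integral B f w) + M2 w.
    by rewrite split_//; ring.
  have h1 := min4 A0 uE.
  have /andP[r0 r1] := rho01 w.
  apply: (le_trans (ler_wpM2l r0 h1)); rewrite -addrA mulrDr mulrCA lerD2l.
  by rewrite ler_piMl// addr_ge0.
rewrite Eint_D; first last.
- by move=> w; rewrite addr_ge0// mulr_ge0 ?sqr_ge0.
- by move=> w; rewrite mulr_ge0// mulr_ge0.
- by meas.
- by meas.
rewrite (Eint_D P (f := fun w => 8 * A ^+ 2 * (U w - fam_integral B f w) ^+ 2)); first last.
- by move=> w; rewrite mulr_ge0 ?sqr_ge0.
- by move=> w; rewrite mulr_ge0 ?sqr_ge0.
- by meas.
- by meas.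
have mr : measurable_fun setT (fun w => rho w * M1 w ^+ 4) by meas.
have mu : measurable_fun setT (fun w => (U w - fam_integral B f w) ^+ 2) by meas.
have mm : measurable_fun setT (fun w => M2 w ^+ 2) by meas.
rewrite (Eint_Z P mr)//; last by move=> w; rewrite mulr_ge0.
rewrite (Eint_Z P mu)//; last by move=> w; exact: sqr_ge0.
rewrite (Eint_Z P mm)//; last by move=> w; exact: sqr_ge0.
have a16 : (0 <= 16%:E :> \bar R)%E by rewrite lee_fin.
have a8 : (0 <= (8 * A ^+ 2)%:E)%E by rewrite lee_fin.
apply: (le_trans (leeD (lee_wpmul2l a16 E1) (leeD (lee_wpmul2l a8 f2) (lee_wpmul2l a8 E2)))).
rewrite DE -!EFinM -!EFinD lee_fin; apply: le_trans (lerD (lexx _) Ch).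
rewrite -subr_ge0 /C.
set X := 33 * _ * _; set Y := 32 * _ + _.
move: (fine D) (ito4_const) => dd kk.
by have -> : 128 * kk * dd + (16 * (kk * Y) + 8 * A ^+ 2 + 8 * A ^+ 2 * X) * h -
  (16 * (kk * (8 * dd + Y * h)) + (8 * A ^+ 2 * h + 8 * A ^+ 2 * (X * h))) = 0 by ring.
Qed.

(** Fatou's lemma removes the cap, the bound being independent of it. *)
Lemma ito_local4 :
  (\int[P]_w (rho w * (chi t w * U w ^+ 4))%:E <=
   (128 * ito4_const)%:E *
   dint P t (fun s w => (rho w * (chi s w * \sum_l H s w 0 l ^+ 4))%R))%E.
Proof.
have mct : measurable_fun setT (chi t) := jmeas_time t jchi.
have mN : measurable_fun setT (fun w => `|U w|) by exact: measurableT_comp.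
have mmin (n : nat) : measurable_fun setT (fun w => Num.min `|U w| n%:R).
  by apply: measurable_minr => //; exact: measurable_cst.
apply: (@fatou_ae_le _ _ _ P (fun n w => (rho w * (chi t w * Num.min `|U w| n%:R ^+ 4))%:E)).
- by move=> n; apply/measurable_EFinP; have mn := mmin n; meas.
- by apply/measurable_EFinP; meas.
- by move=> n w; rewrite lee_fin mulr_ge0// mulr_ge0// exprn_ge0// le_min normr_ge0/=.
- by move=> w; rewrite lee_fin mulr_ge0// mulr_ge0.
- apply: aeW => w; apply: cvg_near_cst.
  exists (Num.trunc `|U w|).+1 => // n /= nU.
  congr (_ * (_ * _))%:E.
  rewrite min_l; first by rewrite -normrX ger0_norm.
  by rewrite (le_trans (ltW (truncnS_gt _)))// ler_nat.
- by move=> n; apply: ito_local4_min.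
Qed.

End local.
End local_fourth_moment.

(** * Increments of functionals of measures *)

Section segment.
Context (R : realType) (d : nat).
Implicit Types (g : 'rV[R]_d -> R) (x y v : 'rV[R]_d).

Lemma derive_grad g a v : differentiable g a -> 'D_v g a = edot (grad g a) v.
Proof.
move=> dg; rewrite deriveE// {1}(row_sum_delta v) linear_sum /edot.
apply: eq_bigr => k _; rewrite linearZ/= mxE deriveE// mulrC.
by [].
Qed.

Lemma segment_mvt g y v : (forall x, differentiable g x) ->
  exists2 th : R, 0 <= th <= 1 & g v - g y = edot (grad g (y + th *: (v - y))) (v - y).
Proof.
move=> dg; have e1 : g v = g (y + (v - y)) by rewrite addrC subrK.
rewrite e1; move: {e1} (v - y) => u; clear v; rename u into v; pose h (t : R) := g (y + t *: v).
have dh (t : R) : is_derive t 1 h (edot (grad g (y + t *: v)) v).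
  have e : (fun s : R => s^-1 *: ((h \o shift t) (s *: 1) - h t)) =
      (fun s : R => s^-1 *: ((g \o shift (y + t *: v)) (s *: v) - g (y + t *: v))).
    apply/funext => s /=; rewrite /h; congr (_ *: (g _ - _)).
    have -> : s *: (1 : R) = s by rewrite /GRing.scale/= mulr1.
    by rewrite scalerDl addrCA.
  have dgt : derivable g (y + t *: v) v by exact: diff_derivable.
  split; first by rewrite /derivable e; exact: dgt.
  by rewrite /derive e -derive_grad.
have ch : {within `[0, 1], continuous h}.
  apply: continuous_subspaceT => t; apply: differentiable_continuous.
  by apply/derivable1_diffP; case: (dh t).
have [th th01] := MVT_segment (@ler01 R) (fun (x : R) _ => dh x) ch.
rewrite /h scale1r scale0r addr0 subr0 mulr1 => ->.
by exists th => //; move: th01; rewrite in_itv.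
Qed.

Lemma continuous_measurable g : continuous g -> measurable_fun setT g.
Proof.
move=> cg; apply: (measurability _ (RGenOpens.measurableE R)).
move=> _ [_ [a [b ->] <-]]; apply: sub_sigma_algebra; rewrite setTI.
apply: open_comp; last exact: interval_open.
by move=> x _; exact: cg.
Qed.

Lemma enorm_continuous_row x (e : R) : 0 < e ->
  \forall y \near x, enorm (y - x) <= e.
Proof.
move=> e0; pose c := e / d.+1%:R.
have c0 : 0 < c by rewrite divr_gt0.
have : nbhs x [set y : 'rV[R]_d | forall j : 'I_d, `|y 0 j - x 0 j| <= c].
  apply: (@filter_forall _ _ (fun (j : 'I_d) (y : 'rV[R]_d) => `|y 0 j - x 0 j| <= c)
    (nbhs (x : 'rV[R]_d)) (nbhs_filter _)) => j.
  have := @coord_continuous R 1 d 0 j x.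
  by move/cvgrPdist_le => /(_ c c0); apply: filterS => y; rewrite distrC.
apply: filterS => y yx; apply: (le_trans (enorm_le_sum _)); rewrite big_ord1.
apply: (@le_trans _ _ (\sum_(j < d) c)).
  by apply: ler_sum => j _; rewrite !mxE; exact: yx.
rewrite sumr_const card_ord -[leLHS]mulr_natl /c mulrCA ler_piMr ?(ltW e0)//.
by rewrite ler_pdivrMr// mul1r ler_nat.
Qed.

Lemma lipschitz_measurable g (C : R) :
  (forall x y, `|g y - g x| <= C * enorm (y - x)) -> measurable_fun setT g.
Proof.
move=> gC; apply: continuous_measurable => x.
apply/(@cvgrPdist_le R R _ (nbhs (x : 'rV[R]_d))) => e e0.
have C1 : 0 < `|C| + 1 by rewrite ltr_wpDl.
have := enorm_continuous_row x (divr_gt0 e0 C1); apply: filterS => y yx.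
rewrite distrC (le_trans (gC _ _))//.
rewrite (le_trans (ler_wpM2r (enorm_ge0 _) (le_trans (ler_norm C) (_ : _ <= `|C| + 1))))//.
  by rewrite lerDl.
by rewrite (le_trans (ler_wpM2l (ltW C1) yx))// mulrCA divff ?mulr1// gt_eqF.
Qed.

End segment.

(** * The Cauchy-Schwarz inequality for expectations *)

Section cauchy_schwarz_Eint.
Context (R : realType) (disp : measure_display) (Omega : measurableType disp).
Variables (P : probability Omega R).

(** Young's inequality [U V <= (k / 2) U^2 + V^2 / (2 k)] with the optimal ratio [k = b / a].
    Shifting [a] and [b] by a small [t] covers vanishing bounds at the cost [t (a + b + 1) <= e]. *)
Lemma Eint_cauchy_schwarz (U V : Omega -> R) (a b : R) :
  measurable_fun setT U -> measurable_fun setT V ->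
  (forall w, 0 <= U w) -> (forall w, 0 <= V w) -> 0 <= a -> 0 <= b ->
  (\int[P]_w (U w ^+ 2)%:E <= (a ^+ 2)%:E)%E ->
  (\int[P]_w (V w ^+ 2)%:E <= (b ^+ 2)%:E)%E ->
  (\int[P]_w (U w * V w)%:E <= (a * b)%:E)%E.
Proof.
move=> mU mV U0 V0 a0 b0 Ua Vb; apply/lee_addgt0Pr => e e0.
pose c := a + b + 1; have c0 : 0 < c by rewrite ltr_wpDl// addr_ge0.
pose t := Num.min 1 (e / c).
have t0 : 0 < t by rewrite lt_min ltr01 divr_gt0.
have t1 : t <= 1 by rewrite ge_min lexx.
have tc : t * c <= e by rewrite -ler_pdivlMr// ge_min lexx orbT.
have at0 : 0 < a + t by rewrite ltr_wpDl.
have bt0 : 0 < b + t by rewrite ltr_wpDl.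
pose k := (b + t) / (a + t); have k0 : 0 < k by rewrite divr_gt0.
have ki : k^-1 = (a + t) / (b + t) by rewrite /k invf_div.
have i0 : 0 < k^-1 by rewrite invr_gt0.
have kk : k * k^-1 = 1 by rewrite divff// gt_eqF.
have h1 : k * a ^+ 2 <= (a + t) * (b + t).
  have -> : (a + t) * (b + t) = k * (a + t) ^+ 2 by rewrite /k; field; rewrite gt_eqF.
  by rewrite ler_wpM2l ?(ltW k0)// lerXn2r ?nnegrE ?(ltW at0)// lerDl ltW.
have h2 : k^-1 * b ^+ 2 <= (a + t) * (b + t).
  have -> : (a + t) * (b + t) = k^-1 * (b + t) ^+ 2 by rewrite ki; field; rewrite gt_eqF.
  by rewrite ler_wpM2l ?(ltW i0)// lerXn2r ?nnegrE ?(ltW bt0)// lerDl ltW.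
have k2 : 0 <= k / 2 by rewrite divr_ge0// ltW.
have i2 : 0 <= k^-1 / 2 by rewrite divr_ge0// ltW.
apply: (@le_trans _ _ (\int[P]_w (k / 2 * U w ^+ 2 + k^-1 / 2 * V w ^+ 2)%:E)%E).
  apply: Eint_le => w; first exact: mulr_ge0.
  have h := mulr_ge0 (ltW i0) (sqr_ge0 (k * U w - V w)).
  rewrite -subr_ge0.
  have -> : k / 2 * U w ^+ 2 + k^-1 / 2 * V w ^+ 2 - U w * V w =
     (k^-1 * (k * U w - V w) ^+ 2) / 2 by field; rewrite gt_eqF.
  by rewrite divr_ge0.
rewrite Eint_D; try (by meas); try (by move=> w; rewrite mulr_ge0// sqr_ge0).
have mU2 : measurable_fun setT (fun w => U w ^+ 2) by meas.
have mV2 : measurable_fun setT (fun w => V w ^+ 2) by meas.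
rewrite (Eint_Z P mU2)//; last by move=> w; exact: sqr_ge0.
rewrite (Eint_Z P mV2)//; last by move=> w; exact: sqr_ge0.
have k2' : (0 <= (k / 2)%:E)%E by rewrite lee_fin.
have i2' : (0 <= (k^-1 / 2)%:E)%E by rewrite lee_fin.
apply: (le_trans (leeD (lee_wpmul2l k2' Ua) (lee_wpmul2l i2' Vb))).
rewrite -!EFinM -!EFinD lee_fin.
have h3 : t * t <= t by rewrite ler_piMl// ltW.
have h4 : (a + t) * (b + t) <= a * b + e.
  apply: le_trans (lerD (lexx _) tc); rewrite /c; lra.
apply: le_trans h4; rewrite (mulrAC k) (mulrAC k^-1); lra.
Qed.

Lemma Eint_le_sqrt (U : Omega -> R) (a : R) :
  measurable_fun setT U -> (forall w, 0 <= U w) -> 0 <= a ->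
  (\int[P]_w (U w ^+ 2)%:E <= (a ^+ 2)%:E)%E -> (\int[P]_w (U w)%:E <= a%:E)%E.
Proof.
move=> mU U0 a0 Ua; rewrite -[a]mulr1.
under eq_integral do rewrite -[U _]mulr1.
apply: Eint_cauchy_schwarz => //.
by rewrite Eint_cst.
Qed.

End cauchy_schwarz_Eint.

(** * Couplings and the Wasserstein distance *)

Section couplings.
Context (R : realType) (disp : measure_display) (Omega : measurableType disp).
Variables (P : probability Omega R) (d : nat).
Implicit Types (Y Z : Omega -> 'rV[R]_d) (mu nu : P2 R d).

Section coupling_measure.
Variables (l : R) (Y Z : Omega -> 'rV[R]_d).
Hypotheses (mY : measurable_fun setT Y) (mZ : measurable_fun setT Z).

Let YY w := (Y w, Y w).
Let YZ w := (Y w, Z w).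
Let mYY : measurable_fun setT YY. Proof. exact: measurable_fun_pair. Qed.
Let mYZ : measurable_fun setT YZ. Proof. exact: measurable_fun_pair. Qed.

Let YY' : {mfun Omega >-> ('rV[R]_d * 'rV[R]_d)%type} := mfun_Sub (mem_set mYY).
Let YZ' : {mfun Omega >-> ('rV[R]_d * 'rV[R]_d)%type} := mfun_Sub (mem_set mYZ).

(** The law of [(Y, Y)] with probability [1 - l] and of [(Y, Z)] with probability [l]: a coupling of
    the law of [Y] with the mixture, and for [l = 1] with the law of [Z]. Its cost is at most
    [E|Z - Y|^2] for every [l]. *)
Definition coupling_measure : set ('rV[R]_d * 'rV[R]_d) -> \bar R :=
  measure_add (mscale (NngNum (clamp01C_ge0 l)) (distribution P YY'))
              (mscale (NngNum (clamp01_ge0 l)) (distribution P YZ')).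

HB.instance Definition _ := Measure.on coupling_measure.

Let coupling_setT : coupling_measure setT = 1%E.
Proof.
rewrite /coupling_measure measure_addE /= /mscale/=.
by rewrite !probability_setT !mule1 -EFinD subrK.
Qed.

HB.instance Definition _ :=
  Measure_isProbability.Build _ _ _ coupling_measure coupling_setT.

Definition coupling_prob : probability ('rV[R]_d * 'rV[R]_d)%type R := coupling_measure.

Lemma coupling_probE A : coupling_prob A =
  ((1 - clamp01 l)%:E * P (YY @^-1` A) + (clamp01 l)%:E * P (YZ @^-1` A))%E.
Proof. by rewrite /coupling_prob/= /coupling_measure measure_addE. Qed.

Lemma coupling_cost :
  (\int[coupling_prob]_z (enorm (z.1 - z.2) ^+ 2)%:E <= msq P (fun w => Z w - Y w)%R)%E.
Proof.
have mc : measurable_fun setT (fun z : 'rV[R]_d * 'rV[R]_d => (enorm (z.1 - z.2) ^+ 2)%:E).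
  by apply: measurable_sqr_EFin; apply: measurable_mxB; [exact: measurable_fst | exact: measurable_snd].
have p2 (z : 'rV[R]_d * 'rV[R]_d) : setT z -> (0 <= (enorm (z.1 - z.2) ^+ 2)%:E)%E.
  by move=> _; rewrite lee_fin sqr_ge0.
rewrite /coupling_prob/= /coupling_measure ge0_integral_measure_add// !ge0_integral_mscale//=.
rewrite !ge0_integral_distribution//; try by move=> z; exact: p2.
have -> : (\int[P]_x ((fun z : 'rV[R]_d * 'rV[R]_d => (enorm (z.1 - z.2) ^+ 2)%:E) \o YY) x = 0)%E.
  by apply: integral0_eq => w _; rewrite /= subrr enorm0 expr0n.
rewrite mule0 add0e /msq.
have -> : (\int[P]_x ((fun z : 'rV[R]_d * 'rV[R]_d => (enorm (z.1 - z.2) ^+ 2)%:E) \o YZ) x =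
   \int[P]_w (enorm (Z w - Y w) ^+ 2)%:E)%E.
  by apply: eq_integral => w _; rewrite /= enormC.
rewrite -[leRHS]mul1e lee_wpmul2r// ?lee_fin ?ge_max ?ler01 ?ge_min ?lexx//.
by apply: Eint_ge0 => w; exact: sqr_ge0.
Qed.

End coupling_measure.

Lemma W2_le_cost mu nu (pi : probability ('rV[R]_d * 'rV[R]_d)%type R) (c : R) : 0 <= c ->
  is_coupling mu nu pi -> (\int[pi]_z (enorm (z.1 - z.2) ^+ 2)%:E <= (c ^+ 2)%:E)%E ->
  W2 mu nu <= c.
Proof.
move=> c0 pic pile; rewrite /W2; set S := (X in ereal_inf X).
have S0 : (0 <= ereal_inf S)%E.
  apply: le_ereal_inf_tmp => _ [p _ <-]; apply: integral_ge0 => z _.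
  by rewrite lee_fin sqr_ge0.
have Sc : (ereal_inf S <= (c ^+ 2)%:E)%E.
  by apply: (le_trans _ pile); apply: ereal_inf_lbound; exists pi.
rewrite -[c]ger0_norm// -sqrtr_sqr ler_wsqrtr// -lee_fin fineK//.
by rewrite ge0_fin_numE// (le_lt_trans Sc)// ltry.
Qed.

Local Notation nrm := (ip_norm (L2inner P (d:=d))).
Local Notation L2m := (L2 P measurable (d:=d)).

Let L2B Y Z : L2m Y -> L2m Z -> L2m (fun w => Z w - Y w).
Proof. by move=> hY hZ; apply: (submoduleB (@L2_submodule _ _ _ P d measurable _)). Qed.

Lemma W2_law_le mu nu Y Z : is_law P Y mu -> is_law P Z nu -> L2m Y -> L2m Z ->
  W2 mu nu <= nrm (fun w => Z w - Y w).
Proof.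
move=> lY lZ hY hZ; have mY := L2_measurable hY; have mZ := L2_measurable hZ.
apply: (@W2_le_cost _ _ (coupling_prob 1 mY mZ)); first exact: ip_norm_ge0.
  move=> A mA; rewrite !coupling_probE (lY A mA) (lZ A mA).
  have -> : clamp01 1 = 1 :> R by rewrite /clamp01 minxx max_r.
  rewrite subrr !mul0e !add0e !mul1e; split; congr (P _); apply/seteqP; split => w //=;
    by [case | split].
by apply: (le_trans (coupling_cost _ _ _)); rewrite -msqE//; exact: L2B.
Qed.

Lemma W2_mixture_le l mu nu Y Z : is_law P Y mu -> is_law P Z nu -> L2m Y -> L2m Z ->
  W2 mu (mixture l mu nu) <= nrm (fun w => Z w - Y w).
Proof.
move=> lY lZ hY hZ; have mY := L2_measurable hY; have mZ := L2_measurable hZ.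
apply: (@W2_le_cost _ _ (coupling_prob l mY mZ)); first exact: ip_norm_ge0.
  move=> A mA; rewrite !coupling_probE; split.
    rewrite (lY A mA).
    have -> : (fun w => (Y w, Y w)) @^-1` (A `*` setT) = Y @^-1` A.
      by apply/seteqP; split => w //=; by [case | split].
    have -> : (fun w => (Y w, Z w)) @^-1` (A `*` setT) = Y @^-1` A.
      by apply/seteqP; split => w //=; by [case | split].
    rewrite -ge0_muleDl ?lee_fin ?clamp01_ge0 ?clamp01C_ge0//.
    by rewrite -EFinD subrK mul1e.
  rewrite /= /mixture_measure measure_addE /= /mscale/= (lY A mA) (lZ A mA).
  have -> : (fun w => (Y w, Y w)) @^-1` (setT `*` A) = Y @^-1` A.
    by apply/seteqP; split => w //=; by [case | split].
  have -> // : (fun w => (Y w, Z w)) @^-1` (setT `*` A) = Z @^-1` A.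
  by apply/seteqP; split => w //=; by [case | split].
by apply: (le_trans (coupling_cost _ _ _)); rewrite -msqE//; exact: L2B.
Qed.

Lemma law_Rintegral mu Y (g : 'rV[R]_d -> R) : is_law P Y mu -> measurable_fun setT Y ->
  measurable_fun setT g -> P.-integrable setT (EFin \o (g \o Y)) ->
  \int[mu]_x g x = \int[P]_w g (Y w).
Proof.
move=> lY mY mg ig; rewrite /Rintegral; congr fine.
transitivity (\int[pushforward P Y]_x (g x)%:E)%E.
  by apply: eq_measure_integral => A mA _; exact: lY.
rewrite integral_pushforward//.
exact/measurable_EFinP.
Qed.

End couplings.

Lemma W2_refl (R : realType) (d : nat) (mu : P2 R d) : W2 mu mu = 0.
Proof.
apply/eqP; rewrite eq_le sqrtr_ge0 andbT.
have mi : measurable_fun setT (idfun : 'rV[R]_d -> 'rV[R]_d) by exact: measurable_id.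
apply: (@W2_le_cost _ _ _ _ (coupling_prob mu 1 mi mi)) => //.
  move=> A mA; rewrite !coupling_probE -!ge0_muleDl ?lee_fin ?clamp01_ge0 ?clamp01C_ge0//.
  rewrite -!EFinD !subrK !mul1e; split; congr (mu _); apply/seteqP; split => w //=;
    by [case | split].
apply: (le_trans (coupling_cost _ _ _ _)); rewrite /msq expr0n/=.
by under eq_integral do rewrite subrr enorm0 expr0n/=; rewrite integral0.
Qed.

(** * Taylor expansion in space and in law *)

Section mean_field_expansion.
Context (R : realType) (disp : measure_display) (Omega : measurableType disp).
Variables (P : probability Omega R) (d : nat).
Implicit Types (Y Z : Omega -> 'rV[R]_d) (mu nu : P2 R d).
Local Notation nrm := (ip_norm (L2inner P (d:=d))).
Local Notation L2m := (L2 P measurable (d:=d)).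

Let L2B Y Z : L2m Y -> L2m Z -> L2m (fun w => Z w - Y w).
Proof. by move=> hY hZ; apply: (submoduleB (@L2_submodule _ _ _ P d measurable _)). Qed.

Lemma Eint_enorm_sqr Y : L2m Y -> (\int[P]_w (enorm (Y w) ^+ 2)%:E = (nrm Y ^+ 2)%:E)%E.
Proof. by move=> hY; rewrite -msqE. Qed.

Lemma Eint_enorm_le Y : L2m Y -> (\int[P]_w (enorm (Y w))%:E <= (nrm Y)%:E)%E.
Proof.
move=> hY; apply: Eint_le_sqrt; rewrite ?ip_norm_ge0 ?Eint_enorm_sqr//.
  by apply: measurable_enorm; exact: (L2_measurable hY).
by move=> w; exact: enorm_ge0.
Qed.

Lemma Eint_enorm2_le Y Z : L2m Y -> L2m Z ->
  (\int[P]_w (enorm (Y w) * enorm (Z w))%:E <= (nrm Y * nrm Z)%:E)%E.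
Proof.
move=> hY hZ; apply: Eint_cauchy_schwarz; rewrite ?ip_norm_ge0 ?Eint_enorm_sqr//.
- by apply: measurable_enorm; exact: (L2_measurable hY).
- by apply: measurable_enorm; exact: (L2_measurable hZ).
- by move=> w; exact: enorm_ge0.
- by move=> w; exact: enorm_ge0.
Qed.

Lemma Rintegral_le (F h : Omega -> R) (b : R) : (forall w, `|F w| <= h w) ->
  (\int[P]_w (h w)%:E <= b%:E)%E -> `|\int[P]_w F w| <= b.
Proof.
move=> Fh hb; have fin : (\int[P]_w (h w)%:E < +oo)%E by rewrite (le_lt_trans hb)// ltry.
apply: (le_trans (le_normr_Rintegral_nonmeas (fun w _ => Fh w) fin)).
rewrite -lee_fin fineK// ge0_fin_numE//; apply: integral_ge0 => w _.
by rewrite lee_fin (le_trans (normr_ge0 _) (Fh w)).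
Qed.

Lemma quadratic_integrable (g : 'rV[R]_d -> R) (C : R) Y : measurable_fun setT g ->
  (forall x, `|g x| <= C * (1 + enorm x ^+ 2)) -> L2m Y ->
  P.-integrable setT (EFin \o (g \o Y)).
Proof.
move=> mg gC hY; have mY := L2_measurable hY.
have mgY : measurable_fun setT (g \o Y) by exact: measurableT_comp.
apply/integrableP; split; first exact/measurable_EFinP.
have C0 : 0 <= C by have := le_trans (normr_ge0 _) (gC 0); rewrite enorm0 expr0n/= addr0 mulr1.
apply: (@le_lt_trans _ _ (\int[P]_w (C * (1 + enorm (Y w) ^+ 2))%:E)%E).
  apply: ge0_integral_mono => w _; first exact: abse_ge0.
  by rewrite /= lee_fin; exact: gC.
have m2 : measurable_fun setT (fun w => enorm (Y w) ^+ 2) by exact: measurable_enorm_sqr_comp.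
rewrite Eint_Z//; [|by meas|by move=> w; rewrite addr_ge0// sqr_ge0].
rewrite Eint_D//; last by move=> w; exact: sqr_ge0.
by rewrite Eint_cst Eint_enorm_sqr// -EFinD -EFinM ltry.
Qed.

(** For each [l] the two integrals combine into the expectation of [dphi] at [Z] minus [dphi] at
    [Y], which is within [b] of the expectation of [a]; averaging over [l] keeps this. With [a = 0]
    it gives the Lipschitz bound, with [a] the linear term it gives Taylor's formula. *)
Lemma law_increment (phi : P2 R d -> R) (dphi : P2 R d -> 'rV[R]_d -> R)
    mu nu Y Z (a h : Omega -> R) (b : R) :
  is_linear_functional_derivative phi dphi ->
  (forall mu x, differentiable (dphi mu) x) ->
  is_law P Y mu -> is_law P Z nu -> L2m Y -> L2m Z ->
  P.-integrable setT (EFin \o a) ->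
  (forall l w, 0 <= l <= 1 ->
    `|dphi (mixture l mu nu) (Z w) - dphi (mixture l mu nu) (Y w) - a w| <= h w) ->
  (\int[P]_w (h w)%:E <= b%:E)%E ->
  `|phi nu - phi mu - \int[P]_w a w| <= b.
Proof.
move=> [_ qg ->] dif lY lZ hY hZ ia ah hb.
apply: Rintegral_near_cst => //.
  suff : lebesgue_measure (`[0%R, 1%R]%classic : set R) = 1%E by [].
  by rewrite lebesgue_measure_itv/= lte_fin ltr01 -EFinD subr0.
move=> l; rewrite /= in_itv/= => l01; set g := dphi (mixture l mu nu).
have mg : measurable_fun setT g.
  by apply: continuous_measurable => x; apply: differentiable_continuous; exact: dif.
have [r [C [r0 gC]]] := qg (mixture l mu nu).
have gC' x : `|g x| <= C * (1 + enorm x ^+ 2).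
  by apply: gC; rewrite W2_refl.
have iY := quadratic_integrable mg gC' hY; have iZ := quadratic_integrable mg gC' hZ.
rewrite (law_Rintegral lZ (L2_measurable hZ) mg iZ) (law_Rintegral lY (L2_measurable hY) mg iY).
rewrite -(RintegralB measurableT iZ iY) -RintegralB//; last first.
  have -> : EFin \o (fun x => (g \o Z) x - (g \o Y) x) = ((EFin \o (g \o Z)) \- (EFin \o (g \o Y)))%E.
    by apply/funext => w.
  exact: integrableB.
apply: (Rintegral_le _ hb) => w; exact: ah.
Qed.

Section derivative_bounds.
Variables (f : 'rV[R]_d -> P2 R d -> R) (Df : 'rV[R]_d -> P2 R d -> 'rV[R]_d -> 'rV[R]_d) (C : R).
Hypotheses (C0 : 0 <= C) (fdiff : forall mu x, differentiable (f^~ mu) x).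
Hypotheses (fL : forall x, is_L_derivative (f x) (Df x)).
Hypotheses (gradC : forall x mu, enorm (grad (f^~ mu) x) <= C).
Hypotheses (DfC : forall x mu y, enorm (Df x mu y) <= C).
Hypotheses (gradL : forall x x' mu mu',
  enorm (grad (f^~ mu') x' - grad (f^~ mu) x) <= C * (enorm (x' - x) + W2 mu mu')).
Hypotheses (DfL : forall x x' mu mu' y y',
  enorm (Df x' mu' y' - Df x mu y) <= C * (enorm (x' - x) + W2 mu mu' + enorm (y' - y))).

Lemma Df_L2 x mu Y : L2m Y -> L2m (fun w => Df x mu (Y w)).
Proof.
move=> hY; have mY := L2_measurable hY; split.
  apply: measurable_wrtT; apply: measurable_mx => i k; rewrite (ord1 i).
  apply: (measurableT_comp (f := fun y => Df x mu y 0 k) _ mY).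
  apply: (@lipschitz_measurable _ _ _ C) => y y'.
  have h := DfL x x mu mu y y'; rewrite subrr enorm0 W2_refl !add0r in h.
  by apply: le_trans h; have := enorm_entry (Df x mu y' - Df x mu y) 0 k; rewrite !mxE.
rewrite L2norm_lty; apply: (@le_lt_trans _ _ (\int[P]_w (C ^+ 2)%:E)%E).
  apply: Eint_le => w; first exact: sqr_ge0.
  by rewrite lerXn2r ?nnegrE ?enorm_ge0.
by rewrite Eint_cst ltry.
Qed.

Lemma mean_field_lipschitz x x' mu nu Y Z :
  is_law P Y mu -> is_law P Z nu -> L2m Y -> L2m Z ->
  `|f x' nu - f x mu| <= C * (enorm (x' - x) + nrm (fun w => Z w - Y w)).
Proof.
move=> lY lZ hY hZ.
have h1 : `|f x' nu - f x nu| <= C * enorm (x' - x).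
  have [th _ ->] := segment_mvt x x' (fdiff nu).
  by rewrite (le_trans (edot_le _ _))// ler_wpM2r ?enorm_ge0.
have [dphi [lfd dif DfE _]] := fL x.
have h2 : `|f x nu - f x mu| <= C * nrm (fun w => Z w - Y w).
  have i0 : P.-integrable setT (EFin \o (fun=> 0 : R)) by exact: integrable0.
  have := @law_increment _ _ mu nu Y Z (fun=> 0)
    (fun w => C * enorm (Z w - Y w)) (C * nrm (fun w => Z w - Y w)) lfd dif lY lZ hY hZ i0.
  have -> : \int[P]__ 0 = 0 :> R by rewrite /Rintegral integral0.
  rewrite subr0; apply.
    move=> l w _; rewrite subr0.
    have [th _ ->] := segment_mvt (Y w) (Z w) (dif (mixture l mu nu)).
    rewrite -DfE.
    by rewrite (le_trans (edot_le _ _))// ler_wpM2r ?enorm_ge0.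
  rewrite Eint_Z//.
  - by rewrite EFinM lee_wpmul2l ?lee_fin//; apply: Eint_enorm_le; exact: L2B.
  - by apply: measurable_enorm; exact: (L2_measurable (L2B hY hZ)).
  - by move=> w; exact: enorm_ge0.
have -> : f x' nu - f x mu = (f x' nu - f x nu) + (f x nu - f x mu) by ring.
by rewrite (le_trans (ler_normD _ _))// mulrDr lerD.
Qed.

(** The point moves first, at the final law [nu], and then the law, at the initial point [x]. The
    gradient changes by at most [2 C] and at most [C (D + N)], whence the minimum and the mixed term
    [D N]; the L-derivative changes by at most [C (N + |Z - Y|)], whence [N^2]. *)
Lemma mean_field_taylor x x' mu nu Y Z (N D : R) :
  is_law P Y mu -> is_law P Z nu -> L2m Y -> L2m Z ->
  N = nrm (fun w => Z w - Y w) -> D = enorm (x' - x) ->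
  `|f x' nu - f x mu - (edot (grad (f^~ mu) x) (x' - x) +
     L2inner P (fun w => Df x mu (Y w)) (fun w => Z w - Y w))|
  <= 2 * C * (D * Num.min 1 D + D * N + N ^+ 2).
Proof.
move=> lY lZ hY hZ NE DE; have N0 : 0 <= N by rewrite NE; exact: ip_norm_ge0.
have D0 : 0 <= D by rewrite DE; exact: enorm_ge0.
have WN : W2 mu nu <= N by rewrite NE; exact: W2_law_le.
have h1 : `|f x' nu - f x nu - edot (grad (f^~ mu) x) (x' - x)| <=
    (2 * C * Num.min 1 D + C * N) * D.
  have [th /andP[th0 th1] ->] := segment_mvt x x' (fdiff nu).
  set a := grad _ _; set b := grad _ _.
  have -> : edot a (x' - x) - edot b (x' - x) = edot (a - b) (x' - x).
    by rewrite /edot -sumrB; apply: eq_bigr => k _; rewrite !mxE mulrBl.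
  rewrite (le_trans (edot_le _ _))// -DE ler_wpM2r//.
  have b1 : enorm (a - b) <= 2 * C.
    by rewrite (le_trans (enormB _ _))// mulr2n mulrDl mul1r lerD ?gradC.
  have b2 : enorm (a - b) <= C * (D + N).
    rewrite (le_trans (gradL _ _ _ _))// ler_wpM2l// lerD//.
    by rewrite addrAC subrr add0r enormZ ger0_norm// -DE ler_piMl.
  have CN : 0 <= C * N by rewrite mulr_ge0.
  have CD : 0 <= C * D by rewrite mulr_ge0.
  case: (leP 1 D) => D1; first by rewrite mulr1 (le_trans b1)// lerDl.
  by rewrite (le_trans b2)// mulrDr lerD2r -mulrA mulr2n mulrDl mul1r lerDl.
have [dphi [lfd dif DfE _]] := fL x.
have hG := L2B hY hZ.
have h2 : `|f x nu - f x mu - L2inner P (fun w => Df x mu (Y w)) (fun w => Z w - Y w)|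
    <= 2 * C * N ^+ 2.
  have ia := integrable_edot (Df_L2 x mu hY) hG.
  apply: (@law_increment _ _ mu nu Y Z _
    (fun w => C * (N * enorm (Z w - Y w) + enorm (Z w - Y w) ^+ 2)) _ lfd dif lY lZ hY hZ ia).
    move=> l w _.
    have [th /andP[th0 th1] ->] := segment_mvt (Y w) (Z w) (dif (mixture l mu nu)).
    rewrite -DfE.
    set a := Df _ _ _; set b := Df _ _ _; set v := Z w - Y w.
    have -> : edot a v - edot b v = edot (a - b) v.
      by rewrite /edot -sumrB; apply: eq_bigr => k _; rewrite !mxE mulrBl.
    rewrite (le_trans (edot_le _ _))// expr2 -mulrDl mulrA ler_wpM2r ?enorm_ge0//.
    rewrite (le_trans (DfL _ _ _ _ _ _))// ler_wpM2l// subrr enorm0 add0r lerD//.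
      by rewrite NE; exact: W2_mixture_le.
    by rewrite addrAC subrr add0r enormZ ger0_norm// ler_piMl// enorm_ge0.
  have mG := measurable_enorm (L2_measurable hG).
  have mG2 : measurable_fun setT (fun w => enorm (Z w - Y w) ^+ 2) by meas.
  rewrite Eint_Z//; first last.
  - by move=> w; rewrite addr_ge0 ?sqr_ge0// mulr_ge0// enorm_ge0.
  - by meas.
  rewrite (Eint_D P (f := fun w => N * enorm (Z w - Y w)))//; first last.
  - by move=> w; exact: sqr_ge0.
  - by move=> w; rewrite mulr_ge0// enorm_ge0.
  - by meas.
  rewrite (Eint_Z P mG)//; last by move=> w; exact: enorm_ge0.
  have -> : 2 * C * N ^+ 2 = C * (N * N + N ^+ 2) by ring.
  rewrite EFinM lee_wpmul2l ?lee_fin// EFinD EFinM; apply: leeD.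
    by rewrite lee_wpmul2l ?lee_fin// NE; exact: Eint_enorm_le.
  by rewrite Eint_enorm_sqr// NE.
set E1 := edot _ _ in h1 *; set E2 := L2inner _ _ _ in h2 *.
have -> : f x' nu - f x mu - (E1 + E2) = (f x' nu - f x nu - E1) + (f x nu - f x mu - E2) by ring.
rewrite (le_trans (ler_normD _ _))// (le_trans (lerD h1 h2))//.
have CND : 0 <= C * (N * D) by rewrite !mulr_ge0.
move: (Num.min 1 D) => k; rewrite -subr_ge0.
by have -> : 2 * C * (D * k + D * N + N ^+ 2) - ((2 * C * k + C * N) * D + 2 * C * N ^+ 2) =
   C * (N * D) by ring.
Qed.

(** Taylor's formula divided by [r], with [D = |r| q] and [N] at most [|r| Lam]. The assumption
    [1 <= Lam] lets [Lam^2] absorb the lower powers. *)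
Lemma mean_field_quotient x x' mu nu Y Z (r del Lam : R) :
  is_law P Y mu -> is_law P Z nu -> L2m Y -> L2m Z ->
  r != 0 -> `|r| <= del -> 1 <= Lam -> nrm (fun w => r^-1 *: (Z w - Y w)) <= Lam ->
  forall q, q = enorm (r^-1 *: (x' - x)) ->
  `|r^-1 * (f x' nu - f x mu) - (edot (grad (f^~ mu) x) (r^-1 *: (x' - x)) +
     L2inner P (fun w => Df x mu (Y w)) (fun w => r^-1 *: (Z w - Y w)))|
  <= 2 * C * Lam ^+ 2 * (q * Num.min 1 (del * q) + del * q + del).
Proof.
move=> lY lZ hY hZ r0 rd L1 nL q qE.
have h := mean_field_taylor (x := x) (x' := x') lY lZ hY hZ erefl erefl.
have hG := L2B hY hZ; have hA := Df_L2 x mu hY.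
have sub := @L2_submodule _ _ _ P d measurable (fun _ => id).
have ipP := @L2inner_product _ _ _ P d.
have eN : nrm (fun w => Z w - Y w) = `|r| * nrm (fun w => r^-1 *: (Z w - Y w)).
  have := ip_normZ sub ipP r^-1 hG => ->.
  by rewrite mulrA -normrM divff// normr1 mul1r.
have eI : L2inner P (fun w => Df x mu (Y w)) (fun w => r^-1 *: (Z w - Y w)) =
    r^-1 * L2inner P (fun w => Df x mu (Y w)) (fun w => Z w - Y w).
  exact: (ipZr sub ipP).
have eD : enorm (x' - x) = `|r| * q.
  by rewrite qE enormZ mulrA -normrM divff// normr1 mul1r.
have ee : edot (grad (f^~ mu) x) (r^-1 *: (x' - x)) = r^-1 * edot (grad (f^~ mu) x) (x' - x).
  move: (grad _ _) => a; rewrite /edot mulr_sumr.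
  by apply: eq_bigr => k _; rewrite mxE mulrCA.
rewrite eI ee -mulrDr -mulrBr normrM normrV ?unitfE// ler_pdivrMl ?normr_gt0//.
apply: (le_trans h); rewrite eN eD.
set nQ := nrm _ in nL *; have nQ0 : 0 <= nQ by exact: ip_norm_ge0.
have q0 : 0 <= q by rewrite qE; exact: enorm_ge0.
have a0 : 0 <= `|r| by [].
have Lam0 : 0 <= Lam by exact: le_trans L1.
have Lam2 : 1 <= Lam ^+ 2 by rewrite expr_ge1.
have dl0 : 0 <= del by exact: le_trans rd.
have -> : `|r| * q * Num.min 1 (`|r| * q) + `|r| * q * (`|r| * nQ) + (`|r| * nQ) ^+ 2 =
  `|r| * (q * Num.min 1 (`|r| * q) + `|r| * q * nQ + `|r| * nQ ^+ 2) by ring.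
have e0 : `|r| * (2 * C * Lam ^+ 2 * (q * Num.min 1 (del * q) + del * q + del)) =
  2 * C * (`|r| * (Lam ^+ 2 * (q * Num.min 1 (del * q) + del * q + del))) by ring.
rewrite e0; apply: ler_wpM2l; first by rewrite mulr_ge0.
apply: ler_wpM2l => //; rewrite !mulrDr.
have m1 : 0 <= Num.min 1 (`|r| * q) by rewrite le_min ler01 mulr_ge0.
have m2 : Num.min 1 (`|r| * q) <= Num.min 1 (del * q).
  by rewrite le_min !ge_min lexx/= ler_wpM2r ?orbT.
apply: lerD; first apply: lerD.
- rewrite -[leLHS]mul1r; apply: ler_pM => //; first exact: mulr_ge0.
  by rewrite ler_wpM2l.
- have h1 : `|r| * q * nQ <= (del * q) * Lam.
    by apply: ler_pM => //; rewrite ?mulr_ge0// ler_wpM2r.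
  rewrite (le_trans h1)// [leLHS]mulrC ler_wpM2r ?mulr_ge0//.
  by rewrite expr2 ler_peMl.
- rewrite mulrC; apply: ler_pM => //; first exact: sqr_ge0.
  by rewrite lerXn2r ?nnegrE.
Qed.

(** After Taylor's formula at both base points only the linear terms are compared. The difference
    [Q - Q'] meets a bounded derivative, which gives [C (|Q - Q'| + g)]; the change of the
    derivative between the base points meets [Q]. [g] stays a parameter, because the mean of
    [|Q - Q'|] is bounded later through the weight. *)
Lemma mean_field_four_point X0 X1 X2 X3 mu0 mu1 mu2 mu3 (r r' del Lam nu g : R) w :
  is_law P X0 mu0 -> is_law P X1 mu1 -> is_law P X2 mu2 -> is_law P X3 mu3 ->
  L2m X0 -> L2m X1 -> L2m X2 -> L2m X3 ->
  r != 0 -> r' != 0 -> `|r| <= del -> `|r'| <= del -> 1 <= Lam ->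
  let Q := fun w => r^-1 *: (X1 w - X0 w) in
  let Q' := fun w => r'^-1 *: (X3 w - X2 w) in
  nrm Q <= Lam -> nrm Q' <= Lam -> nrm (fun w => X2 w - X0 w) <= nu ->
  (\int[P]_w (enorm (Q w - Q' w))%:E <= g%:E)%E ->
  forall q q' e, q = enorm (Q w) -> q' = enorm (Q' w) -> e = enorm (X2 w - X0 w) ->
  `|r^-1 * (f (X1 w) mu1 - f (X0 w) mu0) - r'^-1 * (f (X3 w) mu3 - f (X2 w) mu2)|
  <= C * (enorm (Q w - Q' w) + g) + 2 * C * Lam ^+ 2 *
     ((q * Num.min 1 (del * q) + del * q + del) +
      (q' * Num.min 1 (del * q') + del * q' + del) +
      (Num.min 1 e * q + nu * q + e + nu)).
Proof.
move=> l0 l1 l2 l3 h0 h1 h2 h3 r0 r'0 rd r'd L1 Q Q' nQ nQ' n02 gP q q' e qE q'E eE.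
have t1 := mean_field_quotient (x := X0 w) (x' := X1 w) l0 l1 h0 h1 r0 rd L1 nQ qE.
have t2 := mean_field_quotient (x := X2 w) (x' := X3 w) l2 l3 h2 h3 r'0 r'd L1 nQ' q'E.
rewrite -/(Q w) in t1; rewrite -/(Q' w) in t2.
set A0 := fun w0 => Df (X0 w) mu0 (X0 w0) in t1.
set A2 := fun w0 => Df (X2 w) mu2 (X2 w0) in t2.
have hA0 : L2m A0 by exact: Df_L2.
have hA2 : L2m A2 by exact: Df_L2.
have sub := @L2_submodule _ _ _ P d measurable (fun _ => id).
have ipP := @L2inner_product _ _ _ P d.
have hQ : L2m Q by apply: (submoduleZ sub); exact: L2B.
have hQ' : L2m Q' by apply: (submoduleZ sub); exact: L2B.
have q0 : 0 <= q by rewrite qE; exact: enorm_ge0.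
have e0 : 0 <= e by rewrite eE; exact: enorm_ge0.
have nu0 : 0 <= nu by exact: (le_trans (ip_norm_ge0 _ _) n02).
have Lam0 : 0 <= Lam by exact: le_trans L1.
have Lam2 : Lam <= Lam ^+ 2 by rewrite expr2 ler_peMl.
have Lam21 : 1 <= Lam ^+ 2 by exact: le_trans Lam2.
have W02 : W2 mu0 mu2 <= nu by apply: le_trans n02; exact: W2_law_le.
set a0 := grad (f^~ mu0) (X0 w) in t1; set a2 := grad (f^~ mu2) (X2 w) in t2.
have k1 : `|edot a0 (Q w) - edot a2 (Q' w)| <=
    C * enorm (Q w - Q' w) + 2 * C * Lam ^+ 2 * (Num.min 1 e * q + nu * q).
  have -> : edot a0 (Q w) - edot a2 (Q' w) = edot a2 (Q w - Q' w) - edot (a2 - a0) (Q w).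
    by rewrite /edot -!sumrB; apply: eq_bigr => k _; rewrite !mxE; ring.
  apply: (le_trans (ler_normB _ _)); apply: lerD.
    by rewrite (le_trans (edot_le _ _))// ler_wpM2r ?enorm_ge0 ?gradC.
  apply: (le_trans (edot_le _ _)); rewrite -qE -mulrDl mulrA ler_wpM2r//.
  have b1 : enorm (a2 - a0) <= 2 * C.
    by rewrite (le_trans (enormB _ _))// mulr2n mulrDl mul1r lerD ?gradC.
  have b2 : enorm (a2 - a0) <= C * (e + nu).
    by rewrite (le_trans (gradL _ _ _ _))// ler_wpM2l// lerD// eE.
  have b3 : enorm (a2 - a0) <= 2 * C * (Num.min 1 e + nu).
    have c0 : 0 <= C * nu by exact: mulr_ge0.
    have c1 : 0 <= C * e by exact: mulr_ge0.
    case: (leP 1 e) => _.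
      by rewrite (le_trans b1)// mulrDr mulr1 lerDl -mulrA mulr_ge0.
    by rewrite (le_trans b2)// -mulrA mulr2n mulrDl mul1r lerDl mulr_ge0// addr_ge0.
  apply: (le_trans b3); rewrite -(mulrA (2 * C)); apply: ler_wpM2l; first by rewrite mulr_ge0.
  by rewrite ler_peMl// addr_ge0// le_min ler01.
have k2 : `|L2inner P A0 Q - L2inner P A2 Q'| <=
    C * g + 2 * C * Lam ^+ 2 * (e + nu).
  have hQQ : L2m (Q - Q') by exact: (submoduleB sub).
  have hAA : L2m (A2 - A0) by exact: (submoduleB sub).
  have -> : L2inner P A0 Q - L2inner P A2 Q' =
      L2inner P A2 (Q - Q') - L2inner P (A2 - A0) Q.
    rewrite (ipDr sub ipP hQ (submoduleN sub hQ') hA2).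
    rewrite (ipDl ipP hA2 (submoduleN sub hA0) hQ).
    by rewrite (ipNr sub ipP hQ' hA2) (ipNl sub ipP hA0 hQ) opprB [RHS]addrC subrKA.
  apply: (le_trans (ler_normB _ _)); apply: lerD.
    apply: (@Rintegral_le _ (fun w => C * enorm (Q w - Q' w))) => [w0|].
      by rewrite (le_trans (edot_le _ _))// ler_wpM2r ?enorm_ge0//; exact: DfC.
    have mQQ := measurable_enorm (L2_measurable hQQ).
    rewrite (Eint_Z P mQQ)//; last by move=> w0; exact: enorm_ge0.
    by rewrite EFinM lee_wpmul2l ?lee_fin.
  have hX := L2B h0 h2.
  apply: (@Rintegral_le _ (fun w0 => C * ((e + nu) * enorm (Q w0) +
     enorm (X2 w0 - X0 w0) * enorm (Q w0)))) => [w0|].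
    rewrite (le_trans (edot_le _ _))// -mulrDl mulrA ler_wpM2r ?enorm_ge0//.
    by rewrite (le_trans (DfL _ _ _ _ _ _))// ler_wpM2l// lerD2r eE lerD2l.
  have mQ := measurable_enorm (L2_measurable hQ).
  have mX := measurable_enorm (L2_measurable hX).
  have en0 : 0 <= e + nu by exact: addr_ge0.
  rewrite Eint_Z//; first last.
  - by move=> w0; rewrite addr_ge0// mulr_ge0// enorm_ge0.
  - by meas.
  rewrite (Eint_D P (f := fun w => (e + nu) * enorm (Q w)))//; first last.
  - by move=> w0; rewrite mulr_ge0// enorm_ge0.
  - by move=> w0; rewrite mulr_ge0// enorm_ge0.
  - by meas.
  - by meas.
  rewrite (Eint_Z P mQ)//; last by move=> w0; exact: enorm_ge0.
  have c1 : (0 <= (e + nu)%:E)%E by rewrite lee_fin.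
  have cC : (0 <= C%:E)%E by rewrite lee_fin.
  apply: (le_trans (lee_wpmul2l cC (leeD (lee_wpmul2l c1 (Eint_enorm_le hQ))
    (Eint_enorm2_le hX hQ)))).
  rewrite -(EFinM (e + nu)) -EFinD -EFinM lee_fin.
  move: (ip_norm_ge0 (L2inner P (d:=d)) Q) (ip_norm_ge0 (L2inner P (d:=d)) (fun w0 => X2 w0 - X0 w0)).
  move: nQ n02; move: (nrm Q) (nrm (fun w0 => X2 w0 - X0 w0)) => y z yL zn y0 z0.
  have n1 : (e + nu) * y <= (e + nu) * Lam by exact: ler_wpM2l.
  have n2 : z * y <= nu * Lam by exact: ler_pM.
  have -> : 2 * C * Lam ^+ 2 * (e + nu) = C * (2 * (e + nu) * Lam ^+ 2) by ring.
  rewrite ler_wpM2l// (le_trans (lerD n1 n2))//.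
  have n3 : (e + nu) * Lam + nu * Lam <= 2 * (e + nu) * Lam.
    rewrite -mulrDl; apply: ler_wpM2r => //.
    by rewrite (mulr_natl _ 2) mulr2n lerD2l lerDr.
  by rewrite (le_trans n3)// ler_wpM2l// mulr_ge0.
move: t1 t2 k1 k2.
set u1 := r^-1 * _; set u2 := r'^-1 * _.
move: (edot a0 (Q w)) (edot a2 (Q' w)) (L2inner P A0 Q) (L2inner P A2 Q') => v1 v2 v3 v4 t1 t2 k1 k2.
have -> : u1 - u2 = (u1 - (v1 + v3)) - (u2 - (v2 + v4)) + (v1 - v2) + (v3 - v4) by ring.
rewrite (le_trans (ler_normD _ _))// (le_trans (lerD (ler_normD _ _) k2))//.
rewrite (le_trans (lerD (lerD (ler_normB _ _) k1) (lexx _)))//.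
rewrite (le_trans (lerD (lerD (lerD t1 t2) (lexx _)) (lexx _)))//.
move: (2 * C * Lam ^+ 2) => c; rewrite -subr_ge0.
set x1 := q * _ + _ + _; set x2 := q' * _ + _ + _; set x3 := Num.min _ _ * q.
by have -> : C * (enorm (Q w - Q' w) + g) + c * (x1 + x2 + (x3 + nu * q + e + nu)) -
 (c * x1 + c * x2 + (C * enorm (Q w - Q' w) + c * (x3 + nu * q)) + (C * g + c * (e + nu))) = 0 by ring.
Qed.

End derivative_bounds.

End mean_field_expansion.

(** * Regularity of the coefficients *)

Section coefficient_bounds.
Context (R : realType) (disp : measure_display) (Omega : measurableType disp).
Variables (P : probability Omega R) (d : nat).
Local Notation nrm := (ip_norm (L2inner P (d:=d))).
Local Notation L2m := (L2 P measurable (d:=d)).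

(* Second order terms left over when the linearisations of a coefficient along two
   quotients of sizes [q] and [q'], based at points at distance [e] and laws at
   distance [nu], are compared; the minima come from derivatives that are both bounded
   and Lipschitz. *)
Definition four_point_error (del nu q q' e : R) : R :=
  (q * Num.min 1 (del * q) + del * q + del) +
  (q' * Num.min 1 (del * q') + del * q' + del) +
  (Num.min 1 e * q + nu * q + e + nu).

(* W_2 is replaced by the L^2 distance of random variables with the given laws, which
   dominates it. *)
Definition lipschitz_coef (p q : nat) (b : 'rV[R]_d -> P2 R d -> 'M[R]_(p, q)) (C : R) : Prop :=
  forall x x' mu nu Y Z, is_law P Y mu -> is_law P Z nu -> L2m Y -> L2m Z ->
    enorm (b x' nu - b x mu) <= C * (enorm (x' - x) + nrm (fun w => Z w - Y w)).

Definition four_point_coef (p q : nat) (b : 'rV[R]_d -> P2 R d -> 'M[R]_(p, q)) (C : R) : Prop :=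
  forall X0 X1 X2 X3 mu0 mu1 mu2 mu3 (r r' del Lam nu g : R) w,
  is_law P X0 mu0 -> is_law P X1 mu1 -> is_law P X2 mu2 -> is_law P X3 mu3 ->
  L2m X0 -> L2m X1 -> L2m X2 -> L2m X3 ->
  r != 0 -> r' != 0 -> `|r| <= del -> `|r'| <= del -> 1 <= Lam ->
  nrm (fun w => r^-1 *: (X1 w - X0 w)) <= Lam ->
  nrm (fun w => r'^-1 *: (X3 w - X2 w)) <= Lam ->
  nrm (fun w => X2 w - X0 w) <= nu ->
  (\int[P]_w (enorm (r^-1 *: (X1 w - X0 w) - r'^-1 *: (X3 w - X2 w)))%:E <= g%:E)%E ->
  enorm (r^-1 *: (b (X1 w) mu1 - b (X0 w) mu0) - r'^-1 *: (b (X3 w) mu3 - b (X2 w) mu2))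
  <= C * (enorm (r^-1 *: (X1 w - X0 w) - r'^-1 *: (X3 w - X2 w)) + g +
     Lam ^+ 2 * four_point_error del nu (enorm (r^-1 *: (X1 w - X0 w)))
       (enorm (r'^-1 *: (X3 w - X2 w))) (enorm (X2 w - X0 w))).

(** A scalar coefficient is viewed as a 1-by-1 matrix, so that it falls under the same two
    properties as drift and diffusion. The factor 2 is that of the Taylor remainder. *)
Lemma C11b_real_coef (f : 'rV[R]_d -> P2 R d -> R) : C11b_real f ->
  exists2 C : R, 0 <= C & lipschitz_coef (fun x mu => (f x mu)%:M : 'M[R]_1) C /\
    four_point_coef (fun x mu => (f x mu)%:M : 'M[R]_1) C.
Proof.
have e1 (x : R) : enorm (x%:M : 'M[R]_1) = `|x|.
  by rewrite /enorm !big_ord1 mxE eqxx mulr1n sqrtr_sqr.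
move=> [fd _ [Df [fL [C0 [gC DC gL DL]]]]].
pose C := `|C0|.
have CC : C0 <= C by exact: ler_norm.
have gC' x mu : enorm (grad (f^~ mu) x) <= C by exact: le_trans (gC _ _) CC.
have DC' x mu y : enorm (Df x mu y) <= C by exact: le_trans (DC _ _ _) CC.
have W0 (mu nu : P2 R d) : 0 <= W2 mu nu by exact: sqrtr_ge0.
have gL' x x' mu mu' : enorm (grad (f^~ mu') x' - grad (f^~ mu) x) <= C * (enorm (x' - x) + W2 mu mu').
  by rewrite (le_trans (gL _ _ _ _))// ler_wpM2r// addr_ge0// enorm_ge0.
have DL' x x' mu mu' y y' : enorm (Df x' mu' y' - Df x mu y) <=
    C * (enorm (x' - x) + W2 mu mu' + enorm (y' - y)).
  by rewrite (le_trans (DL _ _ _ _ _ _))// ler_wpM2r// !addr_ge0// enorm_ge0.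
have Cp : 0 <= C by exact: normr_ge0.
have sB (a b : R) : a%:M - b%:M = (a - b)%:M :> 'M[R]_1 by rewrite raddfB.
have sZ (c a : R) : c *: a%:M = (c * a)%:M :> 'M[R]_1 by rewrite scale_scalar_mx.
exists (2 * C); first by rewrite mulr_ge0.
split.
  move=> x x' mu nu Y Z lY lZ hY hZ; rewrite sB e1.
  apply: (le_trans (mean_field_lipschitz Cp fd fL gC' DC' x x' lY lZ hY hZ)).
  rewrite ler_wpM2r ?addr_ge0 ?enorm_ge0 ?ip_norm_ge0//.
  by rewrite mulr2n mulrDl mul1r lerDl.
move=> X0 X1 X2 X3 mu0 mu1 mu2 mu3 r r' del Lam nu g w l0 l1 l2 l3 h0 h1 h2 h3 r0 r'0 rd r'd L1
  nQ nQ' n02 gP.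
rewrite !sB !sZ sB e1.
have h := mean_field_four_point Cp fd fL gC' DC' gL' DL' (w := w) l0 l1 l2 l3 h0 h1 h2 h3 r0 r'0
  rd r'd L1 nQ nQ' n02 gP erefl erefl erefl.
apply: (le_trans h); rewrite -/(four_point_error _ _ _ _ _).
have g0 : 0 <= g.
  by rewrite -lee_fin (le_trans _ gP)//; apply: Eint_ge0 => w0; exact: enorm_ge0.
rewrite [leRHS]mulrDr mulrA lerD2r ler_wpM2r ?addr_ge0 ?enorm_ge0//.
by rewrite mulr2n mulrDl mul1r lerDl.
Qed.

Lemma C11b_coef (p q : nat) (b : 'rV[R]_d -> P2 R d -> 'M[R]_(p, q)) : C11b b ->
  exists2 C : R, 0 <= C & lipschitz_coef b C /\ four_point_coef b C.
Proof.
move=> bC.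
have e1 (x : R) : enorm (x%:M : 'M[R]_1) = `|x|.
  by rewrite /enorm !big_ord1 mxE eqxx mulr1n sqrtr_sqr.
have sB (a c : R) : a%:M - c%:M = (a - c)%:M :> 'M[R]_1 by rewrite raddfB.
have sZ (c a : R) : c *: a%:M = (c * a)%:M :> 'M[R]_1 by rewrite scale_scalar_mx.
have /choice[K KP] : forall ij : 'I_p * 'I_q, exists C : R, 0 <= C /\
    lipschitz_coef (fun x mu => (b x mu ij.1 ij.2)%:M : 'M[R]_1) C /\
    four_point_coef (fun x mu => (b x mu ij.1 ij.2)%:M : 'M[R]_1) C.
  by move=> ij; have [C C0 CP] := C11b_real_coef (bC ij.1 ij.2); exists C.
pose C := \sum_i \sum_j K (i, j).
exists C; first by rewrite sumr_ge0// => i _; rewrite sumr_ge0// => j _; case: (KP (i, j)).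
split.
  move=> x x' mu nu Y Z lY lZ hY hZ.
  apply: (le_trans (enorm_le_sum _)); rewrite mulr_suml; apply: ler_sum => i _.
  rewrite mulr_suml; apply: ler_sum => j _; rewrite !mxE -e1 -sB.
  by case: (KP (i, j)) => _ [h _]; exact: h.
move=> X0 X1 X2 X3 mu0 mu1 mu2 mu3 r r' del Lam nu g w l0 l1 l2 l3 h0 h1 h2 h3 r0 r'0 rd r'd L1
  nQ nQ' n02 gP.
apply: (le_trans (enorm_le_sum _)); rewrite mulr_suml; apply: ler_sum => i _.
rewrite mulr_suml; apply: ler_sum => j _; rewrite !mxE -e1.
case: (KP (i, j)) => _ [_ h].
have := h X0 X1 X2 X3 mu0 mu1 mu2 mu3 r r' del Lam nu g w l0 l1 l2 l3 h0 h1 h2 h3 r0 r'0 rd r'd L1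
  nQ nQ' n02 gP.
by rewrite /= !sB !sZ sB.
Qed.

End coefficient_bounds.

(** * Countably many times and rounding to a grid *)

Section dense_times.
Context (R : realType).

(** Enumerates the rationals of [[0, 1]], with repetitions: a code stands for a pair of numerator
    and denominator minus one, values above 1 are capped, and a code of no pair gives 0. *)
Definition dense_time (j : nat) : R :=
  let z := odflt (0, 0)%N (unpickle j : option (nat * nat)) in
  Num.min 1 (z.1%:R / z.2.+1%:R).

Lemma dense_time01 j : 0 <= dense_time j <= 1.
Proof. by rewrite /dense_time ge_min lexx/= andbT le_min ler01 divr_ge0. Qed.

(** Rounding down to the grid of mesh [1 / (n + 1)]. Since [Num.trunc] vanishes on negative numbers,
    negative times are sent to 0. *)
Definition floor_time (n : nat) (s : R) : R := (Num.trunc (s * n.+1%:R))%:R / n.+1%:R.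

Lemma floor_time_le n s : 0 <= s -> s - n.+1%:R^-1 <= floor_time n s <= s.
Proof.
move=> s0; have n0 : 0 < n.+1%:R :> R by [].
have h0 : 0 <= s * n.+1%:R by rewrite mulr_ge0.
have /andP[h1 h2] := truncn_itv h0; rewrite /floor_time; apply/andP; split; last first.
  by rewrite ler_pdivrMr.
rewrite ler_pdivlMr// mulrBl mulVf ?gt_eqF// lerBlDr.
by rewrite natr1 ltW.
Qed.

Lemma floor_time_cvg s : 0 <= s -> floor_time n s @[n --> \oo] --> s.
Proof.
move=> s0; apply/cvgrPdist_le => e e0.
have [N NP] := ltr_natV_small e0; exists N => // n /= Nn.
have /andP[h1 h2] := floor_time_le n s0.
rewrite ger0_norm ?subr_ge0// (le_trans _ (NP n Nn))//.
by rewrite lerBlDr addrC -lerBlDr.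
Qed.

Lemma dense_time_le (g : R -> R) (s c : R) : 0 <= s ->
  (forall (v : nat -> R) t, v n @[n --> \oo] --> t -> g (v n) @[n --> \oo] --> g t) ->
  (forall j, g (s * dense_time j) <= c) -> forall u, 0 <= u <= s -> g u <= c.
Proof.
move=> s0 cg gc u /andP[u0 us].
have [v /andP[v0 v1] uE] : exists2 v, 0 <= v <= 1 & u = s * v.
  move: s0; rewrite le_eqVlt => /predU1P[s0|s0].
    exists 0; first by rewrite lexx ler01.
    by apply/eqP; rewrite mulr0 eq_le u0 -s0 in us *; rewrite us.
  exists (u / s); last by rewrite mulrCA divff ?mulr1// gt_eqF.
  by rewrite divr_ge0 ?(ltW s0)//= ler_pdivrMr// mul1r.
have h : g (s * floor_time n v) @[n --> \oo] --> g u.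
  rewrite uE; apply: cg; apply: cvgM; first exact: cvg_cst.
  exact: floor_time_cvg.
apply: (@closed_cvg _ _ _ _ (fun n => g (s * floor_time n v)) (fun y => y <= c)) h.
  exact: closed_le.
apply: nearW => n.
have := gc (pickle (Num.trunc (v * n.+1%:R), n)); rewrite /dense_time pickleK/= -/(floor_time n v).
rewrite min_r//; case/andP: (floor_time_le n v0) => _ h1; exact: le_trans v1.
Qed.

End dense_times.

(** * Ito processes and solutions *)

Section joint_measurability.
Context (R : realType) (disp : measure_display) (Omega : measurableType disp).

Lemma floor_time_nondecreasing n : {homo @floor_time R n : s t / s <= t}.
Proof.
move=> s t st; rewrite ler_wpM2r ?invr_ge0// ler_nat.
rewrite truncn_le_nat; apply: le_lt_trans (truncnS_gt _).
by rewrite ler_wpM2r.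
Qed.

Lemma jmeas_floor_time (f : R -> Omega -> R) n : (forall s, measurable_fun setT (f s)) ->
  jmeas (fun s w => f (floor_time n s) w).
Proof.
move=> mf _ A mA; rewrite setTI.
pose u k : R := k%:R / n.+1%:R.
pose E k := (@floor_time R n @^-1` [set u k]) `*` (f (u k) @^-1` A).
have -> : (fun z : measurableTypeR R * Omega => f (floor_time n z.1) z.2) @^-1` A =
    \bigcup_k E k.
  apply/seteqP; split => [[s w] /= fA|[s w] [k _ [/= -> //]]].
  by exists (Num.trunc (s * n.+1%:R)).
apply: bigcupT_measurable => k; apply: measurableX.
  have mt := nondecreasing_measurable measurableT (@floor_time_nondecreasing n).
  by have := mt measurableT [set u k] (measurable_set1 _); rewrite setTI.
by have := mf (u k) measurableT A mA; rewrite setTI.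
Qed.

(** Rounded to a grid, the time takes countably many values, so each discretised function is jointly
    measurable; they converge pointwise to [f]. *)
Lemma jmeas_caratheodory (f : R -> Omega -> R) : (forall s, measurable_fun setT (f s)) ->
  (forall s w, f (floor_time n s) w @[n --> \oo] --> f s w) -> jmeas f.
Proof.
move=> mf fl; apply: (measurable_fun_cvg (h := fun n (z : measurableTypeR R * Omega) => f (floor_time n z.1) z.2)).
- by move=> n; exact: jmeas_floor_time.
- by move=> z _; exact: fl.
Qed.

Lemma floor_time_neg n (s : R) : s <= 0 -> floor_time n s = 0.
Proof.
move=> s0; rewrite /floor_time.
have h : (Num.trunc (s * n.+1%:R) <= 0)%N.
  by rewrite truncn_le_nat (le_lt_trans _ ltr01)// pmulr_lle0.
by move: h; rewrite leqn0 => /eqP ->; rewrite mul0r.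
Qed.

End joint_measurability.

Section clamped_time.
Context (R : realType) (T : R).
Hypothesis T0 : 0 <= T.

(* Solutions are constrained on [[0, T]] only; composing with [clamp_time] makes them
   continuous, hence jointly measurable, on the whole line. *)
Definition clamp_time (s : R) : R := Num.max 0 (Num.min s T).

Lemma clamp_timeP s : 0 <= clamp_time s <= T.
Proof. by rewrite /clamp_time le_max lexx/= ge_max T0 ge_min lexx orbT. Qed.

Lemma clamp_time_id s : 0 <= s <= T -> clamp_time s = s.
Proof. by move=> /andP[s0 sT]; rewrite /clamp_time min_l// max_r. Qed.

Lemma clamp_time_lip s u : `|clamp_time s - clamp_time u| <= `|s - u|.
Proof.
have t0 := T0; have h3 := ler_norm (s - u); have h4 := ler_norm (- (s - u)); rewrite normrN in h4.
rewrite /clamp_time; case: (leP s T) => h1; case: (leP u T) => h2; rewrite /Order.max;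
  repeat case: ifPn; rewrite -?leNgt => *; rewrite ler_norml; apply/andP; split; lra.
Qed.

Lemma clamp_time_cvg (u : nat -> R) s : u n @[n --> \oo] --> s ->
  clamp_time (u n) @[n --> \oo] --> clamp_time s.
Proof.
move/cvgrPdist_le => us; apply/cvgrPdist_le => e e0; have [N _ NP] := us e e0.
by exists N => // n Nn; apply: le_trans (NP n Nn); exact: clamp_time_lip.
Qed.

Lemma clamp_time_neg s : s <= 0 -> clamp_time s = clamp_time 0.
Proof.
move=> s0; rewrite (clamp_time_id (s := 0)) ?lexx//; apply/eqP.
by rewrite eq_le /clamp_time ge_max lexx ge_min s0/= le_max lexx.
Qed.

Lemma clamped_cvg (d : nat) (f : R -> 'rV[R]_d) (u : nat -> R) s :
  {within `[0, T], continuous f} -> u n @[n --> \oo] --> s ->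
  enorm (f (clamp_time (u n)) - f (clamp_time s)) @[n --> \oo] --> 0.
Proof.
move/subspace_continuousP => cf us; apply/cvgrPdist_le => e e0.
have := cf (clamp_time s); rewrite /= in_itv/= => /(_ (clamp_timeP s)) h.
have {}h := h _ (enorm_continuous_row (f (clamp_time s)) e0).
have [N _ NP] := clamp_time_cvg us h; exists N => // n Nn.
rewrite sub0r normrN ger0_norm ?enorm_ge0//.
by apply: (NP n Nn); rewrite /= in_itv/= clamp_timeP.
Qed.

End clamped_time.

(** * Sequential continuity of paths *)

Section sequential_continuity.
Context (R : realType) (d : nat).

Definition seq_continuous (f : R -> 'rV[R]_d) : Prop :=
  forall (u : nat -> R) s, u n @[n --> \oo] --> s ->
    enorm (f (u n) - f s) @[n --> \oo] --> 0.

Lemma enorm_dist_le (x y : 'rV[R]_d) : `|enorm x - enorm y| <= enorm (x - y).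
Proof.
rewrite ler_norml lerBlDr lerBrDr.
have h1 := enormD (x - y) y; rewrite subrK in h1.
have h2 := enormD (y - x) x; rewrite subrK enormC in h2.
by apply/andP; split; lra.
Qed.

Lemma enorm_continuous : continuous (@enorm R 1 d).
Proof.
move=> x; apply/(@cvgrPdist_le R R _ (nbhs (x : 'rV[R]_d))) => e e0.
have := enorm_continuous_row x e0; apply: filterS => y yx.
by rewrite (le_trans (enorm_dist_le _ _))// enormC.
Qed.

Lemma cvg_of_dist (V : nat -> R) (l : R) (D : nat -> R) : (forall n, `|V n - l| <= D n) ->
  D n @[n --> \oo] --> 0 -> V n @[n --> \oo] --> l.
Proof.
move=> VD /cvgrPdist_le D0; apply/cvgrPdist_le => e e0; have [N _ NP] := D0 e e0.
exists N => // n Nn; rewrite distrC (le_trans (VD n))//.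
by rewrite (le_trans (ler_norm _))//; have := NP n Nn; rewrite /= sub0r normrN.
Qed.

Lemma seq_continuous_enorm (f : R -> 'rV[R]_d) : seq_continuous f ->
  forall (u : nat -> R) s, u n @[n --> \oo] --> s -> enorm (f (u n)) @[n --> \oo] --> enorm (f s).
Proof.
move=> cf u s us; apply: (cvg_of_dist _ (cf u s us)) => n.
exact: enorm_dist_le.
Qed.

Lemma seq_continuous_lin (a : R) (f g : R -> 'rV[R]_d) : seq_continuous f ->
  seq_continuous g -> seq_continuous (fun s => a *: f s + g s).
Proof.
move=> cf cg u s us.
apply: (@cvg_of_dist _ _ (fun n => `|a| * enorm (f (u n) - f s) + enorm (g (u n) - g s))).
  move=> n; rewrite subr0 ger0_norm ?enorm_ge0// opprD addrACA -scalerBr.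
  by rewrite (le_trans (enormD _ _))// enormZ.
have -> : (0 : R) = `|a| * 0 + 0 by rewrite mulr0 addr0.
apply: cvgD; last exact: cg.
by apply: cvgM; [exact: cvg_cst | exact: cf].
Qed.

End sequential_continuity.

(** * Ito processes *)

Section ito_processes.
Context (R : realType) (disp : measure_display) (Omega : measurableType disp).
Variables (P : probability Omega R) (T : R) (d m : nat).
Variables (B : R -> Omega -> 'rV[R]_m) (F0 : set (set Omega)).
Hypotheses (T0 : 0 < T).
Hypotheses (Bbm : brownian_motion P T B) (F0i : initial_sigma_algebra P T B F0).
Local Notation F := (filtration B F0).
Local Notation leb := (@lebesgue_measure R).
Local Notation nrm := (ip_norm (L2inner P (d:=d))).
Local Notation L2m := (L2 P measurable (d:=d)).

Definition jmeas_mx (p q : nat) (X : R -> Omega -> 'M[R]_(p, q)) : Prop :=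
  measurable_fun (setT : set (measurableTypeR R * Omega)) (fun z => X z.1 z.2).

(** [Z_t] is [Z_0] plus the time integral of [A] plus the stochastic integral of [H]. The stochastic
    integral is given separately for each time, path regularity being carried by [Z], and one
    square-integrable [G] dominates all three processes at all times. The record is closed under
    linear combinations, hence contains difference quotients of solutions and their differences. *)
Record ito_process (Z0 : Omega -> 'rV[R]_d) (Z A : R -> Omega -> 'rV[R]_d)
    (H : R -> Omega -> 'M[R]_(d, m)) : Prop := ItoProcess {
  itp_Z : jmeas_mx Z ;
  itp_A : jmeas_mx A ;
  itp_H : jmeas_mx H ;
  itp_Z0 : measurable_fun setT Z0 ;
  itp_adapted : forall t, 0 <= t <= T -> measurable_wrt (F t) (Z t) ;
  itp_continuous : forall w, seq_continuous (Z^~ w) ;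
  itp_dominated : exists G : Omega -> R, [/\ measurable_fun setT G,
     (\int[P]_w (G w ^+ 2)%:E < +oo)%E &
     forall s w, [/\ enorm (Z s w) <= G w, enorm (A s w) <= G w & enorm (H s w) <= G w]] ;
  itp_eq : forall t, 0 <= t <= T -> exists2 U : Omega -> 'rV[R]_d,
     forall e, ito_at P B F0 t (fun s w => row e (H s w)) (fun w => U w 0 e) &
     {ae P, forall w, Z t w = Z0 w +
        (\row_i \int[leb]_(s in `[0, t]) A s w 0 i) + U w} }.

Lemma jmeas_entry (p q : nat) (X : R -> Omega -> 'M[R]_(p, q)) i j :
  jmeas_mx X -> jmeas (fun s w => X s w i j).
Proof. by move=> mX; exact: measurable_entry. Qed.

Lemma itp_integrable Z0 Z A H t w i : ito_process Z0 Z A H ->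
  leb.-integrable `[0, t]%classic (EFin \o (fun s => A s w 0 i)).
Proof.
move=> itp; have [G [_ _ GP]] := itp_dominated itp.
apply: measurable_bounded_integrable => //.
- suff : (leb (`[0%R, t]%classic : set R) < +oo)%E by [].
  by rewrite lebesgue_measure_itv/=; case: ifP => _; rewrite ?ltry// -EFinB ltry.
- by apply: measurable_funTS; exact: (jmeas_section w (jmeas_entry 0 i (itp_A itp))).
- exists (G w); split; first exact: num_real.
  move=> x /ltW Gx s _ /=; rewrite (le_trans (enorm_entry _ _ _))//.
  by case: (GP s w) => _ h _; exact: le_trans Gx.
Qed.

Lemma ito_process_lin (a : R) Z0 Z A H Z0' Z' A' H' :
  ito_process Z0 Z A H -> ito_process Z0' Z' A' H' ->
  ito_process (fun w => a *: Z0 w + Z0' w) (fun s w => a *: Z s w + Z' s w)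
    (fun s w => a *: A s w + A' s w) (fun s w => a *: H s w + H' s w).
Proof.
move=> itp itp'; split.
- apply: measurable_mxD; last exact: itp_Z itp'.
  by apply: measurable_mxZ; [exact: measurable_cst | exact: itp_Z itp].
- apply: measurable_mxD; last exact: itp_A itp'.
  by apply: measurable_mxZ; [exact: measurable_cst | exact: itp_A itp].
- apply: measurable_mxD; last exact: itp_H itp'.
  by apply: measurable_mxZ; [exact: measurable_cst | exact: itp_H itp].
- apply: measurable_mxD; last exact: itp_Z0 itp'.
  by apply: measurable_mxZ; [exact: measurable_cst | exact: itp_Z0 itp].
- move=> t tT; apply: measurable_mxD; last exact: itp_adapted itp' _ tT.
  by apply: measurable_mxZ; [exact: measurable_cst | exact: itp_adapted itp _ tT].
- move=> w; apply: seq_continuous_lin; first exact: itp_continuous itp w.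
  exact: itp_continuous itp' w.
- have [G [mG Gf GP]] := itp_dominated itp; have [G' [mG' Gf' GP']] := itp_dominated itp'.
  exists (fun w => `|a| * G w + G' w); split.
  + by meas.
  + apply: (@le_lt_trans _ _ (\int[P]_w (2 * `|a| ^+ 2 * G w ^+ 2 + 2 * G' w ^+ 2)%:E)%E).
      apply: Eint_le => w; first exact: sqr_ge0.
      by have := sqr_ge0 (`|a| * G w - G' w); nra.
    have c0 : 0 <= 2 * `|a| ^+ 2 by rewrite mulr_ge0// sqr_ge0.
    have mG2 : measurable_fun setT (fun w => G w ^+ 2) by meas.
    have mG'2 : measurable_fun setT (fun w => G' w ^+ 2) by meas.
    rewrite Eint_D; try (by meas); try (by move=> w; rewrite mulr_ge0// sqr_ge0).
    rewrite (Eint_Z P mG2)//; last by move=> w; exact: sqr_ge0.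
    rewrite (Eint_Z P mG'2)//; last by move=> w; exact: sqr_ge0.
    by apply: lte_add_pinfty; rewrite lte_mul_pinfty ?lee_fin.
  + move=> s w; have [h1 h2 h3] := GP s w; have [h1' h2' h3'] := GP' s w.
    split; rewrite (le_trans (enormD _ _))// lerD// enormZ ler_wpM2l//.
- move=> t tT; have [U HU Ueq] := itp_eq itp tT; have [U' HU' Ueq'] := itp_eq itp' tT.
  exists (fun w => a *: U w + U' w).
    move=> e; have := ito_at_lin Bbm F0i a tT (HU e) (HU' e).
    rewrite /ito_at; congr ito_at.
      by apply/funext => s; apply/funext => w; apply/rowP => l; rewrite !mxE.
    by apply/funext => w; rewrite !mxE.
  move: Ueq Ueq'; apply: filterS2 => w -> ->.
  apply/rowP => i; rewrite !mxE.
  under [in RHS]eq_Rintegral do rewrite !mxE.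
  have iA := itp_integrable t w i itp; have iA' := itp_integrable t w i itp'.
  have iaA : leb.-integrable `[0, t]%classic (EFin \o (fun s => a * A s w 0 i)).
    have -> : EFin \o (fun s => a * A s w 0 i) = (fun s : R => a%:E * (A s w 0%R i)%:E)%E.
      by apply/funext => s.
    exact: integrableZl.
  rewrite RintegralD//.
  by rewrite RintegralZl//; ring.
Qed.

End ito_processes.

Lemma jmeas_seq_continuous (R : realType) (disp : measure_display)
    (Omega : measurableType disp) (f : R -> Omega -> R) :
  (forall s, measurable_fun setT (f s)) ->
  (forall w (u : nat -> R) s, u n @[n --> \oo] --> s -> f (u n) w @[n --> \oo] --> f s w) ->
  (forall s w, s <= 0 -> f s w = f 0 w) -> jmeas f.
Proof.
move=> mf cf f0; apply: jmeas_caratheodory => // s w.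
have [s0|s0] := leP 0 s; first by apply: cf; exact: floor_time_cvg.
under eq_fun do rewrite (floor_time_neg _ (ltW s0)).
by rewrite f0 ?(ltW s0)//; exact: cvg_cst.
Qed.

(** * Solutions of the McKean-Vlasov equation as Ito processes *)

Section solutions.
Context (R : realType) (disp : measure_display) (Omega : measurableType disp).
Variables (P : probability Omega R) (T : R) (d m : nat).
Variables (B : R -> Omega -> 'rV[R]_m) (F0 : set (set Omega)).
Hypotheses (T0 : 0 < T).
Hypotheses (Bbm : brownian_motion P T B) (F0i : initial_sigma_algebra P T B F0).
Local Notation F := (filtration B F0).
Local Notation leb := (@lebesgue_measure R).
Local Notation nrm := (ip_norm (L2inner P (d:=d))).
Local Notation L2m := (L2 P measurable (d:=d)).
Let T0' : 0 <= T := ltW T0.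
Local Notation ct := (clamp_time T).

Section one_solution.
Variable (x : R -> Omega -> 'rV[R]_d).
Hypothesis xS2 : S2 P T B F0 x.

Let ctP s : 0 <= ct s <= T. Proof. exact: clamp_timeP. Qed.

Let cx w : seq_continuous (fun s => x (ct s) w).
Proof. by move=> u s us; apply: (clamped_cvg T0' (f := x^~ w) _ us); case: xS2. Qed.

Let mx s : measurable_fun setT (x (ct s)).
Proof.
case: xS2 => mX _ _; have /andP[_ sT] := ctP s.
exact: (measurable_wrtW (filtration_measurable Bbm F0i sT) (mX _ (ctP s))).
Qed.

(** Countably many times keep the supremum measurable; by continuity of paths it bounds the whole
    path on [[0, T]]. *)
Definition path_sup (w : Omega) : R := sups (fun j => enorm (x (T * dense_time R j) w)) 0.

Let dT j : 0 <= T * dense_time R j <= T.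
Proof.
have /andP[h0 h1] := dense_time01 R j.
by rewrite mulr_ge0//= ler_piMr.
Qed.

Let path_max w : exists2 c, 0 <= c <= T & forall t, 0 <= t <= T -> enorm (x t w) <= enorm (x c w).
Proof.
have cf : {within `[0, T], continuous (fun s => enorm (x s w))}.
  apply: (@within_continuous_comp _ _ _ `[0, T]%classic (x^~ w) (@enorm R 1 d)).
    by move=> y _; exact: enorm_continuous.
  by case: xS2.
have [c cT cm] := EVT_max T0' cf.
exists c; first by move: cT; rewrite in_itv.
by move=> t tT; apply: cm; rewrite in_itv.
Qed.

Let sup_bounded w : has_ubound (range (fun j => enorm (x (T * dense_time R j) w))).
Proof. by have [c cT cm] := path_max w; exists (enorm (x c w)) => _ [j _ <-]; exact: cm. Qed.

Lemma path_sup_measurable : measurable_fun setT path_sup.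
Proof.
apply: measurable_fun_sups => [w _|j]; first exact: sup_bounded.
by apply: measurable_enorm; have := mx (T * dense_time R j); rewrite clamp_time_id.
Qed.

Lemma path_sup_ge s w : enorm (x (ct s) w) <= path_sup w.
Proof.
pose g u := enorm (x (ct u) w).
suff h : forall u, 0 <= u <= T -> g u <= path_sup w.
  by have := h _ (ctP s); rewrite /g clamp_time_id// ctP.
apply: (dense_time_le T0').
  by move=> v t vt; exact: (seq_continuous_enorm (cx w) vt).
move=> j; rewrite /g clamp_time_id//.
apply: ub_le_sup; last by exists j.
have [M MP] := sup_bounded w; exists M => _ [k _ <-].
by apply: MP; exists k.
Qed.

Lemma path_sup_fin : (\int[P]_w (path_sup w ^+ 2)%:E < +oo)%E.
Proof.
case: xS2 => _ _; apply: le_lt_trans; apply: ge0_integral_mono => w _.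
  by rewrite lee_fin sqr_ge0.
have [c cT cm] := path_max w.
apply: (@le_trans _ _ (enorm (x c w) ^+ 2)%:E); last first.
  by apply: ereal_sup_ubound; exists c => //; rewrite /= in_itv.
rewrite lee_fin lerXn2r ?nnegrE ?enorm_ge0//.
  by apply: le_trans (path_sup_ge 0 w); exact: enorm_ge0.
apply: ge_sup; first by exists (enorm (x (T * dense_time R 0%N) w)); exists 0%N.
by move=> _ [j _ <-]; exact: cm.
Qed.

Lemma solution_L2 s : L2m (x (ct s)).
Proof.
split; first exact: measurable_wrtT.
rewrite L2norm_lty; apply: le_lt_trans path_sup_fin; apply: Eint_le => w.
  exact: sqr_ge0.
rewrite lerXn2r ?nnegrE ?enorm_ge0 ?path_sup_ge//.
by apply: le_trans (path_sup_ge 0 w); exact: enorm_ge0.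
Qed.

Let L2B (Y Z : Omega -> 'rV[R]_d) : L2m Y -> L2m Z -> L2m (fun w => Z w - Y w).
Proof. by move=> hY hZ; apply: (submoduleB (@L2_submodule _ _ _ P d measurable _)). Qed.

Let g := fine (\int[P]_w (path_sup w ^+ 2)%:E).

Let gE : (\int[P]_w (path_sup w ^+ 2)%:E)%E = g%:E.
Proof. by rewrite /g fineK// ge0_fin_numE ?path_sup_fin// Eint_ge0// => w; exact: sqr_ge0. Qed.

Let path_sup_ge0 w : 0 <= path_sup w.
Proof. by apply: le_trans (path_sup_ge 0 w); exact: enorm_ge0. Qed.

Let dist_sup s u w : enorm (x (ct s) w - x (ct u) w) ^+ 2 <= 4 * path_sup w ^+ 2.
Proof.
have -> : 4 * path_sup w ^+ 2 = (path_sup w + path_sup w) ^+ 2 by ring.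
rewrite lerXn2r ?nnegrE ?enorm_ge0 ?addr_ge0//.
by rewrite (le_trans (enormB _ _))// lerD ?path_sup_ge.
Qed.

Lemma solution_dist_bound s u : nrm (fun w => x (ct s) w - x (ct u) w) <= 2 * Num.sqrt g.
Proof.
have h := L2B (solution_L2 u) (solution_L2 s).
have g0 : 0 <= g by rewrite -lee_fin -gE Eint_ge0// => w; exact: sqr_ge0.
rewrite ip_norm_leP//.
rewrite exprMn sqr_sqrtr// EFinM -gE.
have mp := path_sup_measurable.
have -> : 2 ^+ 2 = 4 :> R by ring.
rewrite -Eint_Z//; first last.
- by move=> w; exact: sqr_ge0.
- by meas.
by apply: Eint_le => w; [exact: sqr_ge0 | exact: dist_sup].
Qed.

(** Dominated convergence under [4 path_sup^2]. Continuity of the solution in L^2 controls the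
    argument of the coefficients that is a law, so that the coefficients along a solution are
    continuous in time and hence jointly measurable. *)
Lemma solution_dist_cvg (u : nat -> R) s : u n @[n --> \oo] --> s ->
  nrm (fun w => x (ct (u n)) w - x (ct s) w) @[n --> \oo] --> 0.
Proof.
move=> us; have mp := path_sup_measurable.
have int4 : P.-integrable setT (fun w => (4 * path_sup w ^+ 2)%:E).
  apply/integrableP; split; first by apply/measurable_EFinP; meas.
  under eq_integral do rewrite gee0_abs ?lee_fin ?mulr_ge0 ?sqr_ge0//.
  rewrite Eint_Z//; first by rewrite gE -EFinM ltry.
    by meas.
  by move=> w; exact: sqr_ge0.
have cv : (\int[P]_w (enorm (x (ct (u n)) w - x (ct s) w) ^+ 2)%:E)%E @[n --> \oo]
    --> (\int[P]_w 0%:E)%E.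
  apply: (dominated_cvg measurableT _ _ _ int4).
  - by move=> n; apply: measurable_sqr_EFin; exact: measurable_mxB.
  - move=> w _; apply/cvg_EFin; first exact: nearW.
    have h := cvgM (cx w us) (cx w us); rewrite mulr0 in h; exact: h.
  - by [].
  - by move=> n w _; rewrite gee0_abs ?lee_fin ?sqr_ge0// dist_sup.
rewrite integral0 in cv.
apply/cvgrPdist_le => e e0.
have [N NP] := cvge0_le (exprn_gt0 2 e0) cv; exists N => // n Nn.
rewrite sub0r normrN ger0_norm ?ip_norm_ge0//.
by rewrite ip_norm_leP ?(ltW e0)//; [exact: NP | apply: L2B; exact: solution_L2].
Qed.

Section coefficient.
Variables (p q : nat) (b : 'rV[R]_d -> P2 R d -> 'M[R]_(p, q)) (C : R) (mu : R -> P2 R d).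
Hypotheses (C0 : 0 <= C) (bL : lipschitz_coef P b C).
Hypothesis xmu : forall t, 0 <= t <= T -> is_law P (x t) (mu t).

Lemma coef_measurable nu (Y : Omega -> 'rV[R]_d) : is_law P Y nu -> L2m Y ->
  measurable_fun setT (fun w => b (Y w) nu).
Proof.
move=> lY hY; apply: measurable_mx => i j.
apply: (measurableT_comp (f := fun y => b y nu i j) _ (L2_measurable hY)).
apply: (@lipschitz_measurable _ _ _ C) => y y'.
have h := bL y y' lY lY hY hY.
have n0 : nrm (fun w => Y w - Y w) = 0.
  have -> : (fun w => Y w - Y w) = 0 by apply/funext => w; rewrite subrr.
  exact: (ip_norm0 (@L2_submodule _ _ _ P d measurable (fun _ => id)) (@L2inner_product _ _ _ P d)).
rewrite n0 addr0 in h; apply: le_trans h.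
by have := enorm_entry (b y' nu - b y nu) i j; rewrite !mxE.
Qed.

Lemma coef_jmeas : jmeas_mx (fun s w => b (x (ct s) w) (mu (ct s))).
Proof.
apply: measurable_mx => i j.
apply: (@jmeas_seq_continuous _ _ _ (fun s w => b (x (ct s) w) (mu (ct s)) i j)).
- by move=> s; apply: measurable_entry; apply: coef_measurable; [exact: xmu | exact: solution_L2].
- move=> w u s us.
  apply: (@cvg_of_dist _ _ _ (fun n => C * (enorm (x (ct (u n)) w - x (ct s) w) +
    nrm (fun w => x (ct (u n)) w - x (ct s) w)))).
    move=> n; have h := bL (x (ct s) w) (x (ct (u n)) w) (xmu (ctP s)) (xmu (ctP (u n)))
      (solution_L2 s) (solution_L2 (u n)).
    apply: le_trans h.
    by have := enorm_entry (b (x (ct (u n)) w) (mu (ct (u n))) - b (x (ct s) w) (mu (ct s))) i j;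
      rewrite !mxE.
  have -> : (0 : R) = C * (0 + 0) by rewrite addr0 mulr0.
  apply: cvgM; first exact: cvg_cst.
  by apply: cvgD; [exact: cx | exact: solution_dist_cvg].
- by move=> s w s0; rewrite clamp_time_neg.
Qed.

(** Comparison with the coefficient at the point 0 and the law at time 0. The distance between the
    laws is uniformly bounded in time, so [w] enters through [path_sup] only. *)
Lemma coef_bound : exists2 K : R, 0 <= K &
  forall s w, enorm (b (x (ct s) w) (mu (ct s))) <= K + C * path_sup w.
Proof.
exists (enorm (b 0 (mu (ct 0))) + C * (2 * Num.sqrt g)).
  by rewrite addr_ge0 ?enorm_ge0// !mulr_ge0// sqrtr_ge0.
move=> s w; have h := bL 0 (x (ct s) w) (xmu (ctP 0)) (xmu (ctP s)) (solution_L2 0) (solution_L2 s).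
rewrite subr0 in h.
have h1 := enormD (b (x (ct s) w) (mu (ct s)) - b 0 (mu (ct 0))) (b 0 (mu (ct 0))).
rewrite subrK in h1; apply: (le_trans h1); rewrite addrC -addrA lerD2l (le_trans h)//.
by rewrite -mulrDr ler_wpM2l// addrC lerD ?path_sup_ge ?solution_dist_bound.
Qed.

End coefficient.

End one_solution.

Variables (b0 : 'rV[R]_d -> P2 R d -> 'rV[R]_d) (b1 : 'rV[R]_d -> P2 R d -> 'M[R]_(d, m)) (C0 C1 : R).
Hypotheses (C00 : 0 <= C0) (C10 : 0 <= C1).
Hypotheses (b0L : lipschitz_coef P b0 C0) (b1L : lipschitz_coef P b1 C1).

Lemma solution_ito_process (xi : Omega -> 'rV[R]_d) (x : R -> Omega -> 'rV[R]_d) :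
  L2 P F0 xi -> mckean_vlasov_solution P T B F0 b0 b1 xi x ->
  exists2 mu : R -> P2 R d, (forall t, 0 <= t <= T -> is_law P (x t) (mu t)) &
    ito_process P T B F0 xi (fun s => x (ct s))
      (fun s w => b0 (x (ct s) w) (mu (ct s))) (fun s w => b1 (x (ct s) w) (mu (ct s))).
Proof.
move=> Lxi [xS2 [mu [I [xmu Iito xeq]]]]; exists mu => //.
have F0m : F0 `<=` measurable by case: F0i.
have mH := coef_jmeas xS2 b1L xmu.
split.
- apply: measurable_mx => i j.
  apply: (@jmeas_seq_continuous _ _ _ (fun s w => x (ct s) w i j)).
  + by move=> s; apply: measurable_entry; exact: (L2_measurable (solution_L2 xS2 s)).
  + move=> w u s us.
    apply: (@cvg_of_dist _ _ _ (fun n => enorm (x (ct (u n)) w - x (ct s) w))).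
      by move=> n; have := enorm_entry (x (ct (u n)) w - x (ct s) w) i j; rewrite !mxE.
    by apply: (clamped_cvg T0' (f := x^~ w) _ us); case: xS2.
  + by move=> s w s0; rewrite clamp_time_neg.
- exact: (coef_jmeas xS2 b0L xmu).
- exact: mH.
- by case: Lxi => mxi _; exact: (measurable_wrtW F0m mxi).
- by move=> t tT; rewrite clamp_time_id//; case: xS2 => h _ _; exact: h.
- by move=> w u s us; apply: (clamped_cvg T0' (f := x^~ w) _ us); case: xS2.
- have [K0 K00 K0P] := coef_bound xS2 C00 b0L xmu.
  have [K1 K10 K1P] := coef_bound xS2 C10 b1L xmu.
  have ms := path_sup_measurable xS2.
  have s0 w : 0 <= path_sup x w.
    by apply: le_trans (path_sup_ge xS2 0 w); exact: enorm_ge0.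
  exists (fun w => (K0 + K1) + (1 + C0 + C1) * path_sup x w); split.
  + by meas.
  + have c0 : 0 <= 2 * (1 + C0 + C1) ^+ 2 by rewrite mulr_ge0// sqr_ge0.
    apply: (@le_lt_trans _ _ (\int[P]_w (2 * (K0 + K1) ^+ 2 + 2 * (1 + C0 + C1) ^+ 2 * path_sup x w ^+ 2)%:E)%E).
      apply: Eint_le => w; first exact: sqr_ge0.
      by have := sqr_ge0 ((K0 + K1) - (1 + C0 + C1) * path_sup x w); nra.
    have m2 : measurable_fun setT (fun w => path_sup x w ^+ 2) by meas.
    rewrite Eint_D; try (by meas); try (by move=> w; rewrite mulr_ge0// sqr_ge0).
    rewrite (Eint_Z P m2)//; last by move=> w; exact: sqr_ge0.
    by rewrite Eint_cst lte_add_pinfty ?ltry// lte_mul_pinfty ?lee_fin// path_sup_fin.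
  + move=> s w; have e0 := path_sup_ge xS2 s w; have e1 := K0P s w; have e2 := K1P s w.
    have f0 := mulr_ge0 C00 (s0 w); have f1 := mulr_ge0 C10 (s0 w); have s0w := s0 w.
    by split; [apply: (le_trans e0) | apply: (le_trans e1) | apply: (le_trans e2)]; lra.
- move=> t tT; exists (I t).
    move=> e; apply: (ito_integral_at Bbm F0i e tT Iito mH) => s w sT.
    by rewrite clamp_time_id.
  have := xeq t tT; apply: filterS => w; rewrite clamp_time_id// => ->.
  congr (_ + _ + _); apply/rowP => i; rewrite !mxE; apply: eq_Rintegral => s.
  rewrite inE/= in_itv/= => /andP[s0 st]; rewrite clamp_time_id// s0 (le_trans st)//.
  by case/andP: tT.
Qed.

End solutions.

(** * Weighted second moment estimates *)

Section drift.
Context (R : realType).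
Local Notation leb := (@lebesgue_measure R).

Let leb_itv (t : R) : 0 <= t -> (leb (`[0%R, t]%classic : set R) = t%:E)%E.
Proof.
move=> t0; rewrite lebesgue_measure_itv/= lte_fin; case: ifPn => [_|].
  by rewrite -EFinD subr0.
by rewrite -leNgt => t0'; congr EFin; apply/eqP; rewrite eq_le t0 t0'.
Qed.

Let time_cst (t c : R) : 0 <= t -> (\int[leb]_(_ in `[0%R, t]) c%:E = (c * t)%:E)%E.
Proof.
move=> t0; rewrite (integral_cst leb)// EFinM; congr (_ * _)%E.
exact: leb_itv.
Qed.

Lemma time_integral_sqr (f : R -> R) (t M : R) : 0 <= t ->
  measurable_fun setT f -> (forall s, `|f s| <= M) ->
  (((\int[leb]_(s in `[0, t]) f s) ^+ 2)%:E <=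
   t%:E * \int[leb]_(s in `[0%R, t]) (f s ^+ 2)%:E)%E.
Proof.
move=> t0 mf fM; have M0 : 0 <= M by exact: le_trans (fM 0).
have mf2 : measurable_fun `[0, t]%classic (fun s => (f s ^+ 2)%:E).
  by apply/measurable_EFinP; apply: measurable_funTS; exact: measurable_funX.
have mfn : measurable_fun `[0, t]%classic (fun s => `|f s|%:E).
  by apply/measurable_EFinP; apply: measurable_funTS; exact: measurableT_comp.
have Jfin : (\int[leb]_(s in `[0%R, t]) (f s ^+ 2)%:E <= (M ^+ 2 * t)%:E)%E.
  rewrite -time_cst//; apply: ge0_integral_mono => s _; rewrite lee_fin ?sqr_ge0//.
  by rewrite -[f s ^+ 2]ger0_norm ?sqr_ge0// normrX lerXn2r ?nnegrE.
have afin : (\int[leb]_(s in `[0%R, t]) `|f s|%:E <= (M * t)%:E)%E.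
  by rewrite -time_cst//; apply: ge0_integral_mono => s _; rewrite lee_fin.
set J := (\int[leb]_(s in `[0%R, t]) (f s ^+ 2)%:E)%E in Jfin *.
set a := (\int[leb]_(s in `[0%R, t]) `|f s|%:E)%E in afin.
have JE : J = (fine J)%:E.
  rewrite fineK// ge0_fin_numE ?(le_lt_trans Jfin) ?ltry//.
  by apply: integral_ge0 => s _; rewrite lee_fin sqr_ge0.
have aE : a = (fine a)%:E.
  rewrite fineK// ge0_fin_numE ?(le_lt_trans afin) ?ltry//.
  by apply: integral_ge0 => s _; rewrite lee_fin.
have a0 : 0 <= fine a by rewrite -lee_fin -aE; apply: integral_ge0 => s _; rewrite lee_fin.
have J0 : 0 <= fine J by rewrite -lee_fin -JE; apply: integral_ge0 => s _; rewrite lee_fin sqr_ge0.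
(* Young's inequality integrated in time; the choice [c = fine a / t] made below turns it into
   Cauchy-Schwarz. *)
have key c : 0 <= c -> 2 * c * fine a <= fine J + c ^+ 2 * t.
  move=> c0; rewrite -lee_fin (EFinM (2 * c)) EFinD -aE -JE -(time_cst (c ^+ 2) t0).
  rewrite /J -ge0_integralD//.
  - rewrite /a -ge0_integralZl//.
    + apply: ge0_integral_mono => s _; rewrite -?EFinM -?EFinD lee_fin ?mulr_ge0//.
      by have := sqr_ge0 (`|f s| - c); have := real_normK (num_real (f s)); nra.
    + by rewrite lee_fin mulr_ge0.
  - by move=> s _; rewrite lee_fin sqr_ge0.
  - by move=> s _; rewrite lee_fin sqr_ge0.
have fa : `|\int[leb]_(s in `[0, t]) f s| <= fine a.
  apply: le_normr_Rintegral_nonmeas => //.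
  by rewrite (le_lt_trans afin)// ltry.
rewrite JE -EFinM lee_fin -real_normK ?num_real//.
apply: (@le_trans _ _ (fine a ^+ 2)); first by rewrite lerXn2r ?nnegrE.
move: t0; rewrite le_eqVlt => /predU1P[t0|t0].
  have := key 1 ler01; have : fine J <= 0 by rewrite -lee_fin -JE (le_trans Jfin)// -t0 mulr0.
  rewrite -t0 mulr0 mul0r addr0 mulr1 => h1 h2.
  have -> : fine a = 0 by apply/eqP; rewrite eq_le a0 andbT; lra.
  by rewrite expr0n.
have := key (fine a / t) (divr_ge0 a0 (ltW t0)).
have -> : 2 * (fine a / t) * fine a = 2 * (fine a ^+ 2 / t) by field; rewrite gt_eqF.
have -> : (fine a / t) ^+ 2 * t = fine a ^+ 2 / t by field; rewrite gt_eqF.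
move=> h; have : fine a ^+ 2 / t <= fine J by lra.
by rewrite ler_pdivrMr// mulrC.
Qed.

Lemma time_integral_pow4 (f : R -> R) (t M : R) : 0 <= t ->
  measurable_fun setT f -> (forall s, `|f s| <= M) ->
  (((\int[leb]_(s in `[0, t]) f s) ^+ 4)%:E <=
   (t ^+ 3)%:E * \int[leb]_(s in `[0%R, t]) (f s ^+ 4)%:E)%E.
Proof.
move=> t0 mf fM; have M0 : 0 <= M by exact: le_trans (fM 0).
have h1 := time_integral_sqr t0 mf fM.
have mf2 : measurable_fun setT (fun s => f s ^+ 2) by exact: measurable_funX.
have f2M s : `|f s ^+ 2| <= M ^+ 2 by rewrite normrX lerXn2r ?nnegrE.
have h2 := time_integral_sqr t0 mf2 f2M.
have JE : (\int[leb]_(s in `[0%R, t]) (f s ^+ 2)%:E)%E = (\int[leb]_(s in `[0, t]) (f s ^+ 2))%:E.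
  rewrite /Rintegral fineK// ge0_fin_numE; last first.
    by apply: integral_ge0 => s _; rewrite lee_fin sqr_ge0.
  apply: (@le_lt_trans _ _ (M ^+ 2 * t)%:E); last exact: ltry.
  rewrite -time_cst//; apply: ge0_integral_mono => s _; rewrite lee_fin ?sqr_ge0//.
  by rewrite -[f s ^+ 2]ger0_norm ?sqr_ge0.
rewrite JE -EFinM lee_fin in h1.
have J0 : 0 <= \int[leb]_(s in `[0, t]) (f s ^+ 2).
  by rewrite -lee_fin -JE; apply: integral_ge0 => s _; rewrite lee_fin sqr_ge0.
have -> : t ^+ 3 = t ^+ 2 * t by ring.
rewrite (EFinM (t ^+ 2) t) -muleA; apply: (@le_trans _ _ ((t ^+ 2)%:E *
    ((\int[leb]_(s in `[0, t]) (f s ^+ 2)) ^+ 2)%:E)%E).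
  rewrite -EFinM lee_fin (exprM _ 2 2) -exprMn lerXn2r ?nnegrE ?sqr_ge0//.
  by rewrite mulr_ge0.
rewrite lee_wpmul2l ?lee_fin ?sqr_ge0// (le_trans h2)//.
rewrite lee_wpmul2l ?lee_fin//; apply: ge0_integral_mono => s _; rewrite lee_fin.
  exact: sqr_ge0.
by rewrite -exprM.
Qed.

Context (disp : measure_display) (Omega : measurableType disp).
Variables (P : probability Omega R) (d : nat).
Variables (A : R -> Omega -> 'rV[R]_d) (G : Omega -> R).
Hypotheses (mA : jmeas_mx A) (AG : forall s w, enorm (A s w) <= G w).
Variables (t : R) (D : Omega -> 'rV[R]_d) (k : Omega -> R) (h : R -> Omega -> R).
Hypotheses (t0 : 0 <= t) (mD : measurable_fun setT D) (mk : measurable_fun setT k).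
Hypotheses (mh : jmeas h) (h0 : forall s w, 0 <= h s w) (k0 : forall w, 0 <= k w).
Hypothesis DA : {ae P, forall w, D w = \row_i \int[leb]_(s in `[0, t]) A s w 0 i}.

Let mAi w i : measurable_fun setT (fun s => A s w 0 i).
Proof. exact: (jmeas_section w (jmeas_entry 0 i mA)). Qed.

Let AiG w i s : `|A s w 0 i| <= G w.
Proof. by rewrite (le_trans (enorm_entry _ _ _)). Qed.

Lemma drift_sqr : (forall s w, 0 <= s <= t -> k w * enorm (A s w) ^+ 2 <= h s w) ->
  (\int[P]_w (k w * enorm (D w) ^+ 2)%:E <= t%:E * dint P t h)%E.
Proof.
move=> kh; rewrite /dint -ge0_integralZl//; first last.
- by move=> w _; apply: integral_ge0 => s _; rewrite lee_fin.
- exact: Eint_time_measurable.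
have mI := Eint_time_measurable (measurable_itv `[0, t]) mh (fun s w _ => h0 s w).
apply: ae_ge0_le_integral => //.
- by move=> w _; rewrite lee_fin mulr_ge0// sqr_ge0.
- apply/measurable_EFinP; apply: measurable_funM => //.
  exact: measurable_enorm_sqr_comp.
- by move=> w _; rewrite mule_ge0 ?lee_fin//; apply: integral_ge0 => s _; rewrite lee_fin.
- by apply: measurable_funeM.
apply: filterS DA => w -> _.
rewrite enorm_sqr big_ord1.
apply: (@le_trans _ _ ((k w)%:E * (t%:E * \sum_(j < d) \int[leb]_(s in `[0%R, t]) (A s w 0%R j ^+ 2)%:E))%E).
  rewrite EFinM lee_wpmul2l ?lee_fin// -sumEFin ge0_sume_distrr; last first.
    by move=> j _; apply: integral_ge0 => s _; rewrite lee_fin sqr_ge0.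
  by apply: lee_sum => j _; rewrite mxE; exact: time_integral_sqr.
rewrite muleCA lee_wpmul2l ?lee_fin// -ge0_integral_sum//; first last.
- by move=> j s _; rewrite lee_fin sqr_ge0.
- by move=> j; apply/measurable_EFinP; apply: measurable_funTS; exact: (measurable_funX _ (mAi w j)).
rewrite -ge0_integralZl//; first last.
- by rewrite lee_fin.
- by move=> s _; apply: sume_ge0 => j _; rewrite lee_fin sqr_ge0.
- apply: emeasurable_sum => j; apply/measurable_EFinP; apply: measurable_funTS.
  exact: (measurable_funX _ (mAi w j)).
apply: ge0_integral_mono => s; rewrite /= in_itv/= => st; rewrite sumEFin -EFinM lee_fin.
  by rewrite mulr_ge0// sumr_ge0// => j _; exact: sqr_ge0.
by have := kh s w st; rewrite enorm_sqr big_ord1.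
Qed.

(** The weight [k] is frozen while [h] varies with time: in the application [k] contains the
    localising indicator at the final time and [h] the one at the current time, which is larger. Two
    uses of Cauchy-Schwarz in time give [t^3], and the sum over coordinates gives [d]. *)
Lemma drift_pow4 : (forall s w, 0 <= s <= t -> k w * enorm (A s w) ^+ 4 <= h s w) ->
  (\int[P]_w (k w * enorm (D w) ^+ 4)%:E <= (d%:R * t ^+ 3)%:E * dint P t h)%E.
Proof.
move=> kh; have c0 : 0 <= d%:R * t ^+ 3 by rewrite mulr_ge0// exprn_ge0.
rewrite /dint -ge0_integralZl//; first last.
- by move=> w _; apply: integral_ge0 => s _; rewrite lee_fin.
- exact: Eint_time_measurable.
have mI := Eint_time_measurable (measurable_itv `[0, t]) mh (fun s w _ => h0 s w).
apply: ae_ge0_le_integral => //.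
- by move=> w _; rewrite lee_fin mulr_ge0// exprn_ge0// enorm_ge0.
- apply/measurable_EFinP; apply: measurable_funM => //.
  by apply: measurable_funX; exact: measurable_enorm.
- by move=> w _; rewrite mule_ge0 ?lee_fin//; apply: integral_ge0 => s _; rewrite lee_fin.
- by apply: measurable_funeM.
apply: filterS DA => w -> _.
have e4 (x : R) : 0 <= x ^+ 4 by rewrite exprn_even_ge0.
rewrite (exprM _ 2 2) enorm_sqr big_ord1.
set D' := fun j : 'I_d => \int[leb]_(s in `[0, t]) A s w 0 j.
have -> : \sum_j (\row_i \int[leb]_(s in `[0, t]) A s w 0 i) ord0 j ^+ 2 = \sum_j D' j ^+ 2.
  by apply: eq_bigr => j _; rewrite mxE.
have hs := sqr_sum_le (fun j => D' j ^+ 2).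
apply: (@le_trans _ _ ((k w)%:E * (d%:R%:E * ((t ^+ 3)%:E * \sum_(j < d) \int[leb]_(s in `[0%R, t]) (A s w 0%R j ^+ 4)%:E)))%E).
  rewrite EFinM lee_wpmul2l ?lee_fin// (le_trans (_ : _ <= (d%:R * \sum_j D' j ^+ 4)%:E)%E)//.
    rewrite lee_fin (le_trans hs)// ler_wpM2l//; apply: ler_sum => j _.
    by rewrite -exprM.
  rewrite EFinM lee_wpmul2l ?lee_fin// -sumEFin ge0_sume_distrr; last first.
    by move=> j _; apply: integral_ge0 => s _; rewrite lee_fin.
  by apply: lee_sum => j _; exact: time_integral_pow4.
rewrite (muleA d%:R%:E) -EFinM muleCA lee_wpmul2l ?lee_fin// -ge0_integral_sum//; first last.
- by move=> j s _; rewrite lee_fin.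
- by move=> j; apply/measurable_EFinP; apply: measurable_funTS; exact: (measurable_funX _ (mAi w j)).
rewrite -ge0_integralZl//; first last.
- by rewrite lee_fin.
- by move=> s _; apply: sume_ge0 => j _; rewrite lee_fin.
- apply: emeasurable_sum => j; apply/measurable_EFinP; apply: measurable_funTS.
  exact: (measurable_funX _ (mAi w j)).
apply: ge0_integral_mono => s; rewrite /= in_itv/= => st; rewrite sumEFin -EFinM lee_fin.
  by rewrite mulr_ge0// sumr_ge0.
apply: le_trans (kh s w st); rewrite ler_wpM2l//.
have n2 j : A s w 0 j ^+ 2 <= enorm (A s w) ^+ 2.
  by rewrite -real_normK ?num_real// lerXn2r ?nnegrE ?enorm_ge0 ?enorm_entry.
rewrite (exprM (enorm _) 2 2) expr2 {1}enorm_sqr big_ord1 mulr_suml; apply: ler_sum => j _.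
by rewrite (exprM _ 2 2) expr2 ler_wpM2l// sqr_ge0.
Qed.

End drift.

(** Arithmetic common to the two Gronwall arguments: [z], [x] and [y] are the moments of the initial
    value, the drift and the stochastic integral, and [i] is the time integral of the unknown
    moment. Distributivity is checked by cases, since [i] may be infinite at this stage. *)
Lemma combine_estimates (R : realType) (c s T M K e0 e1 : R) (i z x y p q : \bar R) :
  0 < c -> 0 <= s -> s <= T -> 0 <= M -> 0 <= K -> 0 <= e1 -> (0 <= i)%E -> (z <= e0%:E)%E ->
  (x <= s%:E * p)%E -> (y <= M%:E * q)%E ->
  (p <= K%:E * i + e1%:E)%E -> (q <= K%:E * i + e1%:E)%E ->
  (c%:E * z + (c%:E * x + c%:E * y) <=
   (c * e0 + c * (T + M) * e1)%:E + (c * (T + M) * K)%:E * i)%E.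
Proof.
move=> c0 s0 sT M0 K0 e10 i0 ze xp yq pe qe.
have r0 : (0 <= K%:E * i + e1%:E)%E by rewrite adde_ge0 ?lee_fin// mule_ge0.
have xT : (x <= T%:E * (K%:E * i + e1%:E))%E.
  apply: (le_trans xp); apply: (le_trans (lee_wpmul2l _ pe)); first by rewrite lee_fin.
  by apply: lee_wpmul2r => //; rewrite lee_fin.
have yM : (y <= M%:E * (K%:E * i + e1%:E))%E.
  by apply: (le_trans yq); apply: lee_wpmul2l => //; rewrite lee_fin.
have T0 := le_trans s0 sT; have t3 : (0 <= c%:E :> \bar R)%E by rewrite lee_fin ltW.
apply: (le_trans (leeD (lee_wpmul2l t3 ze) (leeD (lee_wpmul2l t3 xT) (lee_wpmul2l t3 yM)))).
case: i i0 {r0 xT yM pe qe} => [i| |]// i0; first by rewrite -!(EFinM, EFinD) lee_fin; lra.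
rewrite le_eqVlt in K0; case/predU1P: K0 => [<-|K0].
  by rewrite mulr0 !mul0e !add0e adde0 -!(EFinM, EFinD) lee_fin; lra.
rewrite le_eqVlt in T0; case/predU1P: T0 => [<-|T0].
  rewrite le_eqVlt in M0; case/predU1P: M0 => [<-|M0].
    by rewrite addr0 mulr0 !mul0r !mul0e !mule0 !adde0 addr0.
  by rewrite [X in (_ <= _ + X)%E]gt0_muley ?lte_fin ?mulr_gt0 ?add0r// addeC/= leey.
by rewrite [X in (_ <= _ + X)%E]gt0_muley ?lte_fin ?mulr_gt0// ?ltr_wpDr//= leey.
Qed.

(** * Weighted second moments of an Ito process *)

Section gronwall_estimates.
Context (R : realType) (disp : measure_display) (Omega : measurableType disp).
Variables (P : probability Omega R) (T : R) (d m : nat).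
Variables (B : R -> Omega -> 'rV[R]_m) (F0 : set (set Omega)).
Hypotheses (T0 : 0 < T).
Hypotheses (Bbm : brownian_motion P T B) (F0i : initial_sigma_algebra P T B F0).
Local Notation F := (filtration B F0).
Local Notation leb := (@lebesgue_measure R).

(** Gronwall's lemma with [a = 3 e0 + 3 (T + 132 m) T e1] and rate [3 (T + 132 m) K]: 3 from
    squaring a sum of three terms, [T] from the drift, [132 m] from Ito's isometry. Gronwall's
    factor [2 a] turns 3 into 6. *)
Definition gronwall2_const (K : R) : R :=
  6 * (1 + (T + 132 * m%:R) * T) * expR (2 * (3 * (T + 132 * m%:R) * K) * T).

Lemma enorm_rows_sqr (H : 'M[R]_(d, m)) : \sum_e enorm (row e H) ^+ 2 = enorm H ^+ 2.
Proof.
rewrite enorm_sqr; apply: eq_bigr => e _; rewrite enorm_sqr big_ord1.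
by apply: eq_bigr => l _; rewrite mxE.
Qed.

Lemma jmeas_mx_time (p q : nat) (V : R -> Omega -> 'M[R]_(p, q)) s :
  jmeas_mx V -> measurable_fun setT (V s).
Proof.
move=> mV; apply: measurable_mx => i e.
exact: (jmeas_time s (jmeas_entry i e mV)).
Qed.

(** [D] is defined as [Z s - Z0 - U], so that the decomposition holds everywhere and [D] is
    measurable at once; only its identification with the time integral is almost sure. *)
Lemma itp_decomposition (Z0 : Omega -> 'rV[R]_d) (Z A : R -> Omega -> 'rV[R]_d)
    (H : R -> Omega -> 'M[R]_(d, m)) s :
  ito_process P T B F0 Z0 Z A H -> 0 <= s <= T ->
  exists D U : Omega -> 'rV[R]_d, [/\ measurable_fun setT D, measurable_fun setT U,
    {ae P, forall w, D w = \row_i \int[leb]_(r in `[0, s]) A r w 0 i},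
    forall e, ito_at P B F0 s (fun r w => row e (H r w)) (fun w => U w 0 e) &
    forall w, Z s w = Z0 w + D w + U w].
Proof.
move=> itp sT; have [U HU Ueq] := itp_eq itp sT.
have mU : measurable_fun setT U.
  by apply: measurable_mx => i e; rewrite (ord1 i); case: (HU e).
exists (fun w => Z s w - Z0 w - U w), U; split=> //.
- apply: measurable_mxB => //; apply: measurable_mxB; last exact: itp_Z0 itp.
  exact: jmeas_mx_time (itp_Z itp).
- apply: filterS Ueq => w ->.
  by rewrite [X in X - _]addrAC addrK [X in X - _]addrC addrK.
- by move=> w; rewrite -addrA subrK addrC subrK.
Qed.

(** Drift and diffusion are bounded in weighted mean at each time, not pointwise, because the mean
    field terms depend on the law of [Z]. Splitting [Z] into its three parts gives the inequality
    for [gronwall], and the dominating function of the process the required a priori bound. *)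
Lemma weighted_L2_estimate (Z0 : Omega -> 'rV[R]_d) (Z A : R -> Omega -> 'rV[R]_d)
    (H : R -> Omega -> 'M[R]_(d, m)) (rho : Omega -> R) (K e0 e1 : R) :
  ito_process P T B F0 Z0 Z A H ->
  measurable_fun (setT : set (g_sigma_algebraType F0)) rho ->
  (forall w, 0 <= rho w <= 1) -> 0 < K -> 0 <= e0 -> 0 <= e1 ->
  (\int[P]_w (rho w * enorm (Z0 w) ^+ 2)%:E <= e0%:E)%E ->
  (forall s, 0 <= s <= T -> (\int[P]_w (rho w * enorm (A s w) ^+ 2)%:E <=
     K%:E * \int[P]_w (rho w * enorm (Z s w) ^+ 2)%:E + e1%:E)%E) ->
  (forall s, 0 <= s <= T -> (\int[P]_w (rho w * enorm (H s w) ^+ 2)%:E <=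
     K%:E * \int[P]_w (rho w * enorm (Z s w) ^+ 2)%:E + e1%:E)%E) ->
  forall t, 0 <= t <= T ->
    (\int[P]_w (rho w * enorm (Z t w) ^+ 2)%:E <= (gronwall2_const K * (e0 + e1))%:E)%E.
Proof.
move=> itp mrho rho01 K0 e00 e10 EZ0 EA EH.
have rho0 w : 0 <= rho w by case/andP: (rho01 w).
have T0' := ltW T0.
have mrho' : measurable_fun setT rho.
  by apply: (Fmeas_measurable Bbm F0i (t := T)) => //; exact: F0_Fmeas.
have [G [mG Gf GP]] := itp_dominated itp.
have G0 w : 0 <= G w by case: (GP 0 w) => h _ _; exact: le_trans (enorm_ge0 _) h.
have jw (p q : nat) (V : R -> Omega -> 'M[R]_(p, q)) : jmeas_mx V ->
    jmeas (fun s w => rho w * enorm (V s w) ^+ 2).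
  move=> mV; apply: measurable_funM; first exact: jmeas_snd.
  exact: measurable_enorm_sqr_comp.
have w0 (p q : nat) (V : R -> Omega -> 'M[R]_(p, q)) s w : 0 <= rho w * enorm (V s w) ^+ 2.
  by rewrite mulr_ge0// sqr_ge0.
pose u t := (\int[P]_w (rho w * enorm (Z t w) ^+ 2)%:E)%E.
have dE (p q : nat) (V : R -> Omega -> 'M[R]_(p, q)) t : jmeas_mx V -> 0 <= t <= T ->
   (forall s, 0 <= s <= T -> (\int[P]_w (rho w * enorm (V s w) ^+ 2)%:E <= K%:E * u s + e1%:E)%E) ->
   (dint P t (fun s w => (rho w * enorm (V s w) ^+ 2)%R) <=
    K%:E * (\int[leb]_(s in `[0%R, t]) u s) + (e1 * T)%:E)%E.
  move=> mV /andP[t0 tT] EV.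
  rewrite dint_swap//; last exact: jw.
  apply: (@le_trans _ _ (dint P t (fun s w => (K * (rho w * enorm (Z s w) ^+ 2) + e1)%R))).
    rewrite (@dint_swap _ _ _ P t (fun s w => K * (rho w * enorm (Z s w) ^+ 2) + e1)); first last.
    - by move=> s w; rewrite addr_ge0// mulr_ge0// ltW.
    - apply: measurable_funD; last exact: measurable_cst.
      apply: measurable_funM; first exact: measurable_cst.
      by apply: jw; exact: itp_Z itp.
    apply: ge0_integral_mono => s; rewrite /= in_itv/= => /andP[s0 st]; first exact: Eint_ge0.
    have sT : 0 <= s <= T by rewrite s0 (le_trans st).
    have mZs : measurable_fun setT (fun w => rho w * enorm (Z s w) ^+ 2).
      exact: (jmeas_time s (jw _ _ Z (itp_Z itp))).
    rewrite Eint_D; first last.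
    - by move=> w.
    - by move=> w; rewrite mulr_ge0// ltW.
    - exact: measurable_cst.
    - by apply: measurable_funM => //; exact: measurable_cst.
    rewrite Eint_cst (Eint_Z P mZs)//; last exact: ltW.
    exact: EV.
  have jZ := jw _ _ Z (itp_Z itp).
  rewrite dint_D; first last.
  - by move=> s w.
  - by move=> s w; rewrite mulr_ge0// ltW.
  - exact: measurable_cst.
  - by apply: measurable_funM => //; exact: measurable_cst.
  rewrite (dint_Z P t jZ)//; last exact: ltW.
  rewrite (dint_swap P t jZ)//; apply: leeD => //.
  rewrite /dint -(Eint_cst P (e1 * T)); apply: ge0_integral_mono => w _.
    by apply: integral_ge0 => s _; rewrite lee_fin.
  rewrite (integral_cst leb)// EFinM lee_wpmul2l ?lee_fin//.
  suff : (leb (`[0%R, t]%classic : set R) <= T%:E)%E by [].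
  rewrite lebesgue_measure_itv/= lte_fin; case: ifP => _; last by rewrite lee_fin.
  by rewrite -EFinD subr0 lee_fin.
pose a := 3 * e0 + 3 * (T + 132 * m%:R) * (e1 * T).
pose K' := 3 * (T + 132 * m%:R) * K.
have c0 : 0 < T + 132 * m%:R by rewrite ltr_wpDr// mulr_ge0.
have c0' : 0 <= 3 * (T + 132 * m%:R) by rewrite mulr_ge0// ltW.
have K'0 : 0 < K' by rewrite !mulr_gt0.
have e1T : 0 <= e1 * T by rewrite mulr_ge0.
have a0 : 0 <= a by rewrite addr_ge0 ?mulr_ge0// ltW.
move=> t tT.
have gM : forall s, 0 <= s <= T -> (u s <= (fine (\int[P]_w (G w ^+ 2)%:E))%:E)%E.
  move=> s sT; rewrite fineK; last first.
    by rewrite ge0_fin_numE// Eint_ge0// => w; exact: sqr_ge0.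
  apply: Eint_le => w //; have [h1 _ _] := GP s w.
  have h2 : enorm (Z s w) ^+ 2 <= G w ^+ 2 by rewrite lerXn2r ?nnegrE ?enorm_ge0.
  apply: le_trans h2; rewrite ler_piMl ?sqr_ge0//; by case/andP: (rho01 w).
have u0 s : 0 <= s <= T -> (0 <= u s)%E by move=> _; exact: Eint_ge0.
have rec s : 0 <= s <= T -> (u s <= a%:E + K'%:E * \int[leb]_(r in `[0%R, s]) u r)%E.
  move=> sT; have /andP[s0 sT'] := sT.
  have [D [U [mD mU DA HU ZE]]] := itp_decomposition itp sT.
  have mZ0 := itp_Z0 itp.
  have ED := drift_sqr (itp_A itp) (fun s w => let: And3 _ h _ := GP s w in h) s0 mD mrho'
    (jw _ _ A (itp_A itp)) (w0 _ _ A) rho0 DA (fun r w _ => lexx _).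
  have EU : (\int[P]_w (rho w * enorm (U w) ^+ 2)%:E <=
      (132 * m%:R)%:E * dint P s (fun r w => (rho w * enorm (H r w) ^+ 2)%R))%E.
    have -> : (fun r w => rho w * enorm (H r w) ^+ 2) =
        (fun r w => \sum_e rho w * enorm (row e (H r w)) ^+ 2).
      by apply/funext => r; apply/funext => w; rewrite -mulr_sumr enorm_rows_sqr.
    rewrite (dint_sum P s (index_enum _) (f := fun e r w => rho w * enorm (row e (H r w)) ^+ 2)); first last.
    - by move=> e r w; rewrite mulr_ge0// sqr_ge0.
    - move=> e; apply: (jw _ _ (fun r w => row e (H r w))); apply: measurable_mx => i l.
      under eq_fun do rewrite mxE.
      exact: (jmeas_entry e l (itp_H itp)).
    have -> : (\int[P]_w (rho w * enorm (U w) ^+ 2)%:E =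
        \sum_e \int[P]_w (rho w * U w 0%R e ^+ 2)%:E)%E.
      rewrite -(Eint_sum P (index_enum _) (f := fun e w => rho w * U w 0 e ^+ 2)).
      - by apply: eq_integral => w _; rewrite enorm_sqr big_ord1 mulr_sumr.
      - by move=> e; case: (HU e) => _ mUe _; meas.
      - by move=> e w; rewrite mulr_ge0// sqr_ge0.
    rewrite ge0_sume_distrr; last first.
      by move=> e _; apply: dint_ge0 => r w _; rewrite mulr_ge0// sqr_ge0.
    by apply: lee_sum => e _; exact: (ito_L2_le Bbm F0i sT (HU e) mrho rho01).
  have mz0 : measurable_fun setT (fun w => rho w * enorm (Z0 w) ^+ 2).
    by apply: measurable_funM => //; exact: measurable_enorm_sqr_comp.
  have md : measurable_fun setT (fun w => rho w * enorm (D w) ^+ 2).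
    by apply: measurable_funM => //; exact: measurable_enorm_sqr_comp.
  have mu : measurable_fun setT (fun w => rho w * enorm (U w) ^+ 2).
    by apply: measurable_funM => //; exact: measurable_enorm_sqr_comp.
  have p0 (V : Omega -> 'rV[R]_d) w : 0 <= rho w * enorm (V w) ^+ 2 by rewrite mulr_ge0// sqr_ge0.
  apply: (@le_trans _ _ (\int[P]_w (3 * (rho w * enorm (Z0 w) ^+ 2) +
     (3 * (rho w * enorm (D w) ^+ 2) + 3 * (rho w * enorm (U w) ^+ 2)))%:E)%E).
    apply: Eint_le => w //; rewrite !(mulrCA 3) -!mulrDr ler_wpM2l//.
    have n1 : enorm (Z s w) <= enorm (Z0 w) + enorm (D w) + enorm (U w).
      by rewrite ZE (le_trans (enormD _ _))// lerD2r enormD.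
    have n2 := enorm_ge0 (Z s w); have n3 := enorm_ge0 (Z0 w).
    have n4 := enorm_ge0 (D w); have n5 := enorm_ge0 (U w).
    move: n1 n2 n3 n4 n5; move: (enorm (Z s w)) (enorm (Z0 w)) (enorm (D w)) (enorm (U w)).
    move=> x y z v h1 h2 h3 h4 h5.
    have h6 : x ^+ 2 <= (y + z + v) ^+ 2 by rewrite lerXn2r ?nnegrE// !addr_ge0.
    by have := sqr_ge0 (y - z); have := sqr_ge0 (z - v); have := sqr_ge0 (y - v); nra.
  rewrite Eint_D; first last.
  - by move=> w; rewrite addr_ge0// mulr_ge0.
  - by move=> w; rewrite mulr_ge0.
  - by meas.
  - by meas.
  rewrite (Eint_D P (f := fun w => 3 * (rho w * enorm (D w) ^+ 2))); first last.
  - by move=> w; rewrite mulr_ge0.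
  - by move=> w; rewrite mulr_ge0.
  - by meas.
  - by meas.
  rewrite (Eint_Z P mz0)// (Eint_Z P md)// (Eint_Z P mu)//.
  have i0 : (0 <= \int[leb]_(r in `[0%R, s]) u r)%E.
    by apply: integral_ge0 => r _; exact: Eint_ge0.
  have dA := dE _ _ A s (itp_A itp) sT EA; have dH := dE _ _ H s (itp_H itp) sT EH.
  exact: (combine_estimates (ltr0n _ 3) s0 sT' (mulr_ge0 (ler0n _ _) (ler0n _ _)) (ltW K0) e1T i0 EZ0 ED EU dA dH).
have := gronwall a0 K'0 u0 gM rec tT.
move/le_trans; apply; rewrite lee_fin.
have /andP[t0 tT'] := tT.
have e1' : 1 <= expR (2 * K' * t) by rewrite expR_ge1_nneg// !mulr_ge0// ltW.
have e2 : expR (2 * K' * t) <= expR (2 * K' * T) by rewrite ler_expR ler_wpM2l// mulr_ge0// ltW.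
have q0 : 0 <= (T + 132 * m%:R) * T by rewrite mulr_ge0// ltW.
have -> : gronwall2_const K * (e0 + e1) =
    (6 * (1 + (T + 132 * m%:R) * T) * (e0 + e1)) * expR (2 * K' * T).
  by rewrite /gronwall2_const -/K'; ring.
apply: ler_pM => //; first by rewrite mulr_ge0.
by rewrite /a; have := mulr_ge0 q0 e00; lra.
Qed.

End gronwall_estimates.

(** * Weighted fourth moment estimates *)

Section localisation.
Context (R : realType) (disp : measure_display) (Omega : measurableType disp).
Variables (T : R) (d m : nat) (B : R -> Omega -> 'rV[R]_m) (F0 : set (set Omega)).
Variables (Z : R -> Omega -> 'rV[R]_d) (N : R).
Hypotheses (mZ : jmeas_mx Z) (cZ : forall w, seq_continuous (Z^~ w)).
Hypothesis aZ : forall t, 0 <= t <= T -> measurable_wrt (filtration B F0 t) (Z t).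

(* By path continuity this is the indicator of [|Z_u| <= N for all u in [0, s]];
   quantifying over a countable set of times makes it measurable. *)
Definition stays_below (s : R) : Omega -> R :=
  \1_[set w | forall j, enorm (Z (Num.max 0 s * dense_time R j) w) <= N].

Lemma stays_below01 s w : stays_below s w = 0 \/ stays_below s w = 1.
Proof. by rewrite /stays_below indicE; case: (_ \in _); [right | left]. Qed.

Lemma stays_belowP s w : 0 <= s -> stays_below s w = 1 ->
  forall u, 0 <= u <= s -> enorm (Z u w) <= N.
Proof.
move=> s0; rewrite /stays_below indicE; case: (boolP (_ \in _)) => [|_ /esym/eqP]; last first.
  by rewrite oner_eq0.
rewrite inE/= max_r// => h _; apply: (dense_time_le s0) => //.
by move=> v t vt; exact: (seq_continuous_enorm (cZ w) vt).
Qed.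

Lemma stays_below_eq1 s w : (forall u, enorm (Z u w) <= N) -> stays_below s w = 1.
Proof. by move=> h; rewrite /stays_below indicE mem_set. Qed.

Lemma stays_below_dec s s' w : s <= s' -> stays_below s' w <= stays_below s w.
Proof.
move=> ss'; have [->|h] := stays_below01 s' w.
  by have [->|->] := stays_below01 s w.
suff -> : stays_below s w = 1 by rewrite h.
have [s'0|s'0] := leP 0 s'; last first.
  have e : Num.max 0 s = Num.max 0 s' by rewrite !max_l// ltW// (le_lt_trans ss').
  by rewrite -h /stays_below e.
rewrite /stays_below indicE mem_set//= => j.
apply: (stays_belowP s'0 h); have /andP[q0 q1] := dense_time01 R j.
rewrite mulr_ge0 ?le_max ?lexx//=; apply: (@le_trans _ _ (Num.max 0 s)).
  by rewrite ler_piMr// le_max lexx.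
by rewrite ge_max s'0.
Qed.

Lemma stays_below_Fmeas s : 0 <= s <= T -> Fmeas B F0 s (stays_below s).
Proof.
move=> /andP[s0 sT]; apply: measurable_indic; rewrite max_r//.
have -> : [set w | forall j, enorm (Z (s * dense_time R j) w) <= N] =
    \bigcap_j [set w | enorm (Z (s * dense_time R j) w) <= N].
  by apply/seteqP; split => w /= h j; [move=> _; exact: h | exact: (h j I)].
apply: bigcapT_measurable => j.
have /andP[q0 q1] := dense_time01 R j.
have p0 : 0 <= s * dense_time R j by rewrite mulr_ge0.
have ps : s * dense_time R j <= s by rewrite ler_piMr.
have h : Fmeas B F0 s (fun w => enorm (Z (s * dense_time R j) w)).
  apply: (Fmeas_mono ps); apply: measurable_enorm; apply: aZ.
  by rewrite p0 (le_trans ps).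
have := h measurableT `]-oo, N]%classic (measurable_itv _); rewrite setTI.
by congr measurable; apply/seteqP; split => w /=; rewrite in_itv.
Qed.

Lemma stays_below_jmeas : jmeas stays_below.
Proof.
rewrite /jmeas; pose E := \bigcap_j [set z : measurableTypeR R * Omega |
  enorm (Z (Num.max 0 z.1 * dense_time R j) z.2) <= N].
have -> : (fun z : measurableTypeR R * Omega => stays_below z.1 z.2) = \1_E.
  apply/funext => z; rewrite /stays_below !indicE; congr (_%:R); congr nat_of_bool.
  apply/idP/idP; rewrite !inE /E => h j; [move=> _; exact: h | exact: (h j I)].
apply: measurable_indic; apply: bigcapT_measurable => j.
have mj : measurable_fun (setT : set (measurableTypeR R * Omega))
    (fun z => (Num.max 0 z.1 * dense_time R j : measurableTypeR R, z.2)).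
  apply: measurable_fun_pair; last exact: measurable_snd.
  apply: measurable_funM; last exact: measurable_cst.
  by apply: measurable_maxr; [exact: measurable_cst | exact: measurable_fst].
have h := measurable_enorm (measurableT_comp mZ mj).
have := h measurableT `]-oo, N]%classic (measurable_itv _); rewrite setTI.
by congr measurable; apply/seteqP; split => w /=; rewrite in_itv.
Qed.

End localisation.

(** * Gronwall's argument for localised fourth moments *)

Section fourth_moment.
Context (R : realType) (disp : measure_display) (Omega : measurableType disp).
Variables (P : probability Omega R) (T : R) (d m : nat).
Variables (B : R -> Omega -> 'rV[R]_m) (F0 : set (set Omega)).
Hypotheses (T0 : 0 < T).
Hypotheses (Bbm : brownian_motion P T B) (F0i : initial_sigma_algebra P T B F0).
Local Notation F := (filtration B F0).
Local Notation leb := (@lebesgue_measure R).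

Lemma ito4_const_ge0 : 0 <= ito4_const T m.
Proof.
exact: (mulr_ge0 (moment4_const_ge0 m (ltW T0)) (expR_ge0 _)).
Qed.

(** Two uses of [(x + y)^4 <= 8 x^4 + 8 y^4] give 64, doubled by Gronwall; [8 K^4] comes from
    [(K (z + 1))^4]. [M] dominates the constants of the drift and of the stochastic integral, and
    its summand 1 keeps it positive even for [d = 0]. *)
Definition gronwall4_const (K : R) : R :=
  let M := 1 + d%:R * T ^+ 3 + 128 * ito4_const T m * d%:R in
  128 * (1 + M * (8 * K ^+ 4 * T)) * expR (2 * (64 * M * (8 * K ^+ 4)) * T).

Let e4 (x : R) : 0 <= x ^+ 4. Proof. by rewrite exprn_even_ge0. Qed.

(* Finiteness of the weighted fourth moment is part of the conclusion, so Gronwall is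
   applied to [Z] killed when it exceeds [N], uniformly in [N]. *)
Lemma weighted_L4_estimate (Z0 : Omega -> 'rV[R]_d) (Z A : R -> Omega -> 'rV[R]_d)
    (H : R -> Omega -> 'M[R]_(d, m)) (rho : Omega -> R) (K e0 : R) :
  ito_process P T B F0 Z0 Z A H ->
  measurable_fun (setT : set (g_sigma_algebraType F0)) rho ->
  (forall w, 0 <= rho w <= 1) -> 0 < K -> 0 <= e0 ->
  (\int[P]_w (rho w * enorm (Z0 w) ^+ 4)%:E <= e0%:E)%E ->
  (forall s w, 0 <= s <= T -> enorm (A s w) <= K * (enorm (Z s w) + 1)) ->
  (forall s w, 0 <= s <= T -> enorm (H s w) <= K * (enorm (Z s w) + 1)) ->
  forall t, 0 <= t <= T ->
    (\int[P]_w (rho w * enorm (Z t w) ^+ 4)%:E <= (gronwall4_const K * (e0 + 1))%:E)%E.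
Proof.
move=> itp mrho rho01 K0 e00 EZ0 EA EH.
have rho0 w : 0 <= rho w by case/andP: (rho01 w).
have T0' := ltW T0.
have mrho' : measurable_fun setT rho.
  by apply: (Fmeas_measurable Bbm F0i (t := T)) => //; exact: F0_Fmeas.
have [G [mG Gf GP]] := itp_dominated itp.
have mZ := itp_Z itp; have cZ := itp_continuous itp; have aZ := itp_adapted itp.
have n4 (p q : nat) (V : 'M[R]_(p, q)) : 0 <= enorm V ^+ 4 by rewrite exprn_ge0// enorm_ge0.
move=> t tT.
pose chi N := stays_below Z (N : R).
have chi0 N s w : 0 <= chi N s w by case: (stays_below01 Z N s w) => h; rewrite /chi h.
have chi1 N s w : chi N s w <= 1 by case: (stays_below01 Z N s w) => h; rewrite /chi h.
have jchi N : jmeas (chi N) by exact: stays_below_jmeas.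
have mchi N s : measurable_fun setT (chi N s) by exact: jmeas_time.
(* The whole path at [w] is bounded by [G w], so the indicator is 1 as soon as [N] exceeds [G w];
   Fatou's lemma then removes the localisation. *)
suff main (N : nat) : (\int[P]_w (rho w * (chi N%:R t w * enorm (Z t w) ^+ 4))%:E <=
    (gronwall4_const K * (e0 + 1))%:E)%E.
  apply: (@fatou_ae_le _ _ _ P (fun (n : nat) w => (rho w * (chi n%:R t w * enorm (Z t w) ^+ 4))%:E)) => //.
  - move=> n; apply/measurable_EFinP; have h := mchi n%:R t.
    have h' := measurable_enorm (jmeas_mx_time t mZ); by meas.
  - apply/measurable_EFinP; have h' := measurable_enorm (jmeas_mx_time t mZ); by meas.
  - by move=> n w; rewrite lee_fin mulr_ge0// mulr_ge0.
  - by move=> w; rewrite lee_fin mulr_ge0.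
  - apply: aeW => w; apply: cvg_near_cst.
    exists (Num.truncn (G w)).+1 => // n /= Gn; congr EFin; congr (_ * _).
    rewrite [chi _ _ _]stays_below_eq1 ?mul1r// => u.
    have [h _ _] := GP u w; apply: (le_trans h); apply: ltW.
    by apply: lt_le_trans (truncnS_gt (G w)) _; rewrite ler_nat.
set N' : R := N%:R; have N0 : 0 <= N' by rewrite ler0n.
have jw (p q : nat) (V : R -> Omega -> 'M[R]_(p, q)) : jmeas_mx V ->
    jmeas (fun s w => rho w * (chi N' s w * enorm (V s w) ^+ 4)).
  move=> mV; apply: measurable_funM; first exact: jmeas_snd.
  apply: measurable_funM; first exact: jchi.
  by apply: measurable_funX; exact: measurable_enorm.
have w0 (p q : nat) (V : R -> Omega -> 'M[R]_(p, q)) s w :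
  0 <= rho w * (chi N' s w * enorm (V s w) ^+ 4) by rewrite mulr_ge0// mulr_ge0.
pose u t := (\int[P]_w (rho w * (chi N' t w * enorm (Z t w) ^+ 4))%:E)%E.
pose K4 := 8 * K ^+ 4.
have K40 : 0 < K4 by rewrite mulr_gt0// exprn_gt0.
have dE (p q : nat) (V : R -> Omega -> 'M[R]_(p, q)) s : jmeas_mx V -> 0 <= s <= T ->
   (forall r w, 0 <= r <= T -> enorm (V r w) <= K * (enorm (Z r w) + 1)) ->
   (dint P s (fun r w => (rho w * (chi N' r w * enorm (V r w) ^+ 4))%R) <=
    K4%:E * (\int[leb]_(r in `[0%R, s]) u r) + (K4 * T)%:E)%E.
  move=> mV /andP[s0 sT] EV.
  have jZ := jw _ _ Z mZ.
  apply: (@le_trans _ _ (dint P s (fun r w => (K4 * (rho w * (chi N' r w * enorm (Z r w) ^+ 4)) + K4)%R))).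
    apply: dint_le => [r w _|r w /andP[r0 rs]]; first exact: w0.
    have rT : 0 <= r <= T by rewrite r0 (le_trans rs).
    have h : enorm (V r w) ^+ 4 <= K4 * (enorm (Z r w) ^+ 4 + 1).
      apply: (@le_trans _ _ ((K * (enorm (Z r w) + 1)) ^+ 4)).
        by rewrite lerXn2r ?nnegrE ?enorm_ge0 ?EV// mulr_ge0// ?addr_ge0 ?enorm_ge0// ltW.
      rewrite [leLHS]exprMn (_ : K4 * _ = K ^+ 4 * (8 * (enorm (Z r w) ^+ 4 + 1))); last by rewrite /K4; ring.
      apply: ler_wpM2l => //.
      by have := pow4_add_le (enorm (Z r w)) 1; rewrite expr1n mulr1 mulrDr mulr1.
    have rc0 : 0 <= rho w * chi N' r w by rewrite mulr_ge0.
    have rc1 : rho w * chi N' r w <= 1 by rewrite mulr_ile1//; case/andP: (rho01 w).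
    rewrite !(mulrA (rho w)); apply: (le_trans (ler_wpM2l rc0 h)).
    have := ler_piMl (ltW K40) rc1.
    by move: (rho w * chi N' r w) (enorm (Z r w) ^+ 4) => c z; lra.
  rewrite dint_D; first last.
  - by move=> r w; exact: ltW.
  - by move=> r w; rewrite mulr_ge0// ltW.
  - exact: measurable_cst.
  - by apply: measurable_funM => //; exact: measurable_cst.
  rewrite (dint_Z P s jZ)//; last exact: ltW.
  rewrite (dint_swap P s jZ)//; apply: leeD => //.
  rewrite /dint -(Eint_cst P (K4 * T)); apply: ge0_integral_mono => w _.
    by apply: integral_ge0 => r _; rewrite lee_fin ltW.
  rewrite (integral_cst leb)// (EFinM K4 T) lee_wpmul2l ?lee_fin ?(ltW K40)//.
  suff : (leb (`[0%R, s]%classic : set R) <= T%:E)%E by [].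
  rewrite lebesgue_measure_itv/= lte_fin; case: ifP => _; last by rewrite lee_fin.
  by rewrite -EFinD subr0 lee_fin.
pose I4 := 128 * ito4_const T m * d%:R.
have I40 : 0 <= I4 by rewrite mulr_ge0// mulr_ge0// ito4_const_ge0.
pose M := 1 + d%:R * T ^+ 3 + I4.
have T30 : 0 <= d%:R * T ^+ 3 by rewrite mulr_ge0// exprn_ge0.
have M0 : 0 < M by rewrite /M; lra.
pose a := 64 * e0 + 64 * M * (K4 * T).
pose K' := 64 * M * K4.
have K'0 : 0 < K' by rewrite !mulr_gt0.
have KT0 : 0 <= K4 * T by rewrite mulr_ge0// ltW.
have a0 : 0 <= a by rewrite addr_ge0 ?mulr_ge0// ltW.
have uM s : 0 <= s <= T -> (u s <= (N' ^+ 4)%:E)%E.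
  move=> /andP[s0 _]; rewrite -(Eint_cst P (N' ^+ 4)); apply: Eint_le => w; first exact: w0.
  rewrite mulrA; case: (stays_below01 Z N' s w) => c; rewrite /chi c ?mulr0 ?mul0r//.
  have zN := stays_belowP cZ s0 c (u := s); rewrite s0 lexx in zN.
  rewrite mulr1; apply: le_trans (_ : enorm (Z s w) ^+ 4 <= _).
    by rewrite ler_piMl//; case/andP: (rho01 w).
  by rewrite lerXn2r ?nnegrE ?enorm_ge0// zN.
have u0 s : 0 <= s <= T -> (0 <= u s)%E by move=> _; apply: Eint_ge0 => w; exact: w0.
have rec s : 0 <= s <= T -> (u s <= a%:E + K'%:E * \int[leb]_(r in `[0%R, s]) u r)%E.
  move=> sT; have /andP[s0 sT'] := sT.
  have [D [U [mD mU DA HU ZE]]] := itp_decomposition itp sT.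
  have mZ0 := itp_Z0 itp.
  pose k w := rho w * chi N' s w.
  have k0 w : 0 <= k w by rewrite mulr_ge0.
  have mk : measurable_fun setT k by have h := mchi N' s; rewrite /k; meas.
  have ED : (\int[P]_w (k w * enorm (D w) ^+ 4)%:E <= (d%:R * s ^+ 3)%:E *
      dint P s (fun r w => (rho w * (chi N' r w * enorm (A r w) ^+ 4))%R))%E.
    apply: (drift_pow4 (itp_A itp) (fun s w => let: And3 _ h _ := GP s w in h) s0 mD mk
      (jw _ _ A (itp_A itp)) (w0 _ _ A) k0 DA) => r w /andP[r0 rs].
    by rewrite /k mulrA ler_wpM2r// ler_wpM2l// stays_below_dec.
  have EU : (\int[P]_w (k w * enorm (U w) ^+ 4)%:E <=
      I4%:E * dint P s (fun r w => (rho w * (chi N' r w * enorm (H r w) ^+ 4))%R))%E.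
    have jr e : jmeas (fun r w => rho w * (chi N' r w * \sum_l (row e (H r w)) 0 l ^+ 4)).
      apply: measurable_funM; first exact: jmeas_snd.
      apply: measurable_funM; first exact: jchi.
      apply: measurable_sum => l; apply: measurable_funX.
      have -> : (fun z : measurableTypeR R * Omega => (row e (H z.1 z.2)) 0 l) = (fun z => H z.1 z.2 e l).
        by apply/funext => z; rewrite mxE.
      exact: (jmeas_entry e l (itp_H itp)).
    have r0 e r w : 0 <= rho w * (chi N' r w * \sum_l (row e (H r w)) 0 l ^+ 4).
      by rewrite mulr_ge0// mulr_ge0// sumr_ge0.
    apply: (@le_trans _ _ (I4%:E * \sum_e dint P s (fun r w =>
        (rho w * (chi N' r w * \sum_l (row e (H r w)) 0%R l ^+ 4))%R))%E); last first.
      rewrite lee_wpmul2l ?lee_fin// -dint_sum//.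
      apply: dint_le => r w _; first by rewrite sumr_ge0.
      rewrite -mulr_sumr -mulr_sumr ler_wpM2l// ler_wpM2l//.
      rewrite (exprM _ 2 2) enorm_sqr expr2 mulr_suml; apply: ler_sum => e _.
      rewrite mulr_suml; apply: ler_sum => l _; rewrite mxE (exprM _ 2 2) expr2.
      rewrite ler_wpM2l ?sqr_ge0// (bigD1 e)//= (bigD1 l)//= -addrA lerDl.
      rewrite addr_ge0 ?sumr_ge0// => i _; first exact: sqr_ge0.
      by rewrite sumr_ge0// => j _; exact: sqr_ge0.
    apply: (@le_trans _ _ (d%:R%:E * \sum_e \int[P]_w (rho w * (chi N' s w * U w 0%R e ^+ 4))%:E)%E).
      have mUe e : measurable_fun setT (fun w => rho w * (chi N' s w * U w 0 e ^+ 4)).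
        by have h := mchi N' s; case: (HU e) => _ h' _; meas.
      have s0' w : 0 <= \sum_e rho w * (chi N' s w * U w 0 e ^+ 4).
        by rewrite sumr_ge0// => e _; rewrite mulr_ge0// mulr_ge0.
      have ms : measurable_fun setT (fun w => \sum_e rho w * (chi N' s w * U w 0 e ^+ 4)).
        exact: measurable_sum.
      rewrite -(Eint_sum P (index_enum _) (f := fun e w => rho w * (chi N' s w * U w 0 e ^+ 4)))//; last first.
        by move=> e w; rewrite mulr_ge0// mulr_ge0.
      rewrite -(Eint_Z P ms)//; apply: Eint_le => w; first by rewrite mulr_ge0.
      rewrite (eq_bigr (fun e => k w * U w 0 e ^+ 4)); last by move=> e _; rewrite mulrA.
      rewrite -mulr_sumr (mulrCA d%:R); apply: ler_wpM2l => //.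
      rewrite (exprM _ 2 2) enorm_sqr big_ord1 (le_trans (sqr_sum_le _))// ler_wpM2l//.
      by apply: ler_sum => e _; rewrite -exprM.
    rewrite /I4 (mulrC _ d%:R) (EFinM d%:R) -muleA lee_wpmul2l ?lee_fin//.
    rewrite ge0_sume_distrr; last first.
      by move=> e _; apply: dint_ge0 => r w _.
    apply: lee_sum => e _.
    (* While the path stays in the ball the linear growth bound makes the integrand bounded; the
       next fact gives the square-integrable bound that remains valid afterwards. *)
    have rN r w l : 0 <= r <= s -> chi N' r w = 1 -> `|(row e (H r w)) 0 l| <= K * (N' + 1).
      move=> /andP[r0' rs] c; rewrite mxE (le_trans (enorm_entry _ _ _))//.
      rewrite (le_trans (EH r w _)) ?r0' ?(le_trans rs)// ler_wpM2l ?(ltW K0)// lerD2r.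
      by apply: (stays_belowP cZ r0' c); rewrite r0' lexx.
    have rG r w l : 0 <= r <= s -> `|(row e (H r w)) 0 l| <= G w.
      move=> _; rewrite mxE (le_trans (enorm_entry _ _ _))//.
      by case: (GP r w).
    have KN0 : 0 <= K * (N' + 1) by rewrite mulr_ge0 ?addr_ge0// ltW.
    apply: (ito_local4 Bbm F0i sT (HU e) (stays_below01 Z N') _ _ (jchi N') KN0 rN rG mG Gf mrho rho01).
      by move=> r r' w; exact: stays_below_dec.
    by move=> r rT; exact: stays_below_Fmeas rT.
  have p0 (V : Omega -> 'rV[R]_d) w : 0 <= k w * enorm (V w) ^+ 4 by rewrite mulr_ge0.
  have mp (V : Omega -> 'rV[R]_d) : measurable_fun setT V -> measurable_fun setT (fun w => k w * enorm (V w) ^+ 4).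
    by move=> mV; apply: measurable_funM => //; apply: measurable_funX; exact: measurable_enorm.
  have mz0 := mp _ mZ0; have md := mp _ mD; have mu := mp _ mU.
  apply: (@le_trans _ _ (\int[P]_w (64 * (k w * enorm (Z0 w) ^+ 4) +
     (64 * (k w * enorm (D w) ^+ 4) + 64 * (k w * enorm (U w) ^+ 4)))%:E)%E).
    apply: Eint_le => w; first exact: w0.
    rewrite mulrA -/(k w) !(mulrCA 64) -!mulrDr ler_wpM2l//.
    have n1 : enorm (Z s w) <= enorm (Z0 w) + enorm (D w) + enorm (U w).
      by rewrite ZE (le_trans (enormD _ _))// lerD2r enormD.
    apply: (@le_trans _ _ ((enorm (Z0 w) + enorm (D w) + enorm (U w)) ^+ 4)).
      by rewrite lerXn2r ?nnegrE ?addr_ge0 ?enorm_ge0.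
    have := pow4_add_le (enorm (Z0 w) + enorm (D w)) (enorm (U w)).
    have := pow4_add_le (enorm (Z0 w)) (enorm (D w)); have := n4 _ _ (U w).
    by lra.
  rewrite Eint_D; first last.
  - by move=> w; rewrite addr_ge0// mulr_ge0.
  - by move=> w; rewrite mulr_ge0.
  - by meas.
  - by meas.
  rewrite (Eint_D P (f := fun w => 64 * (k w * enorm (D w) ^+ 4))); first last.
  - by move=> w; rewrite mulr_ge0.
  - by move=> w; rewrite mulr_ge0.
  - by meas.
  - by meas.
  rewrite (Eint_Z P mz0)// (Eint_Z P md)// (Eint_Z P mu)//.
  have i0 : (0 <= \int[leb]_(r in `[0%R, s]) u r)%E.
    by apply: integral_ge0 => r _; apply: Eint_ge0 => w; exact: w0.
  have dA := dE _ _ A s (itp_A itp) sT EA; have dH := dE _ _ H s (itp_H itp) sT EH.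
  have s3 : d%:R * s ^+ 3 <= 1 + d%:R * T ^+ 3.
    rewrite (@le_trans _ _ (d%:R * T ^+ 3))// ?lerDr// ler_wpM2l// lerXn2r ?nnegrE//.
  have s30 : 0 <= d%:R * s ^+ 3 by rewrite mulr_ge0// exprn_ge0.
  have z0e : (\int[P]_w (k w * enorm (Z0 w) ^+ 4)%:E <= e0%:E)%E.
    apply: le_trans EZ0; apply: Eint_le => w //; rewrite /k -mulrA ler_wpM2l// ler_piMl//.
  exact: (combine_estimates (ltr0n _ 64) s30 s3 I40 (ltW K40) KT0 i0 z0e ED EU dA dH).
have := gronwall a0 K'0 u0 uM rec tT.
move/le_trans; apply; rewrite lee_fin.
have /andP[t0 tT'] := tT.
have e2 : expR (2 * K' * t) <= expR (2 * K' * T) by rewrite ler_expR ler_wpM2l// mulr_ge0// ltW.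
have -> : gronwall4_const K * (e0 + 1) =
    (128 * (1 + M * (K4 * T)) * (e0 + 1)) * expR (2 * K' * T).
  by rewrite /gronwall4_const -/I4 -/M -/K4 -/K'; ring.
apply: ler_pM => //; first by rewrite mulr_ge0.
by rewrite /a; have := mulr_ge0 (mulr_ge0 (ltW M0) KT0) e00; lra.
Qed.

End fourth_moment.

(** * Difference quotients of the flow *)

Section error_terms.
Context (R : realType).

(** Young's inequality for [del (rho q^2)^2] and [del^-1 (k^2)^2], followed by [k^4 <= k^2 <= y^2].
    With [y = del q] the last term becomes [del q^2]; with [y = e], where [e] has second moment of
    order [del^2], it is again of order [del]. *)
Let weighted_product (del rho q k y : R) : 0 < del -> 0 <= rho -> 0 <= k <= 1 -> k <= y ->
  rho * (q * k) ^+ 2 <= 2^-1 * (del * (rho ^+ 2 * q ^+ 4) + del^-1 * y ^+ 2).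
Proof.
move=> d0 r0 /andP[k0 k1] ky.
have h : k ^+ 4 <= y ^+ 2.
  apply: (@le_trans _ _ (k ^+ 2)); last by rewrite lerXn2r ?nnegrE// (le_trans k0).
  by rewrite -[k ^+ 4]/(k ^+ (2 + 2)) exprD ler_piMl ?sqr_ge0// exprn_ile1.
have i0 : 0 <= del^-1 by rewrite invr_ge0 ltW.
have di : del * del^-1 = 1 by rewrite mulfV// gt_eqF.
apply: (@le_trans _ _ (2^-1 * (del * (rho ^+ 2 * q ^+ 4) + del^-1 * k ^+ 4))); last first.
  by rewrite ler_wpM2l// lerD2l ler_wpM2l.
rewrite ler_pdivlMl// -subr_ge0.
suff -> : del * (rho ^+ 2 * q ^+ 4) + del^-1 * k ^+ 4 - 2 * (rho * (q * k) ^+ 2) =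
    del^-1 * (del * (rho * q ^+ 2) - k ^+ 2) ^+ 2 by rewrite mulr_ge0// sqr_ge0.
by field; rewrite gt_eqF.
Qed.

(** The error has ten summands, whence the factor 10. The three products containing a minimum go
    through [weighted_product]; those with an explicit factor [del] use [del^2 <= del], and the bare
    [e] uses [1 <= del^-1]. *)
Lemma four_point_error_sqr (del L q q' e rho : R) :
  0 < del <= 1 -> 0 <= L -> 0 <= q -> 0 <= q' -> 0 <= e -> 0 <= rho <= 1 ->
  rho * four_point_error del (L * del) q q' e ^+ 2 <=
  10 * (del * (rho ^+ 2 * q ^+ 4) + (del * (rho ^+ 2 * q' ^+ 4) +
    ((2 + L ^+ 2) * del * q ^+ 2 + (2 * del * q' ^+ 2 +
      (2 * del^-1 * e ^+ 2 + (2 + L ^+ 2) * del))))).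
Proof.
move=> /andP[d0 d1] L0 q0 q'0 e0 /andP[r0 r1].
have i1 : 1 <= del^-1 by rewrite invf_ge1.
have di : del^-1 * del = 1 by rewrite mulVf// gt_eqF.
have mn (y : R) : 0 <= y -> 0 <= Num.min 1 y <= 1 by move=> y0; rewrite le_min ler01 y0 ge_min lexx.
have my (y : R) : Num.min 1 y <= y by rewrite ge_min lexx orbT.
set k := Num.min 1 (del * q); set k' := Num.min 1 (del * q'); set ke := Num.min 1 e.
pose v := [:: q * k; del * q; del; q' * k'; del * q'; del; ke * q; L * del * q; e; L * del].
have := sqr_sum_le (fun i : 'I_10 => nth 0 v i).
rewrite !big_ord_recr !big_ord0/= !add0r => h.
have -> : four_point_error del (L * del) q q' e = q * k + del * q + del + q' * k' + del * q' + del +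
  ke * q + L * del * q + e + L * del by rewrite /four_point_error -/k -/k' -/ke; ring.
apply: (le_trans (ler_wpM2l r0 h)); rewrite mulrCA ler_wpM2l//.
have p1 := weighted_product q d0 r0 (mn _ (mulr_ge0 (ltW d0) q0)) (my _).
have p2 := weighted_product q' d0 r0 (mn _ (mulr_ge0 (ltW d0) q'0)) (my _).
have p3 := weighted_product q d0 r0 (mn _ e0) (my _).
rewrite -/k -/k' -/ke in p1 p2 p3.
have dd (y : R) : del^-1 * (del * y) ^+ 2 = del * y ^+ 2.
  by field; rewrite gt_eqF.
rewrite !dd in p1 p2.
have s (y z : R) : 0 <= y -> z <= y -> rho * z <= y.
  move=> y0 zy; apply: (le_trans (ler_wpM2l r0 zy)); exact: ler_piMl.
have d2 : del ^+ 2 <= del by rewrite expr2 ler_piMl// ltW.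
have sd (y : R) : 0 <= y -> rho * (del ^+ 2 * y) <= del * y.
  by move=> y0; apply: s; [rewrite mulr_ge0// ltW | rewrite ler_wpM2r].
have t1 := sd _ (sqr_ge0 q); have t2 := sd _ (sqr_ge0 q'); have t3 := sd 1 ler01.
have t4 := sd _ (mulr_ge0 (sqr_ge0 L) (sqr_ge0 q)); have t5 := sd _ (sqr_ge0 L).
have t6 : rho * e ^+ 2 <= del^-1 * e ^+ 2.
  by apply: ler_wpM2r; rewrite ?sqr_ge0// (le_trans r1).
have i0 : 0 <= del^-1 * e ^+ 2 by rewrite mulr_ge0 ?sqr_ge0// invr_ge0 ltW.
have n1 : 0 <= del * q ^+ 2 by rewrite mulr_ge0 ?sqr_ge0// ltW.
have n2 : 0 <= del * q' ^+ 2 by rewrite mulr_ge0 ?sqr_ge0// ltW.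
have n3 : 0 <= del * (rho ^+ 2 * q' ^+ 4).
  by rewrite mulr_ge0 ?(ltW d0)// mulr_ge0 ?sqr_ge0// exprn_ge0.
rewrite (mulrC ke) !mulrDr !(exprMn, mulr1) in p1 p2 p3 t1 t2 t3 t4 t5 t6 *.
by move: p1 p2 p3 t1 t2 t3 t4 t5 t6 i0 n1 n2 n3; clear; lra.
Qed.

Lemma weighted_three_sqr (rho c x y z l e : R) : 0 <= rho <= 1 -> 0 <= c -> 0 <= y ->
  l ^+ 4 * e ^+ 2 = z ^+ 2 ->
  rho * (c ^+ 2 * (x + y + z) ^+ 2) <= 3 * c ^+ 2 * (rho * x ^+ 2) +
    (3 * c ^+ 2 * l ^+ 4 * (rho * e ^+ 2) + 3 * c ^+ 2 * y ^+ 2).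
Proof.
move=> /andP[r0 r1] c0 y0 le.
have h : (x + y + z) ^+ 2 <= 3 * (x ^+ 2 + y ^+ 2 + z ^+ 2).
  rewrite -subr_ge0; have -> : 3 * (x ^+ 2 + y ^+ 2 + z ^+ 2) - (x + y + z) ^+ 2 =
    (x - y) ^+ 2 + (x - z) ^+ 2 + (y - z) ^+ 2 by ring.
  by rewrite !addr_ge0 ?sqr_ge0.
have h' := ler_wpM2l (mulr_ge0 r0 (sqr_ge0 c)) h.
rewrite mulrA (le_trans h')//.
have -> : 3 * c ^+ 2 * l ^+ 4 * (rho * e ^+ 2) = 3 * c ^+ 2 * (rho * z ^+ 2) by rewrite -le; ring.
have h2 : rho * (c ^+ 2 * y ^+ 2) <= c ^+ 2 * y ^+ 2 by rewrite ler_piMl// mulr_ge0 ?sqr_ge0.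
by move: h2; clear; lra.
Qed.

End error_terms.

(** * The flow and its Lipschitz bound *)

Section flow.
Context (R : realType) (disp : measure_display) (Omega : measurableType disp).
Variables (P : probability Omega R) (T : R) (d m : nat).
Variables (B : R -> Omega -> 'rV[R]_m) (F0 : set (set Omega)).
Hypotheses (T0 : 0 < T).
Hypotheses (Bbm : brownian_motion P T B) (F0i : initial_sigma_algebra P T B F0).
Local Notation F := (filtration B F0).
Local Notation nrm := (ip_norm (L2inner P (d:=d))).
Local Notation L2m := (L2 P measurable (d:=d)).
Local Notation ct := (clamp_time T).
Variables (b0 : 'rV[R]_d -> P2 R d -> 'rV[R]_d) (b1 : 'rV[R]_d -> P2 R d -> 'M[R]_(d, m)) (C : R).
Hypotheses (C0 : 0 <= C) (b0L : lipschitz_coef P b0 C) (b1L : lipschitz_coef P b1 C).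
Variable X : (Omega -> 'rV[R]_d) -> R -> Omega -> 'rV[R]_d.
Hypothesis X_solution : forall xi, L2 P F0 xi ->
  mckean_vlasov_solution P T B F0 b0 b1 xi (X xi).

Let F0m : F0 `<=` measurable. Proof. by case: F0i. Qed.
Let L2sub : submodule L2m. Proof. exact: (@L2_submodule _ _ _ P d measurable (fun _ => id)). Qed.
Let F0sub : submodule (L2 P F0 (d:=d)). Proof. exact: L2_submodule. Qed.
Let ipP := @L2inner_product _ _ _ P d.
Let ctP s : 0 <= ct s <= T. Proof. exact: (clamp_timeP (ltW T0)). Qed.

Lemma flow_L2 xi s : L2 P F0 xi -> L2m (X xi (ct s)).
Proof. by move=> /X_solution[xS _]; exact: (solution_L2 T0 Bbm F0i xS). Qed.

Let L2B (Y Z : Omega -> 'rV[R]_d) : L2m Y -> L2m Z -> L2m (fun w => Z w - Y w).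
Proof. by move=> hY hZ; apply: (submoduleB L2sub). Qed.

Let L2Z (a : R) (Z : Omega -> 'rV[R]_d) : L2m Z -> L2m (fun w => a *: Z w).
Proof. by move=> hZ; apply: (submoduleZ L2sub). Qed.

Let F0D (a : R) (Y Z : Omega -> 'rV[R]_d) : L2 P F0 Y -> L2 P F0 Z -> L2 P F0 (fun w => Y w + a *: Z w).
Proof. by move=> hY hZ; apply: (submoduleD F0sub) => //; exact: (submoduleZ F0sub). Qed.

(** Linear combinations are available in the shape [a x + y] only, so [a (y - x)] is obtained as
    [(a - 1) D + D] with [D = - x + y]. *)
Lemma ito_process_scaleB (a : R) (Z0 Z0' : Omega -> 'rV[R]_d) (Z A Z' A' : R -> Omega -> 'rV[R]_d)
    (H H' : R -> Omega -> 'M[R]_(d, m)) :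
  ito_process P T B F0 Z0 Z A H -> ito_process P T B F0 Z0' Z' A' H' ->
  ito_process P T B F0 (fun w => a *: (Z0' w - Z0 w)) (fun s w => a *: (Z' s w - Z s w))
    (fun s w => a *: (A' s w - A s w)) (fun s w => a *: (H' s w - H s w)).
Proof.
move=> h h'; have D := ito_process_lin Bbm F0i (-1) h h'.
have := ito_process_lin Bbm F0i (a - 1) D D.
have e (p q : nat) (x y : 'M[R]_(p, q)) : (a - 1) *: (-1 *: x + y) + (-1 *: x + y) = a *: (y - x).
  by rewrite -[X in _ + X]scale1r -scalerDl subrK scaleN1r addrC.
congr ito_process.
- by apply/funext => w; exact: e.
- by apply/funext => s; apply/funext => w; exact: e.
- by apply/funext => s; apply/funext => w; exact: e.
- by apply/funext => s; apply/funext => w; exact: e.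
Qed.

(** The square of [C (|x| + n)], where [n] is the L^2 norm of [x], has mean at most [4 C^2 n^2]; the
    summand 1 keeps the rate in Gronwall's lemma positive. The weight is 1 here. *)
Definition flow_lip : R := Num.sqrt (gronwall2_const T m (4 * C ^+ 2 + 1)).

Lemma flow_lip_ge0 : 0 <= flow_lip. Proof. exact: sqrtr_ge0. Qed.

Let gronwall2_const_ge0 K : 0 <= K -> 0 <= gronwall2_const T m K.
Proof.
move=> K0; apply: mulr_ge0; last exact: expR_ge0.
have c0 : 0 <= T + 132 * m%:R by exact: (addr_ge0 (ltW T0) (mulr_ge0 (ler0n _ _) (ler0n _ _))).
exact: (mulr_ge0 (ler0n _ _) (addr_ge0 ler01 (mulr_ge0 c0 (ltW T0)))).
Qed.

Lemma flow_lipschitz xi xi' t : L2 P F0 xi -> L2 P F0 xi' -> 0 <= t <= T ->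
  nrm (fun w => X xi' t w - X xi t w) <= flow_lip * nrm (fun w => xi' w - xi w).
Proof.
move=> hxi hxi' tT.
have [mu lmu itp] := solution_ito_process T0 Bbm F0i C0 C0 b0L b1L hxi (X_solution hxi).
have [mu' lmu' itp'] := solution_ito_process T0 Bbm F0i C0 C0 b0L b1L hxi' (X_solution hxi').
have it := ito_process_scaleB 1 itp itp'.
have hZ s : L2m (fun w => 1 *: (X xi' (ct s) w - X xi (ct s) w)).
  by apply: L2Z; apply: L2B; exact: flow_L2.
have hZ0 : L2m (fun w => 1 *: (xi' w - xi w)).
  by apply: L2Z; apply: L2B; exact: (L2T F0m).
pose K := 4 * C ^+ 2 + 1.
have K0 : 0 < K by rewrite ltr_wpDl// mulr_ge0// sqr_ge0.
have key (p q : nat) (b : 'rV[R]_d -> P2 R d -> 'M[R]_(p, q)) s : lipschitz_coef P b C ->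
  (\int[P]_w (1 * enorm (1 *: (b (X xi' (ct s) w) (mu' (ct s)) - b (X xi (ct s) w) (mu (ct s)))) ^+ 2)%:E <=
   K%:E * \int[P]_w (1 * enorm (1 *: (X xi' (ct s) w - X xi (ct s) w)) ^+ 2)%:E + 0%:E)%E.
  move=> bL; rewrite adde0.
  have mZ := measurable_enorm_sqr_comp (L2_measurable (hZ s)).
  have sZ := Eint_enorm_sqr (hZ s); set n := nrm _ in sZ.
  have n0 : 0 <= n by exact: ip_norm_ge0.
  apply: (@le_trans _ _ (\int[P]_w (2 * C ^+ 2 * enorm (1 *: (X xi' (ct s) w - X xi (ct s) w)) ^+ 2 +
      2 * C ^+ 2 * n ^+ 2)%:E)%E).
    apply: Eint_le => w; first by rewrite mul1r sqr_ge0.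
    have h := bL (X xi (ct s) w) (X xi' (ct s) w) _ _ _ _ (lmu _ (ctP s)) (lmu' _ (ctP s))
      (flow_L2 s hxi) (flow_L2 s hxi').
    have nE : n = nrm (fun w => X xi' (ct s) w - X xi (ct s) w).
      by rewrite /n; congr (nrm _); apply/funext => v; rewrite scale1r.
    rewrite -nE in h; rewrite mul1r !scale1r.
    move: h (enorm_ge0 (X xi' (ct s) w - X xi (ct s) w)).
    move: (enorm_ge0 (b (X xi' (ct s) w) (mu' (ct s)) - b (X xi (ct s) w) (mu (ct s)))).
    move: (enorm (X xi' _ _ - _)) (enorm _) => x y y0 h x0.
    apply: (@le_trans _ _ ((C * (x + n)) ^+ 2)).
      by rewrite lerXn2r ?nnegrE// mulr_ge0// addr_ge0.
    by have := mulr_ge0 (sqr_ge0 C) (sqr_ge0 (x - n)); lra.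
  have c0 : 0 <= 2 * C ^+ 2 by rewrite mulr_ge0// sqr_ge0.
  rewrite Eint_D; first last.
  - by move=> w; rewrite mulr_ge0// sqr_ge0.
  - by move=> w; rewrite mulr_ge0// sqr_ge0.
  - exact: measurable_cst.
  - by meas.
  rewrite (Eint_Z P mZ)//; last by move=> w; exact: sqr_ge0.
  rewrite Eint_cst; under [in leRHS]eq_integral do rewrite mul1r.
  rewrite sZ -!EFinM -EFinD lee_fin /K; have := sqr_ge0 n; nra.
have r01 : forall w : Omega, 0 <= (1 : R) <= 1 by move=> w; rewrite ler01 lexx.
have e0 := sqr_ge0 (nrm (fun w => 1 *: (xi' w - xi w))).
have h0 : (\int[P]_w (1 * enorm (1 *: (xi' w - xi w)) ^+ 2)%:E <=
    (nrm (fun w => 1 *: (xi' w - xi w)) ^+ 2)%:E)%E.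
  by under eq_integral do rewrite mul1r; rewrite Eint_enorm_sqr.
have mr : measurable_fun (setT : set (g_sigma_algebraType F0)) (fun _ => 1 : R).
  exact: measurable_cst.
have := weighted_L2_estimate T0 Bbm F0i it mr r01 K0 e0 (lexx 0) h0
  (fun s _ => key _ _ b0 s b0L) (fun s _ => key _ _ b1 s b1L) tT.
under eq_integral do rewrite mul1r; rewrite clamp_time_id//.
under eq_integral do rewrite scale1r.
have -> : (fun w => 1 *: (xi' w - xi w)) = (fun w => xi' w - xi w).
  by apply/funext => w; rewrite scale1r.
move=> h; have hL : L2m (fun w => X xi' t w - X xi t w).
  by have := L2B (flow_L2 t hxi) (flow_L2 t hxi'); rewrite clamp_time_id.
rewrite ip_norm_leP ?mulr_ge0 ?ip_norm_ge0 ?flow_lip_ge0//.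
apply: (le_trans h); rewrite addr0 lee_fin [leRHS]exprMn ler_wpM2r ?sqr_ge0// sqr_sqrtr//.
by apply: gronwall2_const_ge0; exact: ltW.
Qed.

(** * Weighted estimates for difference quotients *)

Section quotients.
Variable eta : Omega -> 'rV[R]_d.
Hypotheses (heta : L2 P F0 eta) (eta1 : nrm eta <= 1).

Definition weight (w : Omega) : R := (1 + enorm (eta w) ^+ 2)^-1.

Let one_le w : 1 <= 1 + enorm (eta w) ^+ 2. Proof. by rewrite lerDl sqr_ge0. Qed.

Lemma weight01 w : 0 <= weight w <= 1.
Proof. by rewrite invr_ge0 (le_trans ler01 (one_le w))/= invf_le1// (lt_le_trans ltr01). Qed.

Lemma weight_F0 : measurable_fun (setT : set (g_sigma_algebraType F0)) weight.
Proof.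
have -> : weight = (fun u => u `^ (-1)) \o (fun w => 1 + enorm (eta w) ^+ 2).
  by apply/funext => w; rewrite /= powR_inv1// (le_trans ler01).
apply: (measurableT_comp (measurable_powR (-1))).
apply: measurable_funD; first exact: measurable_cst.
by apply: measurable_enorm_sqr_comp; case: heta.
Qed.

Lemma weight_measurable : measurable_fun setT weight.
Proof.
apply: (Fmeas_measurable Bbm F0i (lexx T)); apply: F0_Fmeas; exact: weight_F0.
Qed.

Lemma weighted_cauchy_schwarz (V : Omega -> R) (a : R) : measurable_fun setT V ->
  (forall w, 0 <= V w) -> 0 <= a -> (\int[P]_w (weight w * V w ^+ 2)%:E <= a%:E)%E ->
  (\int[P]_w (V w)%:E <= (Num.sqrt (2 * a))%:E)%E.
Proof.
move=> mV V0 a0 Va.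
pose s w := Num.sqrt (weight w); pose s' w := Num.sqrt (1 + enorm (eta w) ^+ 2).
have msq (f : Omega -> R) : measurable_fun setT f -> measurable_fun setT (fun w => Num.sqrt (f w)).
  move=> mf; have -> : (fun w => Num.sqrt (f w)) = Num.sqrt \o f by [].
  apply: measurableT_comp => //.
  by apply: continuous_measurable_fun; exact: sqrt_continuous.
have ms : measurable_fun setT s by apply: msq; exact: weight_measurable.
have me : measurable_fun setT (fun w => 1 + enorm (eta w) ^+ 2).
  apply: measurable_funD; first exact: measurable_cst.
  by apply: measurable_enorm_sqr_comp; exact: (L2_measurable (L2T F0m heta)).
have ms' : measurable_fun setT s' by exact: msq.
have p0 w : 0 <= 1 + enorm (eta w) ^+ 2 by exact: le_trans (one_le w).
have w0 w : 0 <= weight w by case/andP: (weight01 w).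
have ss w : s w * s' w = 1.
  rewrite /s /s' -sqrtrM// mulVf ?sqrtr1// gt_eqF// (lt_le_trans ltr01)//.
under eq_integral => w _ do rewrite -[V w]mulr1 -(ss w) mulrA.
rewrite mulrC sqrtrM//.
apply: (@Eint_cauchy_schwarz _ _ _ P (fun w => V w * s w) s').
- by meas.
- by meas.
- by move=> w; rewrite mulr_ge0// sqrtr_ge0.
- by move=> w; exact: sqrtr_ge0.
- exact: sqrtr_ge0.
- exact: sqrtr_ge0.
- under eq_integral do rewrite exprMn sqr_sqrtr// mulrC.
  by rewrite sqr_sqrtr.
- under eq_integral do rewrite sqr_sqrtr//.
  rewrite sqr_sqrtr// Eint_D; first last.
  + by move=> w; exact: sqr_ge0.
  + by [].
  + by apply: measurable_enorm_sqr_comp; exact: (L2_measurable (L2T F0m heta)).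
  + exact: measurable_cst.
  rewrite Eint_cst Eint_enorm_sqr; last exact: (L2T F0m heta).
  have h : nrm eta ^+ 2 <= 1 by rewrite exprn_ile1// ip_norm_ge0.
  by rewrite -(EFinD 1) lee_fin (_ : 2 = 1 + 1 :> R)// lerD2l.
Qed.

Definition quotient (r : R) (xi : Omega -> 'rV[R]_d) (s : R) (w : Omega) : 'rV[R]_d :=
  r^-1 *: (X (fun w' => xi w' + r *: eta w') s w - X xi s w).

Lemma quotient_L2 r xi s : L2 P F0 xi -> L2m (quotient r xi (ct s)).
Proof. by move=> hxi; apply: L2Z; apply: L2B; apply: flow_L2 => //; exact: F0D. Qed.

Lemma quotient_norm r xi s : r != 0 -> L2 P F0 xi -> 0 <= s <= T ->
  nrm (quotient r xi s) <= flow_lip.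
Proof.
move=> r0 hxi sT.
have hr := F0D r hxi heta.
rewrite /quotient; have -> : nrm (fun w => r^-1 *: (X (fun w' => xi w' + r *: eta w') s w - X xi s w)) =
    `|r^-1| * nrm (fun w => X (fun w' => xi w' + r *: eta w') s w - X xi s w).
  apply: (ip_normZ L2sub ipP); have := L2B (flow_L2 s hxi) (flow_L2 s hr).
  by rewrite clamp_time_id.
rewrite normfV ler_pdivrMl ?normr_gt0//.
apply: (le_trans (flow_lipschitz hxi hr sT)).
have -> : nrm (fun w => xi w + r *: eta w - xi w) = `|r| * nrm eta.
  rewrite -(ip_normZ L2sub ipP r (L2T F0m heta)); congr (nrm _).
  by apply/funext => w; rewrite addrAC subrr add0r.
rewrite mulrC ler_wpM2r ?flow_lip_ge0// ler_piMr//.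
Qed.

Let K4 := (C + 1) * (flow_lip + 1).

(** The quotient starts from [eta], and [weight^2 |eta|^4 <= 1], so [e0 = 1] in
    [weighted_L4_estimate]. Its dynamics are bounded by [C (|Q| + flow_lip)], hence by
    [(C + 1) (flow_lip + 1) (|Q| + 1)]. *)
Definition quotient4_const : R := gronwall4_const T d m ((C + 1) * (flow_lip + 1)) * (1 + 1).

Lemma quotient_process r xi : r != 0 -> L2 P F0 xi -> exists mu mu' : R -> P2 R d,
  [/\ forall s, 0 <= s <= T -> is_law P (X xi s) (mu s),
      forall s, 0 <= s <= T -> is_law P (X (fun w' => xi w' + r *: eta w') s) (mu' s) &
  ito_process P T B F0 eta (fun s => quotient r xi (ct s))
    (fun s w => r^-1 *: (b0 (X (fun w' => xi w' + r *: eta w') (ct s) w) (mu' (ct s))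
      - b0 (X xi (ct s) w) (mu (ct s))))
    (fun s w => r^-1 *: (b1 (X (fun w' => xi w' + r *: eta w') (ct s) w) (mu' (ct s))
      - b1 (X xi (ct s) w) (mu (ct s))))].
Proof.
move=> r0 hxi; have hr := F0D r hxi heta.
have [mu lmu itp] := solution_ito_process T0 Bbm F0i C0 C0 b0L b1L hxi (X_solution hxi).
have [mu' lmu' itp'] := solution_ito_process T0 Bbm F0i C0 C0 b0L b1L hr (X_solution hr).
exists mu, mu'; split => //.
have := ito_process_scaleB r^-1 itp itp'.
suff -> : (fun w => r^-1 *: (xi w + r *: eta w - xi w)) = eta by [].
by apply/funext => w; rewrite addrAC subrr add0r scalerA mulVf// scale1r.
Qed.

Lemma quotient_L4 r xi t : r != 0 -> L2 P F0 xi -> 0 <= t <= T ->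
  (\int[P]_w (weight w ^+ 2 * enorm (quotient r xi t w) ^+ 4)%:E <= quotient4_const%:E)%E.
Proof.
move=> r0 hxi tT; have hr := F0D r hxi heta.
have [mu [mu' [lmu lmu' it]]] := quotient_process r0 hxi.
have L0 := flow_lip_ge0.
have K0 : 0 < K4 by rewrite mulr_gt0// ltr_wpDl.
have key (p q : nat) (b : 'rV[R]_d -> P2 R d -> 'M[R]_(p, q)) s w : lipschitz_coef P b C ->
    enorm (r^-1 *: (b (X (fun w' => xi w' + r *: eta w') (ct s) w) (mu' (ct s))
      - b (X xi (ct s) w) (mu (ct s)))) <= K4 * (enorm (quotient r xi (ct s) w) + 1).
  move=> bL; rewrite /quotient !enormZ.
  have h := bL (X xi (ct s) w) (X (fun w' => xi w' + r *: eta w') (ct s) w) _ _ _ _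
    (lmu _ (ctP s)) (lmu' _ (ctP s)) (flow_L2 s hxi) (flow_L2 s hr).
  have nq := quotient_norm r0 hxi (ctP s).
  have nZ : nrm (quotient r xi (ct s)) =
    `|r^-1| * nrm (fun w => X (fun w' => xi w' + r *: eta w') (ct s) w - X xi (ct s) w).
    by apply: (ip_normZ L2sub ipP); exact: L2B (flow_L2 s hxi) (flow_L2 s hr).
  rewrite nZ in nq; apply: (le_trans (ler_wpM2l (normr_ge0 _) h)).
  rewrite mulrCA mulrDr.
  have x0 := mulr_ge0 (normr_ge0 r^-1) (enorm_ge0 (X (fun w' => xi w' + r *: eta w') (ct s) w - X xi (ct s) w)).
  rewrite /K4 -[leRHS]mulrA ler_pM//.
  - by rewrite addr_ge0// mulr_ge0// ip_norm_ge0.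
  - by rewrite lerDl.
  - move: x0 nq; move: (`|r^-1| * enorm _) (`|r^-1| * nrm _) (flow_lip) L0 => x y l l0 x0 yl.
    by have := mulr_ge0 l0 x0; lra.
have e0 : (\int[P]_w (weight w ^+ 2 * enorm (eta w) ^+ 4)%:E <= 1%:E)%E.
  rewrite -(Eint_cst P 1); apply: Eint_le => w.
    by rewrite mulr_ge0 ?sqr_ge0// exprn_ge0// enorm_ge0.
  rewrite (exprM _ 2 2) -exprMn exprn_ile1//.
    by rewrite mulr_ge0 ?sqr_ge0//; case/andP: (weight01 w).
  rewrite mulrC ler_pdivrMr ?(lt_le_trans ltr01)//.
  by rewrite mul1r lerDr.
have w2 w : 0 <= weight w ^+ 2 <= 1.
  by rewrite sqr_ge0 exprn_ile1//; case/andP: (weight01 w).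
have mw : measurable_fun (setT : set (g_sigma_algebraType F0)) (fun w => weight w ^+ 2).
  by apply: measurable_funX; exact: weight_F0.
have := weighted_L4_estimate T0 Bbm F0i it mw w2 K0 ler01 e0
  (fun s w _ => key _ _ b0 s w b0L) (fun s w _ => key _ _ b1 s w b1L) tT.
by rewrite clamp_time_id.
Qed.

Hypotheses (b0F : four_point_coef P b0 C) (b1F : four_point_coef P b1 C).

(** Coefficient of [del] in the mean of [four_point_error_sqr]: two weighted fourth moments, second
    moments of the quotients at most [flow_lip^2], and [E e^2] at most [(flow_lip * del)^2], which
    compensates the factor [del^-1]. *)
Definition quotient_error : R :=
  10 * (2 * quotient4_const + (4 + flow_lip ^+ 2) * flow_lip ^+ 2 + 3 * flow_lip ^+ 2 + 2).

(** In the rate, [9 C^2] is [3 C^2] for [|Q - Q'|] plus [3 C^2] times 2 for its mean, by the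
    weighted Cauchy-Schwarz inequality. The power [(flow_lip + 1)^4] is the square of [Lam^2] with
    [Lam = flow_lip + 1]. *)
Definition quotient_const : R :=
  gronwall2_const T m (9 * C ^+ 2 + 1) *
    (3 * C ^+ 2 * (flow_lip + 1) ^+ 4 * quotient_error).

Let mean_le (f : Omega -> R) (a : R) : Prop :=
  [/\ measurable_fun setT f, forall w, 0 <= f w & (\int[P]_w (f w)%:E <= a%:E)%E].

(** Measurability, positivity and a bound on the mean travel together, so that nested linear
    combinations are estimated by composing one rule. *)
Let mean_le_lin (c a e : R) (f g : Omega -> R) : 0 <= c -> mean_le f a -> mean_le g e ->
  mean_le (fun w => c * f w + g w) (c * a + e).
Proof.
move=> c0 [mf f0 fa] [mg g0 ge]; split; [by meas | by move=> w; rewrite addr_ge0// mulr_ge0|].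
rewrite Eint_D//; first last.
- by move=> w; rewrite mulr_ge0.
- by meas.
by rewrite (Eint_Z P mf)// EFinD leeD// EFinM lee_wpmul2l.
Qed.

Let mean_le_cst (c : R) : 0 <= c -> mean_le (fun _ => c) c.
Proof. by move=> c0; split => //; rewrite Eint_cst. Qed.

Let quotient4_const_ge0 : 0 <= quotient4_const.
Proof.
have h : L2 P F0 (0 : Omega -> 'rV[R]_d) by exact: submodule0 F0sub.
have T00 : 0 <= (0 : R) <= T by rewrite lexx ltW.
rewrite -lee_fin; apply: le_trans (quotient_L4 (r := 1) _ h T00); last exact: oner_neq0.
by apply: Eint_ge0 => w; rewrite mulr_ge0 ?sqr_ge0// exprn_ge0// enorm_ge0.
Qed.

Let quotient_error_le (del r r' : R) xi xi' s : 0 < del <= 1 -> r != 0 -> r' != 0 ->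
  L2 P F0 xi -> L2 P F0 xi' -> nrm (fun w => xi' w - xi w) <= del -> 0 <= s <= T ->
  (\int[P]_w (weight w * four_point_error del (flow_lip * del) (enorm (quotient r xi s w))
     (enorm (quotient r' xi' s w)) (enorm (X xi' s w - X xi s w)) ^+ 2)%:E <=
   (quotient_error * del)%:E)%E.
Proof.
move=> /andP[d0 d1] r0 r'0 hxi hxi' nd sT.
have L0 := flow_lip_ge0; set L := flow_lip in L0 *.
have hq : L2m (quotient r xi s) by have := quotient_L2 r s hxi; rewrite clamp_time_id.
have hq' : L2m (quotient r' xi' s) by have := quotient_L2 r' s hxi'; rewrite clamp_time_id.
have he : L2m (fun w => X xi' s w - X xi s w).
  by have := L2B (flow_L2 s hxi) (flow_L2 s hxi'); rewrite clamp_time_id.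
have q4 := quotient_L4 r0 hxi sT; have q4' := quotient_L4 r'0 hxi' sT.
have sq (Y : Omega -> 'rV[R]_d) (a : R) : L2m Y -> nrm Y <= a ->
    (\int[P]_w (enorm (Y w) ^+ 2)%:E <= (a ^+ 2)%:E)%E.
  move=> hY Ya; rewrite Eint_enorm_sqr// lee_fin lerXn2r ?nnegrE ?ip_norm_ge0//.
  exact: (le_trans (ip_norm_ge0 _ _) Ya).
have q2 := sq _ _ hq (quotient_norm r0 hxi sT).
have q2' := sq _ _ hq' (quotient_norm r'0 hxi' sT).
have nL : nrm (fun w => X xi' s w - X xi s w) <= L * del.
  by apply: (le_trans (flow_lipschitz hxi hxi' sT)); rewrite ler_wpM2l.
have e2 := sq _ _ he nL.
have mq := L2_measurable hq; have mq' := L2_measurable hq'; have me := L2_measurable he.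
have mw := weight_measurable.
have m4 (Y : Omega -> 'rV[R]_d) : measurable_fun setT Y ->
    measurable_fun setT (fun w => weight w ^+ 2 * enorm (Y w) ^+ 4).
  by move=> mY; have h := measurable_enorm mY; meas.
have p4 (Y : Omega -> 'rV[R]_d) w : 0 <= weight w ^+ 2 * enorm (Y w) ^+ 4.
  by rewrite mulr_ge0 ?sqr_ge0// exprn_ge0// enorm_ge0.
have n2 : 0 <= 2 + L ^+ 2 by rewrite addr_ge0// sqr_ge0.
have mq4 := m4 _ mq; have mq4' := m4 _ mq'.
have mq2 := measurable_enorm_sqr_comp mq; have mq2' := measurable_enorm_sqr_comp mq'.
have me2 := measurable_enorm_sqr_comp me.
have c1 : 0 <= del := ltW d0.
have c2 : 0 <= (2 + L ^+ 2) * del by rewrite mulr_ge0.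
have c3 : 0 <= 2 * del by rewrite mulr_ge0.
have c4 : 0 <= 2 * del^-1 by rewrite mulr_ge0// invr_ge0.
have s0 (Y : Omega -> 'rV[R]_d) w : 0 <= enorm (Y w) ^+ 2 by exact: sqr_ge0.
apply: (@le_trans _ _ (\int[P]_w (10 * (del * (weight w ^+ 2 * enorm (quotient r xi s w) ^+ 4) +
    (del * (weight w ^+ 2 * enorm (quotient r' xi' s w) ^+ 4) +
    ((2 + L ^+ 2) * del * enorm (quotient r xi s w) ^+ 2 + (2 * del * enorm (quotient r' xi' s w) ^+ 2 +
      (2 * del^-1 * enorm (X xi' s w - X xi s w) ^+ 2 + (2 + L ^+ 2) * del))))) + 0)%:E)%E).
  apply: Eint_le => w; first by rewrite mulr_ge0 ?sqr_ge0//; case/andP: (weight01 w).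
  rewrite addr0; apply: four_point_error_sqr; rewrite ?enorm_ge0 ?weight01 ?d0//.
have -> : quotient_error * del = 10 * (del * quotient4_const + (del * quotient4_const +
    ((2 + L ^+ 2) * del * L ^+ 2 + (2 * del * L ^+ 2 +
      (2 * del^-1 * (L * del) ^+ 2 + (2 + L ^+ 2) * del))))) + 0.
  by rewrite /quotient_error -/L; field; rewrite gt_eqF.
have B1 := mean_le_lin c4 (And3 me2 (s0 _) e2) (mean_le_cst c2).
have B2 := mean_le_lin c3 (And3 mq2' (s0 _) q2') B1.
have B3 := mean_le_lin c2 (And3 mq2 (s0 _) q2) B2.
have B4 := mean_le_lin c1 (And3 mq4' (p4 _) q4') B3.
have B5 := mean_le_lin c1 (And3 mq4 (p4 _) q4) B4.
by have [] := mean_le_lin (ler0n _ 10) B5 (mean_le_cst (lexx 0)).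
Qed.

(* The constant does not depend on [eta], which is what the adjoint requires. *)
Lemma quotient_cauchy (del r r' : R) xi xi' t : 0 < del <= 1 ->
  r != 0 -> r' != 0 -> `|r| <= del -> `|r'| <= del ->
  L2 P F0 xi -> L2 P F0 xi' -> nrm (fun w => xi' w - xi w) <= del -> 0 <= t <= T ->
  (\int[P]_w (weight w * enorm (quotient r xi t w - quotient r' xi' t w) ^+ 2)%:E <=
   (quotient_const * del)%:E)%E.
Proof.
move=> d01 r0 r'0 rd r'd hxi hxi' nd tT; have /andP[d0 d1] := d01.
have hr := F0D r hxi heta; have hr' := F0D r' hxi' heta.
have [mu [mu1 [lmu lmu1 it]]] := quotient_process r0 hxi.
have [mu' [mu1' [lmu' lmu1' it']]] := quotient_process r'0 hxi'.
have itG := ito_process_scaleB 1 it' it.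
have L0 := flow_lip_ge0; set L := flow_lip in L0 *.
have w0 w : 0 <= weight w by case/andP: (weight01 w).
have hG s : L2m (fun w => quotient r xi (ct s) w - quotient r' xi' (ct s) w).
  by apply: L2B; exact: quotient_L2.
have mG s := L2_measurable (hG s).
pose v s := (\int[P]_w (weight w * enorm (quotient r xi (ct s) w - quotient r' xi' (ct s) w) ^+ 2)%:E)%E.
have vfin s : v s = (fine (v s))%:E.
  rewrite fineK// ge0_fin_numE; last first.
    by apply: Eint_ge0 => w; rewrite mulr_ge0// sqr_ge0.
  apply: (@le_lt_trans _ _ (\int[P]_w (enorm (quotient r xi (ct s) w - quotient r' xi' (ct s) w) ^+ 2)%:E)%E).
    apply: Eint_le => w; first by rewrite mulr_ge0// sqr_ge0.
    by rewrite ler_piMl ?sqr_ge0//; case/andP: (weight01 w).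
  by rewrite Eint_enorm_sqr// ltry.
have v0 s : 0 <= fine (v s).
  by apply: fine_ge0; apply: Eint_ge0 => w; rewrite mulr_ge0// sqr_ge0.
(* The mean field term is bounded by the very weighted second moment to be estimated, which closes
   the Gronwall inequality. *)
have mean s : (\int[P]_w (enorm (quotient r xi (ct s) w - quotient r' xi' (ct s) w))%:E <=
    (Num.sqrt (2 * fine (v s)))%:E)%E.
  apply: weighted_cauchy_schwarz => //.
  - exact: measurable_enorm.
  - by move=> w; exact: enorm_ge0.
  - by rewrite -vfin.
pose K := 9 * C ^+ 2 + 1; pose e1 := 3 * C ^+ 2 * (L + 1) ^+ 4 * (quotient_error * del).
have K0 : 0 < K by rewrite ltr_wpDl// mulr_ge0// sqr_ge0.
have e1s : quotient_const * del = gronwall2_const T m K * (0 + e1).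
  by rewrite /quotient_const /e1 -/K -/L add0r; ring.
have key (p q : nat) (b : 'rV[R]_d -> P2 R d -> 'M[R]_(p, q)) s : four_point_coef P b C ->
  (\int[P]_w (weight w * enorm (1 *: (r^-1 *: (b (X (fun w' => xi w' + r *: eta w') (ct s) w) (mu1 (ct s))
      - b (X xi (ct s) w) (mu (ct s))) - r'^-1 *: (b (X (fun w' => xi' w' + r' *: eta w') (ct s) w) (mu1' (ct s))
      - b (X xi' (ct s) w) (mu' (ct s))))) ^+ 2)%:E <=
   K%:E * \int[P]_w (weight w * enorm (1 *: (quotient r xi (ct s) w - quotient r' xi' (ct s) w)) ^+ 2)%:E + e1%:E)%E.
  move=> bF; have sT := ctP s.
  under [in leRHS]eq_integral do rewrite scale1r.
  rewrite -/(v s).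
  pose g := Num.sqrt (2 * fine (v s)).
  pose er w := four_point_error del (L * del) (enorm (quotient r xi (ct s) w))
     (enorm (quotient r' xi' (ct s) w)) (enorm (X xi' (ct s) w - X xi (ct s) w)).
  have E2 := quotient_error_le d01 r0 r'0 hxi hxi' nd sT; rewrite -/L in E2.
  have nL : nrm (fun w => X xi' (ct s) w - X xi (ct s) w) <= L * del.
    by apply: (le_trans (flow_lipschitz hxi hxi' sT)); rewrite ler_wpM2l.
  have L1 : 1 <= L + 1 by rewrite lerDr.
  have nq : nrm (quotient r xi (ct s)) <= L + 1.
    by apply: (le_trans (quotient_norm r0 hxi sT)); rewrite lerDl.
  have nq' : nrm (quotient r' xi' (ct s)) <= L + 1.
    by apply: (le_trans (quotient_norm r'0 hxi' sT)); rewrite lerDl.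
  have mg : (\int[P]_w (enorm (quotient r xi (ct s) w - quotient r' xi' (ct s) w))%:E <= g%:E)%E := mean s.
  have h w := bF _ _ _ _ _ _ _ _ r r' del (L + 1) (L * del) g w (lmu _ sT) (lmu1 _ sT) (lmu' _ sT)
    (lmu1' _ sT) (flow_L2 s hxi) (flow_L2 s hr) (flow_L2 s hxi') (flow_L2 s hr') r0 r'0 rd r'd L1
    nq nq' nL mg.
  have mer : measurable_fun setT (fun w => weight w * er w ^+ 2).
    have mw := weight_measurable.
    have m1 := measurable_enorm (L2_measurable (quotient_L2 r s hxi)).
    have m2 := measurable_enorm (L2_measurable (quotient_L2 r' s hxi')).
    have m3 := measurable_enorm (L2_measurable (L2B (flow_L2 s hxi) (flow_L2 s hxi'))).
    have mn (f : Omega -> R) : measurable_fun setT f -> measurable_fun setT (fun w => Num.min 1 (f w)).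
      by move=> mf; apply: measurable_minr => //; exact: measurable_cst.
    rewrite /er /four_point_error; apply: measurable_funM => //; apply: measurable_funX.
    do ?[apply: measurable_funD]; do ?[apply: measurable_funM]; do ?[apply: mn]; by meas.
  have mG2 : measurable_fun setT (fun w => weight w * enorm (quotient r xi (ct s) w - quotient r' xi' (ct s) w) ^+ 2).
    by have mw := weight_measurable; have me := measurable_enorm (mG s); meas.
  have c1 : 0 <= 3 * C ^+ 2 by rewrite mulr_ge0// sqr_ge0.
  have c2 : 0 <= 3 * C ^+ 2 * (L + 1) ^+ 4 by rewrite mulr_ge0// exprn_ge0// addr_ge0.
  apply: (@le_trans _ _ (\int[P]_w (3 * C ^+ 2 * (weight w * enorm (quotient r xi (ct s) w - quotient r' xi' (ct s) w) ^+ 2)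
     + (3 * C ^+ 2 * (L + 1) ^+ 4 * (weight w * er w ^+ 2) + 3 * C ^+ 2 * (2 * fine (v s))))%:E)%E).
    apply: Eint_le => w; first by rewrite mulr_ge0// sqr_ge0.
    rewrite scale1r; have {h} := h w.
    rewrite -/(quotient r xi (ct s) w) -/(quotient r' xi' (ct s) w) -/(er w).
    move: (enorm_ge0 (quotient r xi (ct s) w - quotient r' xi' (ct s) w)).
    move: (enorm (quotient r xi (ct s) w - _)) => x x0.
    set y := enorm _ => h; have y0 : 0 <= y by exact: enorm_ge0.
    have g2 : g ^+ 2 = 2 * fine (v s) by rewrite sqr_sqrtr// mulr_ge0.
    have h2 : y ^+ 2 <= (C * (x + g + (L + 1) ^+ 2 * er w)) ^+ 2.
      by rewrite lerXn2r ?nnegrE// (le_trans y0).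
    apply: (le_trans (ler_wpM2l (w0 w) h2)); rewrite -g2 exprMn.
    apply: (@weighted_three_sqr _ (weight w) C x g ((L + 1) ^+ 2 * er w)) => //.
    - exact: weight01.
    - exact: sqrtr_ge0.
    - by ring.
  apply: (@le_trans _ _ (3 * C ^+ 2 * fine (v s) +
     (3 * C ^+ 2 * (L + 1) ^+ 4 * (quotient_error * del) + 3 * C ^+ 2 * (2 * fine (v s))))%:E).
    have z0 w : 0 <= weight w * er w ^+ 2 by rewrite mulr_ge0// sqr_ge0.
    have z1 w : 0 <= weight w * enorm (quotient r xi (ct s) w - quotient r' xi' (ct s) w) ^+ 2.
      by rewrite mulr_ge0// sqr_ge0.
    have z2 : 0 <= 3 * C ^+ 2 * (2 * fine (v s)) by rewrite mulr_ge0// mulr_ge0.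
    have zv : (\int[P]_w (weight w * enorm (quotient r xi (ct s) w - quotient r' xi' (ct s) w) ^+ 2)%:E
      <= (fine (v s))%:E)%E by rewrite -/(v s) -vfin.
    by have [] := mean_le_lin c1 (And3 mG2 z1 zv) (mean_le_lin c2 (And3 mer z0 E2) (mean_le_cst z2)).
  rewrite vfin -EFinM -EFinD lee_fin -subr_ge0.
  rewrite (_ : _ - _ = fine (v s)); first exact: v0.
  by rewrite /K /e1; ring.
have e10 : 0 <= e1.
  have s0 := sqr_ge0 flow_lip; have L4 : 0 <= (L + 1) ^+ 4 by rewrite exprn_ge0// addr_ge0.
  apply: mulr_ge0; first by rewrite mulr_ge0// mulr_ge0// sqr_ge0.
  apply: mulr_ge0; last exact: ltW.
  apply: mulr_ge0 => //; apply: addr_ge0 => //; apply: addr_ge0; last exact: mulr_ge0.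
  by apply: addr_ge0; [exact: mulr_ge0 | apply: mulr_ge0 => //; exact: addr_ge0].
(* Both quotients start from [eta], whatever their step and base point, so their difference starts
   from zero. *)
have h0 : (\int[P]_w (weight w * enorm (1 *: (eta w - eta w)) ^+ 2)%:E <= 0%:E)%E.
  rewrite -(Eint_cst P 0); apply: Eint_le => w; first by rewrite mulr_ge0// sqr_ge0.
  by rewrite subrr scaler0 enorm0 expr0n/= mulr0.
have := weighted_L2_estimate T0 Bbm F0i itG weight_F0 weight01 K0 (lexx 0) e10 h0
  (fun s _ => key _ _ b0 s b0F) (fun s _ => key _ _ b1 s b1F) tT.
rewrite clamp_time_id// -e1s; under eq_integral do rewrite scale1r.
by [].
Qed.

End quotients.

End flow.

(** * Derivative and adjoint at a fixed time *)

Section moduli.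
Context (R : realType) (V : Type) (K0 : set V) (dist g : V -> V -> R) (c : R).
Hypotheses (x0 : exists x, K0 x) (dist0 : forall x, K0 x -> dist x x = 0).
Hypothesis g0 : forall x x', K0 x -> K0 x' -> 0 <= g x x' <= c.
Hypothesis gUC : forall e : R, 0 < e -> exists2 del : R, 0 < del &
  forall x x', K0 x -> K0 x' -> dist x x' <= del -> g x x' <= e.

(** The modulus is the supremum of [g] over pairs at distance at most [s]: finite by the bound [c],
    over a nonempty set because of the diagonal, monotone in [s], and small near 0 by uniform
    continuity. *)
Lemma exists_modulus : exists2 v : R -> R, modulus v &
  forall x x', K0 x -> K0 x' -> 0 <= dist x x' -> g x x' <= v (dist x x').
Proof.
pose S s := [set g z.1 z.2 | z in [set z | [/\ K0 z.1, K0 z.2 & dist z.1 z.2 <= s]]].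
have Sg x x' s : K0 x -> K0 x' -> dist x x' <= s -> S s (g x x').
  by move=> hx hx' h; exists (x, x').
have Sub s : has_ubound (S s).
  by exists c => _ [[x x'] [/= hx hx' _] <-]; have /andP[] := g0 hx hx'.
have S0 s : 0 <= s -> exists2 y, S s y & 0 <= y.
  case: x0 => x hx s0; exists (g x x); first by apply: Sg => //; rewrite dist0.
  by have /andP[] := g0 hx hx.
exists (fun s => sup (S s)); last first.
  by move=> x x' hx hx' _; apply: ub_le_sup => //; exact: Sg.
split.
- by move=> s /S0[y Sy y0]; apply: le_trans y0 _; exact: ub_le_sup.
- move=> s s' s0 ss'; have [y Sy _] := S0 _ s0.
  apply: ge_sup; first by exists y.
  move=> _ [[x x'] [/= hx hx' h] <-]; apply: ub_le_sup => //; apply: Sg => //.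
  exact: le_trans ss'.
- apply/cvgrPdist_le => e e0; have [del del0 H] := gUC e0.
  near=> s; have s0 : 0 <= s by near: s; exact: nbhs_right_ge.
  have sd : s <= del by near: s; exact: nbhs_right_le.
  have [y Sy y0] := S0 _ s0.
  rewrite sub0r normrN ger0_norm; last by apply: le_trans y0 _; exact: ub_le_sup.
  apply: ge_sup; first by exists y.
  by move=> _ [[x x'] [/= hx hx' h] <-]; apply: H => //; exact: le_trans sd.
Unshelve. all: by end_near. Qed.

End moduli.

(** * Differentiability of the flow at one time *)

Section fixed_time.
Context (R : realType) (disp : measure_display) (Omega : measurableType disp).
Variables (P : probability Omega R) (T : R) (d m : nat).
Variables (B : R -> Omega -> 'rV[R]_m) (F0 : set (set Omega)).
Hypotheses (T0 : 0 < T).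
Hypotheses (Bbm : brownian_motion P T B) (F0i : initial_sigma_algebra P T B F0).
Local Notation F := (filtration B F0).
Local Notation ip := (L2inner P (d:=d)).
Local Notation nrm := (ip_norm (L2inner P (d:=d))).
Local Notation L2m := (L2 P measurable (d:=d)).
Local Notation K0 := (L2 P F0 (d:=d)).
Variables (b0 : 'rV[R]_d -> P2 R d -> 'rV[R]_d) (b1 : 'rV[R]_d -> P2 R d -> 'M[R]_(d, m)) (C : R).
Hypotheses (C0 : 0 <= C) (b0L : lipschitz_coef P b0 C) (b1L : lipschitz_coef P b1 C).
Hypotheses (b0F : four_point_coef P b0 C) (b1F : four_point_coef P b1 C).
Variable X : (Omega -> 'rV[R]_d) -> R -> Omega -> 'rV[R]_d.
Hypothesis X_solution : forall xi, L2 P F0 xi ->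
  mckean_vlasov_solution P T B F0 b0 b1 xi (X xi).
Variable t : R.
Hypothesis tT : 0 <= t <= T.
Local Notation K1 := (L2 P (F t) (d:=d)).
Local Notation Lip := (flow_lip T m C).
Local Notation Phi := (X^~ t).

Let F0m : F0 `<=` measurable. Proof. by case: F0i. Qed.
Let Ftm : F t `<=` measurable.
Proof. by have /andP[_ h] := tT; exact: (filtration_measurable Bbm F0i h). Qed.
Let L2sub : submodule L2m. Proof. exact: (@L2_submodule _ _ _ P d measurable (fun _ => id)). Qed.
Let F0sub : submodule K0. Proof. exact: L2_submodule. Qed.
Let Ftsub : submodule K1. Proof. exact: L2_submodule. Qed.
Let F0K : K0 `<=` L2m. Proof. exact: L2T. Qed.
Let FtK : K1 `<=` L2m. Proof. exact: L2T. Qed.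
Let ipP : inner_product L2m ip := @L2inner_product _ _ _ P d.
Let Lip0 : 0 <= Lip. Proof. exact: flow_lip_ge0. Qed.

Let PhiK x : K0 x -> K1 (Phi x).
Proof.
move=> hx; have [_ Xoo] := flow_L2 T0 Bbm F0i X_solution t hx.
rewrite clamp_time_id// in Xoo; split => //.
by have [[h _ _] _] := X_solution hx; exact: h.
Qed.

Let PhiL x y : K0 x -> K0 y -> nrm (Phi y - Phi x) <= Lip * nrm (y - x).
Proof. by move=> hx hy; exact: (flow_lipschitz T0 Bbm F0i C0 b0L b1L X_solution hx hy tT). Qed.

Let qK1 r x h : K0 x -> K0 h -> K1 (diff_quot Phi r x h).
Proof. exact: (diff_quotK F0sub Ftsub PhiK). Qed.

Let qK r x h : K0 x -> K0 h -> L2m (diff_quot Phi r x h).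
Proof. by move=> hx hh; apply: FtK; exact: qK1. Qed.

Let quotUC1 eta (M : R) : K0 eta -> nrm eta <= 1 -> (forall w, enorm (eta w) <= M) ->
  forall e : R, 0 < e -> exists2 del : R, 0 < del &
  forall x x' (r r' : R), K0 x -> K0 x' -> r != 0 -> r' != 0 ->
    `|r| <= del -> `|r'| <= del -> nrm (x' - x) <= del ->
    nrm (diff_quot Phi r x eta - diff_quot Phi r' x' eta) <= e.
Proof.
move=> heta eta1 etaM e e0.
pose Q := `|quotient_const T d m C|.
have M20 : 0 <= 1 + M ^+ 2 by rewrite addr_ge0// sqr_ge0.
have Q0 : 0 < (1 + M ^+ 2) * Q + 1 by rewrite ltr_wpDl ?mulr_ge0 ?normr_ge0.
pose del := Num.min 1 (e ^+ 2 / ((1 + M ^+ 2) * Q + 1)).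
have d0 : 0 < del by rewrite lt_min ltr01 divr_gt0// exprn_gt0.
have d1 : del <= 1 by rewrite ge_min lexx.
exists del => // x x' r r' hx hx' r0 r'0 rd r'd nd.
have d01 : 0 < del <= 1 by rewrite d0.
have h := quotient_cauchy T0 Bbm F0i C0 b0L b1L X_solution heta eta1 b0F b1F d01 r0 r'0 rd r'd
  hx hx' nd tT.
have hL := submoduleB L2sub (qK r hx heta) (qK r' hx' heta).
rewrite ip_norm_leP ?(ltW e0)//.
have mh : measurable_fun setT (fun w => weight eta w *
    enorm (quotient X eta r x t w - quotient X eta r' x' t w) ^+ 2).
  apply: measurable_funM; first exact: (weight_measurable Bbm F0i).
  by apply: measurable_enorm_sqr_comp; exact: (L2_measurable hL).
have w01 := weight01 eta.
apply: (@le_trans _ _ (\int[P]_w ((1 + M ^+ 2) * (weight eta w *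
    enorm (quotient X eta r x t w - quotient X eta r' x' t w) ^+ 2))%:E)%E).
  apply: Eint_le => w; first exact: sqr_ge0.
  rewrite mulrA ler_peMl ?sqr_ge0//.
  rewrite ler_pdivlMr ?mul1r; last by rewrite ltr_pwDl// sqr_ge0.
  rewrite lerD2l lerXn2r ?nnegrE ?enorm_ge0//.
  by rewrite (le_trans (enorm_ge0 (eta w))).
rewrite (Eint_Z P mh)//; last first.
  by move=> w; have /andP[h0 _] := w01 w; rewrite mulr_ge0// sqr_ge0.
apply: (le_trans (lee_wpmul2l _ h)); first by rewrite lee_fin.
rewrite -EFinM lee_fin mulrA.
apply: (@le_trans _ _ (((1 + M ^+ 2) * Q + 1) * del)).
  rewrite ler_wpM2r ?(ltW d0)// (@le_trans _ _ ((1 + M ^+ 2) * Q))// ?lerDl//.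
  by rewrite ler_wpM2l// ler_norm.
by rewrite mulrC -ler_pdivlMr// ge_min lexx orbT.
Qed.

(** Removes the normalisation by scaling: the quotient along [c *: h] with step [r] is [c] times the
    quotient along [h] with step [r * c]. Taking [c] as the norm plus 1 avoids division by zero. *)
Let quotUC2 eta (M : R) : K0 eta -> (forall w, enorm (eta w) <= M) ->
  forall e : R, 0 < e -> exists2 del : R, 0 < del &
  forall x x' (r r' : R), K0 x -> K0 x' -> r != 0 -> r' != 0 ->
    `|r| <= del -> `|r'| <= del -> nrm (x' - x) <= del ->
    nrm (diff_quot Phi r x eta - diff_quot Phi r' x' eta) <= e.
Proof.
move=> heta etaM e e0.
pose c := nrm eta + 1.
have c1 : 1 <= c by rewrite lerDr ip_norm_ge0.
have c0 : 0 < c by exact: lt_le_trans c1.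
have cn0 : c != 0 by rewrite gt_eqF.
pose h := c^-1 *: eta.
have hh : K0 h by exact: (submoduleZ F0sub).
have h1 : nrm h <= 1.
  rewrite (ip_normZ L2sub ipP _ (F0K heta)) ger0_norm ?invr_ge0 ?(ltW c0)//.
  by rewrite ler_pdivrMl// mulr1 lerDl.
have hM w : enorm (h w) <= M.
  rewrite /h (_ : (c^-1 *: eta) w = c^-1 *: eta w)// enormZ ger0_norm ?invr_ge0 ?(ltW c0)//.
  apply: le_trans (etaM w); rewrite ler_piMl ?enorm_ge0//.
  by rewrite invf_le1.
have [del d0 H] := quotUC1 hh h1 hM (divr_gt0 e0 c0).
have etaE : eta = c *: h by rewrite /h scalerA divff// scale1r.
have qE r x : r != 0 -> diff_quot Phi r x eta = c *: diff_quot Phi (r * c) x h.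
  move=> r0; rewrite /diff_quot scalerA invfM mulrCA divff// mulr1.
  by rewrite {1}etaE scalerA.
exists (del / c); first by rewrite divr_gt0.
move=> x x' r r' hx hx' r0 r'0 rd r'd nd.
rewrite !qE// -scalerBr (ip_normZ L2sub ipP); last first.
  by apply: (submoduleB L2sub); exact: qK.
rewrite gtr0_norm// mulrC -ler_pdivlMr//; apply: H => //.
- exact: mulf_neq0.
- exact: mulf_neq0.
- by rewrite normrM (gtr0_norm c0) -ler_pdivlMr.
- by rewrite normrM (gtr0_norm c0) -ler_pdivlMr.
- apply: (le_trans nd); rewrite ler_pdivrMr// ler_peMr//; exact: ltW.
Qed.

(** Quotients along [h] and along a bounded [k] differ in norm by at most [Lip * nrm (h - k)], for
    every step and base point, so the bounded case suffices up to [e / 3] on either side. *)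
Let quotUC h : K0 h -> forall e : R, 0 < e -> exists2 del : R, 0 < del &
  forall x x' (r r' : R), K0 x -> K0 x' -> r != 0 -> r' != 0 ->
    `|r| <= del -> `|r'| <= del -> nrm (x' - x) <= del ->
    nrm (diff_quot Phi r x h - diff_quot Phi r' x' h) <= e.
Proof.
move=> hh e e0; have L1 : 0 < Lip + 1 by rewrite ltr_wpDl.
have e3 : 0 < e / 3 by rewrite divr_gt0.
have [k [M [hk kM nk]]] := L2_bounded_dense F0m hh (divr_gt0 e3 L1).
have [del d0 H] := quotUC2 hk kM e3.
have near r x : r != 0 -> K0 x -> nrm (diff_quot Phi r x h - diff_quot Phi r x k) <= e / 3.
  move=> r0 hx; rewrite /diff_quot -scalerBr opprB [X in nrm (_ *: X)](_ : _ =
    Phi (x + r *: h) - Phi (x + r *: k)); last by rewrite addrA subrK.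
  have hxh := submoduleD F0sub hx (submoduleZ F0sub r hh).
  have hxk := submoduleD F0sub hx (submoduleZ F0sub r hk).
  rewrite (ip_normZ L2sub ipP); last first.
    by apply: (submoduleB L2sub); apply: FtK; exact: PhiK.
  rewrite normfV ler_pdivrMl ?normr_gt0//; apply: (le_trans (PhiL hxk hxh)).
  rewrite opprD addrACA subrr add0r -scalerBr (ip_normZ L2sub ipP); last first.
    by apply: (submoduleB L2sub); exact: F0K.
  rewrite mulrCA ler_wpM2l//; apply: (@le_trans _ _ ((Lip + 1) * nrm (h - k))).
    by rewrite ler_wpM2r ?ip_norm_ge0// lerDl.
  by rewrite mulrC -ler_pdivlMr.
exists del => // x x' r r' hx hx' r0 r'0 rd r'd nd.
have KA := submoduleB L2sub (qK r hx hh) (qK r hx hk).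
have KB := submoduleB L2sub (qK r hx hk) (qK r' hx' hk).
have KC := submoduleB L2sub (qK r' hx' hh) (qK r' hx' hk).
have -> : diff_quot Phi r x h - diff_quot Phi r' x' h =
   (diff_quot Phi r x h - diff_quot Phi r x k) + ((diff_quot Phi r x k - diff_quot Phi r' x' k)
     + - (diff_quot Phi r' x' h - diff_quot Phi r' x' k)).
  by rewrite opprB !subrKA.
apply: (le_trans (ip_normD L2sub ipP KA (submoduleD L2sub KB (submoduleN L2sub KC)))).
have h2 := ip_normD L2sub ipP KB (submoduleN L2sub KC).
rewrite (ip_normN L2sub ipP KC) in h2.
have h3 := near r x r0 hx; have h4 := near r' x' r'0 hx'.
have h5 := H x x' r r' hx hx' r0 r'0 rd r'd nd.
have -> : e = e / 3 + (e / 3 + e / 3) by field.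
exact: (lerD h3 (le_trans h2 (lerD h5 h4))).
Qed.

(** An L^1 bound needs no lower bound on the weight, so unlike the L^2 bound for bounded directions
    it is uniform over the unit ball of [h]. *)
Lemma quotient_mean (del r : R) x x' h : 0 < del <= 1 -> r != 0 -> `|r| <= del ->
  K0 x -> K0 x' -> K0 h -> nrm h <= 1 -> nrm (x' - x) <= del ->
  (\int[P]_w (enorm ((diff_quot Phi r x' h - diff_quot Phi r x h) w))%:E <=
   (Num.sqrt (2 * (`|quotient_const T d m C| * del)))%:E)%E.
Proof.
move=> d01 r0 rd hx hx' hh h1 nd; have /andP[d0 d1] := d01.
apply: (weighted_cauchy_schwarz Bbm F0i hh h1).
- apply: measurable_enorm; apply: L2_measurable; apply: (submoduleB L2sub); exact: qK.
- by move=> w; exact: enorm_ge0.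
- by rewrite mulr_ge0// ltW.
have nd' : nrm (x - x') <= del by rewrite (ip_normC L2sub ipP) //; exact: F0K.
have H := quotient_cauchy T0 Bbm F0i C0 b0L b1L X_solution hh h1 b0F b1F d01 r0 r0 rd rd
  hx' hx nd' tT.
apply: (le_trans H); rewrite lee_fin ler_wpM2r ?(ltW d0)// ler_norm//.
Qed.

Lemma flow_derivative : exists D Ds : (Omega -> 'rV[R]_d) -> (Omega -> 'rV[R]_d) -> (Omega -> 'rV[R]_d),
  [/\ [/\ forall x h, K0 x -> K0 h -> K1 (D x h),
      forall x h, K0 x -> K0 h -> forall e : R, 0 < e -> exists2 del : R, 0 < del &
        forall r : R, r != 0 -> `|r| <= del -> nrm (diff_quot Phi r x h - D x h) <= e,
      forall x h, K0 x -> K0 h -> nrm (D x h) <= Lip * nrm h,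
      forall x a h k, K0 x -> K0 h -> K0 k ->
        nrm (D x (a *: h + k) - (a *: D x h + D x k)) = 0 &
      forall h, K0 h -> forall e : R, 0 < e -> exists2 del : R, 0 < del &
        forall x x', K0 x -> K0 x' -> nrm (x' - x) <= del ->
          nrm (D x' h - D x h) <= e] &
      [/\ forall x z, K0 x -> K1 z -> K0 (Ds x z),
      forall x h z, K0 x -> K0 h -> K1 z -> ip (D x h) z = ip h (Ds x z),
      forall x z, K0 x -> K1 z -> nrm (Ds x z) <= Lip * nrm z,
      forall x a z y, K0 x -> K1 z -> K1 y ->
        nrm (Ds x (a *: z + y) - (a *: Ds x z + Ds x y)) = 0 &
      forall z, K1 z -> forall e : R, 0 < e -> exists2 del : R, 0 < del &
        forall x x', K0 x -> K0 x' -> nrm (x' - x) <= del ->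
          nrm (Ds x' z - Ds x z) <= e]].
Proof.
have [D [DK1 Dlim Dle Dlin DUC]] := quotient_derivative L2sub F0sub Ftsub F0K FtK ipP
  (L2_complete Ftm) PhiK PhiL quotUC.
have DK x h : K0 x -> K0 h -> L2m (D x h) by move=> hx hh; apply: FtK; exact: DK1.
(* The vector [z] is split into a bounded [y], paired with the uniform L^1 bound, and a remainder
   small in L^2, paired with the uniform bound on the derivatives. *)
have weak z : K1 z -> forall e : R, 0 < e -> exists2 del : R, 0 < del &
    forall x x' h, K0 x -> K0 x' -> K0 h -> nrm (x' - x) <= del -> nrm h <= 1 ->
     `|ip (D x' h - D x h) z| <= e.
  move=> hz e e0; have L1 : 0 < 2 * Lip + 1 by rewrite ltr_wpDl// mulr_ge0.
  have e2 : 0 < e / 2 by rewrite divr_gt0.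
  have [y [M [hy yM ny]]] := L2_bounded_dense Ftm hz (divr_gt0 e2 L1).
  have Ky := FtK hy; have Kz := FtK hz; have Kzy := submoduleB L2sub Kz Ky.
  pose Q := 2 * `|quotient_const T d m C|; pose N := `|M| + 1.
  have N0 : 0 < N by rewrite ltr_wpDl.
  have e2N : 0 < e / 2 / N by rewrite divr_gt0.
  have Q1 : 0 < Q + 1 by rewrite ltr_wpDl// mulr_ge0.
  pose del := Num.min 1 ((e / 2 / N) ^+ 2 / (Q + 1)).
  have d0 : 0 < del by rewrite lt_min ltr01 divr_gt0// exprn_gt0.
  have d01 : 0 < del <= 1 by rewrite d0 ge_min lexx.
  exists del => // x x' h hx hx' hh nd h1.
  have KD := DK _ _ hx hh; have KD' := DK _ _ hx' hh; have KB := submoduleB L2sub KD' KD.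
  have nD : nrm (D x' h - D x h) <= 2 * Lip.
    have -> : 2 * Lip = Lip + Lip by ring.
    apply: (le_trans (ip_normD L2sub ipP KD' (submoduleN L2sub KD))).
    rewrite (ip_normN L2sub ipP KD) lerD//.
      by apply: (le_trans (Dle _ _ hx' hh)); rewrite ler_piMr.
    by apply: (le_trans (Dle _ _ hx hh)); rewrite ler_piMr.
  have -> : z = y + (z - y) by rewrite addrC subrK.
  rewrite (ipDr L2sub ipP Ky Kzy KB) (le_trans (ler_normD _ _))//.
  rewrite [e]splitr; apply: lerD; last first.
    apply: (le_trans (cauchy_schwarz L2sub ipP KB Kzy)).
    apply: (@le_trans _ _ ((2 * Lip + 1) * nrm (z - y))).
      by rewrite ler_wpM2r ?ip_norm_ge0// (le_trans nD)// lerDl.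
    by rewrite mulrC -ler_pdivlMr.
  (* The L^1 bound concerns quotients, so the derivatives are replaced by quotients with a small
     step at the cost of [a]. That step may depend on [h], while [del] does not. *)
  apply/ler_addgt0Pr => a a0.
  have n1 : 0 < 2 * (nrm y + 1) by rewrite mulr_gt0// ltr_wpDl// ip_norm_ge0.
  have a1 : 0 < a / (2 * (nrm y + 1)) by rewrite divr_gt0.
  have [d1 d10 H1] := Dlim _ hh _ a1.
  pose r := Num.min del d1.
  have r0 : 0 < r by rewrite lt_min d0.
  have rn : r != 0 by rewrite gt_eqF.
  have rd : `|r| <= del by rewrite gtr0_norm// ge_min lexx.
  have rd1 : `|r| <= d1 by rewrite gtr0_norm// ge_min lexx orbT.
  have q := quotient_mean d01 rn rd hx hx' hh h1 nd.
  pose Z := diff_quot Phi r x' h - diff_quot Phi r x h.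
  have KZ : L2m Z by apply: (submoduleB L2sub); exact: qK.
  have KA := submoduleB L2sub (qK r hx hh) KD; have KA' := submoduleB L2sub (qK r hx' hh) KD'.
  have n2 : `|ip (Z - (D x' h - D x h)) y| <= a.
    apply: (le_trans (cauchy_schwarz L2sub ipP (submoduleB L2sub KZ KB) Ky)).
    have -> : Z - (D x' h - D x h) = (diff_quot Phi r x' h - D x' h) + - (diff_quot Phi r x h - D x h).
      by rewrite /Z opprB opprB addrACA [in RHS]addrACA; congr (_ + _); rewrite addrC.
    have := ip_normD L2sub ipP KA' (submoduleN L2sub KA).
    rewrite (ip_normN L2sub ipP KA) => n3.
    apply: (le_trans (ler_wpM2r (ip_norm_ge0 _ _) n3)).
    apply: (le_trans (ler_wpM2r (ip_norm_ge0 _ _) (lerD (H1 x' r hx' rn rd1) (H1 x r hx rn rd1)))).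
    rewrite (_ : _ + _ = a / (nrm y + 1)); last by field; rewrite gt_eqF// ltr_wpDl// ip_norm_ge0.
    rewrite mulrAC ler_pdivrMr; last by rewrite ltr_wpDl// ip_norm_ge0.
    by rewrite ler_wpM2l ?(ltW a0)// lerDl.
  have n4 : `|ip Z y| <= e / 2.
    have NM w : enorm (y w) <= N.
      by rewrite (le_trans (yM w))// (le_trans (ler_norm _))// lerDl.
    have mZ := measurable_enorm (L2_measurable KZ).
    have s0 : 0 <= Num.sqrt (Q * del) by exact: sqrtr_ge0.
    have bnd : (\int[P]_w `|edot (Z w) (y w)|%:E <= (N * Num.sqrt (Q * del))%:E)%E.
      apply: (@le_trans _ _ (\int[P]_w (N * enorm (Z w))%:E)%E).
        apply: Eint_le => w //; rewrite (le_trans (edot_le _ _))// mulrC.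
        by rewrite ler_wpM2r ?enorm_ge0.
      rewrite (Eint_Z P mZ)//; [|by move=> w; exact: enorm_ge0|exact: ltW].
      by rewrite EFinM lee_wpmul2l ?lee_fin ?(ltW N0)// /Q -mulrA.
    have se : N * Num.sqrt (Q * del) <= e / 2.
      rewrite mulrC -ler_pdivlMr// -[leRHS]ger0_norm ?(ltW e2N)// -sqrtr_sqr ler_sqrt ?sqr_ge0//.
      apply: (@le_trans _ _ ((Q + 1) * del)); first by rewrite ler_wpM2r ?(ltW d0)// lerDl.
      by rewrite mulrC -ler_pdivlMr// ge_min lexx orbT.
    apply: le_trans se; have bfin := le_lt_trans bnd (ltry _).
    apply: (@le_trans _ _ (fine (\int[P]_w `|edot (Z w) (y w)|%:E))).
      exact: le_normr_Rintegral_nonmeas.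
    by rewrite -lee_fin fineK// ge0_fin_numE// Eint_ge0.
  have -> : D x' h - D x h = Z + - (Z - (D x' h - D x h)) by rewrite subKr.
  have KZB := submoduleB L2sub KZ KB.
  rewrite (ipDl ipP KZ (submoduleN L2sub KZB) Ky) (ipNl L2sub ipP KZB Ky).
  by apply: (le_trans (ler_normD _ _)); rewrite normrN lerD.
have [Ds DsP] := adjoint_family L2sub F0sub Ftsub F0K FtK ipP (L2_complete F0m) Lip0 DK1 Dle Dlin weak.
exists D, Ds; split => //; split => //.
by move=> x h hx hh e e0; have [del d0 H] := Dlim _ hh _ e0; exists del => // r r0 rd; exact: H.
Qed.

End fixed_time.

(** * The family of derivatives *)

Section operators.
Context (R : realType) (disp : measure_display) (Omega : measurableType disp).
Variables (P : probability Omega R) (d : nat).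
Local Notation nrm := (ip_norm (L2inner P (d:=d))).
Local Notation L2m := (L2 P measurable (d:=d)).

Lemma ip_norm_eq0_ae (Z : Omega -> 'rV[R]_d) : L2m Z -> nrm Z = 0 ->
  {ae P, forall w, Z w = 0}.
Proof.
move=> hZ Z0; have mZ := measurable_sqr_EFin (L2_measurable hZ).
have E : msq P Z = 0%E by rewrite msqE// Z0 expr0n.
have := (ae_eq_integral_abs P measurableT mZ).1.
have -> : (\int[P]_w `|(enorm (Z w) ^+ 2)%:E| = 0)%E.
  rewrite -[RHS]E; apply: eq_integral => w _.
  by rewrite gee0_abs// lee_fin sqr_ge0.
move=> /(_ erefl); apply: filterS => w /(_ I)[] /eqP; rewrite sqrf_eq0 => /eqP h.
apply/rowP => i; rewrite mxE; apply/eqP; rewrite -normr_le0 -h.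
exact: enorm_entry.
Qed.

(** Linearity up to norm zero is linearity almost surely, which is the form required of operators on
    representatives. *)
Lemma bounded_linear_ip (G H : set (set Omega)) (L : R)
    (A : (Omega -> 'rV[R]_d) -> (Omega -> 'rV[R]_d)) :
  G `<=` measurable -> H `<=` measurable -> 0 <= L ->
  (forall h, L2 P G h -> L2 P H (A h)) ->
  (forall h, L2 P G h -> nrm (A h) <= L * nrm h) ->
  (forall a h k, L2 P G h -> L2 P G k -> nrm (A (a *: h + k) - (a *: A h + A k)) = 0) ->
  bounded_linear P G H A /\ (opnorm P G A <= L%:E)%E.
Proof.
move=> Gm Hm L0 AH Ale Alin.
have opL : (opnorm P G A <= L%:E)%E.
  apply: ge_ereal_sup => _ [h [hh h1] <-].
  rewrite (L2norm_ip (L2T Hm (AH _ hh))).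
  move: h1; rewrite /= L2norm_ip ?lee_fin; last exact: (L2T Gm).
  by move=> h1; rewrite (le_trans (Ale _ hh))// ler_piMr.
split => //; split => //; last by rewrite (le_lt_trans opL)// ltry.
move=> a h k hh hk.
have Gsub : submodule (L2 P G (d:=d)) by exact: L2_submodule.
have Hsub : submodule (L2 P H (d:=d)) by exact: L2_submodule.
have KA : L2m (A (a *: h + k) - (a *: A h + A k)).
  apply: (L2T Hm); apply: (submoduleB Hsub); first by apply: AH; case: Gsub => _; exact.
  by case: Hsub => _; apply; exact: AH.
apply: filterS (ip_norm_eq0_ae KA (Alin a h k hh hk)) => w.
by move=> /eqP; rewrite subr_eq0 => /eqP.
Qed.

End operators.

Lemma lipschitz_coefW (R : realType) (disp : measure_display) (Omega : measurableType disp)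
    (P : probability Omega R) (d p q : nat) (b : 'rV[R]_d -> P2 R d -> 'M[R]_(p, q)) (C C' : R) :
  C <= C' -> lipschitz_coef P b C -> lipschitz_coef P b C'.
Proof.
move=> CC' h x x' mu nu Y Z lY lZ hY hZ; apply: (le_trans (h x x' mu nu Y Z lY lZ hY hZ)).
by rewrite ler_wpM2r// addr_ge0// ?enorm_ge0 ?ip_norm_ge0.
Qed.

Lemma four_point_coefW (R : realType) (disp : measure_display) (Omega : measurableType disp)
    (P : probability Omega R) (d p q : nat) (b : 'rV[R]_d -> P2 R d -> 'M[R]_(p, q)) (C C' : R) :
  C <= C' -> four_point_coef P b C -> four_point_coef P b C'.
Proof.
move=> CC' h X0 X1 X2 X3 mu0 mu1 mu2 mu3 r r' del Lam nu g w l0 l1 l2 l3 h0 h1 h2 h3 r0 r'0 rd r'd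
  L1 nq nq' n02 gP.
apply: (le_trans (h X0 X1 X2 X3 mu0 mu1 mu2 mu3 r r' del Lam nu g w l0 l1 l2 l3 h0 h1 h2 h3 r0 r'0
  rd r'd L1 nq nq' n02 gP)).
have del0 : 0 <= del by exact: le_trans rd.
have nu0 : 0 <= nu by apply: le_trans n02; exact: ip_norm_ge0.
have g0 : 0 <= g.
  by rewrite -lee_fin (le_trans _ gP)//; apply: Eint_ge0 => w0; exact: enorm_ge0.
rewrite ler_wpM2r//.
have m0 (y : R) : 0 <= y -> 0 <= Num.min 1 y by move=> y0; rewrite le_min ler01.
have e0 := @enorm_ge0 R 1 d.
have f0 (y y' e : R) : 0 <= y -> 0 <= y' -> 0 <= e -> 0 <= four_point_error del nu y y' e.
  move=> y0 y'0 e0'; have d1 := mulr_ge0 del0 y0; have d2 := mulr_ge0 del0 y'0.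
  have d3 := mulr_ge0 nu0 y0; have d4 := mulr_ge0 y0 (m0 _ d1).
  have d5 := mulr_ge0 y'0 (m0 _ d2); have d6 := mulr_ge0 (m0 _ e0') y0.
  by rewrite /four_point_error; do ?[assumption | apply: addr_ge0].
apply: addr_ge0; first by apply: addr_ge0.
by rewrite mulr_ge0 ?sqr_ge0// f0.
Qed.

(** Assembles the operators found at each time of [[0, T]] into one family; outside that interval
    the default, here the zero operator, is taken. *)
Lemma choice_on (I U : Type) (A : I -> Prop) (Q : I -> U -> Prop) (u0 : U) :
  (forall i, A i -> exists u, Q i u) -> exists f : I -> U, forall i, A i -> Q i (f i).
Proof.
move=> h; have [i|f fP] := @choice I U (fun i u => A i -> Q i u); last by exists f.
by have [/h[u Qu]|nA] := pselect (A i); [exists u | exists u0].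
Qed.

(** The single constant [flow_lip] bounds the derivatives and their adjoints for all times and base
    points. The moduli are obtained at each fixed time from uniform continuity, for a direction held
    fixed. *)
Theorem theorem3p7 (R : realType) (disp : measure_display)
  (Omega : measurableType disp) (P : probability Omega R)
  (T : R) (d m : nat)
  (B : R -> Omega -> 'rV[R]_m) (F0 : set (set Omega))
  (b0 : 'rV[R]_d -> P2 R d -> 'rV[R]_d)
  (b1 : 'rV[R]_d -> P2 R d -> 'M[R]_(d, m))
  (X : (Omega -> 'rV[R]_d) -> R -> Omega -> 'rV[R]_d)
  (T_gt0 : 0 < T)
  (P_complete : measure_is_complete P)
  (B_brownian : brownian_motion P T B)
  (F0_initial : initial_sigma_algebra P T B F0)
  (b0_C11b : C11b b0)
  (b1_C11b : C11b b1)
  (X_solution : forall xi, L2 P F0 xi ->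
     mckean_vlasov_solution P T B F0 b0 b1 xi (X xi)) :
  exists D : R -> (Omega -> 'rV[R]_d) ->
             (Omega -> 'rV[R]_d) -> (Omega -> 'rV[R]_d),
    [/\ (forall t xi, 0 <= t <= T -> L2 P F0 xi ->
          bounded_linear P F0 (filtration B F0 t) (D t xi)),
        (ereal_sup [set opnorm P F0 (D z.1 z.2)
           | z in `[0%R, T]%classic `*` L2 P F0 (d:=d)] < +oo)%E,
        (forall t xi eta, 0 <= t <= T -> L2 P F0 xi -> L2 P F0 eta ->
          (`|r|^-1%:E *
            L2norm P (fun w => (X (fun w' => xi w' + r *: eta w') t w
                                - X xi t w - r *: D t xi eta w)%R))%E
            @[r --> (0 : R)^'] --> 0%E) &
        (forall t eta, 0 <= t <= T -> L2 P F0 eta ->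
          exists2 v : R -> R, modulus v &
            forall xi xi', L2 P F0 xi -> L2 P F0 xi' ->
              (L2norm P (fun w => (D t xi' eta w - D t xi eta w)%R)
               <= (v (fine (L2norm P (fun w => xi' w - xi w)%R)))%:E)%E)]
    /\
    exists Dstar : R -> (Omega -> 'rV[R]_d) ->
                   (Omega -> 'rV[R]_d) -> (Omega -> 'rV[R]_d),
    [/\ (forall t xi, 0 <= t <= T -> L2 P F0 xi ->
          is_adjoint P F0 (filtration B F0 t) (D t xi) (Dstar t xi)),
        (ereal_sup [set opnorm P (filtration B F0 z.1) (Dstar z.1 z.2)
           | z in `[0%R, T]%classic `*` L2 P F0 (d:=d)] < +oo)%E &
        (forall t eta, 0 <= t <= T -> L2 P (filtration B F0 t) eta ->
          exists2 v : R -> R, modulus v &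
            forall xi xi', L2 P F0 xi -> L2 P F0 xi' ->
              (L2norm P (fun w => (Dstar t xi' eta w - Dstar t xi eta w)%R)
               <= (v (fine (L2norm P (fun w => xi' w - xi w)%R)))%:E)%E)].
Proof.
have F0m : F0 `<=` measurable by case: F0_initial.
have [Ca Ca0 [aL aF]] := C11b_coef P b0_C11b.
have [Cb Cb0 [bL bF]] := C11b_coef P b1_C11b.
pose C := Num.max Ca Cb.
have aC : Ca <= C by rewrite le_max lexx.
have bC : Cb <= C by rewrite le_max lexx orbT.
have C0 : 0 <= C by exact: le_trans aC.
have Lip0 : 0 <= (flow_lip T m C) by exact: flow_lip_ge0.
have der t (tT : 0 <= t <= T) := flow_derivative T_gt0 B_brownian F0_initial C0
  (lipschitz_coefW aC aL) (lipschitz_coefW bC bL) (four_point_coefW aC aF) (four_point_coefW bC bF)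
  X_solution tT.
have [D DP] := choice_on (fun _ _ => 0) der.
have [Ds {DP}DP] := choice_on (fun _ _ => 0) DP.
have F0K := L2T (P := P) (d := d) F0m.
have F0sub : submodule (L2 P F0 (d:=d)) by exact: L2_submodule.
have Ftm t : 0 <= t <= T -> filtration B F0 t `<=` measurable.
  by move=> /andP[_ h]; exact: (filtration_measurable B_brownian F0_initial h).
have L2sub : submodule (L2 P measurable (d:=d)).
  exact: (@L2_submodule _ _ _ P d measurable (fun _ => id)).
have ipP := @L2inner_product _ _ _ P d.
have F00 : L2 P F0 (0 : Omega -> 'rV[R]_d) by exact: submodule0 F0sub.
have dist0 x : L2 P F0 x -> ip_norm (L2inner P (d:=d)) (x - x) = 0 by move=> _; rewrite subrr (ip_norm0 L2sub ipP).
have bl t xi (tT : 0 <= t <= T) (hxi : L2 P F0 xi) :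
    bounded_linear P F0 (filtration B F0 t) (D t xi) /\ (opnorm P F0 (D t xi) <= (flow_lip T m C)%:E)%E.
  have [[DK _ Dle Dlin _] _] := DP t tT.
  apply: bounded_linear_ip => //; first exact: Ftm.
  - by move=> h; exact: DK.
  - by move=> h; exact: Dle.
  - by move=> a h k; exact: Dlin.
have bls t xi (tT : 0 <= t <= T) (hxi : L2 P F0 xi) :
    bounded_linear P (filtration B F0 t) F0 (Ds t xi) /\
    (opnorm P (filtration B F0 t) (Ds t xi) <= (flow_lip T m C)%:E)%E.
  have [_ [DK _ Dle Dlin _]] := DP t tT.
  apply: bounded_linear_ip => //; first exact: Ftm.
  - by move=> h; exact: DK.
  - by move=> h; exact: Dle.
  - by move=> a h k; exact: Dlin.
(* Shared by the derivative and its adjoint, each applied to a fixed vector; the difference of two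
   values is bounded by [c + c], which makes the supremum defining the modulus finite. *)
have modulus_of (S : (Omega -> 'rV[R]_d) -> Omega -> 'rV[R]_d) (c : R) :
    (forall x, L2 P F0 x -> L2 P measurable (S x)) ->
    (forall x, L2 P F0 x -> ip_norm (L2inner P (d:=d)) (S x) <= c) ->
    (forall e : R, 0 < e -> exists2 del : R, 0 < del &
        forall x x', L2 P F0 x -> L2 P F0 x' -> ip_norm (L2inner P (d:=d)) (x' - x) <= del -> ip_norm (L2inner P (d:=d)) (S x' - S x) <= e) ->
    exists2 v : R -> R, modulus v & forall xi xi', L2 P F0 xi -> L2 P F0 xi' ->
      (L2norm P (fun w => (S xi' w - S xi w)%R)
        <= (v (fine (L2norm P (fun w => xi' w - xi w)%R)))%:E)%E.
  move=> SK Sle SUC.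
  have [|v mv vP] := @exists_modulus R _ (L2 P F0 (d:=d)) (fun x x' => ip_norm (L2inner P (d:=d)) (x' - x))
    (fun x x' => ip_norm (L2inner P (d:=d)) (S x' - S x)) (c + c) (ex_intro _ _ F00) dist0 _ SUC.
    move=> x x' hx hx'; rewrite ip_norm_ge0/=.
    have KS := SK _ hx; have KS' := SK _ hx'.
    apply: (le_trans (ip_normD L2sub ipP KS' (submoduleN L2sub KS))).
    by rewrite (ip_normN L2sub ipP KS) lerD// Sle.
  exists v => // xi xi' hx hx'.
  rewrite (L2norm_ip (submoduleB L2sub (F0K _ hx') (F0K _ hx))).
  rewrite (L2norm_ip (submoduleB L2sub (SK _ hx') (SK _ hx))) lee_fin.
  by apply: vP => //; exact: ip_norm_ge0.
exists D; split; first split.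
- by move=> t xi tT hxi; have [] := bl t xi tT hxi.
- apply: (@le_lt_trans _ _ (flow_lip T m C)%:E); last exact: ltry.
  apply: ge_ereal_sup => _ [[t xi] [/= tT hxi] <-].
  by rewrite /= in_itv/= in tT; have [] := bl t xi tT hxi.
- move=> t xi eta tT hxi heta; have [[DK Dlim _ _ _] _] := DP t tT.
  have KD := L2T (Ftm t tT) (DK _ _ hxi heta).
  have Kx y : L2 P F0 y -> L2 P measurable (X y t).
    move=> hy; have := flow_L2 T_gt0 B_brownian F0_initial X_solution t hy.
    by rewrite clamp_time_id.
  have hr r : L2 P F0 (xi + r *: eta).
    by apply: (submoduleD F0sub) => //; exact: (submoduleZ F0sub).
  have Kq r : L2 P measurable (diff_quot (X^~ t) r xi eta).
    by apply: (submoduleZ L2sub); apply: (submoduleB L2sub); exact: Kx.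
  have KqD r := submoduleB L2sub (Kq r) KD.
  have qE r : r != 0 -> (`|r|^-1%:E * L2norm P (fun w => (X (fun w' => xi w' + r *: eta w') t w
      - X xi t w - r *: D t xi eta w)%R))%E = (ip_norm (L2inner P (d:=d)) (diff_quot (X^~ t) r xi eta - D t xi eta))%:E.
    move=> r0; have -> : (fun w => X (fun w' => xi w' + r *: eta w') t w - X xi t w
        - r *: D t xi eta w) = r *: (diff_quot (X^~ t) r xi eta - D t xi eta).
      by rewrite scalerBr /diff_quot scalerA divff// scale1r.
    rewrite (L2norm_ip (submoduleZ L2sub r (KqD r))) (ip_normZ L2sub ipP r (KqD r)).
    by rewrite -EFinM mulKf// normr_eq0.
  have lim0 : ip_norm (L2inner P (d:=d)) (diff_quot (X^~ t) r xi eta - D t xi eta) @[r --> (0 : R)^'] --> (0 : R).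
    apply/cvgrPdist_le => e e0; have [del d0 H] := Dlim _ _ hxi heta _ e0.
    near=> r; rewrite sub0r normrN ger0_norm ?ip_norm_ge0//; apply: H.
    + by near: r; exact: nbhs_dnbhs_neq.
    + by apply: ltW; near: r; exact: dnbhs0_lt.
  apply: cvg_trans (_ : (ip_norm (L2inner P (d:=d)) (diff_quot (X^~ t) r xi eta - D t xi eta))%:E @[r --> (0 : R)^'] --> 0%E).
    apply: near_eq_cvg; near=> r; rewrite qE//.
    by near: r; exact: nbhs_dnbhs_neq.
  by apply: cvg_EFin; first exact: nearW.
- move=> t eta tT heta; have [[DK _ Dle _ DUC] _] := DP t tT.
  apply: (modulus_of (fun x => D t x eta) ((flow_lip T m C) * ip_norm (L2inner P (d:=d)) eta)).
  + by move=> x hx; exact: (L2T (Ftm t tT) (DK _ _ hx heta)).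
  + by move=> x hx; exact: Dle.
  + exact: DUC.
exists Ds; split.
- move=> t xi tT hxi; split; first by have [] := bls t xi tT hxi.
  by have [_ [_ h _ _ _]] := DP t tT; move=> eta zeta; exact: h.
- apply: (@le_lt_trans _ _ (flow_lip T m C)%:E); last exact: ltry.
  apply: ge_ereal_sup => _ [[t xi] [/= tT hxi] <-].
  by rewrite /= in_itv/= in tT; have [] := bls t xi tT hxi.
- move=> t eta tT heta; have [_ [DK _ Dle _ DUC]] := DP t tT.
  apply: (modulus_of (fun x => Ds t x eta) ((flow_lip T m C) * ip_norm (L2inner P (d:=d)) eta)).
  + by move=> x hx; exact: (F0K _ (DK _ _ hx heta)).
  + by move=> x hx; exact: Dle.
  + exact: DUC.
Unshelve. all: by end_near. Qed.
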